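(* Let $d\ge 1$ and $k\ge 1$, and let $D>0$ satisfy $k^{1/2}D>\sqrt{\pi}$. Let $p,r$ be non-negative integers. For every $u\in\widehat{H}^{p+r}(\mathbb R^d)$ we have $\Pi_D u\in \widehat{H}^{p}(\mathbb R^d)$, and $$\|u-\Pi_D u\|_{\widehat{H}^p_k(\mathbb R^d)}\le C_{p,r}\,D^{-r}\,\|u\|_{\widehat{H}^{p+r}_k(\mathbb R^d)},$$ where $C_{p,r}$ depends only on $d$, $p$, $r$.
   Context: For $[\boldsymbol m,\boldsymbol n]\in\mathbb Z^{2d}$ set $\boldsymbol x^{k,\boldsymbol m}=\sqrt{\pi/k}\,\boldsymbol m$, $\boldsymbol \xi^{k,\boldsymbol n}=\sqrt{\pi/k}\,\boldsymbol n$ and define the Gaussian state $\Psi_{k,\boldsymbol m,\boldsymbol n}(\boldsymbol x)=(k/\pi)^{d/4}e^{-\frac k2|\boldsymbol x-\boldsymbol x^{k,\boldsymbol m}|^2}e^{ik(\boldsymbol x-\boldsymbol x^{k,\boldsymbol m})\cdot\boldsymbol \xi^{k,\boldsymbol n}}$. $(\cdot,\cdot)$ denotes the $L^2(\mathbb R^d)$ inner product. It is known that this family is a frame: there are $\alpha,\beta>0$ depending only on $d$ with $\alpha^2\|u\|_{L^2}^2\le\sum_{[\boldsymbol m,\boldsymbol n]}|(u,\Psi_{k,\boldsymbol m,\boldsymbol n})|^2\le\beta^2\|u\|_{L^2}^2$ for all $u\in L^2(\mathbb R^d)$. Hence the frame operator $u\mapsto\sum_{[\boldsymbol m,\boldsymbol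 n]}(u,\Psi_{k,\boldsymbol m,\boldsymbol n})\Psi_{k,\boldsymbol m,\boldsymbol n}$ is bounded, self-adjoint and invertible on $L^2(\mathbb R^d)$; let $S_k$ be its inverse and define the dual frame $\Psi^\star_{k,\boldsymbol m,\boldsymbol n}=S_k\Psi_{k,\boldsymbol m,\boldsymbol n}$. For $D>0$ with $k^{1/2}D>\sqrt\pi$ define $\Pi_D u=\sum_{[\boldsymbol m,\boldsymbol n]\in\mathbb Z^{2d},\ |(\boldsymbol x^{k,\boldsymbol m},\boldsymbol \xi^{k,\boldsymbol n})|\le D}(u,\Psi^\star_{k,\boldsymbol m,\boldsymbol n})\Psi_{k,\boldsymbol m,\boldsymbol n}$, where $|(\boldsymbol x^{k,\boldsymbol m},\boldsymbol \xi^{k,\boldsymbol n})|$ is the Euclidean norm in $\mathbb R^{2d}$. For multi-indices $\boldsymbol a\in\mathbb N^d$, $[\boldsymbol a]=a_1+\dots+a_d$ and $\partial^{\boldsymbol a}$ is the distributional derivative. For $p\in\mathbb N$ and Schwartz $v$, $\|v\|^2_{\widehat H^p_k(\mathbb R^d)}=\sum_{[\boldsymbol a]\le p}\sum_{q=0}^{p-[\boldsymbol a]}k^{-2[\boldsymbol a]}\||\boldsymbol x|^q\partial^{\boldsymbol a}v\|^2_{L^2(\mathbb R^d)}$, and $\widehat H^p(\mathbb R^d)$ is the closure of the Schwartz space in $L^2(\mathbb R^d)$ for this norm (the norm extends to it). *)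

(* Defs.v *)
From mathcomp Require Import all_boot all_order all_algebra.
From mathcomp Require Import all_classical all_reals all_analysis.
From mathcomp Require Import complex.
Set Implicit Arguments.
Unset Strict Implicit.
Unset Printing Implicit Defensive.
Import Order.TTheory GRing.Theory Num.Theory.
Import numFieldNormedType.Exports.
Local Open Scope classical_set_scope.
Local Open Scope ring_scope.
Local Open Scope complex_scope.

Section Gabor.
Variable R : realType.
Local Notation C := R[i].

(* ---------- Euclidean structure on R^d = 'rV[R]_d ---------- *)
Definition euc (d : nat) (x : 'rV[R]_d) : R := Num.sqrt (\sum_i x 0 i ^+ 2).

(* conversion from tuples (which carry the product Borel sigma-algebra) *)
Definition rv_of_tuple (d : nat) (t : d.-tuple R) : 'rV[R]_d := \row_i tnth t i.

(* ---------- Lebesgue integral on R^d, as an iterated integral ---------- *)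
Fixpoint iint (d : nat) : ('rV[R]_d -> \bar R) -> \bar R :=
  match d return ('rV[R]_d -> \bar R) -> \bar R with
  | 0 => fun F => F 0
  | d'.+1 => fun F =>
      (\int[@lebesgue_measure R]_(t in [set: R])
         iint (fun y : 'rV[R]_d' => F (row_mx (\row_(j < 1) t) y)))%E
  end.

Definition cabs2 (z : C) : R := complex.Re z ^+ 2 + complex.Im z ^+ 2.

(* squared L^2 norm *)
Definition L2sq (d : nat) (g : 'rV[R]_d -> C) : \bar R :=
  iint (fun x => (cabs2 (g x))%:E).

(* complex-valued integral of an integrable function *)
Definition cint (d : nat) (f : 'rV[R]_d -> C) : C :=
  (fine (iint (fun x => (complex.Re (f x))%:E)))%:C
  + 'i * (fine (iint (fun x => (complex.Im (f x))%:E)))%:C.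

(* the L^2(R^d) inner product (u, v) *)
Definition ip (d : nat) (u v : 'rV[R]_d -> C) : C := cint (fun x => u x * (v x)^*).

(* measurability (Borel) and L^2 membership *)
Definition cmeasurable (d : nat) (u : 'rV[R]_d -> C) : Prop :=
  measurable_fun [set: d.-tuple R] (fun t => complex.Re (u (rv_of_tuple t))) /\
  measurable_fun [set: d.-tuple R] (fun t => complex.Im (u (rv_of_tuple t))).

Definition L2 (d : nat) (u : 'rV[R]_d -> C) : Prop :=
  cmeasurable u /\ (L2sq u < +oo)%E.

(* ---------- derivatives and Schwartz space ---------- *)
(* partial derivative in the j-th coordinate direction *)
Definition pd (d : nat) (j : 'I_d) (f : 'rV[R]_d -> R) : 'rV[R]_d -> R :=
  fun x => derive f x (delta_mx 0 j).

(* iterated partial derivatives along a word of directions *)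
Definition pdw (d : nat) (s : seq 'I_d) (f : 'rV[R]_d -> R) := foldr (@pd d) f s.

(* \partial^a for a multi-index a *)
Definition dmulti (d : nat) (a : 'I_d -> nat) (f : 'rV[R]_d -> R) : 'rV[R]_d -> R :=
  foldr (fun j g => iter (a j) (@pd d j) g) f (enum 'I_d).

Definition schwartzR (d : nat) (f : 'rV[R]_d -> R) : Prop :=
  (forall (s : seq 'I_d) (j : 'I_d) (x : 'rV[R]_d),
      derivable (pdw s f) x (delta_mx 0 j)) /\
  (forall (s : seq 'I_d) (q : nat), exists M : R,
      forall x, euc x ^+ q * `|pdw s f x| <= M).

Definition reP (d : nat) (u : 'rV[R]_d -> C) := fun x => complex.Re (u x).
Definition imP (d : nat) (u : 'rV[R]_d -> C) := fun x => complex.Im (u x).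

Definition schwartz (d : nat) (u : 'rV[R]_d -> C) : Prop :=
  schwartzR (reP u) /\ schwartzR (imP u).

Definition cdmulti (d : nat) (a : 'I_d -> nat) (u : 'rV[R]_d -> C) : 'rV[R]_d -> C :=
  fun x => (dmulti a (reP u) x)%:C + 'i * (dmulti a (imP u) x)%:C.

(* [a] = a_1 + ... + a_d *)
Definition mlen (d p : nat) (a : {ffun 'I_d -> 'I_p.+1}) : nat := \sum_i (a i : nat).

(* squared \hat H^p_k norm of a Schwartz function;
   multi-indices with [a] <= p are enumerated as {ffun 'I_d -> 'I_p.+1} *)
Definition Hsq (d : nat) (k : R) (p : nat) (v : 'rV[R]_d -> C) : \bar R :=
  (\sum_(a : {ffun 'I_d -> 'I_p.+1} | (mlen a <= p)%N)
     \sum_(q < (p - mlen a).+1)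
       ((k ^- (2 * mlen a))%R%:E *
        L2sq (fun x => ((euc x ^+ q)%:C * cdmulti (fun j => (a j : nat)) v x)%R)))%E.

(* ---------- \hat H^p as the closure of Schwartz space ---------- *)
(* Hhat_norm k p u N : u lies in \hat H^p (closure in L^2 of the Schwartz space
   for the \hat H^p_k norm), and its (extended) \hat H^p_k norm equals N. *)
Definition Hhat_norm (d : nat) (k : R) (p : nat) (u : 'rV[R]_d -> C) (N : R) : Prop :=
  L2 u /\ 0 <= N /\
  exists phi : nat -> 'rV[R]_d -> C,
    (forall n, schwartz (phi n)) /\
    (forall e : R, 0 < e -> exists M, forall n, (M <= n)%N ->
        (L2sq (fun x => (phi n x - u x)%R) < e%:E)%E) /\
    (forall e : R, 0 < e -> exists M, forall n m, (M <= n)%N -> (M <= m)%N ->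
        (Hsq k p (fun x => (phi n x - phi m x)%R) < e%:E)%E) /\
    (forall e : R, 0 < e -> exists M, forall n, (M <= n)%N ->
        ((N ^+ 2 - e)%R%:E < Hsq k p (phi n) < (N ^+ 2 + e)%R%:E)%E).

Definition Hhat (d : nat) (k : R) (p : nat) (u : 'rV[R]_d -> C) : Prop :=
  exists N, Hhat_norm k p u N.

(* ---------- the Gaussian frame ---------- *)
Definition gidx (d : nat) := ('rV[int]_d * 'rV[int]_d)%type.

Definition xk (d : nat) (k : R) (m : 'rV[int]_d) : 'rV[R]_d :=
  \row_i (Num.sqrt (pi / k) * (m 0 i)%:~R).

Definition Psi (d : nat) (k : R) (mn : gidx d) : 'rV[R]_d -> C :=
  fun x =>
    let y := x - xk k mn.1 in
    let xi := xk k mn.2 in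
    let th := k * \sum_i (y 0 i * xi 0 i) in
    (powR (k / pi) (d%:R / 4) * expR (- (k / 2) * euc y ^+ 2))%:C
      * ((cos th)%:C + 'i * (sin th)%:C).

(* finite boxes exhausting Z^{2d} *)
Definition box (d : nat) (M : nat) : set (gidx d) :=
  [set mn : gidx d | forall i, `|mn.1 0 i| <= M%:Z /\ `|mn.2 0 i| <= M%:Z].

(* g is the dual frame element S_k Psi_j0, i.e. g is in L^2 and solves
   F g = Psi_j0 for the frame operator F u = sum_j (u, Psi_j) Psi_j,
   stated weakly: for every v in L^2,
   sum_j (g, Psi_j) (Psi_j, v) = (Psi_j0, v),
   the (absolutely convergent) series being summed over exhausting boxes. *)
Definition dual_elem (d : nat) (k : R) (j0 : gidx d) (g : 'rV[R]_d -> C) : Prop :=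
  L2 g /\
  forall v : 'rV[R]_d -> C, L2 v ->
    let S := fun M : nat =>
      \sum_(j \in box M) (ip g (Psi k j) * ip (Psi k j) v) in
    (fun M => complex.Re (S M)) @ \oo --> complex.Re (ip (Psi k j0) v) /\
    (fun M => complex.Im (S M)) @ \oo --> complex.Im (ip (Psi k j0) v).

Definition dual_frame (d : nat) (k : R) (Psistar : gidx d -> 'rV[R]_d -> C) : Prop :=
  forall j, dual_elem k j (Psistar j).

(* index set |(x^{k,m}, xi^{k,n})| <= D *)
Definition idxD (d : nat) (k D : R) : set (gidx d) :=
  [set mn : gidx d | Num.sqrt (\sum_i (xk k mn.1 0 i) ^+ 2 + \sum_i (xk k mn.2 0 i) ^+ 2) <= D].

(* Pi_D u = sum_{|(x^m, xi^n)| <= D} (u, Psi*_{m,n}) Psi_{m,n} *)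
Definition PiD (d : nat) (k D : R) (Psistar : gidx d -> 'rV[R]_d -> C)
    (u : 'rV[R]_d -> C) : 'rV[R]_d -> C :=
  fun x => \sum_(j \in idxD k D) (ip u (Psistar j) * Psi k j x).

End Gabor.

(* Main.v *)
(** In the variable [t = x / hk k] the Gaussian state is a tensor product of the functions
    [exp(-pi/2 (t-m)^2 + i pi n (t-m))].  The sequence [exp(-pi z^2)], [z] an integer, is so close to
    a Dirac mass that a finite Neumann series inverts convolution with it up to any error.  If [K] is
    such an approximate inverse, then combining the states with indices [j + 2 a], for [a] in the
    support of [K], makes the kernel of [sum_j Psi_j (x) conj (K Psi)_j (y)] an explicit product of a
    Fejer kernel in [(x-y)/2h] (after Cesaro summation in the frequency index) with a function
    that is nearly [1] on the diagonal and nearly [0] at the other peaks of the Fejer kernel; the sum is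
    therefore close to [2^d] times the identity.
    Hence [2^d (u, Psi*_j)] is the limit of the [K]-combinations of the coefficients [(u, Psi_i)],
    although no formula for the dual frame is available.

    The weight of [j] being [1 + |(x^m, xi^n)|^2], integration by parts and Bessel inequalities for
    Gaussians times polynomials bound the weighted [l^2] norm of the coefficients of [u] by
    the [Hhat^q_k] norm of [u], and conversely the [Hhat^p_k] norm of a synthesised sum by the
    weighted [l^2] norm of its coefficients.  These bounds survive the limit in [K], all
    combinations being uniformly summable against an exponential weight.  The
    indices discarded by [Pi_D] have weight at least [D^2], which yields the factor [D^-r] for Schwartz [u];
    lower semicontinuity of the norms under weak convergence extends it to the closure. *)

From HB Require Import structures.
Require Import Defs.
From mathcomp Require Import all_boot all_order all_algebra.
From mathcomp Require Import all_classical all_reals all_analysis.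
From mathcomp Require Import measurable_realfun complex ring lra zify.
Set Implicit Arguments.
Unset Strict Implicit.
Unset Printing Implicit Defensive.
Import Order.TTheory GRing.Theory Num.Theory.
Import numFieldNormedType.Exports.
Local Open Scope classical_set_scope.
Local Open Scope ring_scope.

(** * Integration over R^d *)

(** The index lattice has cells of phase space area [pi / k] per dimension, half of the critical
    [2 pi / k]. This redundancy is the origin of [2^d], and it explains why only even shifts
    [j + 2 a] are combined: translation by an even lattice vector permutes the states exactly, every
    leftover phase being a multiple of [2 pi]. A [K]-combination of the coefficients of [u] is
    therefore again a family of coefficients, that of a sum of phase space translates of [u].
    Inserting this sum into the weak equation of a dual element gives the limit formula, with no
    other knowledge of the inverse frame operator.

    Neither the error [eta] of [K] nor the Cesaro weights vanish at a finite stage. Both are removed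
    through absolute summability and [l^2] bounds in which [K] enters only by [knorm K <= 9], so
    that approximations of the test function can be fixed before [K].

    In the closure, an element is reached by many approximating sequences. The sequence that defines
    the norm of [u - Pi_D u] is unrelated to the one built from [u], and closability compares the
    two. *)

Section Euclidean_measure.
Variable R : realType.
Local Notation RT := (measurableTypeR R : measurableType _).

(** Nested pairs mirror the recursion of [iint]: one Fubini step removes one coordinate. The tuples
    used in [cmeasurable] are related to them by [mfun_tupleP]. *)
Fixpoint edisp (d : nat) : measure_display :=
  if d is d'.+1 then
    measure_prod_display (sigma_display (R.-ocitv.-measurable), edisp d')
  else default_measure_display.

Fixpoint espace (d : nat) : measurableType (edisp d) :=
  match d return measurableType (edisp d) with
  | 0 => unit
  | d'.+1 => (measurableTypeR R * espace d')%type
  end.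

(* The canonical sigma-finite structure found on a product measure is the one
   inherited from sub-probabilities, hence the structure below. *)
Section leb_prod.
Context d (T : measurableType d) (m : {sigma_finite_measure set T -> \bar R}).

Definition leb_prod : set (measurableTypeR R * T) -> \bar R :=
  (@lebesgue_measure R \x m)%E.

HB.instance Definition _ := Measure.on leb_prod.

Let sigma_finite_leb_prod : sigma_finite setT leb_prod.
Proof.
have [F [FT ndF Foo]] := (sigma_finiteP _ _).1 (sigma_finiteT (@lebesgue_measure R)).
have [G [GT ndG Goo]] := (sigma_finiteP _ _).1 (sigma_finiteT m).
exists (fun n => F n `*` G n) => [|n]; last first.
  have [mF lF] := Foo n; have [mG lG] := Goo n.
  split; first exact: measurableX.
  by rewrite /leb_prod product_measure1E// lte_mul_pinfty// ge0_fin_numE.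
apply/esym; rewrite -subTset => -[x y] _.
have [i _ Fi] : (\bigcup_i F i) x by rewrite -FT.
have [j _ Gj] : (\bigcup_j G j) y by rewrite -GT.
exists (maxn i j) => //; split => /=.
  by move: Fi; apply/subsetPset/ndF/leq_maxl.
by move: Gj; apply/subsetPset/ndG/leq_maxr.
Qed.

HB.instance Definition _ :=
  Measure_isSigmaFinite.Build _ _ _ leb_prod sigma_finite_leb_prod.
End leb_prod.

Fixpoint emeas (d : nat) : {sigma_finite_measure set (espace d) -> \bar R} :=
  match d return {sigma_finite_measure set (espace d) -> \bar R} with
  | 0 => \d_ tt
  | d'.+1 => leb_prod (emeas d')
  end.

Fixpoint evec (d : nat) : espace d -> 'rV[R]_d :=
  match d return espace d -> 'rV[R]_d with
  | 0 => fun _ => 0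
  | d'.+1 => fun z => row_mx (\row_(j < 1) z.1) (evec z.2)
  end.

Lemma row0E (x : 'rV[R]_0) : x = 0.
Proof. by apply/rowP => -[]. Qed.

(** The integral is the difference of two Tonelli integrals whatever the sign of the integrand, so
    measurability in the parameter holds even where a section is not integrable. *)
Lemma measurable_integral_param d d' (X : measurableType d)
    (Y : measurableType d') (m : {sigma_finite_measure set Y -> \bar R})
    (G : X * Y -> \bar R) :
  measurable_fun [set: X * Y] G ->
  measurable_fun [set: X] (fun x => \int[m]_t G (x, t))%E.
Proof.
move=> mG.
have -> : (fun x => \int[m]_t G (x, t))%E =
  (fun x => (\int[m]_t (G^\+ (x, t))) - (\int[m]_t (G^\- (x, t))))%E.
  apply/funext => x; rewrite [LHS](integralE _ _ (G \o pair x)).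
  by rewrite funepos_comp funeneg_comp.
apply: emeasurable_funB.
  apply: (@measurable_fun_fubini_tonelli_F _ _ X Y R m (G^\+)%E) => //.
  exact: measurable_funepos.
apply: (@measurable_fun_fubini_tonelli_F _ _ X Y R m (G^\-)%E) => //.
exact: measurable_funeneg.
Qed.

(** The parameter space is arbitrary because each induction step moves the outermost integration
    variable into it. *)
Lemma measurable_iint_param d : forall d0 (X : measurableType d0)
    (F : X -> 'rV[R]_d -> \bar R),
  measurable_fun [set: X * espace d] (fun z => F z.1 (evec z.2)) ->
  measurable_fun setT (fun x => iint (F x)).
Proof.
elim: d => [|d IH] d0 X F mF /=.
  have mt : measurable_fun setT (fun x : X => (x, tt) : X * espace 0).
    exact: measurable_pair2.
  exact: (measurableT_comp mF mt).
pose G (z : X * measurableTypeR R) :=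
  iint (fun y : 'rV_d => F z.1 (row_mx (\row_(j < 1) z.2) y)).
have mG : measurable_fun setT G.
  apply: (IH _ (X * measurableTypeR R)%type
    (fun z y => F z.1 (row_mx (\row_(j < 1) z.2) y))).
  have ma : measurable_fun setT
      (fun z : X * measurableTypeR R * espace d =>
        (z.1.1, (z.1.2, z.2)) : X * espace d.+1).
    apply/measurable_fun_pairP; split.
      exact: (measurableT_comp (measurable_fst) measurable_fst).
    apply/measurable_fun_pairP; split.
      exact: (measurableT_comp (measurable_snd) measurable_fst).
    exact: measurable_snd.
  exact: (measurableT_comp mF ma).
exact: measurable_integral_param mG.
Qed.

Lemma measurable_slice d (F : 'rV[R]_d.+1 -> \bar R) t :
  measurable_fun setT (F \o @evec d.+1) ->
  measurable_fun setT ((fun y : 'rV_d => F (row_mx (\row_(j < 1) t) y)) \o @evec d).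
Proof.
move=> mF.
have mt : measurable_fun setT (fun y : espace d => (t, y) : espace d.+1).
  exact: measurable_pair1.
exact: (measurableT_comp mF mt).
Qed.

Lemma iint_ge0E d (F : 'rV[R]_d -> \bar R) :
  measurable_fun setT (F \o @evec d) -> (forall x, 0 <= F x)%E ->
  iint F = (\int[emeas d]_z F (evec z))%E.
Proof.
elim: d F => [|d IH] F mF F0.
  by rewrite /= integral_dirac ?diracT ?mul1e //; exact: mF.
have FP := @fubini_tonelli1 _ _ _ _ R (@lebesgue_measure R) (emeas d)
  (F \o @evec d.+1) mF (fun _ => F0 _).
apply: etrans (esym FP) => /=; apply: eq_integral => t _ /=.
by rewrite IH//; exact: measurable_slice.
Qed.

Lemma iintE d (F : 'rV[R]_d -> \bar R) :
  (emeas d).-integrable setT (F \o @evec d) ->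
  iint F = (\int[emeas d]_z F (evec z))%E.
Proof.
elim: d F => [|d IH] F iF.
  by rewrite /= integral_dirac ?diracT ?mul1e //; exact: measurable_int iF.
have mF : measurable_fun setT (F \o @evec d.+1) := measurable_int _ iF.
have FP := @integral12_prod_meas1 _ _ _ _ R (@lebesgue_measure R) (emeas d)
  (F \o @evec d.+1) iF.
(* Only almost every slice of an integrable function is integrable, so the induction hypothesis
   identifies the inner integrals almost everywhere. *)
apply: etrans FP => /=; apply: ae_eq_integral => //.
- apply: (@measurable_iint_param d _ (measurableTypeR R)
    (fun t y => F (row_mx (\row_(j < 1) t) y))).
  exact: mF.
- exact: (measurable_fubini_F iF).
have [N [mN N0 h]] := ae_integrable1 iF.
exists N; split => // t /= nt; apply: h => /= ti; apply: nt => _.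
by rewrite IH.
Qed.

End Euclidean_measure.

(** * Real integrals, square-integrable functions, dominated convergence *)

Section Real_integrals.
Variable R : realType.
Local Notation leb := (@lebesgue_measure R).

Definition rowc d (t : R) (y : 'rV[R]_d) : 'rV[R]_d.+1 :=
  row_mx (\row_(j < 1) t) y.

Lemma rowc0 d t (y : 'rV[R]_d) : rowc t y 0 ord0 = t.
Proof.
have -> : ord0 = lshift d (ord0 : 'I_1) :> 'I_(1 + d) by apply: ord_inj.
by rewrite /rowc (row_mxEl (\row_(j < 1) t)) mxE.
Qed.

Lemma rowcS d t (y : 'rV[R]_d) i : rowc t y 0 (lift ord0 i) = y 0 i.
Proof.
have -> : lift ord0 i = rshift 1 i :> 'I_(1 + d) by apply: ord_inj.
by rewrite /rowc (row_mxEr (\row_(j < 1) t)).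
Qed.

Lemma rowc_surj d (x : 'rV[R]_d.+1) :
  x = rowc (x 0 ord0) (\row_i x 0 (lift ord0 i)).
Proof.
apply/rowP => i; case: (unliftP ord0 i) => [j|] ->; first by rewrite rowcS mxE.
by rewrite rowc0.
Qed.

Definition mfun d (f : 'rV[R]_d -> R) :=
  measurable_fun [set: espace R d] (f \o @evec R d).
Definition intg d (f : 'rV[R]_d -> R) :=
  (emeas R d).-integrable setT (EFin \o (f \o @evec R d)).
Definition Int d (f : 'rV[R]_d -> R) : R :=
  (\int[emeas R d]_z f (evec z))%R.

Section fixed_dim.
Variable d : nat.
Implicit Types f g : 'rV[R]_d -> R.

Lemma intg_mfun f : intg f -> mfun f.
Proof. by move=> /(measurable_int _) /measurable_EFinP. Qed.

Lemma iint_Int f : intg f -> iint (fun x => (f x)%:E) = (Int f)%:E.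
Proof.
move=> fi; rewrite iintE// /Int /Rintegral fineK//.
exact: integrable_fin_num.
Qed.

Lemma ge0_intgP f : mfun f -> (forall x, 0 <= f x) ->
  intg f <-> (iint (fun x => (f x)%:E) < +oo)%E.
Proof.
move=> mf f0.
have mf' : measurable_fun setT ((fun x => (f x)%:E) \o @evec R d).
  exact/measurable_EFinP.
rewrite iint_ge0E//; split.
  move=> /integrableP[_]; under eq_integral do rewrite gee0_abs ?lee_fin ?f0//.
  by [].
move=> h; apply/integrableP; split => //.
by under eq_integral do rewrite gee0_abs ?lee_fin ?f0//.
Qed.

Lemma mfun_cst (c : R) : mfun (fun _ : 'rV[R]_d => c).
Proof. exact: measurable_cst. Qed.

Lemma mfunD f g : mfun f -> mfun g -> mfun (fun x => f x + g x).
Proof. exact: measurable_funD. Qed.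

Lemma mfunM f g : mfun f -> mfun g -> mfun (fun x => f x * g x).
Proof. exact: measurable_funM. Qed.

Lemma mfunN f : mfun f -> mfun (fun x => - f x).
Proof. exact: measurable_funN. Qed.

Lemma mfunB f g : mfun f -> mfun g -> mfun (fun x => f x - g x).
Proof. exact: measurable_funB. Qed.

Lemma mfunX f n : mfun f -> mfun (fun x => f x ^+ n).
Proof. exact: measurable_funX. Qed.

Lemma mfun_comp (phi : R -> R) f : measurable_fun setT phi -> mfun f ->
  mfun (fun x => phi (f x)).
Proof. by move=> mp mf; exact: measurableT_comp. Qed.

Lemma mfun_sum (T : Type) (s : seq T) (F : T -> 'rV[R]_d -> R) :
  (forall i, mfun (F i)) -> mfun (fun x => \sum_(i <- s) F i x).
Proof.
move=> mF; elim: s => [|a s IH].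
  by under eq_fun do rewrite big_nil; exact: mfun_cst.
by under eq_fun do rewrite big_cons; exact: mfunD.
Qed.

Lemma mfun_prod (T : Type) (s : seq T) (F : T -> 'rV[R]_d -> R) :
  (forall i, mfun (F i)) -> mfun (fun x => \prod_(i <- s) F i x).
Proof.
move=> mF; elim: s => [|a s IH].
  by under eq_fun do rewrite big_nil; exact: mfun_cst.
by under eq_fun do rewrite big_cons; exact: mfunM.
Qed.

Lemma intg_dom f g : mfun f -> intg g -> (forall x, `|f x| <= g x) -> intg f.
Proof.
move=> mf ig fg; apply: (le_integrable measurableT _ _ ig).
  exact/measurable_EFinP.
by move=> x _ /=; rewrite lee_fin (le_trans (fg _))// ler_norm.
Qed.

Lemma intgD f g : intg f -> intg g -> intg (fun x => f x + g x).
Proof.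
move=> fi gi; have := integrableD measurableT fi gi.
by apply: eq_integrable => // x _; rewrite /= EFinD.
Qed.

Lemma intgZ c f : intg f -> intg (fun x => c * f x).
Proof.
move=> fi; have := integrableZl measurableT c fi.
by apply: eq_integrable => // x _; rewrite /= EFinM.
Qed.

Lemma intg_eq f g : (forall x, f x = g x) -> intg f -> intg g.
Proof. by move=> /funext ->. Qed.

Lemma intgN f : intg f -> intg (fun x => - f x).
Proof. by move=> /(intgZ (-1)); apply: intg_eq => x; rewrite mulN1r. Qed.

Lemma intgB f g : intg f -> intg g -> intg (fun x => f x - g x).
Proof. by move=> fi gi; apply: intgD => //; exact: intgN. Qed.

Lemma intg0 : intg (fun _ : 'rV[R]_d => 0).
Proof. exact: integrable0. Qed.

Lemma intg_norm f : intg f -> intg (fun x => `|f x|).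
Proof.
move=> fi; have := integrable_abse fi.
by apply: eq_integrable => // x _.
Qed.

Lemma intg_sum (T : Type) (s : seq T) (F : T -> 'rV[R]_d -> R) :
  (forall i, intg (F i)) -> intg (fun x => \sum_(i <- s) F i x).
Proof.
move=> mF; elim: s => [|a s IH].
  by under eq_fun do rewrite big_nil; exact: intg0.
by under eq_fun do rewrite big_cons; exact: intgD.
Qed.

Lemma Int_eq f g : (forall x, f x = g x) -> Int f = Int g.
Proof. by move=> /funext ->. Qed.

Lemma IntD f g : intg f -> intg g -> Int (fun x => f x + g x) = Int f + Int g.
Proof. by move=> fi gi; rewrite /Int RintegralD. Qed.

Lemma IntZ c f : intg f -> Int (fun x => c * f x) = c * Int f.
Proof. by move=> fi; rewrite /Int RintegralZl. Qed.

Lemma IntN f : intg f -> Int (fun x => - f x) = - Int f.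
Proof.
by move=> fi; rewrite -mulN1r -IntZ//; apply: Int_eq => x; rewrite mulN1r.
Qed.

Lemma IntB f g : intg f -> intg g -> Int (fun x => f x - g x) = Int f - Int g.
Proof. by move=> fi gi; rewrite IntD ?IntN//; exact: intgN. Qed.

Lemma Int0 : Int (fun _ : 'rV[R]_d => 0) = 0.
Proof. by rewrite /Int /Rintegral integral0. Qed.

Lemma Int_sum (T : Type) (s : seq T) (F : T -> 'rV[R]_d -> R) :
  (forall i, intg (F i)) ->
  Int (fun x => \sum_(i <- s) F i x) = \sum_(i <- s) Int (F i).
Proof.
move=> mF; elim: s => [|a s IH].
  by rewrite big_nil; apply: etrans Int0; apply: Int_eq => x; rewrite big_nil.
rewrite big_cons -IH -IntD//; last exact: intg_sum.
by apply: Int_eq => x; rewrite big_cons.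
Qed.

Lemma Int_ge0 f : (forall x, 0 <= f x) -> 0 <= Int f.
Proof. by move=> f0; apply: Rintegral_ge0. Qed.

Lemma le_Int f g : intg f -> intg g -> (forall x, f x <= g x) -> Int f <= Int g.
Proof. by move=> fi gi fg; apply: le_Rintegral. Qed.

Lemma le_norm_Int f : intg f -> `|Int f| <= Int (fun x => `|f x|).
Proof. by move=> fi; apply: le_normr_Rintegral. Qed.

Lemma le_norm_Int_dom f g : mfun f -> intg g -> (forall x, `|f x| <= g x) ->
  `|Int f| <= Int g.
Proof.
move=> mf gi fg; have fi := intg_dom mf gi fg.
by rewrite (le_trans (le_norm_Int fi))// le_Int//; exact: intg_norm.
Qed.

(** Real square-integrable functions; complex ones are handled through [reP] and [imP], see
    [L2_sqi]. *)
Definition sqi f := mfun f /\ intg (fun x => f x ^+ 2).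

Lemma sqi_mul f g : sqi f -> sqi g -> intg (fun x => f x * g x).
Proof.
move=> [mf fi] [mg gi]; apply: (@intg_dom _ (fun x => f x ^+ 2 + g x ^+ 2)).
- exact: mfunM.
- exact: intgD.
move=> x; rewrite ler_norml; apply/andP; split.
  by have := sqr_ge0 (f x + g x); nra.
by have := sqr_ge0 (f x - g x); nra.
Qed.

Lemma sqiZ c f : sqi f -> sqi (fun x => c * f x).
Proof.
move=> [mf fi]; split; first by apply: mfunM => //; exact: mfun_cst.
by apply: intg_eq (intgZ (c ^+ 2) fi) => x; rewrite exprMn.
Qed.

Lemma sqiD f g : sqi f -> sqi g -> sqi (fun x => f x + g x).
Proof.
move=> sf sg; split; first by case: sf sg => mf _ [mg _]; exact: mfunD.
have := intgD (intgD sf.2 sg.2) (intgZ 2 (sqi_mul sf sg)).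
by apply: intg_eq => x; ring.
Qed.

Lemma sqiN f : sqi f -> sqi (fun x => - f x).
Proof.
move=> [mf fi]; split; first exact: mfunN.
by apply: intg_eq fi => x; rewrite sqrrN.
Qed.

Lemma sqiB f g : sqi f -> sqi g -> sqi (fun x => f x - g x).
Proof. by move=> sf sg; apply: sqiD => //; exact: sqiN. Qed.

Lemma sqi0 : sqi (fun _ => 0).
Proof.
split; first exact: mfun_cst.
by apply: intg_eq intg0 => x; rewrite expr0n.
Qed.

Lemma sqi_sum (T : Type) (s : seq T) (F : T -> 'rV[R]_d -> R) :
  (forall i, sqi (F i)) -> sqi (fun x => \sum_(i <- s) F i x).
Proof.
move=> mF; elim: s => [|a s IH].
  by under eq_fun do rewrite big_nil; exact: sqi0.
by under eq_fun do rewrite big_cons; exact: sqiD.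
Qed.

Lemma Cauchy_Schwarz f g : sqi f -> sqi g ->
  Int (fun x => f x * g x) ^+ 2 <=
  Int (fun x => f x ^+ 2) * Int (fun x => g x ^+ 2).
Proof.
move=> sf sg; set A := Int (fun x => f x ^+ 2); set B := Int (fun x => g x ^+ 2).
set P := Int _.
have quad s t : 0 <= s ^+ 2 * A + 2 * s * t * P + t ^+ 2 * B.
  have := @Int_ge0 (fun x => (s * f x + t * g x) ^+ 2) (fun x => sqr_ge0 _).
  rewrite (@Int_eq _ (fun x => s ^+ 2 * f x ^+ 2 + 2 * s * t * (f x * g x)
    + t ^+ 2 * g x ^+ 2)); last by move=> x; ring.
  have i1 := intgZ (s ^+ 2) sf.2; have i2 := intgZ (2 * s * t) (sqi_mul sf sg).
  have i3 := intgZ (t ^+ 2) sg.2.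
  rewrite IntD//; last exact: intgD.
  rewrite IntD// !IntZ//; [exact: sg.2|exact: sqi_mul|exact: sf.2].
have A0 : 0 <= A by apply: Int_ge0 => x; exact: sqr_ge0.
have B0 : 0 <= B by apply: Int_ge0 => x; exact: sqr_ge0.
have [B1|B1] := ltP 0 B.
  have := quad B (- P).
  rewrite (_ : _ + _ = B * (A * B - P ^+ 2)); last by ring.
  by rewrite pmulr_rge0// subr_ge0.
have BE : B = 0 by apply/eqP; rewrite eq_le B1 B0.
(* When [B = 0] the form is affine in its second argument; this choice gives [- P^2 (A + 2)], which
   forces [P = 0]. *)
have := quad P (- (A + 1)).
rewrite BE !mulr0 addr0 (_ : _ + _ = - (P ^+ 2 * (A + 2))); last by ring.
rewrite oppr_ge0 pmulr_lle0//; lra.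
Qed.

Lemma Int_dominated (F : nat -> 'rV[R]_d -> R) f g :
  (forall n, mfun (F n)) -> intg g ->
  (forall x, F ^~ x @ \oo --> f x) -> (forall n x, `|F n x| <= g x) ->
  intg f /\ (fun n => Int (F n)) @ \oo --> Int f.
Proof.
move=> mF ig Ff Fg.
have mf : mfun f.
  by apply: (measurable_fun_cvg mF) => z _; exact: Ff.
have fg x : `|f x| <= g x.
  have h : (fun n => `|F n x|) @ \oo --> `|f x| by exact: cvg_norm.
  rewrite -(cvg_lim _ h)//; apply: limr_le; first by apply/cvg_ex; exists `|f x|.
  by apply: nearW => n.
have fi : intg f := intg_dom mf ig fg.
split => //.
have EFf z : (fun n => (F n (evec z))%:E) @ \oo --> (f (evec z))%:E.
  by apply/fine_cvgP; split; [exact: nearW|exact: Ff].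
have [_ _ h] := @dominated_convergence _ _ _ (emeas R d) setT measurableT
  (fun n z => (F n (evec z))%:E) (fun z => (f (evec z))%:E)
  (fun z => (g (evec z))%:E)
  (fun n => (measurable_EFinP _ _).2 (mF n)) ((measurable_EFinP _ _).2 mf)
  (aeW _ (fun z _ => EFf z))
  ig (aeW _ (fun z n _ => Fg n _)).
by apply: fine_cvg; rewrite fineK//; exact: integrable_fin_num.
Qed.

End fixed_dim.
End Real_integrals.

(** * Coordinates, slices and tensor products *)

Section Coordinates.
Variable R : realType.
Local Notation leb := (@lebesgue_measure R).

Lemma mfun_coord d (i : 'I_d) : mfun (fun x : 'rV[R]_d => x 0 i).
Proof.
elim: d i => [[]//|d IH] i; rewrite /mfun.
case: (unliftP ord0 i) => [j|] ->.
  rewrite (_ : _ \o _ = ((fun x : 'rV[R]_d => x 0 j) \o @evec R d) \o snd).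
    exact: (measurableT_comp (IH j) measurable_snd).
  by apply/funext => z /=; exact: rowcS.
rewrite (_ : _ \o _ = fst); first exact: measurable_fst.
by apply/funext => z /=; exact: rowc0.
Qed.

Fixpoint efrom d : ('I_d -> R) -> espace R d :=
  match d return ('I_d -> R) -> espace R d with
  | 0 => fun _ => tt
  | d'.+1 => fun c => (c ord0, efrom (fun i => c (lift ord0 i)))
  end.

Lemma evec_efrom d (c : 'I_d -> R) : evec (efrom c) = \row_i c i.
Proof.
elim: d c => [|d IH] c; first by apply/rowP => -[].
transitivity (rowc (c ord0) (\row_i c (lift ord0 i))); first by rewrite -IH.
apply/rowP => i; case: (unliftP ord0 i) => [j|] ->; first by rewrite rowcS !mxE.
by rewrite rowc0 mxE.
Qed.

Lemma measurable_efrom d d0 (X : measurableType d0) (c : X -> 'I_d -> R) :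
  (forall i, measurable_fun [set: X] (c ^~ i)) ->
  measurable_fun [set: X] (fun x => efrom (c x)).
Proof.
elim: d c => [|d IH] c mc; first exact: measurable_cst.
apply/measurable_fun_pairP; split; first exact: (mc ord0).
by apply: (IH (fun x i => c x (lift ord0 i))) => i; exact: mc.
Qed.

(** Either representation of a point is rebuilt measurably from the coordinates of the other, so
    each direction is a composition with such a map. *)
Lemma mfun_tupleP d (f : 'rV[R]_d -> R) :
  measurable_fun [set: d.-tuple R] (fun t => f (rv_of_tuple t)) <-> mfun f.
Proof.
split=> mf.
  have mt : measurable_fun [set: espace R d]
      (fun z => [tuple evec z 0 i | i < d]).
    apply/measurable_fun_tnthP => i.
    rewrite (_ : _ \o _ = (fun x : 'rV[R]_d => x 0 i) \o @evec R d).
      exact: mfun_coord.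
    by apply/funext => z /=; rewrite tnth_mktuple.
  have := measurableT_comp mf mt; rewrite /mfun.
  rewrite (_ : _ \o _ = f \o @evec R d)//.
  apply/funext => z /=; congr f; apply/rowP => i.
  by rewrite mxE tnth_mktuple.
have me : measurable_fun [set: d.-tuple R] (fun t => efrom (tnth t)).
  by apply: (measurable_efrom (c := @tnth d R)) => i; exact: measurable_tnth.
have := measurableT_comp mf me; apply: eq_measurable_fun => t _ /=.
by rewrite evec_efrom.
Qed.

Lemma Int_dim0 (f : 'rV[R]_0 -> R) : mfun f -> Int f = f 0.
Proof.
by move=> mf; rewrite /Int /Rintegral integral_dirac// diracT mul1e.
Qed.

Lemma intg_dim0 (f : 'rV[R]_0 -> R) : mfun f -> intg f.
Proof.
move=> mf; apply/integrableP; split; first exact/measurable_EFinP.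
by rewrite integral_dirac// ?diracT ?mul1e ?ltry//.
Qed.

Section slices.
Variables (d : nat) (F : 'rV[R]_d.+1 -> R).
Hypothesis iF : intg F.

Lemma Int_rowc : (forall t, intg (fun y => F (rowc t y))) ->
  leb.-integrable setT (EFin \o (fun t => Int (fun y => F (rowc t y)))) /\
  Int F = \int[leb]_t Int (fun y => F (rowc t y)).
Proof.
move=> h.
pose G := fubini_F (emeas R d) (EFin \o (F \o @evec R d.+1)).
have GE : G = EFin \o (fun t => Int (fun y => F (rowc t y))).
  apply/funext => t; rewrite /G /fubini_F /Int /Rintegral /= fineK//.
  exact: (integrable_fin_num measurableT (h t)).
have iG : leb.-integrable setT G.
  exact: (@integrable_fubini_F _ _ _ _ R leb (emeas R d) _ iF).
have EG := @integral12_prod_meas1 _ _ _ _ R leb (emeas R d) _ iF.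
split; first by rewrite -GE.
rewrite /Int /Rintegral; congr fine.
by apply: etrans (esym EG) _; rewrite -/G GE.
Qed.

Lemma Int_rowc' :
  (forall y, leb.-integrable setT (EFin \o (fun t => F (rowc t y)))) ->
  Int F = Int (fun y => \int[leb]_t F (rowc t y)).
Proof.
move=> h.
pose G := fubini_G leb (EFin \o (F \o @evec R d.+1)).
have GE : G = EFin \o ((fun y => \int[leb]_t F (rowc t y)) \o @evec R d).
  apply/funext => z; rewrite /G /fubini_G /Rintegral /= fineK//.
  exact: (integrable_fin_num measurableT (h (evec z))).
have EG := @integral21_prod_meas1 _ _ _ _ R leb (emeas R d) _ iF.
rewrite /Int /Rintegral; congr fine.
by apply: etrans (esym EG) _; rewrite -/G GE.
Qed.

End slices.

Definition rtail d (x : 'rV[R]_d.+1) : 'rV[R]_d := \row_i x 0 (lift ord0 i).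

Lemma rtail_rowc d t (y : 'rV[R]_d) : rtail (rowc t y) = y.
Proof. by apply/rowP => i; rewrite mxE rowcS. Qed.

Lemma rowcE d (x : 'rV[R]_d.+1) : x = rowc (x 0 ord0) (rtail x).
Proof. exact: rowc_surj. Qed.

Lemma intg_tensor d (f : R -> R) (g : 'rV[R]_d -> R) :
  leb.-integrable setT (EFin \o f) -> intg g ->
  intg (fun x : 'rV[R]_d.+1 => f (x 0 ord0) * g (rtail x)).
Proof.
move=> iF ig.
have mf : measurable_fun [set: measurableTypeR R] f.
  by move: (measurable_int _ iF) => /measurable_EFinP.
have mg : measurable_fun [set: espace R d] (g \o @evec R d) := intg_mfun ig.
have E (z : espace R d.+1) : (fun x : 'rV[R]_d.+1 => f (x 0 ord0) * g (rtail x)) (evec z) =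
  f z.1 * g (evec z.2).
  by case: z => t z; rewrite [evec _]/(rowc t (evec z)) rowc0 rtail_rowc.
have mfg : measurable_fun [set: espace R d.+1]
    (fun z => f z.1 * g (evec z.2)).
  apply: measurable_funM.
    exact: (measurableT_comp mf measurable_fst).
  exact: (measurableT_comp mg measurable_snd).
rewrite /intg (_ : EFin \o _ = (fun z => (f z.1 * g (evec z.2))%:E)); last first.
  by apply/funext => z /=; rewrite -E.
have mfg' : measurable_fun [set: (measurableTypeR R * espace R d)%type]
   (fun z => (f z.1 * g (evec z.2))%:E) by exact/measurable_EFinP.
apply/(@integrable12ltyP _ _ _ _ R leb (emeas R d) _ mfg') => /=.
have -> : (fun t => \int[emeas R d]_y `|(f t * g (evec y))%:E|)%E =
    (fun t => (\int[emeas R d]_y `|(g (evec y))%:E|) * `|(f t)%:E|)%E.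
  apply/funext => t.
  under eq_integral do rewrite EFinM abseM muleC.
  rewrite ge0_integralZr//.
  by apply: measurableT_comp => //; exact/measurable_EFinP.
have /integrableP[_ fg] := ig; have /integrableP[_ ff] := iF.
rewrite ge0_integralZl//.
- rewrite lte_mul_pinfty//; first exact: integral_ge0.
  by rewrite ge0_fin_numE//; exact: integral_ge0.
- by apply: measurableT_comp => //; exact/measurable_EFinP.
- exact: integral_ge0.
Qed.

Lemma Int_tensor d (f : R -> R) (g : 'rV[R]_d -> R) :
  leb.-integrable setT (EFin \o f) -> intg g ->
  Int (fun x : 'rV[R]_d.+1 => f (x 0 ord0) * g (rtail x)) =
  (\int[leb]_t f t) * Int g.
Proof.
move=> iF ig.
have [|_ ->] := Int_rowc (intg_tensor iF ig).
  by move=> t; apply: intg_eq (intgZ (f t) ig) => y; rewrite rowc0 rtail_rowc.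
rewrite -RintegralZr//; apply: eq_Rintegral => t _.
rewrite -IntZ//; apply: Int_eq => y; by rewrite rowc0 rtail_rowc.
Qed.

Lemma Int_prod d (f : 'I_d -> R -> R) :
  (forall i, leb.-integrable setT (EFin \o f i)) ->
  intg (fun x : 'rV[R]_d => \prod_i f i (x 0 i)) /\
  Int (fun x : 'rV[R]_d => \prod_i f i (x 0 i)) = \prod_i \int[leb]_t f i t.
Proof.
elim: d f => [|d IH] f fi.
  have m1 : mfun (fun x : 'rV[R]_0 => \prod_i f i (x 0 i)).
    rewrite (_ : (fun x => _) = (fun _ => 1)); first exact: mfun_cst.
    by apply/funext => x; rewrite big_ord0.
  by split; [exact: intg_dim0|rewrite Int_dim0// !big_ord0].
have [IH1 IH2] := IH (fun i => f (lift ord0 i)) (fun i => fi _).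
have E (x : 'rV[R]_d.+1) : \prod_i f i (x 0 i) =
    f ord0 (x 0 ord0) * \prod_i f (lift ord0 i) (rtail x 0 i).
  by rewrite big_ord_recl; congr (_ * _); apply: eq_bigr => i _; rewrite mxE.
rewrite (funext E); split; first exact: (intg_tensor (fi ord0) IH1).
by rewrite (Int_tensor (fi ord0) IH1) IH2 big_ord_recl.
Qed.

End Coordinates.

(** * Translation invariance of the integral *)

Section Translation.
Variable R : realType.
Local Notation leb := (@lebesgue_measure R).
Local Notation RT := (measurableTypeR R).

Let shift (c : R) : RT -> RT := fun t => t + c.

Let mshift c : measurable_fun [set: RT] (shift c).
Proof. by apply: measurable_funD => //; exact: measurable_cst. Qed.

Lemma leb_shift c (A : set RT) : measurable A ->
  pushforward leb (shift c) A = leb A.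
Proof.
move=> mA; apply/esym.
pose m := measure_function_pushforward__canonical__measure_function_Measure leb (mshift c).
apply: (lebesgue_measure_unique (mu := m)) => // _ [[a b] _ <-] /=.
rewrite /m /= /pushforward.
have -> : shift c @^-1` `]a, b] = `]a - c, b - c]%classic.
  by apply/seteqP; split => x /=; rewrite !in_itv /= /shift ltrBlDr lerBrDr.
rewrite !lebesgue_measure_itv /= !lte_fin ltrD2r.
by case: ifP => // _; rewrite -!EFinB; congr EFin; ring.
Qed.

Lemma ge0_integral_shift c (f : RT -> \bar R) : measurable_fun setT f ->
  (forall t, 0 <= f t)%E ->
  (\int[leb]_t f (t + c)%R = \int[leb]_t f t)%E.
Proof.
move=> mf f0.
pose m := measure_function_pushforward__canonical__measure_function_Measure
  leb (mshift c).
have <- : (\int[m]_t f t = \int[leb]_t f t)%E.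
  by apply: eq_measure_integral => A mA _; exact: leb_shift.
by have := ge0_integral_pushforward (mshift c) leb measurableT mf
  (fun y _ => f0 y); rewrite preimage_setT => <-.
Qed.

Lemma rowcD d t s (x y : 'rV[R]_d) : rowc t x + rowc s y = rowc (t + s) (x + y).
Proof.
apply/rowP => i; case: (unliftP ord0 i) => [j|] ->; rewrite mxE.
  by rewrite !rowcS mxE.
by rewrite !rowc0.
Qed.

Lemma measurable_evec_shift d (a : 'rV[R]_d) (F : 'rV[R]_d -> \bar R) :
  measurable_fun setT (F \o @evec R d) ->
  measurable_fun setT ((fun x => F (x + a)) \o @evec R d).
Proof.
move=> mF.
have me : measurable_fun [set: espace R d]
    (fun z => efrom (fun i => evec z 0 i + a 0 i)).
  apply: (@measurable_efrom R d _ (espace R d) (fun z i => evec z 0 i + a 0 i)).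
  move=> i; have := mfunD (mfun_coord i) (mfun_cst (d:=d) (a 0 i)).
  by [].
have := measurableT_comp mF me; apply: eq_measurable_fun => z _ /=.
by congr F; rewrite evec_efrom; apply/rowP => i; rewrite !mxE.
Qed.

Lemma mfun_shift d (a : 'rV[R]_d) f : mfun f -> mfun (fun x => f (x + a)).
Proof.
move=> mf; apply/measurable_EFinP.
by apply: (@measurable_evec_shift _ a (EFin \o f)); exact/measurable_EFinP.
Qed.

Lemma ge0_integral_evec_shift d (a : 'rV[R]_d) (F : 'rV[R]_d -> \bar R) :
  measurable_fun setT (F \o @evec R d) -> (forall x, 0 <= F x)%E ->
  (\int[emeas R d]_z F (evec z + a)%R = \int[emeas R d]_z F (evec z))%E.
Proof.
elim: d a F => [|d IH] a F mF F0.
  by apply: eq_integral => z _; congr F; rewrite (row0E (_ + a)) (row0E (evec z)).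
have mFa := measurable_evec_shift a mF.
have FP := @fubini_tonelli1 _ _ _ _ R leb (emeas R d) (F \o @evec R d.+1) mF
  (fun _ => F0 _).
have FQ := @fubini_tonelli1 _ _ _ _ R leb (emeas R d)
  ((fun x => F (x + a)) \o @evec R d.+1) mFa (fun _ => F0 _).
apply: (etrans FQ); apply: etrans (esym FP).
pose G (t : RT) := (\int[emeas R d]_z F (rowc t (evec z)))%E.
have mG : measurable_fun [set: RT] G.
  exact: (@measurable_fun_fubini_tonelli_F _ _ RT (espace R d) R (emeas R d)
    (F \o @evec R d.+1) mF (fun _ => F0 _)).
have G0 t : (0 <= G t)%E by exact: integral_ge0.
apply: etrans (ge0_integral_shift (a 0 ord0) mG G0).
apply: eq_integral => t _; rewrite /fubini_F /G /=.
rewrite -(IH (rtail a) (fun y => F (rowc (t + a 0 ord0) y)))//.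
  apply: eq_integral => z _; rewrite -rowcD -rowcE//.
exact: (measurable_slice (t + a 0 ord0) mF).
Qed.

Lemma integral_evec_shift d (a : 'rV[R]_d) (F : 'rV[R]_d -> \bar R) :
  measurable_fun setT (F \o @evec R d) ->
  (\int[emeas R d]_z F (evec z + a)%R = \int[emeas R d]_z F (evec z))%E.
Proof.
move=> mF.
pose s (z : espace R d) := evec z + a.
rewrite [LHS](integralE _ _ (F \o s)) [RHS](integralE _ _ (F \o @evec R d)).
have mp := measurable_funepos mF; have mn := measurable_funeneg mF.
move: mp mn; rewrite (funepos_comp F (@evec R d)) (funeneg_comp F (@evec R d)).
rewrite (funepos_comp F s) (funeneg_comp F s) => mp mn.
congr (_ - _)%E.
  by apply: (@ge0_integral_evec_shift _ a F^\+%E).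
by apply: (@ge0_integral_evec_shift _ a F^\-%E).
Qed.

Lemma Int_shift d (a : 'rV[R]_d) f : mfun f ->
  Int (fun x => f (x + a)) = Int f.
Proof.
move=> mf; rewrite /Int /Rintegral; congr fine.
by apply: (@integral_evec_shift _ a (EFin \o f)); exact/measurable_EFinP.
Qed.

Lemma intg_shift d (a : 'rV[R]_d) f : intg f -> intg (fun x => f (x + a)).
Proof.
move=> fi; have mf := intg_mfun fi; have /integrableP[mF lF] := fi.
apply/integrableP; split.
  by apply/measurable_EFinP; exact: mfun_shift.
apply: le_lt_trans lF.
rewrite -(@ge0_integral_evec_shift _ a (fun x => `|(f x)%:E|%E))//.
by apply: measurableT_comp => //; exact/measurable_EFinP.
Qed.

Lemma integrable_shift (c : R) (f : RT -> R) :
  leb.-integrable setT (EFin \o f) ->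
  leb.-integrable setT (EFin \o (fun t => f (t + c))).
Proof.
move=> /integrableP[/measurable_EFinP mf lf].
have mfc : measurable_fun [set: RT] (f \o shift c).
  exact: measurableT_comp mf (mshift c).
apply/integrableP; split; first exact/measurable_EFinP.
apply: le_lt_trans lf.
rewrite -(@ge0_integral_shift c (fun t => `|(f t)%:E|%E))//.
by apply: measurableT_comp => //; exact/measurable_EFinP.
Qed.

Lemma Rintegral_shift (c : R) (f : RT -> R) : measurable_fun setT f ->
  \int[leb]_t f (t + c) = \int[leb]_t f t.
Proof.
move=> mf; rewrite /Rintegral; congr fine.
have mF : measurable_fun [set: RT] (EFin \o f) by exact/measurable_EFinP.
have mp := measurable_funepos mF; have mn := measurable_funeneg mF.
rewrite [LHS](integralE _ _ ((EFin \o f) \o shift c)).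
rewrite [RHS](integralE _ _ (EFin \o f)).
rewrite (funepos_comp (EFin \o f) (shift c)) (funeneg_comp (EFin \o f) (shift c)).
congr (_ - _)%E.
  by apply: (@ge0_integral_shift c (EFin \o f)^\+%E).
by apply: (@ge0_integral_shift c (EFin \o f)^\-%E).
Qed.

End Translation.

(** * Integrals over the line: fundamental theorem, scaling, Gaussians *)

Section Line_integrals.
Variable R : realType.
Local Notation leb := (@lebesgue_measure R).
Local Notation RT := (measurableTypeR R).

Definition integ (f : R -> R) := leb.-integrable [set: RT] (EFin \o f).

Lemma integ_mfun (f : R -> R) : integ f -> measurable_fun [set: RT] f.
Proof. by move=> /(measurable_int _) /measurable_EFinP. Qed.

Lemma integ_dom (f g : R -> R) : measurable_fun [set: RT] f -> integ g ->
  (forall x, `|f x| <= g x) -> integ f.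
Proof.
move=> mf ig fg; apply: (le_integrable measurableT _ _ ig).
  exact/measurable_EFinP.
by move=> x _ /=; rewrite lee_fin (le_trans (fg _))// ler_norm.
Qed.

Lemma integZ c (f : R -> R) : integ f -> integ (fun x => c * f x).
Proof.
move=> fi; have := integrableZl measurableT c fi.
by apply: eq_integrable => // x _; rewrite /= EFinM.
Qed.

Lemma integD (f g : R -> R) : integ f -> integ g -> integ (fun x => f x + g x).
Proof.
move=> fi gi; have := integrableD measurableT fi gi.
by apply: eq_integrable => // x _; rewrite /= EFinD.
Qed.

Lemma integ_norm (f : R -> R) : integ f -> integ (fun x => `|f x|).
Proof.
move=> fi; have := integrable_abse fi.
by apply: eq_integrable => // x _.
Qed.

Lemma Rint_le_dom (f g : R -> R) : measurable_fun [set: RT] f -> integ g ->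
  (forall x, `|f x| <= g x) -> `|\int[leb]_t f t| <= \int[leb]_t g t.
Proof.
move=> mf gi fg; have fi := integ_dom mf gi fg.
apply: (le_trans (le_normr_Rintegral measurableT fi)).
by apply: le_Rintegral => //; exact: integ_norm.
Qed.

Lemma Rint_dominated (F : nat -> R -> R) (f g : R -> R) :
  (forall n, measurable_fun [set: RT] (F n)) -> integ g ->
  (forall x, F ^~ x @ \oo --> f x) -> (forall n x, `|F n x| <= g x) ->
  integ f /\ (fun n => \int[leb]_t F n t) @ \oo --> \int[leb]_t f t.
Proof.
move=> mF ig Ff Fg.
have mf : measurable_fun [set: RT] f.
  by apply: (measurable_fun_cvg mF) => z _; exact: Ff.
have fg x : `|f x| <= g x.
  have h : (fun n => `|F n x|) @ \oo --> `|f x| by exact: cvg_norm.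
  rewrite -(cvg_lim _ h)//; apply: limr_le; first by apply/cvg_ex; exists `|f x|.
  by apply: nearW => n.
have fi : integ f := integ_dom mf ig fg.
split => //.
have EFf z : (fun n => (F n z)%:E) @ \oo --> (f z)%:E.
  by apply/fine_cvgP; split; [exact: nearW|exact: Ff].
have mF' n : measurable_fun [set: RT] (fun z => (F n z)%:E).
  exact/measurable_EFinP.
have mf' : measurable_fun [set: RT] (fun z => (f z)%:E) by exact/measurable_EFinP.
have [||_ _ h] := dominated_convergence measurableT mF' mf' _ ig.
- by apply: aeW => z _; exact: EFf.
- by apply: aeW => z n _; exact: Fg.
by apply: fine_cvg; rewrite fineK//; exact: integrable_fin_num.
Qed.

Lemma integ_continuous_dom (f g : R -> R) : continuous f -> integ g ->
  (forall x, `|f x| <= g x) -> integ f.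
Proof. by move=> cf; apply: integ_dom; exact: continuous_measurable_fun. Qed.

Lemma integ_oneDsqrV : integ (fun t => (1 + t ^+ 2)^-1).
Proof.
have c1 : continuous (fun t : R => (1 + t ^+ 2)^-1).
  exact: (@continuous_oneDsqrV R).
have m1 : measurable_fun [set: RT] (fun t : R => (1 + t ^+ 2)^-1).
  exact: continuous_measurable_fun.
have p1 (t : R) : 0 <= (1 + t ^+ 2)^-1.
  by rewrite invr_ge0 addr_ge0// sqr_ge0.
apply/integrableP; split; first exact/measurable_EFinP.
rewrite (eq_integral (fun t : RT => ((1 + t ^+ 2 : R)^-1)%:E)); last first.
  by move=> t _ /=; rewrite ger0_norm.
rewrite ge0_symfun_integralT//; last by move=> t /=; rewrite sqrrN.
rewrite -set_itvcy (@ge0_continuous_FTC2y R _ atan _ (pi / 2))//.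
- by rewrite atan0 sube0 -EFinM ltry.
- exact: continuous_subspaceT.
- exact: cvgy_atan.
- by apply: cvg_at_right_filter; exact: continuous_atan.
- by move=> x _; rewrite derive1_atan.
Qed.

(** Truncating [f] to [[-n, n]] and letting [n] grow by dominated convergence, only the values of
    [F] at the integers matter. *)
Lemma Rintegral_deriv0 (F f : R -> R) :
  (forall t : R, is_derive t 1 F (f t)) -> continuous f -> integ f ->
  (fun n => F n%:R) @ \oo --> 0 -> (fun n => F (- n%:R)) @ \oo --> 0 ->
  \int[leb]_t f t = 0.
Proof.
move=> dF cf fi F1 F2.
pose G n t := f t * \1_(`[- n%:R, n%:R]%classic : set R) t.
have mf := integ_mfun fi.
have mG n : measurable_fun [set: RT] (G n).
  apply: measurable_funM => //; exact: measurable_indic.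
have Gf x : G ^~ x @ \oo --> f x.
  apply/cvgrPdist_le => e e0; near=> n.
  rewrite (_ : G n x = f x) ?subrr ?normr0 ?ltW//.
  rewrite /G indicE mem_set ?mulr1//= in_itv /= -ler_norml.
  by near: n; exact: nbhs_infty_ger.
have Gb n x : `|G n x| <= `|f x|.
  rewrite /G normrM ler_piMr//.
  by rewrite indicE; case: (_ \in _); rewrite ?normr1 ?normr0.
have [_ h] := Rint_dominated mG (integ_norm fi) Gf Gb.
(* The index is shifted by one because the fundamental theorem needs a nondegenerate interval. *)
have E n : \int[leb]_t G n.+1 t = F n.+1%:R - F (- n.+1%:R).
  have lt : - n.+1%:R < n.+1%:R :> R by rewrite -subr_gt0 opprK -natrD ltr0n.
  have cF : continuous F.
    move=> x; apply: differentiable_continuous; apply/derivable1_diffP.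
    by case: (dF x).
  have := @continuous_FTC2 R f F _ _ lt (continuous_subspaceT cf).
  move=> H; rewrite /Rintegral.
  have -> : (\int[leb]_t (G n.+1 t)%:E =
      \int[leb]_(t in `[(- n.+1%:R)%R, n.+1%:R]) (f t)%:E)%E.
    rewrite [RHS]integral_mkcond; apply: eq_integral => t _.
    by rewrite patchE /G indicE; case: ifP => _; rewrite ?mulr1 ?mulr0.
  rewrite H//=.
    split; first by move=> x _; case: (dF x).
      by apply: cvg_at_right_filter; exact: cF.
    by apply: cvg_at_left_filter; exact: cF.
  by move=> x _; rewrite derive1E; exact: derive_val.
have h2 : (fun n => \int[leb]_t G n.+1 t) @ \oo --> 0.
  rewrite (funext E) -[X in _ --> X](subrr (0 : R)).
  apply: cvgB; first by rewrite (cvg_shiftS (fun n => F n%:R)).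
  by rewrite (cvg_shiftS (fun n => F (- n%:R))).
have h1 : (fun n => \int[leb]_t G n.+1 t) @ \oo --> \int[leb]_t f t.
  by rewrite (cvg_shiftS (fun n => \int[leb]_t G n t)).
exact: (cvg_unique _ h1 h2).
Unshelve. all: by end_near. Qed.

Lemma leb_scale (c : R) (c0 : c != 0) (A : set RT) : measurable A ->
  (`|c|%:E * leb ((fun t : RT => (c * t)%R : RT) @^-1` A) = leb A)%E.
Proof.
move=> mA.
have mc : measurable_fun [set: RT] (fun t : RT => (c * t)%R : RT).
  by apply: measurable_funM => //; exact: measurable_cst.
pose m1 := measure_function_pushforward__canonical__measure_function_Measure
  leb mc.
pose m := [the measure _ _ of mscale (NngNum (normr_ge0 c)) m1].
apply/esym; apply: (lebesgue_measure_unique (mu := m)) => // _ [[a b] _ <-] /=.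
rewrite /m /= /mscale /= /pushforward.
have [c1|c1|c1] := ltgtP c 0.
- have -> : (fun t : RT => (c * t)%R) @^-1` `]a, b] = `[b / c, a / c[%classic.
    apply/seteqP; split => x /=; rewrite !in_itv /=.
      by rewrite ler_ndivrMr// ltr_ndivlMr// ![x * _]mulrC andbC.
    by rewrite ler_ndivrMr// ltr_ndivlMr// ![x * _]mulrC andbC.
  rewrite !lebesgue_measure_itv /= !lte_fin ltr_nM2r ?invr_lt0//.
  case: ifP => // _; last by rewrite mule0.
  by rewrite -!EFinB -EFinM ltr0_norm//; congr EFin; field.
- have -> : (fun t : RT => (c * t)%R) @^-1` `]a, b] = `]a / c, b / c]%classic.
    apply/seteqP; split => x /=; rewrite !in_itv /=.
      by rewrite ltr_pdivrMr// ler_pdivlMr// ![x * _]mulrC.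
    by rewrite ltr_pdivrMr// ler_pdivlMr// ![x * _]mulrC.
  rewrite !lebesgue_measure_itv /= !lte_fin ltr_pM2r ?invr_gt0//.
  case: ifP => // _; last by rewrite mule0.
  by rewrite -!EFinB -EFinM gtr0_norm//; congr EFin; field.
- by rewrite c1 eqxx in c0.
Qed.

Lemma ge0_integral_scale c (f : RT -> \bar R) : c != 0 ->
  measurable_fun setT f -> (forall t, 0 <= f t)%E ->
  (`|c|%:E * \int[leb]_t f (c * t)%R = \int[leb]_t f t)%E.
Proof.
move=> c0 mf f0.
have mc : measurable_fun [set: RT] (fun t : RT => (c * t)%R : RT).
  by apply: measurable_funM => //; exact: measurable_cst.
pose m1 := measure_function_pushforward__canonical__measure_function_Measure
  leb mc.
pose m := [the measure _ _ of mscale (NngNum (normr_ge0 c)) m1].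
have <- : (\int[m]_t f t = \int[leb]_t f t)%E.
  by apply: eq_measure_integral => A mA _; exact: leb_scale.
rewrite /m ge0_integral_mscale//; congr (_ * _)%E.
by have := ge0_integral_pushforward mc leb measurableT mf
  (fun y _ => f0 y); rewrite preimage_setT => <-.
Qed.

Lemma integ_scale c (f : R -> R) : c != 0 -> integ f -> integ (fun t => f (c * t)).
Proof.
move=> c0 /integrableP[/measurable_EFinP mf lf].
have mc : measurable_fun [set: RT] (fun t : RT => (c * t)%R : RT).
  by apply: measurable_funM => //; exact: measurable_cst.
apply/integrableP; split.
  by apply/measurable_EFinP; exact: (measurableT_comp mf mc).
rewrite -(@lte_pmul2l _ `|c|%:E) ?lte_fin ?normr_gt0//.
rewrite (@ge0_integral_scale c (fun t => `|(f t)%:E|%E))//.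
  by rewrite gt0_muley ?lte_fin ?normr_gt0//.
by apply: measurableT_comp => //; exact/measurable_EFinP.
Qed.

Lemma Rintegral_scale c (f : R -> R) : c != 0 -> integ f ->
  \int[leb]_t f (c * t) = `|c|^-1 * \int[leb]_t f t.
Proof.
move=> c0 fi; have mf := integ_mfun fi.
apply: (@mulfI _ `|c|); rewrite ?normr_eq0// mulrA divff ?normr_eq0// mul1r.
have mF : measurable_fun [set: RT] (EFin \o f) by exact/measurable_EFinP.
have mp := measurable_funepos mF; have mn := measurable_funeneg mF.
pose s (t : RT) : RT := c * t.
have E : (`|c|%:E * \int[leb]_t (f (c * t))%:E = \int[leb]_t (f t)%:E)%E.
  have E1 := integralE leb setT ((EFin \o f) \o s).
  have E2 := integralE leb setT (EFin \o f).
  rewrite [X in (_ * X)%E]E1 [RHS]E2.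
  rewrite (funepos_comp (EFin \o f) s) (funeneg_comp (EFin \o f) s).
  have fic := integ_scale c0 fi.
  rewrite muleBr//; last first.
    rewrite fin_num_adde_defl// fin_numN.
    rewrite -(funeneg_comp (EFin \o f) s).
    exact: (integrable_fin_num measurableT (integrable_funeneg measurableT fic)).
  congr (_ - _)%E.
    by apply: (@ge0_integral_scale c (EFin \o f)^\+%E).
  by apply: (@ge0_integral_scale c (EFin \o f)^\-%E).
rewrite /Rintegral -E fineM//.
by apply: integrable_fin_num => //; exact: integ_scale.
Qed.

Lemma integ_gauss (a : R) : 0 < a -> integ (fun t => expR (- (a * t ^+ 2))).
Proof.
move=> a0.
have s0 : Num.sqrt a != 0 by rewrite gt_eqF// sqrtr_gt0.
have := integ_scale s0 (@integrableT_gauss R).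
rewrite (_ : (fun t => _) = (fun t => expR (- (a * t ^+ 2))))//.
by apply/funext => t; rewrite /gauss_fun exprMn sqr_sqrtr// ltW.
Qed.

Lemma Rintegral_gauss_pi : \int[leb]_t expR (- (pi * t ^+ 2)) = 1.
Proof.
have p0 : 0 < Num.sqrt (pi : R) by rewrite sqrtr_gt0 pi_gt0.
transitivity (\int[leb]_t gauss_fun (Num.sqrt pi * t)).
  by apply: eq_Rintegral => t _; rewrite /gauss_fun exprMn sqr_sqrtr// pi_ge0.
rewrite Rintegral_scale ?gt_eqF//; last exact: integrableT_gauss.
by rewrite /Rintegral integralT_gauss/= gtr0_norm// mulVf// gt_eqF.
Qed.

End Line_integrals.

(** * Gaussian sums and Fejer kernels *)

Section Bounded_sums.
Variable R : realType.

(* Summability of a nonnegative family is expressed by a bound on its finite partial sums. *)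
Definition sumle (T : eqType) (f : T -> R) (K : R) :=
  forall s : seq T, uniq s -> \sum_(x <- s) f x <= K.

Lemma sumle_ge0 (T : eqType) (f : T -> R) K : sumle f K -> 0 <= K.
Proof. by move/(_ [::] isT); rewrite big_nil. Qed.

Lemma sumle_inj (T U : eqType) (f : T -> R) (g : U -> T) K :
  injective g -> sumle f K -> sumle (f \o g) K.
Proof.
move=> gi fK s us; rewrite -(big_map g xpredT f); apply: fK.
by rewrite map_inj_uniq.
Qed.

Lemma sumle_le (T : eqType) (f g : T -> R) K :
  (forall x, f x <= g x) -> sumle g K -> sumle f K.
Proof.
by move=> fg gK s us; apply: le_trans (gK s us); apply: ler_sum => x _.
Qed.

Lemma sumleZ (T : eqType) (f : T -> R) c K : 0 <= c ->
  sumle f K -> sumle (fun x => c * f x) (c * K).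
Proof.
by move=> c0 fK s us; rewrite -mulr_sumr; apply: ler_wpM2l => //; exact: fK.
Qed.

Lemma sumleD (T : eqType) (f g : T -> R) K L :
  sumle f K -> sumle g L -> sumle (fun x => f x + g x) (K + L).
Proof. by move=> fK gL s us; rewrite big_split lerD ?fK ?gL. Qed.

Lemma sumle_sum (T : eqType) (I : Type) (r : seq I) (f : I -> T -> R)
    (K : I -> R) :
  (forall i, sumle (f i) (K i)) ->
  sumle (fun x => \sum_(i <- r) f i x) (\sum_(i <- r) K i).
Proof.
move=> fK s us; rewrite exchange_big /=; apply: ler_sum => i _; exact: fK.
Qed.

Lemma sum_sub_le (T : eqType) (f : T -> R) (s t : seq T) :
  (forall x, 0 <= f x) -> uniq s -> {subset s <= t} ->
  \sum_(x <- s) f x <= \sum_(x <- t) f x.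
Proof.
move=> f0 us st; elim: s us t st => [|a s IH] /=.
  by move=> _ t _; rewrite big_nil sumr_ge0.
move=> /andP[as_ us] t st.
have at_ : a \in t by apply: st; rewrite mem_head.
rewrite big_cons (perm_big _ (perm_to_rem at_)) /= big_cons lerD2l.
apply: IH => // x xs.
have xt : x \in t by apply: st; rewrite inE xs orbT.
have := perm_mem (perm_to_rem at_) x; rewrite xt inE => /esym/orP[/eqP xa|//].
by rewrite xa (negbTE as_) in xs.
Qed.

Definition zi (M : nat) (i : 'I_(2 * M).+1) : int := (i : nat)%:Z - M%:Z.

Lemma zi_inj M : injective (@zi M).
Proof. by move=> i j /addIr /eqP; rewrite eqz_nat => /eqP /ord_inj. Qed.

Lemma zi_ub M (i : 'I_(2 * M).+1) : `|zi i| <= M%:Z.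
Proof. by case: i => i im; rewrite /zi /=; lia. Qed.

Lemma ziP M (z : int) : `|z| <= M%:Z -> exists i : 'I_(2 * M).+1, zi i = z.
Proof.
move=> zM.
pose w : int := z + M%:Z.
have h : (`|w| < (2 * M).+1)%N by rewrite /w; lia.
by exists (Ordinal h); rewrite /zi /= /w; lia.
Qed.

(** Windows are symmetric so that odd summands cancel exactly at every finite stage. *)
Definition zsum (V : nmodType) (M : nat) (f : int -> V) : V :=
  \sum_(i < (2 * M).+1) f (zi i).

Lemma zsum0 (V : nmodType) (f : int -> V) : zsum 0 f = f 0.
Proof. by rewrite /zsum big_ord1. Qed.

Lemma zsumS (V : nmodType) M (f : int -> V) :
  zsum M.+1 f = f (- M.+1%:Z) + zsum M f + f M.+1%:Z.
Proof.
have E N : zsum N f = \sum_(0 <= i < (2 * N).+1) f (i%:Z - N%:Z).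
  by rewrite big_mkord.
rewrite !E mulnS addSn big_nat_recl// -addrA; congr (_ + _).
  by congr f; lia.
rewrite big_nat_recr//=; congr (_ + _); last by congr f; lia.
by apply: eq_big_nat => i _; congr f; lia.
Qed.

Lemma sumle_zsum (f : int -> R) K : sumle f K -> forall M, zsum M f <= K.
Proof.
move=> fK M; rewrite /zsum -(big_map (@zi M) xpredT f); apply: fK.
by rewrite map_inj_uniq ?index_enum_uniq//; exact: zi_inj.
Qed.

Lemma zsum_sumle (f : int -> R) K :
  (forall z, 0 <= f z) -> (forall M, zsum M f <= K) -> sumle f K.
Proof.
move=> f0 fK s us.
pose M := (\sum_(z <- s) `|z|)%N.
apply: le_trans (fK M).
rewrite /zsum -(big_map (@zi M) xpredT f); apply: sum_sub_le => // z zs.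
have zM : (`|z| <= M)%N by rewrite /M (big_rem z)//= leq_addr.
have [i <-] : exists i : 'I_(2 * M).+1, zi i = z by apply: ziP; lia.
by apply: map_f; rewrite mem_index_enum.
Qed.

Lemma zsum_le (f g : int -> R) M :
  (forall z, f z <= g z) -> zsum M f <= zsum M g.
Proof. by move=> fg; apply: ler_sum. Qed.

Definition expz (z : int) : R := expR (- `|z|%:~R).

Lemma sumle_expz : sumle expz 4.
Proof.
apply: zsum_sumle => [z|M]; first exact: expR_ge0.
have e2 : expR (-1) <= 1/2 :> R.
  have := expR_ge1Dx (1 : R); rewrite expRN => h.
  rewrite div1r lef_pV2 ?posrE ?expR_gt0//; lra.
(* Replacing [exp(-1)] by [1/2] gives a geometric sum; this strengthened bound is its exact value
   and makes the induction close. *)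
suff : zsum M expz <= 3 - 2 * (1/2) ^+ M.
  by have : 0 <= (1/2 : R) ^+ M by [apply: exprn_ge0; lra]; lra.
have e3 n : expR (- n%:R) <= (1/2) ^+ n :> R.
  elim: n => [|n IH]; first by rewrite oppr0 expR0 expr0.
  rewrite -natr1 opprD expRD exprSr ler_pM ?expR_ge0//.
elim: M => [|M IH].
  by rewrite zsum0 /expz normr0 oppr0 expR0 expr0; lra.
rewrite zsumS /expz normrN ger0_norm// -pmulrn.
have h := e3 M.+1; rewrite -/(expz _) exprSr.
have : zsum M expz <= 3 - 2 * (1 / 2) ^+ M by [].
rewrite exprSr in h; rewrite /expz; lra.
Qed.

(* The constant absorbs the distance from [t] to the nearest integer. *)
Lemma sumle_expR_dist (t : R) : sumle (fun z => expR (- `|z%:~R - t|)) (4 * expR 1).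
Proof.
pose m := Num.floor t.
have mt : `|t - m%:~R| <= 1.
  have /andP[h1 h2] := floor_itv t.
  by rewrite ler_norml; move: h2; rewrite intrD => h2; rewrite -/m in h1 h2; lra.
apply: (@sumle_le _ _ (fun z => expR 1 * (expz \o (fun z => z - m)) z)).
  move=> z /=; rewrite /expz -expRD ler_expR intr_norm intrD rmorphN /=.
  have := ler_normD (z%:~R - t) (t - m%:~R).
  rewrite addrA subrK => h; lra.
rewrite mulrC; apply: sumleZ; first exact: expR_ge0.
by apply: sumle_inj sumle_expz => x y /addIr.
Qed.

Lemma zsum_eq_delta (V : nmodType) M (m : int) (f : int -> V) : `|m| <= M%:Z ->
  (forall z, z != m -> f z = 0) -> zsum M f = f m.
Proof.
move=> mM f0; have [i im] := ziP mM.
rewrite /zsum (bigD1 i)//= im big1 ?addr0// => j ji.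
by apply: f0; rewrite -im (inj_eq (@zi_inj M)).
Qed.

End Bounded_sums.

(** * The Gaussian and its Fourier transform *)

Section Gaussian_Fourier.
Variable R : realType.
Local Notation leb := (@lebesgue_measure R).
Local Notation RT := (measurableTypeR R).

Lemma pi_ge2 : 2 <= pi :> R.
Proof. by have := @pihalf_ge1 R; lra. Qed.

(** The normalisation for which the Gaussian has integral 1 and equals its own Fourier transform,
    see [Fourier_gs]. *)
Definition gs (t : R) : R := expR (- (pi * t ^+ 2)).

Lemma gs_ge0 t : 0 <= gs t. Proof. exact: expR_ge0. Qed.

Lemma gs_le1 t : gs t <= 1.
Proof.
rewrite /gs -expR0 ler_expR oppr_le0 mulr_ge0 ?sqr_ge0//.
by rewrite pi_ge0.
Qed.

Lemma gsN t : gs (- t) = gs t.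
Proof. by rewrite /gs sqrrN. Qed.

Lemma integ_gs : integ gs.
Proof. by apply: integ_gauss; exact: pi_gt0. Qed.

Lemma is_derive_comp1 (f g : R -> R) (t df dg : R) :
  is_derive (g t) 1 f df -> is_derive t 1 g dg ->
  is_derive t 1 (fun x => f (g x)) (df * dg).
Proof. by move=> h1 h2; have := @is_derive1_comp _ f g t df dg h1 h2. Qed.

Lemma is_derive_mul1 (f g : R -> R) (t df dg : R) :
  is_derive t 1 f df -> is_derive t 1 g dg ->
  is_derive t 1 (fun x => f x * g x) (df * g t + f t * dg).
Proof.
move=> h1 h2; have H := is_deriveM h1 h2; apply: (is_derive_eq H).
by rewrite /GRing.scale /=; ring.
Qed.

Lemma is_derive_sqr (c t : R) : is_derive t 1 (fun t : R => c * t ^+ 2) (2 * c * t).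
Proof. by apply: is_derive_eq; rewrite /GRing.scale /=; ring. Qed.

Lemma is_derive_lin (a b t : R) : is_derive t 1 (fun t : R => a * t + b) a.
Proof. by apply: is_derive_eq; rewrite /GRing.scale /=; ring. Qed.

Lemma is_derive_gs (t : R) : is_derive t 1 gs (- (2 * pi * t) * gs t).
Proof.
have := @is_derive_comp1 expR (fun t => - pi * t ^+ 2) t _ _
  (is_derive_expR _) (is_derive_sqr (- pi) t).
rewrite (_ : (fun x => _) = gs); last by apply/funext => x; rewrite mulNr.
by move=> H; apply: (is_derive_eq H); rewrite /gs mulNr; ring.
Qed.

Lemma is_derive_cosM (a b t : R) :
  is_derive t 1 (fun t => cos (a * t + b)) (- a * sin (a * t + b)).
Proof.
have := @is_derive_comp1 cos (fun t => a * t + b) t _ _ (is_derive_cos _)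
  (is_derive_lin a b t).
by rewrite mulrC mulrN mulNr.
Qed.

Lemma is_derive_sinM (a b t : R) :
  is_derive t 1 (fun t => sin (a * t + b)) (a * cos (a * t + b)).
Proof.
have := @is_derive_comp1 sin (fun t => a * t + b) t _ _ (is_derive_sin _)
  (is_derive_lin a b t).
by rewrite mulrC.
Qed.

Lemma is_derive_continuous (f df : R -> R) :
  (forall t : R, is_derive t 1 f (df t)) -> continuous f.
Proof.
move=> fd x; apply: differentiable_continuous; apply/derivable1_diffP.
by case: (fd x).
Qed.

Lemma continuous_gs : continuous gs.
Proof. exact: is_derive_continuous is_derive_gs. Qed.

Lemma continuous_cosM (a b : R) : continuous (fun t => cos (a * t + b)).
Proof. exact: is_derive_continuous (is_derive_cosM a b). Qed.

Lemma continuous_sinM (a b : R) : continuous (fun t => sin (a * t + b)).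
Proof. exact: is_derive_continuous (is_derive_sinM a b). Qed.

Lemma norm_cos_le1 (x : R) : `|cos x| <= 1.
Proof. by rewrite ler_norml cos_geN1 cos_le1. Qed.

Lemma norm_sin_le1 (x : R) : `|sin x| <= 1.
Proof. by rewrite ler_norml sin_geN1 sin_le1. Qed.

Lemma continuous_mulr (f g : R -> R) :
  continuous f -> continuous g -> continuous (fun x => f x * g x).
Proof. by move=> cf cg x; apply: cvgM; [exact: cf|exact: cg]. Qed.

Lemma integ_t_gs : integ (fun t => `|t| * gs t).
Proof.
apply: (@integ_continuous_dom _ _ (fun t => expR (- ((pi - 1) * t ^+ 2)))).
- apply: continuous_mulr; last exact: continuous_gs.
  exact: norm_continuous.
- by apply: integ_gauss; have := pi_ge2; lra.
move=> t; rewrite normrM normr_id (ger0_norm (gs_ge0 _)).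
rewrite (_ : - (_ * _) = t ^+ 2 - pi * t ^+ 2); last by ring.
rewrite expRD ler_wpM2r ?expR_ge0//.
apply: le_trans (expR_ge1Dx _).
have := sqr_ge0 (`|t| - 1); rewrite -(real_normK (num_real t)); have := normr_ge0 t.
nra.
Qed.

Lemma integ_gs_bounded (b : R -> R) M : continuous b -> (forall t, `|b t| <= M) ->
  integ (fun t => gs t * b t).
Proof.
move=> cb bM; apply: (@integ_continuous_dom _ _ (fun t => M * gs t)).
- by apply: continuous_mulr => //; exact: continuous_gs.
- exact: integZ integ_gs.
move=> t; rewrite normrM (ger0_norm (gs_ge0 _)) mulrC ler_wpM2r//; exact: gs_ge0.
Qed.

(** The Fourier integral and, next, its formal derivative in [xi]. The summand [+ 0] matches the
    affine arguments of [is_derive_cosM] and [is_derive_sinM]. *)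
Let phi (xi : R) := \int[leb]_t (gs t * cos (2 * pi * xi * t + 0)).
Let dphi (xi : R) := \int[leb]_t (gs t * (- (2 * pi * t) * sin (2 * pi * xi * t + 0))).

Let is_derive_phi (xi : R) : is_derive xi 1 phi (dphi xi).
Proof.
pose f (x t : R) := gs t * cos (2 * pi * t * x + 0).
have fd (x t : R) : is_derive x 1 (f ^~ t) (gs t * (- (2 * pi * t) * sin (2 * pi * t * x + 0))).
  have d1 := is_derive_cosM (2 * pi * t) 0 x.
  have d2 : is_derive x 1 (fun _ : R => gs t) 0 by exact: is_derive_cst.
  have := is_derive_mul1 d2 d1.
  by rewrite mul0r add0r.
have sw (x t : R) : 2 * pi * t * x + 0 = 2 * pi * x * t + 0 by ring.
have If : (fun x => \int[leb]_(t in setT) f x t) = phi.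
  by apply/funext => x; apply: eq_Rintegral => t _; rewrite /f sw.
have I x : integ (f x).
  rewrite /f; under eq_fun do rewrite sw.
  apply: (@integ_gs_bounded _ 1); first exact: continuous_cosM.
  by move=> t; exact: norm_cos_le1.
have xiI : xi \in `]xi - 1, xi + 1[ by rewrite in_itv /=; apply/andP; split; lra.
have G0 (t : R) : 0 <= 2 * pi * (`|t| * gs t).
  by rewrite !mulr_ge0 ?gs_ge0// pi_ge0.
have D1 x t : partial1of2 f x t = gs t * (- (2 * pi * t) * sin (2 * pi * t * x + 0)).
  by rewrite partial1of2E; exact: derive_val.
have dbl (x t : R) : `|partial1of2 f x t| <= 2 * pi * (`|t| * gs t).
  rewrite D1 !normrM normrN !normrM (ger0_norm (gs_ge0 _)) ger0_norm//.
  rewrite (ger0_norm (pi_ge0 _)) [leRHS]mulrA [leRHS]mulrC ler_wpM2l ?gs_ge0//.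
  by rewrite ler_piMr ?norm_sin_le1// !mulr_ge0// pi_ge0.
have H := @cvg_differentiation_under_integral R _ RT leb f setT measurableT xi
  (xi - 1) (xi + 1) xiI (fun x _ => I x)
  (fun x t _ _ => @ex_derive _ _ _ _ _ _ _ (fd x t))
  (fun t => 2 * pi * (`|t| * gs t)) G0
  (integZ _ integ_t_gs) (fun x t _ _ => dbl x t).
have E : \int[leb]_(y in setT) (partial1of2 f) xi y = dphi xi.
  by apply: eq_Rintegral => t _; rewrite D1 sw.
have H' : (fun h : R => h^-1 *: (phi (h *: (1 : R) + xi) - phi xi)) @ 0^' --> dphi xi.
  by under eq_fun do rewrite scaler1; rewrite -E -If; exact: H.
apply: DeriveDef; last exact: (cvg_lim _ H').
by apply/cvg_ex; exists (dphi xi).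
Qed.

Lemma cvg_decay (F : R -> R) (C : R) : (forall t, `|F t| <= C * (1 + t ^+ 2)^-1) ->
  (fun n => F n%:R) @ \oo --> 0 /\ (fun n => F (- n%:R)) @ \oo --> 0.
Proof.
move=> FC.
have C0 : 0 <= C.
  by have := FC 0; rewrite expr0n /= addr0 invr1 mulr1; exact: le_trans.
have key (G : nat -> R) : (forall n, `|G n| <= C * (1 + n%:R ^+ 2)^-1) ->
    G @ \oo --> 0.
  move=> GC; apply/cvgr0Pnorm_le => e e0; near=> n.
  apply: (le_trans (GC n)); rewrite ler_pdivrMr ?ltr_pwDl ?sqr_ge0//.
  have : C / e <= n%:R by near: n; exact: nbhs_infty_ger.
  rewrite ler_pdivrMr// => h.
  have n1 : n%:R <= 1 + n%:R ^+ 2 :> R.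
    by have := sqr_ge0 (n%:R - 1 : R); have : 0 <= n%:R :> R by []; nra.
  by rewrite (le_trans h)// mulrC ler_wpM2l// ltW.
split; apply: key => n; first exact: FC.
by rewrite -[leRHS](_ : C * (1 + (- n%:R) ^+ 2)^-1 = _) ?FC// sqrrN.
Unshelve. all: by end_near. Qed.

Lemma gs_decay t : gs t <= (1 + t ^+ 2)^-1.
Proof.
have p1 : 0 < 1 + t ^+ 2 by rewrite ltr_pwDl ?sqr_ge0.
rewrite /gs expRN lef_pV2 ?posrE ?expR_gt0//.
apply: le_trans (expR_ge1Dx _).
rewrite lerD2l ler_peMl ?sqr_ge0//; have := pi_ge2; lra.
Qed.

(** The derivative of [gs t * sin (2 pi xi t)] has integral zero; written out, this is a
    differential equation for [phi]. *)
Let dphiE (xi : R) : dphi xi = - (2 * pi * xi) * phi xi.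
Proof.
pose f (t : R) := gs t * (- (2 * pi * t) * sin (2 * pi * xi * t + 0))
  + (2 * pi * xi) * (gs t * cos (2 * pi * xi * t + 0)).
have i2 : integ (fun t => gs t * cos (2 * pi * xi * t + 0)).
  apply: (@integ_gs_bounded _ 1); first exact: continuous_cosM.
  by move=> t; exact: norm_cos_le1.
have i1 : integ (fun t => gs t * (- (2 * pi * t) * sin (2 * pi * xi * t + 0))).
  apply: (@integ_continuous_dom _ _ (fun t => 2 * pi * (`|t| * gs t))).
  - apply: continuous_mulr; first exact: continuous_gs.
    apply: continuous_mulr; last exact: continuous_sinM.
    move=> x; apply: cvgN; apply: cvgM; [exact: cvg_cst|exact: cvg_id].
  - exact: integZ integ_t_gs.
  move=> t; rewrite !normrM normrN !normrM (ger0_norm (gs_ge0 _)) ger0_norm ?pi_ge0//.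
  rewrite (ger0_norm (pi_ge0 _)) [leRHS]mulrA [leRHS]mulrC ler_wpM2l ?gs_ge0//.
  by rewrite ler_piMr ?norm_sin_le1// !mulr_ge0// pi_ge0.
have decF : (fun n => (fun t => gs t * sin (2 * pi * xi * t + 0)) n%:R) @ \oo --> 0
    /\ (fun n => (fun t => gs t * sin (2 * pi * xi * t + 0)) (- n%:R)) @ \oo --> 0.
  apply: (@cvg_decay (fun t => gs t * sin (2 * pi * xi * t + 0)) 1) => t; rewrite mul1r normrM (ger0_norm (gs_ge0 _)).
  apply: le_trans (gs_decay t); rewrite ler_piMr ?gs_ge0//; exact: norm_sin_le1.
have : \int[leb]_t f t = 0.
  apply: (@Rintegral_deriv0 _ (fun t => gs t * sin (2 * pi * xi * t + 0))).
  - move=> t.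
    have d1 := is_derive_gs t; have d2 := is_derive_sinM (2 * pi * xi) 0 t.
    have H := is_derive_mul1 d1 d2; apply: (is_derive_eq H).
    by rewrite /f /=; ring.
  - move=> x; apply: cvgD.
      apply: continuous_mulr; first exact: continuous_gs.
      apply: continuous_mulr; last exact: continuous_sinM.
      move=> y; apply: cvgN; apply: cvgM; [exact: cvg_cst|exact: cvg_id].
    apply: cvgM; first exact: cvg_cst.
    apply: continuous_mulr; [exact: continuous_gs|exact: continuous_cosM].
  - by apply: integD => //; exact: integZ.
  - exact: decF.1.
  - exact: decF.2.
rewrite /f RintegralD//; last exact: integZ.
rewrite RintegralZl// -/(dphi xi) -/(phi xi).
by move/eqP; rewrite addr_eq0 mulNr => /eqP.
Qed.

(** By the differential equation [exp(pi xi^2) * phi xi] is constant, and its value at 0 is the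
    Gaussian integral. *)
Lemma Fourier_gs (xi : R) : \int[leb]_t (gs t * cos (2 * pi * xi * t)) = gs xi.
Proof.
have E0 : phi xi = \int[leb]_t (gs t * cos (2 * pi * xi * t)).
  by apply: eq_Rintegral => t _; rewrite addr0.
pose g (x : R) := expR (pi * x ^+ 2) * phi x.
have dg (x : R) : is_derive x 1 g 0.
  have d1 : is_derive x 1 (fun t : R => pi * t ^+ 2) (2 * pi * x).
    apply: is_derive_eq; rewrite /GRing.scale /=; ring.
  have d2 := @is_derive_comp1 expR (fun t => pi * t ^+ 2) x _ _ (is_derive_expR _) d1.
  have d3 := is_derive_phi x.
  have H := is_derive_mul1 d2 d3; apply: (is_derive_eq H).
  by rewrite dphiE; ring.
have := is_derive_0_is_cst xi 0 dg.
rewrite /g expr0n /= mulr0 expR0 mul1r => h.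
have p0 : phi 0 = 1.
  rewrite -(@Rintegral_gauss_pi R); apply: eq_Rintegral => t _.
  by rewrite mulr0 mul0r addr0 cos0 mulr1.
by rewrite -E0 /gs expRN -[phi xi](mulKf (lt0r_neq0 (expR_gt0 (pi * xi ^+ 2)))) h p0 mulr1.
Qed.

End Gaussian_Fourier.

(** * The Fejer kernel as an approximate Dirac comb *)

Section Fejer.
Variable R : realType.
Local Notation leb := (@lebesgue_measure R).
Local Notation RT := (measurableTypeR R).

Lemma sin_piz (z : int) : sin (pi * z%:~R) = 0 :> R.
Proof.
have nat_case n : sin (pi * n%:R) = 0 :> R.
  elim: n => [|n IH]; first by rewrite mulr0 sin0.
  by rewrite -natr1 mulrDr mulr1 sinDpi IH oppr0.
case: z => n; first exact: nat_case.
by rewrite NegzE mulrNz mulrN sinN nat_case oppr0.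
Qed.

Lemma cos_2piz (z : int) : cos (2 * pi * z%:~R) = 1 :> R.
Proof.
have -> : 2 * pi * z%:~R = (pi * z%:~R) *+ 2 :> R by rewrite mulr2n; ring.
by rewrite cos_mulr2n cos2sin2 sin_piz; ring.
Qed.

Lemma sin_2piz (z : int) : sin (2 * pi * z%:~R) = 0 :> R.
Proof.
have -> : 2 * pi * z%:~R = (pi * z%:~R) *+ 2 :> R by rewrite mulr2n; ring.
by rewrite sin_mulr2n sin_piz; ring.
Qed.

Definition cosz (t : R) (n : int) : R := cos (2 * pi * n%:~R * t).

Lemma coszN t n : cosz t (- n) = cosz t n.
Proof. by rewrite /cosz mulrNz mulrN mulNr cosN. Qed.

Lemma cosz_shift t n (s : int) : cosz (t + s%:~R) n = cosz t n.
Proof.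
rewrite /cosz mulrDr cosD -[_ * s%:~R]mulrA -intrM cos_2piz sin_2piz.
by rewrite mulr1 mulr0 subr0.
Qed.

Lemma cosz0 t : cosz t 0 = 1.
Proof. by rewrite /cosz mulr0 mul0r cos0. Qed.

Lemma norm_cosz t n : `|cosz t n| <= 1.
Proof. exact: norm_cos_le1. Qed.

Definition fejer (L : nat) (t : R) : R :=
  L%:R^-1 * \sum_(j < L) zsum j (cosz t).

(** Kept in product form, here and in [fejer_sin], so that the zeros of the sine cause no case
    distinction. *)
Lemma dirichlet_sin j t :
  zsum j (cosz t) * sin (pi * t) = sin ((2 * j + 1)%:R * (pi * t)).
Proof.
elim: j => [|j IH]; first by rewrite zsum0 cosz0 !mul1r.
have key (a Z s : R) : (a + Z + a) * s = Z * s + 2 * a * s by ring.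
rewrite zsumS coszN key IH /cosz.
have -> : 2 * pi * (j.+1)%:Z%:~R * t = (2 * j + 2)%:R * (pi * t).
  rewrite -pmulrn; rewrite (_ : (2 * j + 2)%N = (2 * j.+1)%N) ?natrM; first by ring.
  by lia.
have -> : (2 * j + 1)%:R * (pi * t) = (2 * j + 2)%:R * (pi * t) - pi * t.
  by rewrite !natrD; ring.
have -> : (2 * j.+1 + 1)%:R * (pi * t) = (2 * j + 2)%:R * (pi * t) + pi * t.
  by rewrite (_ : (2 * j.+1 + 1)%N = (2 * j + 2 + 1)%N) ?natrD; [ring|lia].
by rewrite sinB sinD; ring.
Qed.

Lemma fejer_sin L t :
  (\sum_(j < L) zsum j (cosz t)) * sin (pi * t) ^+ 2 = sin (L%:R * (pi * t)) ^+ 2.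
Proof.
elim: L => [|L IH]; first by rewrite big_ord0 !mul0r sin0 expr0n.
rewrite big_ord_recr mulrDl IH /= expr2 [X in _ + X]mulrA dirichlet_sin.
set y := pi * t.
have -> : (2 * L + 1)%:R * y = L%:R * y + L.+1%:R * y.
  by rewrite natrD natrM -natr1; ring.
have -> : sin y = sin (L.+1%:R * y - L%:R * y).
  by congr sin; rewrite -natr1; ring.
rewrite sinD sinB.
have h1 := @cos2Dsin2 R (L%:R * y); have h2 := @cos2Dsin2 R (L.+1%:R * y).
have sw (c s : R) : c + s = 1 -> c = 1 - s by move=> <-; rewrite addrK.
have e1 : cos (L%:R * y) ^+ 2 = 1 - sin (L%:R * y) ^+ 2 by exact: sw.
have e2 : cos (L.+1%:R * y) ^+ 2 = 1 - sin (L.+1%:R * y) ^+ 2 by exact: sw.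
transitivity (sin (L%:R * y) ^+ 2 + (sin (L.+1%:R * y) ^+ 2 * cos (L%:R * y) ^+ 2
  - sin (L%:R * y) ^+ 2 * cos (L.+1%:R * y) ^+ 2)); first by ring.
by rewrite e1 e2; ring.
Qed.

Lemma fejer_ge0 L t : 0 <= fejer L t.
Proof.
rewrite /fejer mulr_ge0 ?invr_ge0//.
have [s0|s0] := eqVneq (sin (pi * t)) 0; last first.
  have := fejer_sin L t; have := sqr_ge0 (sin (L%:R * (pi * t))).
  move=> h E; rewrite -E in h; move: h.
  by rewrite pmulr_lge0// exprn_even_gt0.
(* Where [sin (pi t)] vanishes the product formula says nothing, but there all the cosines equal
   1. *)
have c1 n : cosz t n = 1.
  have sn (m : nat) : sin (m%:R * (pi * t)) = 0.
    elim: m => [|m IH]; first by rewrite mul0r sin0.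
    by rewrite -natr1 mulrDl mul1r sinD IH s0 mul0r mulr0 addr0.
  have cn (m : nat) : cosz t m = 1.
    rewrite /cosz -pmulrn.
    have -> : 2 * pi * m%:R * t = (m%:R * (pi * t)) *+ 2 by rewrite mulr2n; ring.
    by rewrite cos_mulr2n cos2sin2 sn; ring.
  by case: n => m; [exact: cn|rewrite NegzE coszN cn].
by apply: sumr_ge0 => j _; apply: sumr_ge0 => i _; rewrite c1.
Qed.

Lemma continuous_cosz n : continuous (cosz ^~ n).
Proof.
have := @continuous_cosM R (2 * pi * n%:~R) 0.
by under eq_fun do rewrite addr0.
Qed.

Lemma continuous_sumr (T : Type) (s : seq T) (F : T -> R -> R) :
  (forall i, continuous (F i)) -> continuous (fun t => \sum_(i <- s) F i t).
Proof.
move=> cF; elim: s => [|a s IH].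
  by under eq_fun do rewrite big_nil; exact: cst_continuous.
by under eq_fun do rewrite big_cons; move=> x; apply: cvgD; [exact: cF|exact: IH].
Qed.

Lemma continuous_fejer L : continuous (fejer L).
Proof.
apply: continuous_mulr; first exact: cst_continuous.
apply: continuous_sumr => j; apply: continuous_sumr => i; exact: continuous_cosz.
Qed.

Lemma fejer_shift L t (s : int) : fejer L (t + s%:~R) = fejer L t.
Proof.
rewrite /fejer; congr (_ * _); apply: eq_bigr => j _; apply: eq_bigr => i _.
exact: cosz_shift.
Qed.

Lemma fejer_bound L t : `|fejer L t| <= (2 * L).+1%:R.
Proof.
have [->|L0] := posnP L.
  by rewrite /fejer big_ord0 mulr0 normr0.
rewrite ger0_norm ?fejer_ge0// /fejer ler_pdivrMl ?ltr0n//.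
have E : \sum_(j < L) (2 * L).+1%:R = L%:R * (2 * L).+1%:R :> R.
  by rewrite sumr_const card_ord [RHS]mulr_natl.
rewrite -E; apply: ler_sum => j _.
apply: (@le_trans _ _ (2 * j).+1%:R); last first.
  by rewrite ler_nat ltnS leq_mul2l (ltnW (ltn_ord j)) orbT.
have E' : \sum_(i < (2 * j).+1) 1 = (2 * j).+1%:R :> R.
  by rewrite sumr_const card_ord.
rewrite -E'; apply: ler_sum => i _; exact: le_trans (ler_norm _) (norm_cosz _ _).
Qed.

(** Half-open, so that the integer translates tile the line without overlap. *)
Definition cell (t : R) : R := \1_(`](- (1/2)), 1/2]%classic : set R) t.

Lemma measurable_cell : measurable_fun [set: RT] cell.
Proof. exact: measurable_indic. Qed.

Lemma cell_ge0 t : 0 <= cell t.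
Proof. by rewrite /cell indicE. Qed.

Lemma cellE t : cell t = ((- (1/2) < t) && (t <= 1/2))%:R.
Proof.
rewrite /cell indicE; congr (_%:R); congr nat_of_bool.
by apply/idP/idP; [rewrite inE /= in_itv|move=> h; rewrite inE /= in_itv].
Qed.

Lemma cell_cases t : cell t = 0 \/ cell t = 1 /\ `|t| <= 1/2.
Proof.
rewrite cellE; case: (boolP (_ && _)) => [/andP[h1 h2]|_]; [right|by left].
by split => //; rewrite ler_norml; apply/andP; split; lra.
Qed.

Lemma zsum_cell M t : 0 <= zsum M (fun s => cell (t - s%:~R)) <= 1.
Proof.
apply/andP; split; first by apply: sumr_ge0 => i _; exact: cell_ge0.
pose n := Num.floor (1/2 - t).
have /andP[n1 n2] := floor_itv (1/2 - t); rewrite -/n in n1 n2.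
(* The condition [-1/2 < t - s <= 1/2] says precisely that [- s] is the floor of [1/2 - t]. *)
have E s : cell (t - s%:~R) = (s == - n)%:R.
  rewrite cellE; congr (_%:R); congr nat_of_bool.
  apply/idP/eqP => [/andP[h1 h2]|->]; last first.
    by move: n2; rewrite intrD rmorphN /= => n2; apply/andP; split; lra.
  move: n2; rewrite intrD => n2.
  have a1 : (s + n)%:~R < 1%:~R :> R by rewrite intrD; lra.
  have a2 : (- 1)%:~R < (s + n)%:~R :> R by rewrite intrD rmorphN /=; lra.
  by move: a1 a2; rewrite !ltr_int; lia.
have [nM|nM] := boolP (`|- n| <= M%:Z).
  rewrite (zsum_eq_delta nM) ?E ?eqxx// => z zn.
  by rewrite E (negbTE zn).
rewrite /zsum big1 ?ler01// => i _; rewrite E; case: eqP => // zin.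
by move: nM; rewrite -zin zi_ub.
Qed.

Lemma zsum_cell_near t : \forall M \near \oo,
  zsum M (fun s => cell (t - s%:~R)) = 1.
Proof.
pose n := Num.floor (1/2 - t).
have /andP[n1 n2] := floor_itv (1/2 - t); rewrite -/n in n1 n2.
have E s : cell (t - s%:~R) = (s == - n)%:R.
  rewrite cellE; congr (_%:R); congr nat_of_bool.
  apply/idP/eqP => [/andP[h1 h2]|->]; last first.
    by move: n2; rewrite intrD rmorphN /= => n2; apply/andP; split; lra.
  move: n2; rewrite intrD => n2.
  have a1 : (s + n)%:~R < 1%:~R :> R by rewrite intrD; lra.
  have a2 : (- 1)%:~R < (s + n)%:~R :> R by rewrite intrD rmorphN /=; lra.
  by move: a1 a2; rewrite !ltr_int; lia.
near=> M.
have nM : `|- n| <= M%:Z.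
  have : (`|n|%N <= M)%N by near: M; exact: nbhs_infty_ge.
  by rewrite normrN; lia.
rewrite (zsum_eq_delta nM) ?E ?eqxx// => z zn.
by rewrite E (negbTE zn).
Unshelve. all: by end_near. Qed.

Lemma integ_cell (f : R -> R) M : measurable_fun [set: RT] f ->
  (forall t, `|f t| <= M) -> integ (fun t => f t * cell t).
Proof.
move=> mf fM.
have i0 : integ cell.
  exact: (@integrable_indic_itv R (- (1/2)) (1/2) false false).
apply: (@integ_dom _ _ (fun t => M * cell t)); last first.
- by move=> t; rewrite normrM (ger0_norm (cell_ge0 _)) ler_wpM2r ?cell_ge0.
- exact: integZ.
by apply: measurable_funM => //; exact: measurable_cell.
Qed.

Lemma Rint_cell_cosz n : \int[leb]_t (cosz t n * cell t) = (n == 0)%:R.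
Proof.
have lt : - (1/2) < 1/2 :> R by lra.
have E (f : R -> R) : continuous f -> (\int[leb]_t (f t * cell t)%:E =
    \int[leb]_(t in `[(- (1/2))%R, (1/2)%R]) (f t)%:E)%E.
  move=> cf; rewrite -integral_itv_obnd_cbnd; last first.
    by apply/measurable_EFinP/measurable_funTS; exact: continuous_measurable_fun.
  rewrite [RHS]integral_mkcond; apply: eq_integral => t _.
  by rewrite patchE /cell indicE; case: ifP => _; rewrite ?mulr1 ?mulr0.
have ftc (F f : R -> R) : (forall t : R, is_derive t 1 F (f t)) -> continuous f ->
    \int[leb]_t (f t * cell t) = F (1/2) - F (- (1/2)).
  move=> dF cf; have cF := is_derive_continuous dF.
  rewrite /Rintegral E// (@continuous_FTC2 R f F _ _ lt)//.
  - exact: continuous_subspaceT.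
  - split; first by move=> x _; case: (dF x).
      by apply: cvg_at_right_filter; exact: cF.
    by apply: cvg_at_left_filter; exact: cF.
  - by move=> x _; rewrite derive1E; exact: derive_val.
have [->|n0] := eqVneq n 0.
  transitivity (\int[leb]_t (1 * cell t)).
    by apply: eq_Rintegral => t _; rewrite cosz0.
  have d1 (t : R) : is_derive t 1 (fun t : R => t) 1 by exact: is_derive_id.
  rewrite (ftc _ _ d1); last exact: cst_continuous.
  by rewrite [RHS]/=; have -> : true%:R = 1 :> R by []; lra.
have a0 : 2 * pi * n%:~R != 0 :> R.
  by rewrite !mulf_neq0 ?intr_eq0 ?pnatr_eq0// gt_eqF// pi_gt0.
pose F (t : R) := (2 * pi * n%:~R)^-1 * sin (2 * pi * n%:~R * t + 0).
have dF (t : R) : is_derive t 1 F (cosz t n).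
  have d1 := is_derive_sinM (2 * pi * n%:~R) 0 t.
  have d2 : is_derive t 1 (fun _ : R => (2 * pi * n%:~R)^-1) 0 by exact: is_derive_cst.
  have H := is_derive_mul1 d2 d1; apply: (is_derive_eq H).
  by rewrite mul0r add0r mulrA mulVf// mul1r addr0.
rewrite (ftc _ _ dF); last exact: continuous_cosz.
rewrite /F !addr0.
have -> : 2 * pi * n%:~R * (1/2) = pi * n%:~R :> R by field.
have -> : 2 * pi * n%:~R * (- (1/2)) = pi * (- n)%:~R :> R.
  by rewrite rmorphN /=; field.
by rewrite !sin_piz subrr.
Qed.

Lemma integ_sum (T : Type) (s : seq T) (F : T -> R -> R) :
  (forall i, integ (F i)) -> integ (fun t => \sum_(i <- s) F i t) /\
  \int[leb]_t (\sum_(i <- s) F i t) = \sum_(i <- s) \int[leb]_t F i t.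
Proof.
move=> iF; elim: s => [|a s [IH1 IH2]].
  split; first by under eq_fun do rewrite big_nil; exact: integrable0.
  rewrite big_nil; under eq_Rintegral do rewrite big_nil.
  by rewrite /Rintegral integral0.
split; first by under eq_fun do rewrite big_cons; exact: integD.
under eq_Rintegral do rewrite big_cons.
by apply: (etrans (RintegralD measurableT (iF a) IH1)); rewrite IH2 big_cons.
Qed.

Lemma Rint_cell_fejer L : (0 < L)%N -> \int[leb]_t (fejer L t * cell t) = 1.
Proof.
move=> L0.
have iz n : integ (fun t => cosz t n * cell t).
  apply: (@integ_cell _ 1); last by move=> t; exact: norm_cosz.
  by apply: continuous_measurable_fun; exact: continuous_cosz.
have Z j : integ (fun t => zsum j (cosz t) * cell t) /\
    \int[leb]_t (zsum j (cosz t) * cell t) = 1.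
  have [i1 i2] := integ_sum (index_enum 'I_(2 * j).+1) (fun i => iz (zi i)).
  have E : (fun t => zsum j (cosz t) * cell t) =
     (fun t => \sum_(i <- index_enum 'I_(2 * j).+1) cosz t (zi i) * cell t).
    by apply/funext => t; rewrite /zsum mulr_suml.
  rewrite E; split => //; rewrite i2.
  under eq_bigr do rewrite Rint_cell_cosz.
  have h0 : `|0 : int| <= j%:Z by rewrite normr0.
  by rewrite -[LHS]/(zsum j (fun n => (n == 0)%:R)) (zsum_eq_delta h0) ?eqxx// => z /negbTE ->.
have [i1 i2] := integ_sum (index_enum 'I_L) (fun j => (Z j).1).
transitivity (\int[leb]_t (L%:R^-1 * \sum_(j < L) zsum j (cosz t) * cell t)).
  by apply: eq_Rintegral => t _; rewrite /fejer -mulrA mulr_suml.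
rewrite RintegralZl// i2.
under eq_bigr do rewrite (Z _).2.
by rewrite sumr_const card_ord mulVf// pnatr_eq0 -lt0n.
Qed.

(** The mean value theorem gives [sin (x/2) >= (x/2) cos (pi/4)]; doubling the angle yields
    [sin x >= x cos(pi/4)^2], and the square is [1/2]. *)
Lemma sin_half_le (x : R) : 0 <= x <= pi / 2 -> x / 2 <= sin x.
Proof.
move=> /andP[x0 xp]; have p0 := pi_gt0 R.
have c4 : cos (pi / 4) ^+ 2 = 1/2 :> R.
  have := @cos_mulr2n R (pi / 4); rewrite mulr2n.
  have -> : pi / 4 + pi / 4 = pi / 2 :> R by field.
  by rewrite cos_pihalf mulr2n; lra.
have c40 : 0 <= cos (pi / 4) :> R.
  by apply: cos_ge0_pihalf; apply/andP; split; lra.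
have cy (y : R) : 0 <= y <= pi / 4 -> cos (pi / 4) <= cos y.
  move=> /andP[y0 y4]; have [->//|yn] := eqVneq y (pi / 4).
  have ylt : y < pi / 4 by rewrite lt_neqAle yn.
  by apply/ltW; rewrite ltr_cos// in_itv /=; apply/andP; split; lra.
have s2 : x / 2 * cos (pi / 4) <= sin (x / 2).
  have [->|xn] := eqVneq x 0; first by rewrite mul0r sin0 mul0r.
  have x20 : 0 < x / 2 by rewrite divr_gt0// lt_neqAle eq_sym xn.
  have [|c] := @MVT R sin cos 0 (x / 2) x20 (fun y _ => is_derive_sin y).
    by apply: continuous_subspaceT; exact: continuous_sin.
  rewrite in_itv /= => /andP[c1 c2]; rewrite sin0 !subr0 => ->.
  apply: (@le_trans _ _ (x / 2 * cos c)); last by rewrite mulrC.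
  by apply: ler_wpM2l; [exact: ltW|apply: cy; apply/andP; split; lra].
have -> : x = (x / 2) *+ 2 by rewrite mulr2n; field.
rewrite sin_mulr2n.
have := cy (x / 2); rewrite (_ : 0 <= x / 2 <= pi / 4); last by apply/andP; split; lra.
move=> /(_ isT) c1.
have h : x / 2 * cos (pi / 4) * cos (pi / 4) <= sin (x / 2) * cos (x / 2).
  by apply: ler_pM => //; rewrite mulr_ge0//; lra.
move: h; rewrite -mulrA -expr2 c4 !mulr2n [cos _ * sin _]mulrC; lra.
Qed.

Lemma norm_le_sin (t : R) : `|t| <= 1/2 -> `|t| <= `|sin (pi * t)|.
Proof.
move=> t2.
have -> : `|sin (pi * t)| = `|sin (pi * `|t|)|.
  by have [h|h] := ger0P t; rewrite // mulrN sinN normrN.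
have p2 := pi_ge2 R; have t0 := normr_ge0 t.
have h1 : pi * `|t| <= pi / 2 by nra.
have := @sin_half_le (pi * `|t|); rewrite h1 mulr_ge0 ?pi_ge0// => /(_ isT) h.
apply: le_trans (ler_norm _); apply: le_trans h; nra.
Qed.

Lemma fejer_cell_ge0 L t : 0 <= `|t| * fejer L t * cell t.
Proof.
apply: mulr_ge0; last exact: cell_ge0.
by apply: mulr_ge0; [exact: normr_ge0|exact: fejer_ge0].
Qed.

(** With [e = L^(-1/2)], the inequality [|t| <= |sin (pi t)| <= e + sin (pi t)^2 / e] splits the
    integral: the kernel has unit mass on the cell, and multiplied by [sin (pi t)^2] it is at most
    [1 / L]. Each part contributes [e]. *)
Lemma Rint_cell_norm_fejer L : (0 < L)%N ->
  \int[leb]_t (`|t| * fejer L t * cell t) <= 2 * (Num.sqrt L%:R)^-1.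
Proof.
move=> L0.
have L1 : 0 < L%:R :> R by rewrite ltr0n.
have s0 : 0 < Num.sqrt L%:R :> R by rewrite sqrtr_gt0.
set e := (Num.sqrt L%:R : R)^-1.
have e0 : 0 < e by rewrite invr_gt0.
have eL : e ^+ 2 = L%:R^-1 by rewrite exprVn sqr_sqrtr// ltW.
have mD : measurable_fun [set: RT] (fejer L).
  by apply: continuous_measurable_fun; exact: continuous_fejer.
pose g t := e * (fejer L t * cell t) + e^-1 * (L%:R^-1 * cell t).
have i1 : integ (fun t => fejer L t * cell t).
  by apply: (@integ_cell _ (2 * L).+1%:R) => // t; exact: fejer_bound.
have i2 : integ (fun t => 1 * cell t).
  by apply: (@integ_cell (fun=> 1) 1) => // t; rewrite normr1.
have c1 : \int[leb]_t (1 * cell t) = 1.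
  apply: etrans (Rint_cell_cosz 0); apply: eq_Rintegral => t _.
  by rewrite cosz0.
have ig : integ g.
  apply: integD; first exact: integZ.
  by under eq_fun do rewrite -[cell _]mul1r; do 2 apply: integZ.
apply: (@le_trans _ _ (\int[leb]_t g t)); last first.
  rewrite RintegralD//; last 2 first.
  - exact: integZ.
  - by under eq_fun do rewrite -[cell _]mul1r; do 2 apply: integZ.
  rewrite RintegralZl// Rint_cell_fejer//.
  under eq_Rintegral do rewrite -[cell _]mul1r.
  rewrite RintegralZl//; last exact: integZ.
  rewrite RintegralZl// c1 !mulr1 -eL expr2 mulrA mulVf ?mul1r ?gt_eqF//; lra.
have bd t : `|t| * fejer L t * cell t <= g t.
  have [cz|[c1' t2]] := cell_cases t; first by rewrite /g cz !mulr0 addr0.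
  have h1 := norm_le_sin t2.
  have h2 : fejer L t * sin (pi * t) ^+ 2 <= L%:R^-1.
    rewrite /fejer -mulrA fejer_sin; apply: ler_piMr; first by rewrite invr_ge0.
    by rewrite sin2cos2 gerBl sqr_ge0.
  have h3 : `|t| <= e + e^-1 * sin (pi * t) ^+ 2.
    apply: (le_trans h1).
    rewrite -(@ler_pM2l _ e)// mulrDr mulrA mulfV ?gt_eqF// mul1r.
    have := sqr_ge0 (`|sin (pi * t)| - e); rewrite -[sin _ ^+ 2](real_normK (num_real _)).
    by have := mulr_ge0 (ltW e0) (normr_ge0 (sin (pi * t))); nra.
  rewrite /g c1' !mulr1.
  have h4 := ler_wpM2r (fejer_ge0 L t) h3.
  apply: (le_trans h4); rewrite mulrDl lerD2l -mulrA ler_wpM2l ?invr_ge0 ?(ltW e0)//.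
  by rewrite mulrC.
apply: le_Rintegral => //.
apply: (integ_dom _ ig) => [|t].
  apply: measurable_funM; last exact: measurable_cell.
  by apply: measurable_funM => //; exact: measurableT_comp.
by rewrite ger0_norm// fejer_cell_ge0.
Qed.

(** The kernel has period 1 and unit mass on each cell, so on the cell of [s] it evaluates [F] at
    [s] up to the first absolute moment times the slope [C s]; the slopes are summable. *)
Lemma fejer_sum (F : R -> R) (C : int -> R) (K A : R) (L : nat) :
  integ F -> (forall s t, `|t| <= 1/2 -> `|F (t + s%:~R) - F s%:~R| <= C s * `|t|) ->
  (forall S, zsum S C <= K) -> (fun S => zsum S (fun s => F s%:~R)) @ \oo --> A ->
  (0 < L)%N ->
  `|\int[leb]_t (F t * fejer L t) - A| <= 2 * K * (Num.sqrt L%:R)^-1.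
Proof.
move=> iF FC CK FA L0.
have mF := integ_mfun iF.
have cD := @continuous_fejer L.
have mD : measurable_fun [set: RT] (fejer L) by exact: continuous_measurable_fun.
have C0 s : 0 <= C s.
  have h : `|1/2 : R| <= 1/2 by rewrite ger0_norm//; lra.
  have := le_trans (normr_ge0 _) (FC s _ h).
  by rewrite pmulr_lge0// normr_gt0; lra.
have iFD : integ (fun t => F t * fejer L t).
  apply: (@integ_dom _ _ (fun t => (2 * L).+1%:R * `|F t|)).
  - exact: measurable_funM.
  - exact: integZ (integ_norm iF).
  by move=> t; rewrite normrM mulrC ler_wpM2r// fejer_bound.
have msh s : measurable_fun [set: RT] (fun t : RT => cell (t - s%:~R)).
  apply: (measurableT_comp measurable_cell).
  by apply: measurable_funD => //; exact: measurable_cst.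
pose G S t := F t * fejer L t * zsum S (fun s => cell (t - s%:~R)).
have mG S : measurable_fun [set: RT] (G S).
  apply: measurable_funM; first exact: measurable_funM.
  by apply: measurable_sum => i; exact: msh.
have Gl t : G ^~ t @ \oo --> F t * fejer L t.
  apply/cvgrPdist_le => e e0; near=> S.
  have E : zsum S (fun s => cell (t - s%:~R)) = 1.
    by near: S; exact: zsum_cell_near.
  by rewrite /G E mulr1 subrr normr0 ltW.
have Gb S t : `|G S t| <= `|F t * fejer L t|.
  rewrite /G normrM ler_piMr//; have /andP[z0 z1] := zsum_cell S t.
  by rewrite ger0_norm.
have [_ lim] := Rint_dominated mG (integ_norm iFD) Gl Gb.
have iGs s : integ (fun t => F t * fejer L t * cell (t - s%:~R)).
  apply: (integ_dom _ (integ_norm iFD)) => [|t].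
    by apply: measurable_funM => //; exact: measurable_funM.
  rewrite normrM ler_piMr// ger0_norm ?cell_ge0//.
  by rewrite /cell indicE; case: (_ \in _).
(* Each cell is translated back to the origin, which periodicity of the kernel permits. *)
have GE S : \int[leb]_t G S t =
    zsum S (fun s => \int[leb]_t (F (t + s%:~R) * fejer L t * cell t)).
  rewrite /zsum.
  have [_ h] := integ_sum (index_enum 'I_(2 * S).+1) (fun i => iGs (zi i)).
  transitivity (\int[leb]_t \sum_(i < (2 * S).+1) F t * fejer L t * cell (t - (zi i)%:~R)).
    by apply: eq_Rintegral => t _; rewrite /G mulr_sumr.
  rewrite h; apply: eq_bigr => i _.
  rewrite -(@Rintegral_shift R (zi i)%:~R (fun t => F t * fejer L t * cell (t - (zi i)%:~R))).
    by apply: eq_Rintegral => t _; rewrite addrK fejer_shift.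
  exact: integ_mfun (iGs _).
have iFs s : integ (fun t => F (t + s%:~R) * fejer L t * cell t).
  have := @integrable_shift R s%:~R _ (iGs s).
  by rewrite /integ; apply: eq_integrable => // t _ /=; rewrite addrK fejer_shift.
have iDc : integ (fun t => fejer L t * cell t).
  by apply: (@integ_cell _ (2 * L).+1%:R) => // t; exact: fejer_bound.
have itDc : integ (fun t => `|t| * fejer L t * cell t).
  apply: (integ_dom _ iDc) => [|t].
    apply: measurable_funM; last exact: measurable_cell.
    by apply: measurable_funM => //; exact: measurableT_comp.
  rewrite (ger0_norm (fejer_cell_ge0 L t)).
  have [->|[-> t2]] := cell_cases t; first by rewrite !mulr0.
  by rewrite !mulr1 ler_piMl ?fejer_ge0//; lra.
have one s : `|\int[leb]_t (F (t + s%:~R) * fejer L t * cell t) - F s%:~R| <=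
    C s * (2 * (Num.sqrt L%:R)^-1).
  have E : F s%:~R = \int[leb]_t (F s%:~R * (fejer L t * cell t)).
    by rewrite RintegralZl// Rint_cell_fejer// mulr1.
  rewrite [X in _ - X]E -(RintegralB measurableT (iFs s) (integZ (F s%:~R) iDc)).
  apply: (@le_trans _ _ (\int[leb]_t (C s * (`|t| * fejer L t * cell t)))); last first.
    rewrite (RintegralZl (C s) measurableT itDc).
    by apply: ler_wpM2l; [exact: C0|exact: Rint_cell_norm_fejer].
  apply: Rint_le_dom.
  - apply: measurable_funB; first exact: integ_mfun (iFs s).
    exact: integ_mfun (integZ _ iDc).
  - exact: integZ.
  move=> t; have [->|[-> t2]] := cell_cases t; first by rewrite !mulr0 subrr normr0.
  rewrite !mulr1 -mulrBl normrM (ger0_norm (fejer_ge0 _ _)) [leRHS]mulrA.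
  by apply: ler_wpM2r; [exact: fejer_ge0|exact: FC].
have err S : `|\int[leb]_t G S t - zsum S (fun s => F s%:~R)| <=
    2 * K * (Num.sqrt L%:R)^-1.
  rewrite GE /zsum -sumrB; apply: (le_trans (ler_norm_sum _ _ _)).
  apply: (@le_trans _ _ (zsum S (fun s => C s * (2 * (Num.sqrt L%:R)^-1)))).
    by apply: ler_sum => i _; exact: one.
  rewrite /zsum -mulr_suml -mulrA [leRHS]mulrCA ler_wpM2r//.
  exact: CK.
have h : (fun S => `|\int[leb]_t G S t - zsum S (fun s => F s%:~R)|) @ \oo -->
    `|\int[leb]_t (F t * fejer L t) - A|.
  by apply: cvg_norm; apply: cvgB.
rewrite -(cvg_lim _ h)//; apply: limr_le; first by apply/cvg_ex; eexists; exact: h.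
by apply: nearW => S; exact: err.
Unshelve. all: by end_near. Qed.
End Fejer.

(** * Approximate inverse of convolution with the Gaussian on the integers *)

Section Convolution_inverse.
Variable R : realType.

Lemma zsum_opp (V : nmodType) M (f : int -> V) : zsum M (fun z => f (- z)) = zsum M f.
Proof.
elim: M => [|M IH]; first by rewrite !zsum0 oppr0.
by rewrite !zsumS IH opprK addrC [RHS]addrC addrCA addrA.
Qed.

Lemma zsum_norm_le (f : int -> R) M : `|zsum M f| <= zsum M (fun z => `|f z|).
Proof. exact: ler_norm_sum. Qed.

Lemma zsumD (V : nmodType) M (f g : int -> V) :
  zsum M (fun z => f z + g z) = zsum M f + zsum M g.
Proof. exact: big_split. Qed.

Lemma zsumB (V : zmodType) M (f g : int -> V) :
  zsum M (fun z => f z - g z) = zsum M f - zsum M g.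
Proof. exact: sumrB. Qed.

Lemma zsumZ M c (f : int -> R) : zsum M (fun z => c * f z) = c * zsum M f.
Proof. by rewrite /zsum mulr_sumr. Qed.

Lemma zsum_cvg (f : int -> R) K : sumle (fun z => `|f z|) K ->
  cvgn (fun M => zsum M f) /\ `|limn (fun M => zsum M f)| <= K.
Proof.
move=> fK.
have nd (g : int -> R) L : (forall z, 0 <= g z) -> (forall M, zsum M g <= L) ->
    cvgn (fun M => zsum M g).
  move=> g0 gL; apply: nondecreasing_is_cvgn.
    apply/nondecreasing_seqP => n; rewrite zsumS.
    by have := g0 (- n.+1%:Z); have := g0 n.+1%:Z; lra.
  by exists L => _ [n _ <-].
have c1 : cvgn (fun M => zsum M (fun z => `|f z|)).
  by apply: (nd _ K) => // M; exact: sumle_zsum fK M.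
have c2 : cvgn (fun M => zsum M (fun z => f z + `|f z|)).
  apply: (nd _ (2 * K)) => [z|M].
    by have := ler_norm (- f z); rewrite normrN; lra.
  apply: (@le_trans _ _ (zsum M (fun z => 2 * `|f z|))).
    by apply: zsum_le => z; have := ler_norm (f z); lra.
  by rewrite zsumZ ler_pM2l//; exact: sumle_zsum fK M.
have c : cvgn (fun M => zsum M f).
  rewrite (_ : (fun M => _) = (fun M => zsum M (fun z => f z + `|f z|) -
     zsum M (fun z => `|f z|))); first exact: is_cvgB.
  by apply/funext => M; rewrite zsumD addrK.
split => //.
have h : (fun M => `|zsum M f|) @ \oo --> `|limn (fun M => zsum M f)|.
  exact: cvg_norm.
rewrite -(cvg_lim _ h)//; apply: limr_le; first by apply/cvg_ex; eexists; exact: h.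
apply: nearW => M; apply: (le_trans (zsum_norm_le _ _)); exact: sumle_zsum fK M.
Qed.

(* A pair [(c, a)] in [K] stands for the mass [c] at the integer [a]. *)
Definition ksum (V : lmodType R) (K : seq (R * int)) (f : int -> V) : V :=
  \sum_(p <- K) p.1 *: f p.2.

(** The weight [exp |a|] is submultiplicative under addition of positions, hence compatible with
    convolution. *)
Definition knorm (K : seq (R * int)) : R :=
  \sum_(p <- K) `|p.1| * expR `|p.2|%:~R.

Definition zlist (S : nat) : seq int :=
  [seq z <- [seq zi i | i <- index_enum 'I_(2 * S).+1] | z != 0].

Lemma zsum_zlist (S : nat) (f : int -> R) :
  zsum S f = f 0 + \sum_(z <- zlist S) f z.
Proof.
have h0 : `|0 : int| <= S%:Z by rewrite normr0.
rewrite /zlist big_filter big_map.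
rewrite -[f 0](@zsum_eq_delta R S 0 (fun z => if z == 0 then f z else 0) h0)//; last first.
  by move=> z /negbTE ->.
rewrite /zsum [X in _ + X]big_mkcond -big_split /=; apply: eq_bigr => i _.
by case: eqP => _; rewrite ?addr0 ?add0r.
Qed.

(** Writing the truncated Gaussian sequence as [delta_0 + g], with [g] carried by [zlist S], this is
    the partial Neumann series [K_(N+1) = delta_0 - g * K_N] for convolution. *)
Fixpoint neumann (S N : nat) : seq (R * int) :=
  if N is N'.+1 then
    (1, 0) :: [seq (- gs z%:~R * p.1, p.2 + z) | z <- zlist S, p <- neumann S N']
  else [:: (1, 0)].

Lemma neumannS S N : neumann S N.+1 =
  (1, 0) :: [seq (- gs z%:~R * p.1, p.2 + z) | z <- zlist S, p <- neumann S N].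
Proof. by []. Qed.

Lemma expR_absz_ge1 (z : int) : 1 <= expR `|z|%:~R :> R.
Proof. by apply: le_trans (expR_ge1Dx _); rewrite lerDl ler0z. Qed.

Lemma ksum_neumannS S N (f : int -> R) : ksum (neumann S N.+1) (f : int -> R^o) =
  f 0 - \sum_(z <- zlist S) gs z%:~R * ksum (neumann S N) (fun x => f (x + z) : R^o).
Proof.
rewrite /ksum neumannS big_cons scale1r; congr (_ + _).
rewrite big_allpairs_dep -sumrN; apply: eq_bigr => z _.
rewrite mulr_sumr -sumrN; apply: eq_bigr => p _ /=.
by rewrite /GRing.scale /=; ring.
Qed.

(** Sharp enough for [exp(-1) <= 2/5] and [exp(-3) <= 1/10], which keep the weighted mass of the
    Gaussian off the origin below 1. *)
Lemma expR1_ge : 5/2 <= expR 1 :> R.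
Proof.
have h : 9/8 <= expR (1/8) :> R by apply: le_trans (expR_ge1Dx _); lra.
have -> : expR 1 = expR (1/8) ^+ 8 :> R.
  by rewrite -expRM_natl; congr expR; lra.
apply: le_trans (_ : (9/8) ^+ 8 <= _); last by rewrite lerXn2r ?nnegrE ?expR_ge0//; lra.
lra.
Qed.

Lemma gs_nat_le (n : nat) : (0 < n)%N ->
  gs n%:R * expR n%:R <= (2/5) * (1/10) ^+ n.-1 :> R.
Proof.
case: n => // n _; rewrite /= /gs -expRD.
have n0 : 0 <= n%:R :> R by [].
(* Here [n] is the predecessor, and [pi >= 2] gives [pi (n+1)^2 - (n+1) >= 1 + 3 n]. *)
apply: (@le_trans _ _ (expR (-1) * expR (- (3 * n%:R)))).
  rewrite -expRD ler_expR -natr1.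
  have := pi_ge2 R; have := sqr_ge0 (n%:R + 1 : R); nra.
have q : expR (-1) <= 2/5 :> R.
  rewrite -(@ler_pM2r _ (expR 1)) ?expR_gt0// -expRD addNr expR0.
  by have := expR1_ge; lra.
rewrite ler_pM ?expR_ge0//.
have -> : - (3 * n%:R) = n%:R * (-3) :> R by ring.
have e3 : expR (-3) <= 1/10 :> R.
  have -> : expR (-3) = expR (-1) ^+ 3 :> R by rewrite -expRM_natl; congr expR; lra.
  have e0 := expR_ge0 (-1 : R).
  have h : expR (-1) ^+ 3 <= (2/5) ^+ 3 :> R by rewrite lerXn2r ?nnegrE//; lra.
  by apply: (le_trans h); lra.
rewrite expRM_natl; apply: lerXn2r e3; rewrite nnegrE ?expR_ge0//; lra.
Qed.

(** Two sides, each dominated by the geometric sequence of [gs_nat_le]: the constant is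
    [2 (2/5) (10/9) = 8/9]. *)
Lemma zsum_tail (S T : nat) : (S <= T)%N ->
  zsum T (fun z => gs z%:~R * expR `|z|%:~R) - zsum S (fun z => gs z%:~R * expR `|z|%:~R)
  <= 8/9 * ((1/10) ^+ S - (1/10) ^+ T) :> R.
Proof.
move=> ST; rewrite -(subnK ST); elim: (T - S)%N => [|n IH].
  by rewrite add0n !subrr mulr0.
rewrite addSn zsumS; set f := (fun z : int => gs z%:~R * expR `|z|%:~R) in IH *.
have fE : f (- (n + S).+1%:Z) = f (n + S).+1%:Z.
  by rewrite /f rmorphN /= gsN normrN.
have h' : f (n + S).+1%:Z <= 2 / 5 * (1 / 10) ^+ (n + S).
  by rewrite /f ger0_norm// -pmulrn; exact: (@gs_nat_le (n + S).+1 isT).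
have e : f (- (n + S).+1%:Z) + zsum (n + S) f + f (n + S).+1%:Z - zsum S f =
  2 * f (n + S).+1%:Z + (zsum (n + S) f - zsum S f) by rewrite fE; ring.
rewrite -/(f _) -/(f (n + S).+1%:Z) e exprS; lra.
Qed.

Lemma sum_zlist_gs S : \sum_(z <- zlist S) gs z%:~R * expR `|z|%:~R <= 8/9 :> R.
Proof.
have := zsum_tail (leq0n S); rewrite zsum0 (zsum_zlist S) expr0.
have : 0 <= (1/10 : R) ^+ S by rewrite exprn_ge0//; lra.
lra.
Qed.

Lemma sum_zlist_gs1 S : \sum_(z <- zlist S) gs z%:~R <= 8/9 :> R.
Proof.
apply: le_trans (sum_zlist_gs S); apply: ler_sum => z _.
by apply: ler_peMr; [exact: gs_ge0|exact: expR_absz_ge1].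
Qed.

(** 9 is the fixed point of [x = 1 + (8/9) x], the recursion obeyed by the weighted norm. *)
Lemma knorm_neumann S N : knorm (neumann S N) <= 9.
Proof.
elim: N => [|N IH].
  by rewrite /knorm big_seq1 /= normr0 expR0 normr1 mul1r; lra.
rewrite /knorm neumannS big_cons normr0 expR0 normr1 mul1r big_allpairs_dep /=.
apply: (@le_trans _ _ (1 + \sum_(z <- zlist S) (gs z%:~R * expR `|z|%:~R * 9))); last first.
  by rewrite -mulr_suml; have := sum_zlist_gs S; lra.
rewrite lerD2l; apply: ler_sum => z _.
apply: (@le_trans _ _ (gs z%:~R * expR `|z|%:~R * knorm (neumann S N))); last first.
  by apply: ler_wpM2l => //; apply: mulr_ge0; [exact: gs_ge0|exact: expR_ge0].
rewrite /knorm mulr_sumr; apply: ler_sum => p _.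
rewrite normrM normrN (ger0_norm (gs_ge0 _)).
apply: (@le_trans _ _ (gs z%:~R * `|p.1| * (expR `|z|%:~R * expR `|p.2|%:~R))).
  apply: ler_wpM2l; first by apply: mulr_ge0 => //; exact: gs_ge0.
  by rewrite -expRD ler_expR -rmorphD ler_int addrC ler_normD.
by rewrite le_eqVlt; apply/orP; left; apply/eqP; ring.
Qed.

Lemma ksum_le (K : seq (R * int)) (f : int -> R^o) B :
  (forall z, `|f z| <= B) -> `|ksum K f| <= knorm K * B.
Proof.
move=> fB; apply: (le_trans (ler_norm_sum _ _ _)).
rewrite /knorm mulr_suml; apply: ler_sum => p _.
rewrite normrM ler_pM//.
by apply: ler_peMr => //; exact: expR_absz_ge1.
Qed.

(** The Gaussian is even and [zlist] symmetric, and the recursion preserves this. Evenness later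
    makes the Fourier series of [K] real. *)
Lemma ksum_neumann_even S N (f : int -> R^o) :
  ksum (neumann S N) (fun x => f (- x)) = ksum (neumann S N) f.
Proof.
elim: N f => [|N IH] f; first by rewrite /ksum !big_seq1 oppr0.
rewrite !ksum_neumannS oppr0; congr (_ - _).
pose g (z : int) := gs z%:~R * ksum (neumann S N) (fun x => f (x + z) : R^o).
have E1 := zsum_zlist S g; have E2 := zsum_zlist S (fun z => g (- z)).
rewrite zsum_opp E1 oppr0 in E2; move: E2 => /addrI E2.
rewrite [RHS]E2; apply: eq_bigr => z _.
rewrite /g rmorphN /= gsN; congr (_ * _).
rewrite -(IH (fun x => f (x - z))); rewrite /ksum; apply: eq_bigr => p _.
by rewrite opprD.
Qed.

(** Passing from one partial series to the next convolves the difference with [-g], whose total mass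
    is at most [8/9]. *)
Lemma neumann_cauchy S N (f : int -> R^o) B : (forall z, `|f z| <= B) ->
  `|ksum (neumann S N) f - ksum (neumann S N.+1) f| <= (8/9) ^+ N.+1 * B.
Proof.
elim: N f => [|N IH] f fB.
  rewrite ksum_neumannS /= {1}/ksum big_seq1 scale1r opprB addrC subrK.
  apply: (le_trans (ler_norm_sum _ _ _)).
  apply: (@le_trans _ _ (\sum_(z <- zlist S) gs z%:~R * B)).
    apply: ler_sum => z _; rewrite /ksum big_seq1 scale1r normrM (ger0_norm (gs_ge0 _)).
    by rewrite ler_wpM2l ?gs_ge0.
  rewrite -mulr_suml expr1 ler_wpM2r ?sum_zlist_gs1//.
  exact: le_trans (normr_ge0 _) (fB 0).
rewrite ksum_neumannS [X in _ - X]ksum_neumannS opprB addrC addrA subrK -sumrB.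
apply: (le_trans (ler_norm_sum _ _ _)).
apply: (@le_trans _ _ (\sum_(z <- zlist S) gs z%:~R * ((8/9) ^+ N.+1 * B))).
  apply: ler_sum => z _; rewrite -mulrBr normrM (ger0_norm (gs_ge0 _)).
  by rewrite ler_wpM2l ?gs_ge0// -normrN opprB; apply: IH.
rewrite -mulr_suml [in leRHS]exprS -mulrA; apply: ler_wpM2r; last exact: sum_zlist_gs1.
have B0 : 0 <= B by exact: le_trans (normr_ge0 _) (fB 0).
by apply: mulr_ge0 => //; apply: exprn_ge0; lra.
Qed.

Lemma geometric_small (a e : R) : 0 <= a < 1 -> 0 < e -> exists n, a ^+ n < e.
Proof.
move=> /andP[a0 a1] e0.
have : (fun n => a ^+ n) @ \oo --> 0 by apply: cvg_expr; rewrite ger0_norm.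
move=> /cvgr0Pnorm_lt /(_ _ e0) [n _ h]; exists n.
by have := h n (leqnn _); rewrite /= ger0_norm// exprn_ge0.
Qed.

Lemma approximate_inverse (eta : R) : 0 < eta -> exists K : seq (R * int),
  [/\ knorm K <= 9,
      forall f : int -> R^o, ksum K (fun x => f (- x)) = ksum K f
    & exists S0, forall S, (S0 <= S)%N -> forall (f : int -> R^o) B,
      (forall z, `|f z| <= B) ->
      `|zsum S (fun s => gs s%:~R * ksum K (fun x => f (s + x))) - f 0| <= eta * B].
Proof.
move=> e0.
have [N hN] : exists N, (8/9 : R) ^+ N < eta / 2.
  by apply: geometric_small; [apply/andP; split; lra|lra].
(* Enlarging the window beyond [S] changes the sum by at most
   [(8/9) 10^(-S) * 9 B = 8 * 10^(-S) * B], which stays below [eta B / 2]. *)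
have [S hS] : exists S, (1/10 : R) ^+ S < eta / 18.
  by apply: geometric_small; [apply/andP; split; lra|lra].
exists (neumann S N); split; [exact: knorm_neumann|exact: ksum_neumann_even|].
exists S => T ST f B fB.
have B0 : 0 <= B by exact: le_trans (normr_ge0 _) (fB 0).
pose g (s : int) := gs s%:~R * ksum (neumann S N) (fun x => f (s + x)).
have g_le s : `|g s| <= gs s%:~R * expR `|s|%:~R * (9 * B).
  rewrite normrM (ger0_norm (gs_ge0 _)) -mulrA ler_wpM2l ?gs_ge0//.
  apply: (@le_trans _ _ (9 * B)).
    apply: (le_trans (ksum_le _ (fun z => fB _))).
    by rewrite ler_wpM2r// knorm_neumann.
  by apply: ler_peMl; [rewrite mulr_ge0|exact: expR_absz_ge1].
(* On the window used to build [K_N], convolving gives [K_N + g * K_N = K_N + delta_0 - K_(N+1)], so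
   the error is one Neumann increment. *)
have E : zsum S g = f 0 + (ksum (neumann S N) f - ksum (neumann S N.+1) f).
  have a0 : gs 0%:~R = 1 :> R by rewrite /gs expr0n /= mulr0 oppr0 expR0.
  have a1 : g 0 = ksum (neumann S N) f.
    by rewrite /g a0 mul1r /ksum; apply: eq_bigr => p _; rewrite add0r.
  have a2 : \sum_(z <- zlist S) g z = \sum_(z <- zlist S)
      gs z%:~R * ksum (neumann S N) (fun x => f (x + z) : R^o).
    apply: eq_bigr => z _; congr (_ * _); apply: eq_bigr => p _.
    by rewrite addrC.
  by rewrite zsum_zlist ksum_neumannS a1 a2; ring.
have tail : `|zsum T g - zsum S g| <= 8/9 * (1/10) ^+ S * (9 * B).
  pose w (z : int) := gs z%:~R * expR `|z|%:~R : R.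
  have key n : `|zsum (n + S) g - zsum S g| <= (zsum (n + S) w - zsum S w) * (9 * B).
    elim: n => [|n IH]; first by rewrite !subrr normr0 mul0r.
    rewrite addSn !zsumS.
    have e (a b c x : R) : a + b + c - x = (b - x) + (a + c) by ring.
    rewrite !e mulrDl; apply: (le_trans (ler_normD _ _)); apply: lerD => //.
    apply: (le_trans (ler_normD _ _)); rewrite mulrDl.
    by apply: lerD; exact: g_le.
  have := key (T - S)%N; rewrite subnK// => h; apply: (le_trans h).
  rewrite ler_wpM2r ?mulr_ge0//; apply: le_trans (zsum_tail ST) _.
  have : 0 <= (1/10 : R) ^+ T by rewrite exprn_ge0//; lra.
  lra.
have := neumann_cauchy S N fB.
rewrite -/(zsum T g) => h.
have -> : zsum T g - f 0 = (zsum T g - zsum S g) +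
    (ksum (neumann S N) f - ksum (neumann S N.+1) f).
  by rewrite E; ring.
apply: (le_trans (ler_normD _ _)).
have h2 : (8/9) ^+ N.+1 * B <= eta / 2 * B.
  rewrite ler_wpM2r// exprS.
  have : 0 <= (8/9 : R) ^+ N by rewrite exprn_ge0//; lra.
  lra.
have h3 : 8/9 * (1/10) ^+ S * (9 * B) <= eta / 2 * B.
  rewrite (_ : 8/9 * (1/10) ^+ S * (9 * B) = 8 * (1/10) ^+ S * B); last by field.
  by rewrite ler_wpM2r//; lra.
lra.
Qed.
End Convolution_inverse.

(** * Periodised Gaussians and Poisson summation *)

Section Theta.
Variable R : realType.
Local Notation leb := (@lebesgue_measure R).
Local Notation RT := (measurableTypeR R).

Lemma gs_exp (x : R) : gs x <= expR 1 * expR (- `|x|).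
Proof.
rewrite /gs -expRD ler_expR.
have p2 := pi_ge2 R; have x0 := normr_ge0 x.
have : 2 * `|x| ^+ 2 <= pi * x ^+ 2.
  by rewrite -(real_normK (num_real x)) ler_wpM2r// sqr_ge0.
have := sqr_ge0 (`|x| - 1/2); nra.
Qed.

Lemma dgs_exp (x : R) : `|- (2 * pi * x) * gs x| <= 8 * expR 1 * expR (- `|x|).
Proof.
rewrite normrM normrN !normrM (ger0_norm (gs_ge0 _)) ger0_norm// (ger0_norm (pi_ge0 R)).
have p4 : pi <= 4 :> R by have /andP[_] := @pihalf_02 R; lra.
have p2 := pi_ge2 R; have x0 := normr_ge0 x.
apply: (@le_trans _ _ (8 * (expR (`|x|) * gs x))).
  rewrite mulrA ler_wpM2r ?gs_ge0//.
  have := expR_ge1Dx `|x|; nra.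
rewrite -[leRHS]mulrA ler_wpM2l// /gs -!expRD ler_expR.
have : 2 * `|x| ^+ 2 <= pi * x ^+ 2.
  by rewrite -(real_normK (num_real x)) ler_wpM2r// sqr_ge0.
have := sqr_ge0 (`|x| - 1/2); nra.
Qed.

Lemma gs_lip (x t : R) : `|t| <= 1/2 ->
  `|gs (x + t) - gs x| <= 8 * expR 2 * expR (- `|x|) * `|t|.
Proof.
move=> t2.
(* The centre [z] of the decay may differ from the left endpoint [y], so that a negative increment
   is treated by exchanging the endpoints. *)
have pos (y u : R) : 0 <= u <= 1/2 -> forall z, `|z - y| <= 1/2 ->
    `|gs (y + u) - gs y| <= 8 * expR 2 * expR (- `|z|) * u.
  move=> /andP[u0 u2] z zy.
  have [->|un] := eqVneq u 0; first by rewrite addr0 subrr normr0 mulr0.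
  have lt : y < y + u by rewrite ltrDl lt_neqAle eq_sym un.
  have [|c] := @MVT R (@gs R) _ y (y + u) lt (fun s _ => is_derive_gs s).
    by apply: continuous_subspaceT; exact: continuous_gs.
  rewrite in_itv /= => /andP[c1 c2] ->.
  rewrite normrM [y + u]addrC addrK (ger0_norm u0) ler_wpM2r//.
  apply: (le_trans (dgs_exp c)).
  have -> : 2 = 1 + 1 :> R by lra.
  rewrite expRD mulrA -[leRHS]mulrA ler_wpM2l ?mulr_ge0 ?expR_ge0//.
  rewrite -expRD ler_expR.
  have h : `|z - c| <= 1.
    apply: (@le_trans _ _ (`|z - y| + `|y - c|)).
      by rewrite (le_trans _ (ler_normD _ _))// addrA subrK.
    have : `|y - c| <= 1/2 by rewrite ler_norml; apply/andP; split; lra.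
    lra.
  have := ler_normD c (z - c); rewrite addrC subrK; lra.
have [t0|t0] := leP 0 t.
  rewrite [X in _ * X]ger0_norm//; apply: pos; last by rewrite subrr normr0; lra.
  by rewrite t0 -(ger0_norm t0).
have tn : 0 <= - t by lra.
have := pos (x + t) (- t); rewrite addrK distrC (ltr0_norm t0) => h.
apply: h; first by rewrite tn -(ger0_norm tn) normrN.
by rewrite opprD addrA subrr add0r normrN.
Qed.

(** Only increments up to [1/2], the radius of [cell], are compared. A single constant for size and
    slope keeps products in the class. *)
Definition lipb (A : R -> R) (B : R) :=
  (forall x, `|A x| <= B) /\
  (forall x y, `|x - y| <= 1/2 -> `|A x - A y| <= B * `|x - y|).

Lemma lipb_ge0 A B : lipb A B -> 0 <= B.
Proof. by move=> [/(_ 0) h _]; exact: le_trans (normr_ge0 _) h. Qed.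

Lemma lipbM A B A' B' : lipb A B -> lipb A' B' ->
  lipb (fun x => A x * A' x) (2 * (B * B')).
Proof.
move=> lA lA'; have B0 := lipb_ge0 lA; have B0' := lipb_ge0 lA'.
case: lA => h1 h2; case: lA' => h1' h2'; split=> [x|x y xy].
  rewrite normrM; apply: (@le_trans _ _ (B * B')); first by rewrite ler_pM.
  by rewrite ler_peMl ?mulr_ge0//; lra.
have -> : A x * A' x - A y * A' y = (A x - A y) * A' x + A y * (A' x - A' y) by ring.
apply: (le_trans (ler_normD _ _)); rewrite !normrM.
have e1 : `|A x - A y| * `|A' x| <= B * `|x - y| * B' by rewrite ler_pM// h2.
have e2 : `|A y| * `|A' x - A' y| <= B * (B' * `|x - y|) by rewrite ler_pM// h2'.
lra.
Qed.

Lemma lipb_continuous A B : lipb A B -> continuous A.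
Proof.
move=> lA; have B0 := lipb_ge0 lA; case: lA => _ h x.
apply/cvgrPdist_le => e e0; near=> y.
have xy : `|x - y| <= 1/2 by near: y; apply: cvgr_dist_le; [exact: cvg_id|lra].
apply: (le_trans (h _ _ xy)).
have : `|x - y| <= e / (B + 1).
  near: y; apply: cvgr_dist_le; [exact: cvg_id|by rewrite divr_gt0//; lra].
rewrite ler_pdivlMr; last lra.
have := normr_ge0 (x - y); nra.
Unshelve. all: by end_near. Qed.

Lemma lipb_gs A B (t0 : R) : lipb A B -> forall s t, `|t| <= 1/2 ->
  `|A (s + t) * gs (s + t - t0) - A s * gs (s - t0)| <=
  B * (8 * expR 2 + expR 2) * expR (- `|s - t0|) * `|t|.
Proof.
move=> lA s t t2; have B0 := lipb_ge0 lA; case: lA => h1 h2.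
have -> : s + t - t0 = (s - t0) + t by ring.
have -> : A (s + t) * gs (s - t0 + t) - A s * gs (s - t0) =
  (A (s + t) - A s) * gs (s - t0 + t) + A s * (gs (s - t0 + t) - gs (s - t0)) by ring.
apply: (le_trans (ler_normD _ _)); rewrite !normrM (ger0_norm (gs_ge0 _)).
have e1 : `|A (s + t) - A s| <= B * `|t|.
  have := h2 (s + t) s; rewrite [s + t]addrC addrK; exact.
have e2 : gs (s - t0 + t) <= expR 2 * expR (- `|s - t0|).
  apply: (le_trans (gs_exp _)).
  have -> : 2 = 1 + 1 :> R by lra.
  rewrite expRD -mulrA ler_wpM2l ?expR_ge0// -expRD ler_expR.
  have := ler_normD (s - t0 + t) (- t); rewrite addrK normrN; lra.
have e3 := gs_lip (s - t0) t2.
have := ler_pM (normr_ge0 _) (gs_ge0 _) e1 e2.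
have := ler_pM (normr_ge0 _) (normr_ge0 _) (h1 s) e3.
lra.
Qed.

Definition cF : R := 2 * ((8 * expR 2 + expR 2) * (4 * expR 1)).

Lemma cF_ge0 : 0 <= cF.
Proof. by rewrite /cF !(mulr_ge0, addr_ge0)// ?expR_ge0. Qed.

Lemma sumle_gs (t0 : R) : sumle (fun s : int => gs (s%:~R - t0)) (expR 1 * (4 * expR 1)).
Proof.
apply: (@sumle_le _ _ _ (fun s : int => expR 1 * expR (- `|s%:~R - t0|))).
  by move=> s; exact: gs_exp.
by apply: sumleZ; [exact: expR_ge0|exact: sumle_expR_dist].
Qed.

Lemma sumle_bounded_gs (A : int -> R) B (t0 : R) : (forall s, `|A s| <= B) ->
  sumle (fun s : int => `|A s * gs (s%:~R - t0)|) (B * (expR 1 * (4 * expR 1))).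
Proof.
move=> AB; have B0 : 0 <= B by exact: le_trans (normr_ge0 _) (AB 0).
apply: (@sumle_le _ _ _ (fun s : int => B * gs (s%:~R - t0))).
  by move=> s; rewrite normrM (ger0_norm (gs_ge0 _)) ler_wpM2r ?gs_ge0.
exact: sumleZ (sumle_gs t0).
Qed.

Lemma integ_gs_shift (t0 : R) : integ (fun t => gs (t - t0)).
Proof. exact: integrable_shift (@integ_gs R). Qed.

Lemma integ_lipb_gs A B (t0 : R) : lipb A B -> integ (fun t => A t * gs (t - t0)).
Proof.
move=> lA; apply: (@integ_dom _ _ (fun t => B * gs (t - t0))).
- apply: measurable_funM; last exact: integ_mfun (integ_gs_shift t0).
  by apply: continuous_measurable_fun; exact: lipb_continuous lA.
- exact: integZ (integ_gs_shift t0).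
by move=> t; rewrite normrM (ger0_norm (gs_ge0 _)) ler_wpM2r ?gs_ge0//; case: lA.
Qed.

Lemma fejer_gauss A B (t0 : R) L : lipb A B -> (0 < L)%N ->
  `|\int[leb]_t (A t * gs (t - t0) * fejer L t)
    - limn (fun S => zsum S (fun s => A s%:~R * gs (s%:~R - t0)))|
  <= cF * B * (Num.sqrt L%:R)^-1.
Proof.
move=> lA L0; have B0 := lipb_ge0 lA; case: (lA) => h1 h2.
have [cv _] := zsum_cvg (sumle_bounded_gs t0 (fun s => h1 s%:~R)).
have := @fejer_sum R (fun t => A t * gs (t - t0))
  (fun s => B * (8 * expR 2 + expR 2) * expR (- `|s%:~R - t0|))
  (B * (8 * expR 2 + expR 2) * (4 * expR 1)) _ L (integ_lipb_gs t0 lA) _ _ cv L0.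
rewrite (_ : 2 * (B * _ * _) = cF * B); last by rewrite /cF; ring.
apply=> [s t t2|S].
  by rewrite [t + _]addrC; exact: lipb_gs.
apply: sumle_zsum; apply: sumleZ; last exact: sumle_expR_dist.
by rewrite !(mulr_ge0, addr_ge0)// ?expR_ge0.
Qed.

(** A Jacobi theta function: the Gaussian made periodic. *)
Definition theta (t : R) : R := limn (fun S => zsum S (fun s => gs (s%:~R - t))).

Lemma theta_cvg t : (fun S => zsum S (fun s => gs (s%:~R - t))) @ \oo --> theta t.
Proof.
have h : sumle (fun s : int => `|gs (s%:~R - t)|) (expR 1 * (4 * expR 1)).
  by apply: sumle_le (sumle_gs t) => s; rewrite ger0_norm// gs_ge0.
by have [] := zsum_cvg h.
Qed.

Definition cT : R := expR 1 * (4 * expR 1).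

Lemma cT_ge0 : 0 <= cT.
Proof. by rewrite /cT !mulr_ge0// expR_ge0. Qed.

Lemma theta_bound t : `|theta t| <= cT.
Proof.
have h : sumle (fun s : int => `|gs (s%:~R - t)|) (expR 1 * (4 * expR 1)).
  by apply: sumle_le (sumle_gs t) => s; rewrite ger0_norm// gs_ge0.
by have [] := zsum_cvg h.
Qed.

Lemma lipb_theta : lipb theta (8 * expR 2 * (4 * expR 1)).
Proof.
split=> [t|x y xy].
  apply: (le_trans (theta_bound t)); rewrite /cT ler_wpM2r ?mulr_ge0 ?expR_ge0//.
  have : expR 1 <= expR 2 :> R by rewrite ler_expR; lra.
  have := expR_ge0 (2 : R); lra.
pose C (s : int) := 8 * expR 2 * `|x - y| * expR (- `|s%:~R - y|).
have hC s : `|gs (s%:~R - x) - gs (s%:~R - y)| <= C s.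
  have := @gs_lip (s%:~R - y) (y - x).
  rewrite addrA subrK distrC => /(_ xy) h; apply: (le_trans h).
  by rewrite /C distrC; lra.
have h : sumle (fun s : int => `|gs (s%:~R - x) - gs (s%:~R - y)|)
    (8 * expR 2 * `|x - y| * (4 * expR 1)).
  apply: sumle_le hC _; apply: sumleZ; last exact: sumle_expR_dist.
  by rewrite !mulr_ge0 ?expR_ge0.
have [_ ] := zsum_cvg h.
have -> : limn (fun M => zsum M (fun s => gs (s%:~R - x) - gs (s%:~R - y))) =
    theta x - theta y.
  apply/cvg_lim => //; under eq_fun do rewrite zsumB.
  by apply: cvgB; exact: theta_cvg.
by move=> h'; apply: (le_trans h'); lra.
Qed.

Lemma Rint_gs_cosz t n : \int[leb]_x (gs (x - t) * cosz x n) = gs n%:~R * cosz t n.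
Proof.
have igs (f : R -> R) : continuous f -> (forall x, `|f x| <= 1) ->
    integ (fun x => gs x * f x).
  by move=> cf f1; exact: (@integ_gs_bounded _ _ 1).
have cc : continuous (fun x : R => cos (2 * pi * n%:~R * x)).
  exact: (@continuous_cosz R n).
have cs : continuous (fun x : R => sin (2 * pi * n%:~R * x)).
  have := @continuous_sinM R (2 * pi * n%:~R) 0.
  by under eq_fun do rewrite addr0.
have ic := igs _ cc (fun x => norm_cos_le1 _).
have is_ := igs _ cs (fun x => norm_sin_le1 _).
have s0 : \int[leb]_x (gs x * sin (2 * pi * n%:~R * x)) = 0.
  have n1 : -1 != 0 :> R by rewrite oppr_eq0 oner_eq0.
  have := Rintegral_scale n1 is_; rewrite normrN normr1 invr1 mul1r.
  have -> : \int[leb]_t0 (gs (-1 * t0) * sin (2 * pi * n%:~R * (-1 * t0))) =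
     - 1 * \int[leb]_x (gs x * sin (2 * pi * n%:~R * x)).
    rewrite -RintegralZl//; apply: eq_Rintegral => x _.
    by rewrite mulN1r gsN mulrN sinN; ring.
  lra.
have m1 : measurable_fun [set: RT] (fun x => gs (x - t) * cosz x n).
  apply: measurable_funM; first exact: integ_mfun (integ_gs_shift t).
  by apply: continuous_measurable_fun; exact: continuous_cosz.
rewrite -(@Rintegral_shift R t _ m1).
transitivity (\int[leb]_x (cosz t n * (gs x * cos (2 * pi * n%:~R * x))
   - sin (2 * pi * n%:~R * t) * (gs x * sin (2 * pi * n%:~R * x)))).
  by apply: eq_Rintegral => x _; rewrite addrK /cosz mulrDr cosD; ring.
rewrite RintegralB//; try exact: integZ.
rewrite !RintegralZl// s0 mulr0 subr0 mulrC.
by have -> : \int[leb]_x (gs x * cos (2 * pi * n%:~R * x)) = gs n%:~R by exact: Fourier_gs.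
Qed.

Lemma sqrt_small (c e : R) : 0 <= c -> 0 < e -> exists L0, forall L, (L0 <= L)%N ->
  (0 < L)%N /\ c * (Num.sqrt L%:R)^-1 <= e.
Proof.
move=> c0 e0.
have [N hN] : exists N : nat, (c / e) ^+ 2 <= N%:R.
  by have [N _ h] := nbhs_infty_ger ((c / e) ^+ 2); exists N; apply: (h N) => /=.
exists N.+1 => L NL; have L0 : (0 < L)%N by exact: leq_trans NL.
split => //.
have sL : 0 < Num.sqrt L%:R :> R by rewrite sqrtr_gt0 ltr0n.
rewrite ler_pdivrMr// mulrC -ler_pdivrMr//.
rewrite -[leLHS]ger0_norm ?divr_ge0 ?(ltW e0)// -sqrtr_sqr ler_wsqrtr//.
by rewrite (le_trans hN)// ler_nat ltnW.
Qed.

(** Poisson summation. A translated Gaussian is integrated against the Fejer kernel in two ways: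
    peak by peak this tends to [theta t], term by term it is the Cesaro mean of the Fourier series.
    The series converges absolutely, so its limit is that of its means. *)
Lemma thetaE t : (fun S => zsum S (fun n => gs n%:~R * cosz t n)) @ \oo --> theta t.
Proof.
have l1 : lipb (fun=> 1) 1.
  by split=> [x|x y _]; rewrite ?normr1// subrr normr0 mulr_ge0.
have h : sumle (fun s : int => `|cosz t s * gs (s%:~R - 0)|) (1 * (expR 1 * (4 * expR 1))).
  by apply: sumle_bounded_gs => s; exact: norm_cosz.
have [cv _] := zsum_cvg h.
have E : (fun S => zsum S (fun n => gs n%:~R * cosz t n)) =
    (fun M => zsum M (fun s => cosz t s * gs (s%:~R - 0))).
  by apply/funext => S; apply: eq_bigr => i _; rewrite subr0 mulrC.
rewrite E; set u := (fun M => _) in cv *; set l := limn u in cv *.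
suff -> : theta t = l by [].
have ces := cesaro cv.
have i1 n : integ (fun x => gs (x - t) * cosz x n).
  apply: (@integ_dom _ _ (fun x => gs (x - t))).
  - apply: measurable_funM; first exact: integ_mfun (integ_gs_shift t).
    by apply: continuous_measurable_fun; exact: continuous_cosz.
  - exact: integ_gs_shift.
  by move=> x; rewrite normrM (ger0_norm (gs_ge0 _)) ler_piMr ?gs_ge0 ?norm_cosz.
have fe L : \int[leb]_x (1 * gs (x - t) * fejer L x) = L%:R^-1 * \sum_(j < L) u j.
  have Z j : integ (fun x => gs (x - t) * zsum j (cosz x)) /\
      \int[leb]_x (gs (x - t) * zsum j (cosz x)) = u j.
    have [i2 e2] := integ_sum (index_enum 'I_(2 * j).+1) (fun i => i1 (zi i)).
    have Ez : (fun x => gs (x - t) * zsum j (cosz x)) =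
       (fun x => \sum_(i <- index_enum 'I_(2 * j).+1) gs (x - t) * cosz x (zi i)).
      by apply/funext => x; rewrite /zsum mulr_sumr.
    rewrite Ez; split => //; rewrite e2 /u /zsum; apply: eq_bigr => i _.
    by rewrite Rint_gs_cosz subr0 mulrC.
  have [i2 e2] := integ_sum (index_enum 'I_L) (fun j => (Z j).1).
  transitivity (\int[leb]_x (L%:R^-1 * \sum_(j < L) gs (x - t) * zsum j (cosz x))).
    by apply: eq_Rintegral => x _; rewrite /fejer mul1r mulrCA mulr_sumr.
  rewrite (RintegralZl L%:R^-1 measurableT i2) e2; congr (_ * _).
  by apply: eq_bigr => j _; exact: (Z j).2.
have lim : (fun L => \int[leb]_x (1 * gs (x - t) * fejer L.+1 x)) @ \oo --> theta t.
  apply/cvgrPdist_le => e e0.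
  have [L0 hL] := sqrt_small cF_ge0 e0.
  near=> L.
  have LL : (L0 <= L.+1)%N.
    by apply: (@leq_trans L) => //; near: L; exact: nbhs_infty_ge.
  have := @fejer_gauss _ _ t L.+1 l1 isT.
  rewrite distrC (_ : limn _ = theta t); last first.
    by rewrite /theta; congr (limn _); apply/funext => S; apply: eq_bigr => i _; rewrite mul1r.
  by move=> h1; apply: (le_trans h1); rewrite mulr1; exact: (hL _ LL).2.
apply: (cvg_unique _ lim) => //.
rewrite (_ : (fun L => _) = arithmetic_mean u)//.
by apply/funext => L; rewrite fe /arithmetic_mean /= /series /= big_mkord.
Unshelve. all: by end_near. Qed.

End Theta.

(** * The kernel of the filtered frame operator *)

Section Kernel.
Variable R : realType.
Local Notation leb := (@lebesgue_measure R).
Local Notation RT := (measurableTypeR R).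

Lemma Rint_affine (c b : R) (f : R -> R) : c != 0 -> integ f ->
  integ (fun t => f (c * t + b)) /\
  \int[leb]_t f (c * t + b) = `|c|^-1 * \int[leb]_t f t.
Proof.
move=> c0 fi; have ib := integrable_shift b fi.
have mf := integ_mfun fi.
split; first exact: (integ_scale c0 (f := fun t => f (t + b)) ib).
rewrite (Rintegral_scale c0 (f := fun t => f (t + b)) ib).
by rewrite Rintegral_shift.
Qed.

Lemma cos_lip (x y : R) : `|cos x - cos y| <= `|x - y|.
Proof.
wlog xy : x y / x <= y.
  move=> h; have [/h //|/ltW /h] := leP x y.
  by rewrite distrC [leRHS]distrC.
have [->|xn] := eqVneq x y; first by rewrite !subrr.
have lt : x < y by rewrite lt_neqAle xn.
have [|c _] := @MVT R cos (fun t => - sin t) x y lt (fun t _ => is_derive_cos t).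
  by apply: continuous_subspaceT; exact: continuous_cos.
rewrite distrC [leRHS]distrC => ->; rewrite normrM normrN.
by rewrite ler_piMl// norm_sin_le1.
Qed.

(** The Fourier series of an even [K]. The function [phik] after it is [K] convolved with the
    Gaussian, hence close to a delta at 0 on the integers when [K] is an approximate inverse. *)
Definition Qk (K : seq (R * int)) (t : R) : R := ksum K (cosz t : int -> R^o).
Definition phik (K : seq (R * int)) (x : R) : R :=
  ksum K (fun a => gs (x + a%:~R) : R^o).

Lemma Qk_bound K t : knorm K <= 9 -> `|Qk K t| <= 9.
Proof.
move=> K9; apply: (le_trans (ksum_le K (B := 1) _)); last by rewrite mulr1.
by move=> z; exact: norm_cosz.
Qed.

Lemma lipb_Qk K t : knorm K <= 9 -> lipb (fun x => Qk K (t - 2 * x)) 144.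
Proof.
move=> K9; split=> [x|x y _].
  by apply: (le_trans (Qk_bound _ K9)); lra.
rewrite /Qk /ksum -sumrB; apply: (le_trans (ler_norm_sum _ _ _)).
have p4 : pi <= 4 :> R by have /andP[_] := @pihalf_02 R; lra.
(* Each cosine has slope at most [4 pi |b| <= 16 exp |b|]; the exponential is absorbed by
   [knorm K <= 9], and [144 = 9 * 16]. *)
apply: (@le_trans _ _ (knorm K * (16 * `|x - y|))); last first.
  by rewrite mulrA ler_wpM2r//; lra.
rewrite /knorm mulr_suml; apply: ler_sum => p _.
rewrite -scalerBr normrZ -mulrA ler_wpM2l//.
apply: (le_trans (cos_lip _ _)).
have -> : 2 * pi * p.2%:~R * (t - 2 * x) - 2 * pi * p.2%:~R * (t - 2 * y) =
  - (4 * pi * p.2%:~R * (x - y)) by ring.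
rewrite normrN !normrM (ger0_norm (pi_ge0 R)) ger0_norm//.
have b1 : `|p.2%:~R| <= expR `|p.2|%:~R :> R.
  by rewrite -intr_norm; apply: le_trans (expR_ge1Dx _); rewrite lerDr; lra.
apply: (@le_trans _ _ (16 * expR `|p.2|%:~R * `|x - y|)); last first.
  by rewrite le_eqVlt; apply/orP; left; apply/eqP; ring.
rewrite ler_wpM2r// ler_pM//; first by rewrite mulr_ge0// pi_ge0.
lra.
Qed.

Lemma lipb_theta_refl (t : R) :
  lipb (fun x => theta (t - x)) (8 * expR 2 * (4 * expR 1)).
Proof.
have [h1 h2] := lipb_theta R; split=> [x|x y xy]; first exact: h1.
have E : (t - x) - (t - y) = - (x - y) by ring.
by have := h2 (t - x) (t - y); rewrite E normrN; apply.
Qed.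

Lemma theta_shift (t : R) (s : int) : theta (t + s%:~R) = theta t.
Proof.
rewrite -(cvg_lim _ (@thetaE R (t + s%:~R)))// -[RHS](cvg_lim _ (@thetaE R t))//.
congr (limn _); apply/funext => S; apply: eq_bigr => i _.
by rewrite cosz_shift.
Qed.

Lemma cvg_sumr (T : Type) (r : seq T) (F : T -> nat -> R) (l : T -> R) :
  (forall i, F i @ \oo --> l i) ->
  (fun n => \sum_(i <- r) F i n) @ \oo --> \sum_(i <- r) l i.
Proof.
move=> Fl; elim: r => [|a r IH].
  by rewrite big_nil; under eq_fun do rewrite big_nil; exact: cvg_cst.
rewrite big_cons; under eq_fun do rewrite big_cons.
by apply: cvgD; [exact: Fl|exact: IH].
Qed.

(* The exponentially weighted norm bound, uniform in [eta], is what later controls the growth of the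
   weights under index shifts; the last clause says that [K] inverts convolution with [gs]. *)
Definition good_inverse (K : seq (R * int)) (eta : R) :=
  [/\ knorm K <= 9,
      forall f : int -> R^o, ksum K (fun x => f (- x)) = ksum K f
    & exists S0, forall S, (S0 <= S)%N -> forall (f : int -> R^o) B,
      (forall z, `|f z| <= B) ->
      `|zsum S (fun s => gs s%:~R * ksum K (fun x => f (s + x))) - f 0| <= eta * B].

(** The inversion property tested on [cosz t], that is, in Fourier space, where convolution becomes
    multiplication. The sine part of the addition formula drops out since [K] is even. *)
Lemma Qk_theta K eta t : good_inverse K eta -> `|Qk K t * theta t - 1| <= eta.
Proof.
move=> [_ ev [S0 h]].
have s0 : ksum K (fun b => sin (2 * pi * b%:~R * t) : R^o) = 0.
  have := ev (fun b => sin (2 * pi * b%:~R * t)).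
  have -> : ksum K (fun x => sin (2 * pi * (- x)%:~R * t) : R^o) =
     - ksum K (fun b => sin (2 * pi * b%:~R * t) : R^o).
    rewrite /ksum -sumrN; apply: eq_bigr => p _.
    by rewrite rmorphN /= mulrN mulNr sinN scalerN.
  by move=> e; lra.
have E n : Qk K t * (gs n%:~R * cosz t n) =
    gs n%:~R * ksum K (fun x => cosz t (n + x) : R^o).
  have -> : ksum K (fun x => cosz t (n + x) : R^o) = cosz t n * Qk K t
      - sin (2 * pi * n%:~R * t) * ksum K (fun b => sin (2 * pi * b%:~R * t) : R^o).
    rewrite /Qk /ksum !mulr_sumr -sumrB; apply: eq_bigr => p _.
    by rewrite /cosz rmorphD /= mulrDr mulrDl cosD /GRing.scale /=; ring.
  by rewrite s0; ring.
have lim : (fun S => `|zsum S (fun n => Qk K t * (gs n%:~R * cosz t n)) - 1|) @ \oo -->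
    `|Qk K t * theta t - 1|.
  apply: cvg_norm; apply: cvgB; last exact: cvg_cst.
  under eq_fun do rewrite zsumZ.
  by apply: cvgM; [exact: cvg_cst|exact: thetaE].
rewrite -(cvg_lim _ lim)//; apply: limr_le; first by apply/cvg_ex; eexists; exact: lim.
near=> S; have SS : (S0 <= S)%N by near: S; exact: nbhs_infty_ge.
have := h S SS (cosz t) 1 (fun z => norm_cosz t z); rewrite cosz0 mulr1.
by rewrite (_ : zsum S _ = zsum S (fun n => Qk K t * (gs n%:~R * cosz t n)))//;
  apply: eq_bigr => i _; rewrite E.
Unshelve. all: by end_near. Qed.

Definition cA : R := 2 * (2 * (144 * (8 * expR 2 * (4 * expR 1)))).

(** The Fejer kernel has a peak at every integer, and [phik] must suppress all but the one at 0.
    Periodicity moves the translates of the Gaussian from [phik] to [A]; the sum over the peaks then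
    becomes the convolution that [K] inverts. *)
Lemma fejer_phik K L (A : R -> R) B eta : good_inverse K eta -> lipb A B ->
  (0 < L)%N ->
  integ (fun x => A x * phik K x * fejer L x) /\
  `|\int[leb]_x (A x * phik K x * fejer L x) - A 0| <=
    eta * B + 9 * (cF R * B * (Num.sqrt L%:R)^-1).
Proof.
move=> [K9 ev [S0 hS]] lA L0; have B0 := lipb_ge0 lA.
have lAs (a : int) : lipb (fun x => A (x - a%:~R)) B.
  case: lA => h1 h2; split=> [x|x y xy]; first exact: h1.
  have E : (x - a%:~R) - (y - a%:~R) = x - y by ring.
  by have := h2 (x - a%:~R) (y - a%:~R); rewrite E; apply.
have mD : measurable_fun [set: RT] (fejer L).
  by apply: continuous_measurable_fun; exact: continuous_fejer.
pose g (a : int) x := A (x - a%:~R) * gs (x - 0) * fejer L x.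
have ig a : integ (g a).
  apply: (@integ_dom _ _ (fun x => (2 * L).+1%:R * `|A (x - a%:~R) * gs (x - 0)|)).
  - apply: measurable_funM => //; exact: integ_mfun (integ_lipb_gs 0 (lAs a)).
  - by apply: integZ; apply: integ_norm; exact: integ_lipb_gs.
  by move=> x; rewrite normrM mulrC ler_wpM2r// fejer_bound.
have igs a : integ (fun x => g a (x + a%:~R)) := integrable_shift a%:~R (ig a).
have gE a x : g a (x + a%:~R) = A x * gs (x + a%:~R) * fejer L x.
  by rewrite /g addrK subr0 fejer_shift.
have [iS eS] := integ_sum K (fun p => integZ p.1 (igs p.2)).
have E : (fun x => A x * phik K x * fejer L x) =
    (fun x => \sum_(p <- K) p.1 * g p.2 (x + p.2%:~R)).
  apply/funext => x; rewrite /phik /ksum mulr_sumr mulr_suml.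
  by apply: eq_bigr => p _; rewrite gE /GRing.scale /=; ring.
rewrite E; split => //; rewrite eS.
have {}eS p : \int[leb]_x (p.1 * g p.2 (x + p.2%:~R)) = p.1 * \int[leb]_x g p.2 x.
  rewrite (RintegralZl p.1 measurableT (igs p.2)); congr (_ * _).
  by rewrite (@Rintegral_shift R p.2%:~R (g p.2))//; exact: integ_mfun (ig _).
under eq_bigr do rewrite eS.
pose l (a : int) := limn (fun S => zsum S (fun s => A (s%:~R - a%:~R) * gs (s%:~R - 0))).
have lcv a : (fun S => zsum S (fun s => A (s%:~R - a%:~R) * gs (s%:~R - 0))) @ \oo --> l a.
  have [h1 _] := lAs a.
  by have [] := zsum_cvg (sumle_bounded_gs 0 (fun s : int => h1 s%:~R)).
have h1 : `|\sum_(p <- K) p.1 * \int[leb]_x g p.2 x - \sum_(p <- K) p.1 * l p.2| <=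
    9 * (cF R * B * (Num.sqrt L%:R)^-1).
  rewrite -sumrB; apply: (le_trans (ler_norm_sum _ _ _)).
  have c0 : 0 <= cF R * B * (Num.sqrt L%:R)^-1.
    by rewrite mulr_ge0 ?invr_ge0 ?sqrtr_ge0// mulr_ge0// cF_ge0.
  apply: (@le_trans _ _ (knorm K * (cF R * B * (Num.sqrt L%:R)^-1))); last first.
    by rewrite ler_wpM2r.
  rewrite /knorm mulr_suml; apply: ler_sum => p _.
  rewrite -mulrBr normrM ler_pM//; last exact: (fejer_gauss 0 (lAs p.2) L0).
  by apply: ler_peMr => //; exact: expR_absz_ge1.
have h2 : `|\sum_(p <- K) p.1 * l p.2 - A 0| <= eta * B.
  have lim : (fun S => `|zsum S (fun s => \sum_(p <- K) p.1 *
      (A (s%:~R - p.2%:~R) * gs (s%:~R - 0))) - A 0|) @ \oo -->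
      `|\sum_(p <- K) p.1 * l p.2 - A 0|.
    apply: cvg_norm; apply: cvgB; last exact: cvg_cst.
    under eq_fun do rewrite /zsum exchange_big /=.
    rewrite (_ : (fun S => _) = (fun S => \sum_(p <- K) p.1 *
      zsum S (fun s => A (s%:~R - p.2%:~R) * gs (s%:~R - 0)))); last first.
      by apply/funext => S; apply: eq_bigr => p _; rewrite /zsum mulr_sumr.
    apply: cvg_sumr => p; apply: cvgM; [exact: cvg_cst|exact: lcv].
  rewrite -(cvg_lim _ lim)//; apply: limr_le; first by apply/cvg_ex; eexists; exact: lim.
  near=> S; have SS : (S0 <= S)%N by near: S; exact: nbhs_infty_ge.
  have [a1 _] := lA.
  have := hS S SS (fun z => A z%:~R) B (fun z => a1 _).
  rewrite (_ : zsum S _ = zsum S (fun s => \sum_(p <- K) p.1 *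
      (A (s%:~R - p.2%:~R) * gs (s%:~R - 0))))//.
  (* Evenness of [K] turns the differences [s - a] into the sums [s + a] of the inversion
     property. *)
  apply: eq_bigr => i _; rewrite -(ev (fun x => A (zi i + x)%:~R)) /ksum mulr_sumr.
  by apply: eq_bigr => p _; rewrite subr0 intrD rmorphN /= /GRing.scale /=; ring.
rewrite -(subrKA (\sum_(p <- K) p.1 * l p.2)).
by apply: (le_trans (ler_normD _ _)); rewrite addrC lerD.
Unshelve. all: by end_near. Qed.

(** An [L^1] bound uniform in [L]: in a tensor product, the error made in the other coordinates is
    integrated against this kernel. *)
Lemma phik_norm_le K L : knorm K <= 9 -> (0 < L)%N ->
  integ (fun x => phik K x * fejer L x) /\
  \int[leb]_x `|phik K x * fejer L x| <= 9 * (cT R + cF R).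
Proof.
move=> K9 L0.
have mD : measurable_fun [set: RT] (fejer L).
  by apply: continuous_measurable_fun; exact: continuous_fejer.
pose g (a : int) (x : R) := gs (x + a%:~R) * fejer L x.
have mg a : measurable_fun [set: RT] (fun x : R => gs (x + a%:~R)).
  exact: integ_mfun (integrable_shift a%:~R (@integ_gs R)).
have ig a : integ (g a).
  apply: (@integ_dom _ _ (fun x => (2 * L).+1%:R * gs (x + a%:~R))).
  - exact: measurable_funM.
  - by apply: integZ; exact: integrable_shift (@integ_gs R).
  move=> x; rewrite normrM (ger0_norm (gs_ge0 _)) mulrC.
  by rewrite ler_wpM2r ?gs_ge0// fejer_bound.
have l1 : lipb (fun _ : R => 1) 1.
  by split=> [x|x y _]; rewrite ?normr1// subrr normr0 mulr_ge0.
have g_le a : \int[leb]_x g a x <= cT R + cF R.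
  have E : \int[leb]_x g a x = \int[leb]_x (1 * gs (x - (- a%:~R)) * fejer L x).
    by apply: eq_Rintegral => x _; rewrite mul1r opprK.
  have := fejer_gauss (- a%:~R) l1 L0; rewrite -E.
  have -> : limn (fun S => zsum S (fun s => (1 : R) * gs (s%:~R - - a%:~R))) = theta (- a%:~R).
    by rewrite /theta; congr (limn _); apply/funext => S; apply: eq_bigr => i _; rewrite mul1r.
  have tb := theta_bound (- a%:~R : R); rewrite mulr1.
  have sL : (Num.sqrt L%:R)^-1 <= 1 :> R.
    rewrite invf_le1 ?sqrtr_gt0 ?ltr0n// -[leLHS]sqrtr1 ler_wsqrtr//.
    by rewrite ler1n.
  have := ler_wpM2l (cF_ge0 R) sL; rewrite mulr1.
  move: tb; rewrite !ler_norml => /andP[_ tb] h1 /andP[_ h2]; lra.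
have [iS eS] := integ_sum K (fun p => integZ p.1 (ig p.2)).
have [iN eN] := integ_sum K (fun p => integZ `|p.1| (ig p.2)).
have E : (fun x => phik K x * fejer L x) = (fun x => \sum_(p <- K) p.1 * g p.2 x).
  apply/funext => x; rewrite /phik /ksum mulr_suml; apply: eq_bigr => p _.
  by rewrite /g mulrA.
have ip : integ (fun x => phik K x * fejer L x) by rewrite E.
split => //.
apply: (@le_trans _ _ (\int[leb]_x (\sum_(p <- K) `|p.1| * g p.2 x))).
  apply: le_Rintegral => //; first exact: integ_norm ip.
  move=> x _.
  have -> : phik K x * fejer L x = \sum_(p <- K) p.1 * g p.2 x.
    exact: (congr1 (fun f => f x) E).
  apply: (le_trans (ler_norm_sum _ _ _)); apply: ler_sum => p _.
  rewrite normrM [X in _ * X]ger0_norm//.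
  by apply: mulr_ge0; [exact: gs_ge0|exact: fejer_ge0].
rewrite eN.
have c0 : 0 <= cT R + cF R by rewrite addr_ge0 ?cT_ge0 ?cF_ge0.
apply: (@le_trans _ _ (knorm K * (cT R + cF R))); last by rewrite ler_wpM2r.
rewrite /knorm mulr_suml; apply: ler_sum => p _.
rewrite (RintegralZl `|p.1| measurableT (ig p.2)) -mulrA ler_wpM2l//.
apply: (le_trans (g_le _)); apply: ler_peMl => //; exact: expR_absz_ge1.
Qed.

Variable h : R.
Hypothesis h0 : 0 < h.

(* Limit for [M] to infinity of the one-dimensional kernel of [frame_kernel]. *)
Definition ker (K : seq (R * int)) (L : nat) (x y : R) : R :=
  let tau := (x - y) / (2 * h) in
  h^-1 * (fejer L tau * Qk K (y / h) * phik K tau * theta (x / h - tau)).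

Let hn : h != 0. Proof. by rewrite gt_eqF. Qed.

Let c0 : - (2 * h)^-1 != 0.
Proof. by rewrite oppr_eq0 invr_eq0 mulf_neq0. Qed.

(** The kernel in the variables [t = x / h] and [tau = (x - y) / (2 h)], in which [y / h] becomes
    [t - 2 tau]. *)
Definition kerg K L (t x : R) :=
  fejer L x * Qk K (t - 2 * x) * phik K x * theta (t - x).

Lemma kerE K L x y :
  ker K L x y = h^-1 * kerg K L (x / h) (- (2 * h)^-1 * y + x / (2 * h)).
Proof.
have -> : - (2 * h)^-1 * y + x / (2 * h) = (x - y) / (2 * h) by ring.
rewrite /kerg; have -> : x / h - 2 * ((x - y) / (2 * h)) = y / h by field.
by rewrite /ker.
Qed.

(** The Jacobian [2 h] against the prefactor [h^-1] leaves the factor 2 of each dimension. *)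
Lemma ker_integral (g : R -> R) (x : R) : integ g ->
  integ (fun y => h^-1 * g (- (2 * h)^-1 * y + x / (2 * h))) /\
  \int[leb]_y (h^-1 * g (- (2 * h)^-1 * y + x / (2 * h))) = 2 * \int[leb]_t g t.
Proof.
move=> ig; have [i1 e1] := Rint_affine (x / (2 * h)) c0 ig.
split; first exact: integZ.
rewrite (RintegralZl h^-1 measurableT i1) e1 normrN normfV gtr0_norm ?mulr_gt0//.
by rewrite mulrA; congr (_ * _); field.
Qed.

Definition cK : R := 2 + 2 * cA + 18 * (cF R * cA) + 2 * (9 * cT R * (9 * (cT R + cF R))).

Lemma cA_ge0 : 0 <= cA.
Proof. by rewrite /cA !mulr_ge0 ?expR_ge0. Qed.

Lemma cK_ge : [/\ 2 + 2 * cA <= cK, 18 * (cF R * cA) <= cK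
  & 2 * (9 * cT R * (9 * (cT R + cF R))) <= cK].
Proof.
have a0 := cA_ge0; have f0 := cF_ge0 R; have t0 := cT_ge0 R.
have p1 : 0 <= cF R * cA by rewrite mulr_ge0.
have p2 : 0 <= cT R * (cT R + cF R) by rewrite mulr_ge0// addr_ge0.
by rewrite /cK; split; lra.
Qed.

Lemma ker_norm_le K L x : knorm K <= 9 -> (0 < L)%N ->
  integ (ker K L x) /\ \int[leb]_y `|ker K L x y| <= cK.
Proof.
move=> K9 L0.
have [ip ep] := phik_norm_le K9 L0.
have cQ : continuous (fun t : R => Qk K (x / h - 2 * t)).
  exact: lipb_continuous (lipb_Qk _ K9).
have cth : continuous (fun t : R => theta (x / h - t)).
  exact: lipb_continuous (lipb_theta_refl _).
pose b t := Qk K (x / h - 2 * t) * theta (x / h - t).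
have gb t : kerg K L (x / h) t = b t * (phik K t * fejer L t).
  by rewrite /kerg /b; ring.
have b_le t : `|b t| <= 9 * cT R.
  by rewrite normrM ler_pM// ?Qk_bound// theta_bound.
have mb : measurable_fun [set: RT] b.
  by apply: measurable_funM; exact: continuous_measurable_fun.
have g_le t : `|kerg K L (x / h) t| <= 9 * cT R * `|phik K t * fejer L t|.
  by rewrite gb normrM ler_wpM2r.
have mg : measurable_fun [set: RT] (kerg K L (x / h)).
  rewrite (funext gb); apply: measurable_funM => //; exact: integ_mfun ip.
have ign := integZ (9 * cT R) (integ_norm ip).
have ig : integ (kerg K L (x / h)) := integ_dom mg ign g_le.
have [i1 _] := ker_integral x ig.
have [_ e2] := ker_integral x (integ_norm ig).
rewrite (funext (kerE K L x)); split => //.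
have -> : \int[leb]_y `|h^-1 * kerg K L (x / h) (- (2 * h)^-1 * y + x / (2 * h))| =
    2 * \int[leb]_t `|kerg K L (x / h) t|.
  rewrite -e2; apply: eq_Rintegral => y _; rewrite normrM ger0_norm//.
  by rewrite invr_ge0 ltW.
have [_ _ c3] := cK_ge; apply: le_trans c3; rewrite ler_pM2l//.
apply: (@le_trans _ _ (\int[leb]_t (9 * cT R * `|phik K t * fejer L t|))).
  by apply: le_Rintegral => //; exact: integ_norm.
rewrite (RintegralZl _ measurableT (integ_norm ip)) ler_wpM2l//.
by rewrite mulr_ge0// cT_ge0.
Qed.

(** In the variable [tau] all factors except [phik] and the Fejer kernel form a Lipschitz amplitude;
    [fejer_phik] evaluates it at [tau = 0], where [Qk_theta] leaves [f x]. *)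
Lemma ker_approx K L x f eta B B1 : good_inverse K eta -> (0 < L)%N ->
  (forall y, `|f y| <= B) -> (forall y z, `|f y - f z| <= B1 * `|y - z|) ->
  `|\int[leb]_y (ker K L x y * f y) - 2 * f x| <=
    cK * (B + 2 * h * B1) * (eta + (Num.sqrt L%:R)^-1).
Proof.
move=> gK L0 fB fL; have [K9 _ _] := gK.
have B0 : 0 <= B by exact: le_trans (normr_ge0 _) (fB 0).
have B10 : 0 <= B1.
  by have := le_trans (normr_ge0 _) (fL 1 0); rewrite subr0 normr1 mulr1.
set BB := B + 2 * h * B1.
have BB0 : 0 <= BB by rewrite addr_ge0// !mulr_ge0// ltW.
have BBB : B <= BB by rewrite lerDl !mulr_ge0// ltW.
pose A t := Qk K (x / h - 2 * t) * theta (x / h - t) * f (x - 2 * h * t).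
have lf : lipb (fun t => f (x - 2 * h * t)) BB.
  split=> [t|t s _]; first exact: le_trans (fB _) BBB.
  apply: (le_trans (fL _ _)).
  have -> : x - 2 * h * t - (x - 2 * h * s) = - (2 * h * (t - s)) by ring.
  rewrite normrN normrM (ger0_norm _) ?mulr_ge0 ?(ltW h0)// mulrA ler_wpM2r//.
  by rewrite /BB mulrC lerDr.
have lA : lipb A (cA * BB).
  have := lipbM (lipbM (lipb_Qk (x / h) K9) (lipb_theta_refl (x / h))) lf.
  rewrite (_ : cA * BB = 2 * (2 * (144 * (8 * expR 2 * (4 * expR 1))) * BB)); first exact.
  by rewrite /cA; ring.
have [ig eg] := fejer_phik gK lA L0.
have [_ e2] := ker_integral x ig.
have -> : \int[leb]_y (ker K L x y * f y) =
    2 * \int[leb]_t (A t * phik K t * fejer L t).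
  rewrite -e2; apply: eq_Rintegral => y _; rewrite kerE /A /kerg.
  have -> : x - 2 * h * (- (2 * h)^-1 * y + x / (2 * h)) = y by field.
  by ring.
have q := Qk_theta (x / h) gK.
have eta0 : 0 <= eta by exact: le_trans (normr_ge0 _) q.
have A0 : `|A 0 - f x| <= eta * BB.
  have -> : A 0 - f x = (Qk K (x / h) * theta (x / h) - 1) * f x.
    by rewrite /A !mulr0 !subr0; ring.
  by rewrite normrM ler_pM// (le_trans (fB _)).
set I := \int[leb]_t _ in eg *; set r := (Num.sqrt L%:R)^-1 in eg *.
have r0 : 0 <= r by rewrite invr_ge0 sqrtr_ge0.
have -> : 2 * I - 2 * f x = 2 * ((I - A 0) + (A 0 - f x)) by ring.
rewrite normrM ger0_norm//.
have tri := ler_normD (I - A 0) (A 0 - f x).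
have [k1 k2 _] := cK_ge.
have p1 : (2 + 2 * cA) * (BB * eta) <= cK * (BB * eta) by rewrite ler_wpM2r// mulr_ge0.
have p2 : 18 * (cF R * cA) * (BB * r) <= cK * (BB * r) by rewrite ler_wpM2r// mulr_ge0.
lra.
Qed.

Lemma good_inverse_exists eta : 0 < eta -> exists K, good_inverse K eta.
Proof. exact: approximate_inverse. Qed.
End Kernel.

(** * Tensor powers of the one-dimensional kernel *)

Section Tensor_kernel.
Variable R : realType.
Local Notation leb := (@lebesgue_measure R).
Local Notation RT := (measurableTypeR R).

Lemma mfun_rowc d t (f : 'rV[R]_d.+1 -> R) : mfun f -> mfun (fun y => f (rowc t y)).
Proof.
move=> mf; apply/measurable_EFinP.
by apply: (@measurable_slice R d (EFin \o f) t); exact/measurable_EFinP.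
Qed.

(** Lipschitz in each coordinate separately: the form that slices inherit and that bounded
    directional derivatives deliver. *)
Definition lipc d (u : 'rV[R]_d -> R) (B : R) :=
  forall (x y : 'rV[R]_d) i, (forall j, j != i -> x 0 j = y 0 j) ->
    `|u x - u y| <= B * `|x 0 i - y 0 i|.

Lemma lipc_rowc d t (u : 'rV[R]_d.+1 -> R) B : lipc u B -> lipc (fun y => u (rowc t y)) B.
Proof.
move=> lu x y i xy; have := lu (rowc t x) (rowc t y) (lift ord0 i).
rewrite !rowcS; apply => j; case: (unliftP ord0 j) => [l|] -> ji; rewrite ?rowc0//.
by rewrite !rowcS xy//; apply: contra ji => /eqP ->.
Qed.

Lemma lipc_rowc0 d y (u : 'rV[R]_d.+1 -> R) B s t : lipc u B ->
  `|u (rowc t y) - u (rowc s y)| <= B * `|t - s|.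
Proof.
move=> lu; have := lu (rowc t y) (rowc s y) ord0.
rewrite !rowc0; apply => j; case: (unliftP ord0 j) => [l|] ->; rewrite ?eqxx//.
by rewrite !rowcS.
Qed.

Lemma lip_continuous (f : R -> R) B : (forall x y, `|f x - f y| <= B * `|x - y|) ->
  continuous f.
Proof.
move=> fL; have B0 : 0 <= B.
  by have := le_trans (normr_ge0 _) (fL 1 0); rewrite subr0 normr1 mulr1.
move=> x; apply/cvgrPdist_le => e e0; near=> y.
apply: (le_trans (fL _ _)).
have : `|x - y| <= e / (B + 1).
  by near: y; apply: cvgr_dist_le => //; apply: divr_gt0 => //; lra.
rewrite ler_pdivlMr; last by lra.
have := normr_ge0 (x - y); nra.
Unshelve. all: by end_near. Qed.

Variables (h eta : R) (K : seq (R * int)) (L : nat).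
Hypotheses (h0 : 0 < h) (gK : good_inverse K eta) (L0 : (0 < L)%N).

Fixpoint cKd (d : nat) : R := if d is d'.+1 then cK R * cKd d' + 2 ^+ d' * cK R else 0.

Lemma cK_ge0 : 0 <= cK R.
Proof. by have [h1 _ _] := cK_ge R; have := cA_ge0 R; lra. Qed.

Lemma cKd_ge0 d : 0 <= cKd d.
Proof.
elim: d => [//|d IH] /=; have k0 := cK_ge0.
by rewrite addr_ge0 ?mulr_ge0// exprn_ge0.
Qed.

Lemma intg_ker d (x : 'rV[R]_d) : intg (fun y : 'rV[R]_d => \prod_i ker h K L (x 0 i) (y 0 i)).
Proof.
have [K9 _ _] := gK.
by have [] := Int_prod (f := fun i => ker h K L (x 0 i))
  (fun i => (ker_norm_le h0 (x 0 i) K9 L0).1).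
Qed.

Lemma intg_bounded_mul d (f g : 'rV[R]_d -> R) B : mfun f -> (forall x, `|f x| <= B) -> intg g ->
  intg (fun x => f x * g x).
Proof.
move=> mf fB ig; apply: (@intg_dom _ _ _ (fun x => B * `|g x|)).
- by apply: mfunM => //; exact: intg_mfun.
- exact: intgZ (intg_norm ig).
by move=> x; rewrite normrM ler_wpM2r.
Qed.

Lemma tensor_ker_approx d (u : 'rV[R]_d -> R) (B B1 : R) (x : 'rV[R]_d) :
  mfun u -> (forall y, `|u y| <= B) -> lipc u B1 -> 0 <= B1 ->
  `|Int (fun y => u y * \prod_i ker h K L (x 0 i) (y 0 i)) - 2 ^+ d * u x| <=
   cKd d * ((B + 2 * h * B1) * (eta + (Num.sqrt L%:R)^-1)).
Proof.
have [K9 _ _] := gK.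
set E := _ * (eta + _).
elim: d u x => [|d IH] u x mu uB lu B10.
  rewrite Int_dim0; last by apply: mfunM => //; exact: intg_mfun (intg_ker x).
  by rewrite big_ord0 mulr1 expr0 mul1r [x]row0E subrr normr0 mul0r.
set F := fun y => _.
have iF : intg F by apply: intg_bounded_mul (intg_ker x).
pose x' := rtail x.
pose G t := fun y : 'rV[R]_d => u (rowc t y) * \prod_i ker h K L (x' 0 i) (y 0 i).
have iG t : intg (G t).
  by apply: intg_bounded_mul (intg_ker x') => //; exact: mfun_rowc.
have FE t y : F (rowc t y) = ker h K L (x 0 ord0) t * G t y.
  rewrite /F /G big_ord_recl rowc0.
  rewrite (eq_bigr (fun i => ker h K L (x' 0 i) (y 0 i))); last first.
    by move=> i _; rewrite rowcS /x' mxE.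
  by ring.
have iFt t : intg (fun y => F (rowc t y)).
  by apply: (intg_eq (fun y => esym (FE t y))); exact: intgZ.
have [i1 ->] := Int_rowc iF iFt.
have FI t : Int (fun y => F (rowc t y)) = ker h K L (x 0 ord0) t * Int (G t).
  by rewrite (Int_eq (FE t)) IntZ.
have [ik nk] := ker_norm_le h0 (x 0 ord0) K9 L0.
have uL s t : `|u (rowc s x') - u (rowc t x')| <= B1 * `|s - t| by exact: lipc_rowc0.
have ap := @ker_approx R h h0 K L (x 0 ord0) (fun t => u (rowc t x')) eta B B1 gK L0
  (fun t => uB _) uL.
have ig t : `|Int (G t) - 2 ^+ d * u (rowc t x')| <= cKd d * E.
  by apply: IH => //; [exact: mfun_rowc|exact: lipc_rowc].
have mu1 : measurable_fun [set: RT] (fun t => u (rowc t x')).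
  by apply: continuous_measurable_fun; exact: lip_continuous uL.
have i2 : integ (fun t => ker h K L (x 0 ord0) t * u (rowc t x')).
  apply: (@integ_dom _ _ (fun t => B * `|ker h K L (x 0 ord0) t|)).
  - apply: measurable_funM => //; exact: integ_mfun ik.
  - exact: integZ (integ_norm ik).
  by move=> t; rewrite normrM mulrC ler_wpM2r.
have i1' : integ (fun t => ker h K L (x 0 ord0) t * Int (G t)).
  by move: i1; rewrite (funext FI).
have [k0 kd0] := (cK_ge0, cKd_ge0 d).
have r0 : 0 <= (Num.sqrt L%:R : R)^-1 by rewrite invr_ge0 sqrtr_ge0.
have e0 : 0 <= cKd d * E by exact: le_trans (normr_ge0 _) (ig 0).
rewrite (_ : \int[leb]_t _ = \int[leb]_t (ker h K L (x 0 ord0) t * Int (G t))); last first.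
  by apply: eq_Rintegral => t _.
rewrite -/(x') in ap; rewrite -rowcE in ap.
set I1 := \int[leb]_t _; set I2 := \int[leb]_t _ in ap.
(* The inner integral is replaced by [2^d u] on the slice. The error is uniform in [t] and is
   integrated against the kernel of the first coordinate, whose [L^1] norm is at most [cK R]. *)
have d1 : `|I1 - 2 ^+ d * I2| <= cK R * (cKd d * E).
  have i3 := integZ (2 ^+ d) i2.
  rewrite -(RintegralZl _ measurableT i2) -(RintegralB measurableT i1' i3).
  apply: (@le_trans _ _ (\int[leb]_t ((cKd d * E) * `|ker h K L (x 0 ord0) t|))).
    apply: Rint_le_dom.
    - apply: measurable_funB; [exact: integ_mfun i1'|exact: integ_mfun i3].
    - exact: integZ (integ_norm ik).
    move=> t; rewrite mulrCA -mulrBr normrM mulrC.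
    by rewrite ler_wpM2r.
  by rewrite (RintegralZl _ measurableT (integ_norm ik)) mulrC ler_wpM2r.
have -> : I1 - 2 ^+ d.+1 * u x = (I1 - 2 ^+ d * I2) + 2 ^+ d * (I2 - 2 * u x).
  by rewrite exprS; ring.
apply: (le_trans (ler_normD _ _)).
have -> : cKd d.+1 * E = cK R * (cKd d * E) + 2 ^+ d * cK R * E by rewrite [cKd _]/=; ring.
rewrite lerD//.
rewrite normrM ger0_norm ?exprn_ge0// -mulrA ler_wpM2l ?exprn_ge0//.
by rewrite /E mulrA.
Qed.

End Tensor_kernel.

Local Open Scope complex_scope.

(** * Exhausting boxes of indices, unit complex numbers, Cesaro weights *)

Section Boxes.
Variable R : realType.
Local Notation C := R[i].

Definition zbox (d M : nat) : seq 'rV[int]_d :=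
  [seq \row_i zi (f i) | f : {ffun 'I_d -> 'I_(2 * M).+1}].

Lemma mem_zbox d M (m : 'rV[int]_d) :
  (m \in zbox d M) = [forall i, `|m 0 i| <= M%:Z].
Proof.
apply/mapP/forallP => [[f _ ->] i|h]; first by rewrite mxE zi_ub.
have h' i : exists j : 'I_(2 * M).+1, zi j == m 0 i.
  by have [j <-] := ziP (h i); exists j.
exists [ffun i => xchoose (h' i)]; first by rewrite mem_enum.
by apply/rowP => i; rewrite mxE ffunE (eqP (xchooseP (h' i))).
Qed.

Lemma uniq_zbox d M : uniq (zbox d M).
Proof.
rewrite map_inj_uniq ?enum_uniq// => f g /rowP fg; apply/ffunP => i.
by apply: (@zi_inj M); have := fg i; rewrite !mxE.
Qed.

Lemma zbox_prod (V : comNzRingType) d M (F : 'I_d -> int -> V) :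
  \sum_(m <- zbox d M) \prod_i F i (m 0 i) = \prod_i zsum M (F i).
Proof.
rewrite /zsum bigA_distr_bigA /= big_map big_enum /=.
by apply: eq_bigr => f _; apply: eq_bigr => i _; rewrite mxE.
Qed.

Definition boxs (d M : nat) : seq (gidx d) :=
  [seq (m, n) | m <- zbox d M, n <- zbox d M].

Lemma mem_boxs d M (j : gidx d) : (j \in boxs d M) = (j.1 \in zbox d M) && (j.2 \in zbox d M).
Proof.
apply/allpairsP/andP => [[[m n] [/= h1 h2 ->]]//|[h1 h2]].
by exists j; split => //; case: j {h1 h2}.
Qed.

Lemma uniq_boxs d M : uniq (boxs d M).
Proof. by apply: allpairs_uniq; rewrite ?uniq_zbox// => -[? ?] [? ?]. Qed.

Lemma boxs_sum (V : nmodType) d M (F : gidx d -> V) :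
  \sum_(j <- boxs d M) F j = \sum_(m <- zbox d M) \sum_(n <- zbox d M) F (m, n).
Proof. by rewrite big_allpairs. Qed.

Lemma boxs_prod (V : comNzRingType) d M (F : 'I_d -> int -> int -> V) :
  \sum_(j <- boxs d M) \prod_i F i (j.1 0 i) (j.2 0 i) =
  \prod_i zsum M (fun m => zsum M (F i m)).
Proof.
rewrite boxs_sum -zbox_prod; apply: eq_bigr => m _.
by rewrite (zbox_prod M (fun i => F i (m 0 i))).
Qed.

Lemma zbox_mono d M N : (M <= N)%N -> {subset zbox d M <= zbox d N}.
Proof.
move=> MN m; rewrite !mem_zbox => /forallP h; apply/forallP => i.
by apply: le_trans (h i) _; rewrite lez_nat.
Qed.

Lemma boxs_mono d M N : (M <= N)%N -> {subset boxs d M <= boxs d N}.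
Proof.
by move=> MN j; rewrite !mem_boxs => /andP[/(zbox_mono MN) -> /(zbox_mono MN) ->].
Qed.

Lemma boxs_exhaust d (s : seq (gidx d)) : exists M, {subset s <= boxs d M}.
Proof.
elim: s => [|j s [M IH]]; first by exists 0%N.
pose N := (M + \sum_i `|j.1 0%R i| + \sum_i `|j.2 0%R i|)%N.
have MN : (M <= N)%N by rewrite /N; lia.
exists N => x; rewrite inE => /orP[/eqP ->|/IH]; last exact: boxs_mono.
rewrite mem_boxs !mem_zbox; apply/andP; split; apply/forallP => i.
  have : (`|j.1 0%R i| <= \sum_i `|j.1 0%R i|)%N by rewrite (bigD1 i)//= leq_addr.
  rewrite /N; lia.
have : (`|j.2 0%R i| <= \sum_i `|j.2 0%R i|)%N by rewrite (bigD1 i)//= leq_addr.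
rewrite /N; lia.
Qed.

Lemma fsum_box (V : nmodType) d M (F : gidx d -> V) :
  \sum_(j \in box M) F j = \sum_(j <- boxs d M) F j.
Proof.
rewrite (fsbig_seq _ _ (uniq_boxs d M)); suff -> : box M = [set` boxs d M] by [].
apply/seteqP; split=> j /=; rewrite mem_boxs !mem_zbox.
  by move=> h; apply/andP; split; apply/forallP => i; have [] := h i.
by move=> /andP[/forallP h1 /forallP h2] i.
Qed.

(** A finite family whose sum is within [e] of the supremum of all finite sums lies in some box;
    whatever is added outside that box cannot exceed [e]. *)
Lemma sumle_tail d (f : gidx d -> R) B e : (forall j, 0 <= f j) -> sumle f B -> 0 < e ->
  exists M, forall s : seq (gidx d), uniq s -> (forall j, j \in s -> j \notin boxs d M) ->
    \sum_(j <- s) f j <= e.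
Proof.
move=> f0 fB e0.
pose S := [set x : R | exists2 s : seq (gidx d), uniq s & x = \sum_(j <- s) f j].
have hS : has_sup S.
  split; first by exists 0; exists [::]; rewrite ?big_nil.
  by exists B => _ [s us ->]; exact: fB.
have [_ [s0 us0 ->] h0] := sup_adherent e0 hS.
have [M hM] := boxs_exhaust s0; exists M => s us sM.
have u : uniq (s ++ boxs d M).
  rewrite cat_uniq us uniq_boxs andbT /=; apply/hasPn => j jM.
  by apply/negP => /sM; rewrite jM.
have h1 : \sum_(j <- s ++ boxs d M) f j <= sup S.
  by apply: sup_upper_bound => //; exists (s ++ boxs d M).
have h2 := sum_sub_le f0 us0 hM.
by rewrite big_cat /= in h1; lra.
Qed.

Definition cis (t : R) : C := cos t +i* sin t.

Lemma cisD s t : cis (s + t) = cis s * cis t.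
Proof. by rewrite /cis cosD sinD; simpc; congr (_ +i* _); rewrite addrC mulrC addrC. Qed.

Lemma cis0 : cis 0 = 1.
Proof. by rewrite /cis cos0 sin0. Qed.

Definition cj (z : C) : C := z^*.

Lemma cis_conj t : cj (cis t) = cis (- t).
Proof. by rewrite /cj /cis cosN sinN. Qed.

Lemma cis_2piz (z : int) : cis (2 * pi * z%:~R) = 1.
Proof. by rewrite /cis cos_2piz sin_2piz. Qed.

Lemma cis_sum (T : Type) (s : seq T) (t : T -> R) :
  cis (\sum_(i <- s) t i) = \prod_(i <- s) cis (t i).
Proof. exact: (big_morph cis cisD cis0). Qed.

Lemma scale_cis_sum (T : Type) (s : seq T) (a t : T -> R) :
  \sum_(i <- s) (a i)%:C * cis (t i) =
  (\sum_(i <- s) a i * cos (t i)) +i* (\sum_(i <- s) a i * sin (t i)).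
Proof.
elim: s => [|x s IH]; first by rewrite !big_nil.
by rewrite !big_cons IH /cis; simpc.
Qed.

Lemma zsum_cis M (a : int -> R) (t : R) : (forall n, a (- n) = a n) ->
  zsum M (fun n => (a n)%:C * cis (2 * pi * n%:~R * t)) = (zsum M (fun n => a n * cosz t n))%:C.
Proof.
move=> ev; rewrite /zsum scale_cis_sum; congr (_ +i* _).
set S := \sum_(i <- _) _.
have : S = - S; last lra.
rewrite {1}/S -/(zsum M (fun n => a n * sin (2 * pi * n%:~R * t))).
rewrite -(zsum_opp M (fun n => a n * sin (2 * pi * n%:~R * t))) /S -sumrN.
by apply: eq_bigr => i _; rewrite ev rmorphN /= mulrN mulNr sinN mulrN.
Qed.

Lemma ksum_cis K eta t : good_inverse K eta ->
  \sum_(q <- K) (q.1)%:C * cis (- (2 * pi * q.2%:~R * t)) = (Qk K t)%:C.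
Proof.
move=> [_ ev _]; rewrite scale_cis_sum; congr (_ +i* _).
  by apply: eq_bigr => q _; rewrite cosN.
have E := ev (fun b => sin (2 * pi * b%:~R * t)).
set S := \sum_(i <- _) _.
have S1 : S = - ksum K (fun b => sin (2 * pi * b%:~R * t) : R^o).
  by rewrite /S /ksum -sumrN; apply: eq_bigr => q _; rewrite sinN mulrN.
have S2 : S = ksum K (fun b => sin (2 * pi * (- b)%:~R * t) : R^o).
  by apply: eq_bigr => q _; rewrite rmorphN /= mulrN mulNr.
by move: S2; rewrite E => S2; lra.
Qed.

(** For [L > 0] this is the Fejer weight [max(0, 1 - |n| / L)], written as an average so that
    exchanging sums gives [fejer]. *)
Definition ces (L : nat) (n : int) : R := L%:R^-1 * \sum_(j < L) (`|n| <= j)%N%:R.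

Lemma cesN L n : ces L (- n) = ces L n.
Proof. by rewrite /ces abszN. Qed.

Lemma ces_bound L n : 0 <= ces L n <= 1.
Proof.
rewrite /ces mulr_ge0 ?invr_ge0 ?sumr_ge0//=.
have [->|L0] := posnP L; first by rewrite big_ord0 mulr0.
rewrite ler_pdivrMl ?ltr0n// mulr1.
apply: (@le_trans _ _ (\sum_(j < L) 1)); last by rewrite sumr_const card_ord.
by apply: ler_sum => j _; rewrite lern1 leq_b1.
Qed.

Lemma ces_cvg n : (fun L => ces L n) @ \oo --> (1 : R).
Proof.
have B L : (0 < L)%N -> `|1 - ces L n| <= `|n|%:R * L%:R^-1.
  move=> L0; have /andP[_ c1] := ces_bound L n; rewrite ger0_norm ?subr_ge0//.
  have {1}-> : 1 = L%:R^-1 * L%:R :> R by rewrite mulVf// pnatr_eq0 -lt0n.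
  rewrite /ces -mulrBr mulrC ler_wpM2r ?invr_ge0//.
  rewrite lerBlDl -natr_sum -natrD ler_nat.
  have -> : (\sum_(j < L) (`|n| <= j)%N)%N = (L - `|n|)%N.
    elim: {L0 c1}L => [|L IH]; first by rewrite big_ord0.
    by rewrite big_ord_recr /= IH; lia.
  by lia.
apply/cvgrPdist_le => e e0.
have [N hN] : exists N : nat, `|n|%:R / e <= N%:R.
  by exists (Num.truncn (`|n|%:R / e)).+1; rewrite ltW// truncnS_gt.
near=> L.
have L0 : (0 < L)%N by near: L; exact: nbhs_infty_gt.
have LN : (N <= L)%N by near: L; exact: nbhs_infty_ge.
apply: (le_trans (B L L0)); rewrite ler_pdivrMr ?ltr0n//.
move: hN; rewrite ler_pdivrMr// => hN; apply: (le_trans hN).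
by rewrite mulrC ler_pM2l// ler_nat.
Unshelve. all: by end_near. Qed.

Lemma zsum_restrict j M (f : int -> R) : (j <= M)%N ->
  zsum M (fun n => (`|n| <= j)%N%:R * f n) = zsum j f.
Proof.
elim: M => [|M IH]; first by rewrite leqn0 => /eqP ->; rewrite !zsum0 mul1r.
rewrite leq_eqVlt => /orP[/eqP ->|jM].
  apply: eq_bigr => i _; have h : (`|zi i| <= M.+1)%N by have := zi_ub i; lia.
  by rewrite h mul1r.
rewrite zsumS IH//.
have -> : (`|(- M.+1%:Z)%R| <= j)%N = false by lia.
by rewrite !mul0r add0r addr0.
Qed.

Lemma zsum_ces L M t : (L <= M)%N -> zsum M (fun n => ces L n * cosz t n) = fejer L t.
Proof.
move=> LM.
transitivity (L%:R^-1 * \sum_(j < L) zsum M (fun n => (`|n| <= j)%N%:R * cosz t n)).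
  rewrite /zsum exchange_big mulr_sumr; apply: eq_bigr => i _.
  by rewrite /ces -mulrA mulr_suml.
rewrite /fejer; congr (_ * _); apply: eq_bigr => j _; apply: zsum_restrict.
by have := ltn_ord j; lia.
Qed.

End Boxes.

(** * Explicit kernel of the combined frame sum *)

Section Frame_kernel.
Variable R : realType.
Local Notation C := R[i].
Local Notation RT := (measurableTypeR R).

Definition gh (s : R) : R := expR (- (pi / 2 * s ^+ 2)).

Lemma gh_ge0 s : 0 <= gh s. Proof. exact: expR_ge0. Qed.

Lemma continuous_gh : continuous gh.
Proof.
apply: (@is_derive_continuous _ _ (fun t => gh t * (2 * (- (pi / 2)) * t))) => t.
have := @is_derive_comp1 R expR (fun t => - (pi / 2) * t ^+ 2) t _ _
  (is_derive_expR _) (is_derive_sqr (- (pi / 2)) t).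
rewrite (_ : (fun x => expR (- (pi / 2) * x ^+ 2)) = gh); last first.
  by apply/funext => x; rewrite /gh mulNr.
by move=> H; apply: (is_derive_eq H); rewrite /gh mulNr.
Qed.

(** The parallelogram identity; it separates the difference of the two points from the position
    index [m]. *)
Lemma gh_mul a b m : gh (a - m) * gh (b - m) = gs ((a - b) / 2) * gs (m - (a + b) / 2).
Proof.
rewrite /gh /gs -!expRD; congr expR; by field.
Qed.

Lemma RCM (a b : R) : (a * b)%:C = a%:C * b%:C :> C.
Proof. by simpc. Qed.

Lemma RC_sum (T : Type) (s : seq T) (F : T -> R) :
  (\sum_(i <- s) F i)%:C = \sum_(i <- s) (F i)%:C :> C.
Proof. exact: (rmorph_sum (@real_complex R)). Qed.

Lemma conjM (z w : C) : cj (z * w) = cj z * cj w.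
Proof. exact: (rmorphM (@conjc R)). Qed.

Lemma conj_real (a : R) : cj a%:C = a%:C.
Proof. by rewrite /cj /conjc /= oppr0. Qed.

Lemma conj_sum_seq (T : Type) (s : seq T) (F : T -> C) :
  cj (\sum_(i <- s) F i) = \sum_(i <- s) cj (F i).
Proof. exact: (rmorph_sum (@conjc R)). Qed.

Lemma conj_prod (T : finType) (F : T -> C) : cj (\prod_i F i) = \prod_i cj (F i).
Proof. exact: (rmorph_prod (@conjc R)). Qed.

Definition psi1 (m n : int) (t : R) : C :=
  (gh (t - m%:~R))%:C * cis (pi * n%:~R * (t - m%:~R)).

(** The cross terms of the phase amount to [2 pi (n a + b m + 2 a b)], which is trivial because the
    shifts are even. Hence [n] only meets [t - t'], [b] only meets [t'], and the sums separate. *)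
Lemma psi1_pair (m n a b : int) t t' :
  psi1 m n t * cj (psi1 (m + 2 * a) (n + 2 * b) t') =
  (gh (t - m%:~R) * gh (t' - m%:~R - 2 * a%:~R))%:C *
    (cis (2 * pi * n%:~R * ((t - t') / 2)) * cis (- (2 * pi * b%:~R * t'))).
Proof.
have E : cis (pi * n%:~R * (t - m%:~R)) * cis (- (pi * (n + 2 * b)%:~R * (t' - (m + 2 * a)%:~R))) =
  cis (2 * pi * n%:~R * ((t - t') / 2)) * cis (- (2 * pi * b%:~R * t')).
  rewrite -!cisD -[RHS]mulr1 -(cis_2piz R (n * a + b * m + 2 * (a * b))) -cisD; congr cis.
  by rewrite !(intrD, intrM); field.
rewrite /psi1 conjM cis_conj conj_real -E rmorphM.
have -> : gh (t' - (m + 2 * a)%:~R) = gh (t' - m%:~R - 2 * a%:~R).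
  by congr gh; rewrite intrD intrM; ring.
by rewrite -!mulrA; congr (_ * _); rewrite mulrCA.
Qed.

Definition kpsi1 (K : seq (R * int)) m n t : C :=
  \sum_(p <- K) \sum_(q <- K) (p.1 * q.1)%:C * psi1 (m + 2 * p.2) (n + 2 * q.2) t.

Definition kerU K (t t' : R) (m : int) : R :=
  gh (t - m%:~R) * ksum K (fun a => gh (t' - m%:~R - 2 * a%:~R) : R^o).

Definition kerM M L K (t t' : R) : R :=
  zsum M (fun n => ces R L n * cosz ((t - t') / 2) n) * Qk K t' * zsum M (kerU K t t').

Lemma kpsi1_pair K eta m n t t' : good_inverse K eta ->
  psi1 m n t * cj (kpsi1 K m n t') =
  (kerU K t t' m)%:C * (cis (2 * pi * n%:~R * ((t - t') / 2)) * (Qk K t')%:C).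
Proof.
move=> gK; rewrite -(ksum_cis t' gK) /kpsi1 conj_sum_seq.
have -> : (kerU K t t' m)%:C = \sum_(p <- K)
    (gh (t - m%:~R) * (p.1 * gh (t' - m%:~R - 2 * p.2%:~R)))%:C :> C.
  by rewrite -RC_sum /kerU /ksum; congr _%:C; exact: mulr_sumr.
rewrite [RHS]mulr_suml [LHS]mulr_sumr; apply: eq_bigr => p _.
rewrite conj_sum_seq !mulr_sumr; apply: eq_bigr => q _.
rewrite conjM conj_real mulrCA psi1_pair !RCM.
ring.
Qed.

Lemma kernel1 M L K eta t t' : good_inverse K eta ->
  zsum M (fun m => zsum M (fun n => (ces R L n)%:C * (psi1 m n t * cj (kpsi1 K m n t')))) =
  (kerM M L K t t')%:C.
Proof.
move=> gK; rewrite /kerM !RCM -(zsum_cis M ((t - t') / 2) (@cesN R L)).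
set Z := zsum M (fun n => _ * cis _).
rewrite -mulrA mulrCA.
have -> : (zsum M (kerU K t t'))%:C = zsum M (fun m => (kerU K t t' m)%:C).
  exact: rmorph_sum.
rewrite mulrC [X in X * _]mulrC; rewrite {3}/zsum mulr_suml mulr_suml; apply: eq_bigr => m _.
rewrite /Z /zsum mulr_sumr mulr_suml; apply: eq_bigr => n _.
by rewrite (kpsi1_pair _ _ _ _ gK); ring.
Qed.

Lemma kerU_sum_le M K t t' : knorm K <= 9 -> `|zsum M (kerU K t t')| <= 9 * cT R.
Proof.
move=> K9; have E : zsum M (kerU K t t') = ksum K (fun a => zsum M (fun m =>
    gh (t - m%:~R) * gh (t' - m%:~R - 2 * a%:~R)) : R^o).
  rewrite /zsum /kerU /ksum; under eq_bigr do rewrite mulr_sumr.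
  rewrite exchange_big; apply: eq_bigr => p _; rewrite scaler_sumr.
  by apply: eq_bigr => m _; rewrite /GRing.scale /=; ring.
rewrite E; apply: (@le_trans _ _ (knorm K * cT R)); last by rewrite ler_wpM2r ?cT_ge0.
apply: ksum_le => a; rewrite ger0_norm; last first.
  by rewrite /zsum sumr_ge0// => i _; rewrite mulr_ge0 ?gh_ge0.
apply: le_trans (sumle_zsum (sumle_gs ((t + (t' - 2 * a%:~R)) / 2)) M).
apply: zsum_le => m.
have -> : t' - m%:~R - 2 * a%:~R = t' - 2 * a%:~R - m%:~R by ring.
by rewrite gh_mul ler_piMl ?gs_ge0// gs_le1.
Qed.

(** After [gh_mul] the sum over positions is a theta series at a point displaced by the shift; the
    period 1 of [theta] removes the displacement, so [theta] factors out of the sum over [K]. *)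
Lemma kerU_cvg K t t' :
  (fun M => zsum M (kerU K t t')) @ \oo --> phik K ((t - t') / 2) * theta (t - (t - t') / 2).
Proof.
pose F (p : R * int) M := p.1 * (gs ((t - t') / 2 + p.2%:~R) *
   zsum M (fun m => gs (m%:~R - (t - (t - t') / 2 - p.2%:~R)))).
have -> : (fun M => zsum M (kerU K t t')) = (fun M => \sum_(p <- K) F p M).
  apply/funext => M; rewrite /F /zsum /kerU /ksum.
  under eq_bigr do rewrite mulr_sumr.
  rewrite exchange_big; apply: eq_bigr => p _; rewrite !mulr_sumr.
  apply: eq_bigr => m _; rewrite /GRing.scale /= mulrCA.
  have -> : t' - (zi m)%:~R - 2 * p.2%:~R = t' - 2 * p.2%:~R - (zi m)%:~R by ring.
  rewrite gh_mul; congr (_ * (gs _ * gs _)); by field.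
have -> : phik K ((t - t') / 2) * theta (t - (t - t') / 2) = \sum_(p <- K) p.1 *
    (gs ((t - t') / 2 + p.2%:~R) * theta (t - (t - t') / 2)).
  by rewrite /phik /ksum mulr_suml; apply: eq_bigr => p _; rewrite mulrA.
apply: cvg_sumr => p.
rewrite /F; apply: cvgM; first exact: cvg_cst.
apply: cvgM; first exact: cvg_cst.
rewrite -[theta (t - _)](theta_shift _ (- p.2)) rmorphN /=.
exact: theta_cvg.
Qed.

Lemma kerM_bound M L K t t' : knorm K <= 9 -> (L <= M)%N ->
  `|kerM M L K t t'| <= (2 * L).+1%:R * 9 * (9 * cT R).
Proof.
move=> K9 LM; rewrite /kerM zsum_ces// normrM ler_pM ?kerU_sum_le//.
by rewrite normrM ler_pM ?Qk_bound// fejer_bound.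
Qed.

(** The window [M + L] contains the support of the Cesaro weights, so the frequency sum is already
    the full Fejer kernel. *)
Lemma kerM_cvg L K t t' : (fun M => kerM (M + L) L K t t') @ \oo -->
  fejer L ((t - t') / 2) * Qk K t' * phik K ((t - t') / 2) * theta (t - (t - t') / 2).
Proof.
rewrite -mulrA; under eq_fun do rewrite /kerM zsum_ces ?leq_addl//.
apply: cvgM; first exact: cvg_cst.
by have := @kerU_cvg K t t'; rewrite -(cvg_shiftn L).
Qed.

Lemma continuous_kerM M L K t : continuous (kerM M L K t).
Proof.
apply: continuous_mulr; first apply: continuous_mulr.
- apply: continuous_sumr => i; apply: continuous_mulr; first exact: cst_continuous.
  have := @continuous_cosM R (- (pi * (zi i)%:~R)) (pi * (zi i)%:~R * t).
  rewrite (_ : (fun x => cos (- (pi * (zi i)%:~R) * x + pi * (zi i)%:~R * t)) =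
    (fun x => cosz ((t - x) / 2) (zi i)))//.
  by apply/funext => x; rewrite /cosz; congr cos; field.
- apply: continuous_sumr => p; apply: continuous_mulr; first exact: cst_continuous.
  have := @continuous_cosM R (2 * pi * p.2%:~R) 0.
  rewrite (_ : (fun x => cos (2 * pi * p.2%:~R * x + 0)) =
    (fun x => cosz x p.2))//.
  by apply/funext => x; rewrite /cosz addr0.
apply: continuous_sumr => i; apply: continuous_mulr; first exact: cst_continuous.
apply: continuous_sumr => p; apply: continuous_mulr; first exact: cst_continuous.
move=> x; apply: (@continuous_comp R R R (fun x => x - (zi i)%:~R - 2 * p.2%:~R) gh x).
  by apply: cvgB; last exact: cvg_cst; apply: cvgB; [exact: cvg_id|exact: cvg_cst].
exact: continuous_gh.
Qed.

Definition nthK (K : seq (R * int)) (l : 'I_(size K)) : R * int := tnth (in_tuple K) l.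

(** Expanding a product over coordinates of double sums over [K] gives one term per choice of two
    entries in each coordinate. Entries are chosen by position, since [K] may contain
    repetitions. *)
Definition kidx d (K : seq (R * int)) := {ffun 'I_d -> 'I_(size K) * 'I_(size K)}.

Definition kc d (K : seq (R * int)) (f : kidx d K) : R :=
  \prod_i ((nthK (f i).1).1 * (nthK (f i).2).1).

Definition kshift d (K : seq (R * int)) (f : kidx d K) (j : gidx d) : gidx d :=
  (j.1 + \row_i (2 * (nthK (f i).1).2), j.2 + \row_i (2 * (nthK (f i).2).2)).

Lemma kidx_prod (V : comNzRingType) d K (F : 'I_d -> R * int -> R * int -> V) :
  \prod_i (\sum_(p <- K) \sum_(q <- K) F i p q) =
  \sum_(f : kidx d K) \prod_i F i (nthK (f i).1) (nthK (f i).2).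
Proof.
rewrite -(bigA_distr_bigA (fun i (z : 'I_(size K) * 'I_(size K)) => F i (nthK z.1) (nthK z.2))).
apply: eq_bigr => i _.
rewrite -(pair_big xpredT xpredT (fun a b => F i (nthK a) (nthK b))) /=.
by rewrite big_tnth; apply: eq_bigr => a _; rewrite big_tnth.
Qed.

Section d_dim.
Variables (d : nat) (k : R).
Hypothesis k0 : 0 < k.

Definition hk : R := Num.sqrt (pi / k).
Definition amp : R := powR (k / pi) (d%:R / 4).

Lemma hk_gt0 : 0 < hk.
Proof. by rewrite sqrtr_gt0 divr_gt0// pi_gt0. Qed.

Lemma hk_neq0 : hk != 0.
Proof. by rewrite gt_eqF// hk_gt0. Qed.

Lemma k_hk2 : k * hk ^+ 2 = pi.
Proof. by rewrite sqr_sqrtr ?divr_ge0 ?pi_ge0 ?ltW// mulrCA mulfV ?mulr1// gt_eqF. Qed.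

Lemma amp_ge0 : 0 <= amp. Proof. exact: powR_ge0. Qed.

(** The squared normalisation supplies the factor [h^-1] of the kernel in every coordinate. *)
Lemma amp2 : amp ^+ 2 = hk^-1 ^+ d.
Proof.
have kp : 0 < k / pi by rewrite divr_gt0// pi_gt0.
rewrite /amp -powR_mulrn ?powR_ge0// -powRrM.
have -> : d%:R / 4 * 2 = 2^-1 * d%:R :> R by field.
rewrite powRrM powR_mulrn ?powR_ge0// powR12_sqrt ?ltW//; congr (_ ^+ _).
by rewrite /hk -sqrtrV ?divr_ge0 ?pi_ge0 ?ltW// invf_div.
Qed.

Lemma Psi_prod (j : gidx d) x :
  Psi k j x = amp%:C * \prod_i psi1 (j.1 0 i) (j.2 0 i) (x 0 i / hk).
Proof.
rewrite /psi1 big_split /= -cis_sum -rmorph_prod /= mulrA -rmorphM /=.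
have gE : amp * \prod_i gh (x 0 i / hk - (j.1 0 i)%:~R) =
    powR (k / pi) (d%:R / 4) * expR (- (k / 2) * euc (x - xk k j.1) ^+ 2).
  congr (_ * _); rewrite /euc sqr_sqrtr; last by apply: sumr_ge0 => i _; exact: sqr_ge0.
  rewrite mulr_sumr expR_sum; apply: eq_bigr => i _; rewrite /gh; congr expR.
  rewrite !mxE -/hk -k_hk2; field; exact: hk_neq0.
have cE : \sum_i pi * (j.2 0 i)%:~R * (x 0 i / hk - (j.1 0 i)%:~R) =
    k * \sum_i ((x - xk k j.1) 0 i * xk k j.2 0 i).
  rewrite mulr_sumr; apply: eq_bigr => i _.
  rewrite !mxE -/hk -k_hk2; field; exact: hk_neq0.
by rewrite gE cE /Psi /cis; simpc.
Qed.

Definition kPsi K (j : gidx d) (x : 'rV[R]_d) : C :=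
  \sum_(f : kidx d K) (kc f)%:C * Psi k (kshift f j) x.

Lemma kPsi_prod K (j : gidx d) x :
  kPsi K j x = amp%:C * \prod_i kpsi1 K (j.1 0 i) (j.2 0 i) (x 0 i / hk).
Proof.
rewrite /kpsi1 kidx_prod mulr_sumr; apply: eq_bigr => f _.
rewrite big_split /= Psi_prod mulrCA; congr (_ * (_ * _)).
  by rewrite /kc rmorph_prod.
by apply: eq_bigr => i _; rewrite !mxE.
Qed.

Definition cesd L (j : gidx d) : R := \prod_i ces R L (j.2 0 i).

Lemma frame_kernel M L K eta x y : good_inverse K eta ->
  \sum_(j <- boxs d M) (cesd L j)%:C * (Psi k j x * cj (kPsi K j y)) =
  (\prod_i (hk^-1 * kerM M L K (x 0 i / hk) (y 0 i / hk)))%:C.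
Proof.
move=> gK; rewrite big_split /= prodr_const card_ord -amp2 rmorphM rmorph_prod /=.
rewrite -(eq_bigr _ (fun i _ => kernel1 M L (x 0 i / hk) (y 0 i / hk) gK)).
rewrite -(boxs_prod M (fun i m n => (ces R L n)%:C * (psi1 m n (x 0 i / hk) *
   cj (kpsi1 K m n (y 0 i / hk))))).
rewrite mulr_sumr; apply: eq_bigr => j _.
rewrite Psi_prod kPsi_prod conjM conj_real conj_prod /cesd rmorph_prod !big_split /=.
by rewrite expr2 rmorphM; ring.
Qed.

End d_dim.
End Frame_kernel.

(** * Bessel bounds and weak reconstruction *)

Section Bessel.
Variable R : realType.
Local Notation leb := (@lebesgue_measure R).
Local Notation RT := (measurableTypeR R).

Lemma weighted_Cauchy (T : Type) (s : seq T) (a b : T -> R) : (forall i, 0 <= a i) ->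
  (\sum_(i <- s) a i * b i) ^+ 2 <= (\sum_(i <- s) a i) * (\sum_(i <- s) a i * b i ^+ 2).
Proof.
move=> a0; set A := \sum_(i <- s) a i; set B := \sum_(i <- s) _ * _; set Q := \sum_(i <- s) _.
have q t : 0 <= Q - 2 * t * B + t ^+ 2 * A.
  have -> : Q - 2 * t * B + t ^+ 2 * A = \sum_(i <- s) a i * (b i - t) ^+ 2.
    rewrite /Q /B /A !mulr_sumr -sumrB -big_split; apply: eq_bigr => i _ /=; ring.
  by apply: sumr_ge0 => i _; rewrite mulr_ge0// sqr_ge0.
have A0 : 0 <= A by apply: sumr_ge0.
have [AE|An] := eqVneq A 0; last first.
  have := q (B / A); have Ap : 0 < A by rewrite lt_neqAle eq_sym An.
  rewrite -(ler_pM2l Ap) mulr0 => h.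
  have : A * (Q - 2 * (B / A) * B + (B / A) ^+ 2 * A) = A * Q - B ^+ 2 by field.
  by move=> e; rewrite e in h; lra.
have B1 := q ((Q + 1) / 2); have B2 := q (- ((Q + 1) / 2)).
have Q0 : 0 <= Q by apply: sumr_ge0 => i _; rewrite mulr_ge0// sqr_ge0.
rewrite AE in q *; have [->|Bn] := eqVneq B 0; first by rewrite expr0n /= mul0r.
(* With zero total weight the form is affine in [t], and at this point its value is -1, a
   contradiction. *)
have := q ((Q + 1) / (2 * B)).
have -> : Q - 2 * ((Q + 1) / (2 * B)) * B + ((Q + 1) / (2 * B)) ^+ 2 * 0 = -1 by field.
by lra.
Qed.

(** Half of the exponent pays for the polynomial of lower degree, the other half for the additional
    factor [s]. *)
Lemma poly_gauss (p : {poly R}) e : 0 < e ->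
  exists2 C, 0 <= C & forall s, `|p.[s]| <= C * expR (e * s ^+ 2).
Proof.
move: e; elim/poly_ind: p => [|p c IH] e e0.
  by exists 0 => // s; rewrite horner0 normr0 mul0r.
have [|C C0 hC] := IH (e / 2); first lra.
have e2 : 0 < e / 2 by lra.
exists (C * (1 + (e / 2)^-1) + `|c|).
  by rewrite addr_ge0// mulr_ge0// addr_ge0// invr_ge0 ltW.
move=> s; rewrite hornerMXaddC; apply: (le_trans (ler_normD _ _)).
have e1 : 1 <= expR (e * s ^+ 2).
  by rewrite -expR0 ler_expR mulr_ge0 ?sqr_ge0// ltW.
rewrite mulrDl lerD//; last by rewrite ler_peMr.
have -> : e * s ^+ 2 = e / 2 * s ^+ 2 + e / 2 * s ^+ 2 by field.
rewrite expRD normrM.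
have -> : C * (1 + (e / 2)^-1) * (expR (e / 2 * s ^+ 2) * expR (e / 2 * s ^+ 2)) =
  C * expR (e / 2 * s ^+ 2) * ((1 + (e / 2)^-1) * expR (e / 2 * s ^+ 2)) by ring.
apply: ler_pM => //.
have h1 : 1 + e / 2 * s ^+ 2 <= expR (e / 2 * s ^+ 2) := expR_ge1Dx _.
have i0 : 0 <= (e / 2)^-1 by rewrite invr_ge0 ltW.
apply: (@le_trans _ _ ((1 + (e / 2)^-1) * (1 + e / 2 * s ^+ 2))); last first.
  by rewrite ler_wpM2l// addr_ge0.
have -> : (1 + (e / 2)^-1) * (1 + e / 2 * s ^+ 2) = 1 + s ^+ 2 + (e / 2)^-1 + e / 2 * s ^+ 2.
  by field; lra.
have s2 := sqr_ge0 (`|s| - 1); have s3 := normr_ge0 s.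
have e4 : 0 <= e / 2 * s ^+ 2 by rewrite mulr_ge0 ?sqr_ge0// ltW.
by have := real_normK (num_real s); nra.
Qed.

(** A square root of the profile [gh]: one factor absorbs polynomials, the other is kept as summable
    envelope. *)
Definition rho (s : R) : R := gs (s / 2).

Lemma rho_ge0 s : 0 <= rho s. Proof. exact: gs_ge0. Qed.
Lemma rho_le1 s : rho s <= 1. Proof. exact: gs_le1. Qed.

Lemma gh_rho s : gh s = rho s * rho s.
Proof. by rewrite /gh /rho /gs -expRD; congr expR; field. Qed.

Lemma poly_gh_bound (p : {poly R}) :
  exists2 C, 0 <= C & forall s, `|p.[s] * gh s| <= C * rho s.
Proof.
have p4 : 0 < pi / 4 :> R by rewrite divr_gt0// pi_gt0.
have [C C0 hC] := poly_gauss p p4; exists C => // s.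
rewrite normrM gh_rho [X in _ * X]ger0_norm ?mulr_ge0 ?rho_ge0// mulrA ler_wpM2r ?rho_ge0//.
have -> : C = C * expR (pi / 4 * s ^+ 2) * rho s.
  rewrite -mulrA /rho /gs -expRD.
  by rewrite (_ : _ + _ = 0) ?expR0 ?mulr1//; field.
by rewrite ler_wpM2r ?rho_ge0.
Qed.

Lemma sumle_rho (t : R) : sumle (fun z : int => rho (t - z%:~R)) (cT R).
Proof.
apply: (@sumle_le _ _ _ (fun z : int => expR 1 * expR (- `|z%:~R - t|))); last first.
  by apply: sumleZ; [exact: expR_ge0|exact: sumle_expR_dist].
move=> z; rewrite /rho /gs -expRD ler_expR distrC.
set s := t - z%:~R; have p2 := pi_ge2 R.
have := real_normK (num_real s); have := normr_ge0 s; set y := `|s| => y0 ys.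
have -> : pi * (s / 2) ^+ 2 = pi / 4 * y ^+ 2 by rewrite ys; field.
have := sqr_ge0 (y - 1); have : 2 / 4 * y ^+ 2 <= pi / 4 * y ^+ 2.
  by rewrite ler_wpM2r ?sqr_ge0//; lra.
nra.
Qed.

Lemma Rint_odd (f : R -> R) : integ f -> (forall t, f (- t) = - f t) ->
  \int[leb]_t f t = 0.
Proof.
move=> fi fo; have n1 : -1 != 0 :> R by rewrite oppr_eq0 oner_eq0.
have [_] := Rint_affine 0 n1 fi.
rewrite normrN1 invr1 mul1r => h.
have : \int[leb]_t f t = - \int[leb]_t f t; last lra.
rewrite -{1}h -(mulN1r (\int[leb]_t f t)) -(RintegralZl (-1) measurableT fi).
by apply: eq_Rintegral => t _; rewrite addr0 mulN1r fo mulN1r.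
Qed.

(** Here [nu] is a sum or difference of two frequency indices. Its Gaussian decay makes Gram
    matrices almost diagonal in frequency. *)
Lemma Rint_rho (h : R) (m nu : int) : 0 < h ->
  [/\ integ (fun x => rho (x / h - m%:~R)),
      \int[leb]_x (rho (x / h - m%:~R) * cos (pi * nu%:~R * (x / h - m%:~R))) =
        2 * h * gs nu%:~R
    & \int[leb]_x (rho (x / h - m%:~R) * sin (pi * nu%:~R * (x / h - m%:~R))) = 0].
Proof.
move=> h0; have c0 : (2 * h)^-1 != 0 by rewrite invr_eq0 mulf_neq0// gt_eqF.
have hn : h != 0 by rewrite gt_eqF.
have E x : (2 * h)^-1 * x + - (m%:~R / 2) = (x / h - m%:~R) / 2 by field.
have E2 x : pi * nu%:~R * (x / h - m%:~R) = 2 * pi * nu%:~R * ((2 * h)^-1 * x + - (m%:~R / 2)).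
  by field.
have cc : continuous (fun x : R => cos (2 * pi * nu%:~R * x)).
  have := @continuous_cosM R (2 * pi * nu%:~R) 0.
  by under eq_fun do rewrite addr0.
have sc : continuous (fun x : R => sin (2 * pi * nu%:~R * x)).
  have := @continuous_sinM R (2 * pi * nu%:~R) 0.
  by under eq_fun do rewrite addr0.
have i1 : integ (fun x : R => gs x * cos (2 * pi * nu%:~R * x)).
  exact: (@integ_gs_bounded R _ 1 cc (fun t => norm_cos_le1 _)).
have i2 : integ (fun x : R => gs x * sin (2 * pi * nu%:~R * x)).
  exact: (@integ_gs_bounded R _ 1 sc (fun t => norm_sin_le1 _)).
have [j0 _] := Rint_affine (- (m%:~R / 2)) c0 (@integ_gs R).
have [_ j1] := Rint_affine (- (m%:~R / 2)) c0 i1.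
have [_ j2] := Rint_affine (- (m%:~R / 2)) c0 i2.
have hh : `|(2 * h)^-1|^-1 = 2 * h.
  by rewrite normfV invrK gtr0_norm// mulr_gt0.
split.
- by move: j0; under eq_fun do rewrite E.
- rewrite -[RHS]/(2 * h * gs nu%:~R) -Fourier_gs -hh -j1.
  by apply: eq_Rintegral => x _; rewrite E2 /rho E.
- transitivity (`|(2 * h)^-1|^-1 * \int[leb]_x (gs x * sin (2 * pi * nu%:~R * x))).
    by rewrite -j2; apply: eq_Rintegral => x _; rewrite E2 /rho E.
  rewrite Rint_odd ?mulr0// => t; rewrite gsN mulrN sinN; ring.
Qed.

(** Since every sine integral vanishes, expanding the cosine of the sum leaves only the product of
    cosines. In the induction the sine of the remaining variables is a cosine with phase
    [b - pi / 2]. *)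
Lemma Int_prod_cos d (f th : 'I_d -> R -> R) b :
  (forall i, integ (f i)) -> (forall i, continuous (th i)) ->
  (forall i, \int[leb]_t (f i t * sin (th i t)) = 0) ->
  intg (fun x : 'rV[R]_d => \prod_i f i (x 0 i) * cos (\sum_i th i (x 0 i) + b)) /\
  Int (fun x : 'rV[R]_d => \prod_i f i (x 0 i) * cos (\sum_i th i (x 0 i) + b)) =
  cos b * \prod_i \int[leb]_t (f i t * cos (th i t)).
Proof.
move=> fi ct st.
have mc : measurable_fun [set: RT] (@cos R).
  by apply: continuous_measurable_fun; exact: continuous_cos.
have ci i : integ (fun t => f i t * cos (th i t)).
  apply: (@integ_dom _ _ (fun t => `|f i t|)).
  - apply: measurable_funM; first exact: integ_mfun (fi i).
    by apply: measurableT_comp => //; exact: continuous_measurable_fun.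
  - exact: integ_norm.
  by move=> t; rewrite normrM ler_piMr// norm_cos_le1.
have si i : integ (fun t => f i t * sin (th i t)).
  apply: (@integ_dom _ _ (fun t => `|f i t|)).
  - apply: measurable_funM; first exact: integ_mfun (fi i).
    apply: measurableT_comp => //; last exact: continuous_measurable_fun.
    by apply: continuous_measurable_fun; exact: continuous_sin.
  - exact: integ_norm.
  by move=> t; rewrite normrM ler_piMr// norm_sin_le1.
elim: d f th b fi ct st ci si => [|d IH] f th b fi ct st ci si.
  have m1 : mfun (fun x : 'rV[R]_0 =>
    \prod_i f i (x 0 i) * cos (\sum_i th i (x 0 i) + b)).
    rewrite (_ : (fun x => _) = (fun _ => cos b)); first exact: mfun_cst.
    by apply/funext => x; rewrite !big_ord0 mul1r add0r.
  split; first exact: intg_dim0.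
  by rewrite Int_dim0// !big_ord0 mul1r mulr1 add0r.
pose L i := lift (ord0 : 'I_d.+1) i.
have IHb b' := IH (f \o L) (th \o L) b' (fun i => fi _) (fun i => ct _) (fun i => st _)
  (fun i => ci _) (fun i => si _).
pose G b' (y : 'rV[R]_d) := \prod_i f (L i) (y 0 i) * cos (\sum_i th (L i) (y 0 i) + b').
have E (x : 'rV[R]_d.+1) : \prod_i f i (x 0 i) * cos (\sum_i th i (x 0 i) + b) =
    f ord0 (x 0 ord0) * cos (th ord0 (x 0 ord0)) * G b (rtail x) -
    f ord0 (x 0 ord0) * sin (th ord0 (x 0 ord0)) * G (b - pi / 2) (rtail x).
  rewrite !big_ord_recl -addrA cosD /G.
  have -> : \prod_(i < d) f (lift ord0 i) (x 0 (lift ord0 i)) = \prod_i f (L i) (rtail x 0 i).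
    by apply: eq_bigr => i _; rewrite mxE.
  have -> : \sum_(i < d) th (lift ord0 i) (x 0 (lift ord0 i)) = \sum_i th (L i) (rtail x 0 i).
    by apply: eq_bigr => i _; rewrite mxE.
  set A := \sum_i _; have -> : A + (b - pi / 2) = (A + b) - pi / 2 by ring.
  by rewrite cosB cos_pihalf sin_pihalf; ring.
have [g1 e1] := IHb b; have [g2 e2] := IHb (b - pi / 2).
have t1 := intg_tensor (ci ord0) g1; have t2 := intg_tensor (si ord0) g2.
split; first by apply: (intg_eq (fun x => esym (E x))); exact: intgB.
rewrite (Int_eq E) (IntB t1 t2) (Int_tensor (ci ord0) g1) (Int_tensor (si ord0) g2).
by rewrite st mul0r subr0 e1 big_ord_recl /=; ring.
Qed.

Section family.
Variables (d : nat) (k : R).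
Hypothesis k0 : 0 < k.
Local Notation h := (hk k).

Definition sj (j : gidx d) (i : 'I_d) (x : 'rV[R]_d) : R := x 0 i / h - (j.1 0 i)%:~R.

(* The phases [b = 0] and [b = - pi / 2] with constant profiles give the real and imaginary parts of
   [Psi]; the polynomial profiles come from derivatives and multiplication by coordinates. *)
Definition efam (P : 'I_d -> {poly R}) (b : R) (j : gidx d) (x : 'rV[R]_d) : R :=
  amp d k * \prod_i ((P i).[sj j i x] * gh (sj j i x)) *
  cos (\sum_i pi * (j.2 0 i)%:~R * sj j i x + b).

Definition rhom (m : 'rV[int]_d) (x : 'rV[R]_d) : R := \prod_i rho (x 0 i / h - (m 0 i)%:~R).

Lemma rhom_ge0 m x : 0 <= rhom m x.
Proof. by apply: prodr_ge0 => i _; exact: rho_ge0. Qed.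

Lemma rhom_le1 m x : rhom m x <= 1.
Proof. by apply: prodr_ile1 => i; rewrite rho_ge0 rho_le1. Qed.

Lemma rhom_sum M x : \sum_(m <- zbox d M) rhom m x <= cT R ^+ d.
Proof.
rewrite /rhom (zbox_prod M (fun i z => rho (x 0 i / h - z%:~R))).
rewrite -[in leRHS](card_ord d) -prodr_const; apply: ler_prod => i _.
rewrite (sumle_zsum (sumle_rho _)) andbT.
by apply: sumr_ge0 => z _; exact: rho_ge0.
Qed.

Definition gsd (nu : 'rV[int]_d) : R := \prod_i gs (nu 0 i)%:~R.

Lemma gsd_ge0 nu : 0 <= gsd nu.
Proof. by apply: prodr_ge0 => i _; exact: gs_ge0. Qed.

Lemma gsd_sum M (nu : 'rV[int]_d) : \sum_(n <- zbox d M) gsd (n - nu) <= cT R ^+ d.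
Proof.
rewrite (_ : \sum_(n <- _) _ = \sum_(n <- zbox d M) \prod_i gs ((n 0 i)%:~R - (nu 0 i)%:~R)).
  rewrite (zbox_prod M (fun i z => gs (z%:~R - (nu 0 i)%:~R))).
  rewrite -[in leRHS](card_ord d) -prodr_const; apply: ler_prod => i _.
  rewrite (sumle_zsum (sumle_gs _)) andbT.
  by apply: sumr_ge0 => z _; exact: gs_ge0.
by apply: eq_bigr => n _; apply: eq_bigr => i _; rewrite !mxE rmorphB.
Qed.

Definition phase (n m : 'rV[int]_d) (x : 'rV[R]_d) : R :=
  \sum_i pi * (n 0 i)%:~R * (x 0 i / h - (m 0 i)%:~R).

Lemma rhom_phase (m nu : 'rV[int]_d) b :
  intg (fun x => rhom m x * cos (phase nu m x + b)) /\
  `|Int (fun x => rhom m x * cos (phase nu m x + b))| <= (2 * h) ^+ d * gsd nu.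
Proof.
have h0 : 0 < h := hk_gt0 k0.
have A i := Rint_rho (m 0 i) (nu 0 i) h0.
have [||i|ig ->] := @Int_prod_cos d (fun i x => rho (x / h - (m 0 i)%:~R))
  (fun i x => pi * (nu 0 i)%:~R * (x / h - (m 0 i)%:~R)) b.
- by move=> i; have [] := A i.
- move=> i x; apply: cvgM; first exact: cvg_cst.
  by apply: cvgB; [apply: cvgM; [exact: cvg_id|exact: cvg_cst]|exact: cvg_cst].
- by have [] := A i.
split => //; rewrite normrM; apply: (@le_trans _ _ (1 * ((2 * h) ^+ d * gsd nu))).
  apply: ler_pM => //; first exact: norm_cos_le1.
  rewrite (eq_bigr (fun i => 2 * h * gs (nu 0 i)%:~R)); last first.
    by move=> i _; have [] := A i.
  rewrite big_split /= prodr_const card_ord ger0_norm// mulr_ge0 ?gsd_ge0// exprn_ge0//.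
  by rewrite mulr_ge0// ltW.
by rewrite mul1r.
Qed.

Definition gram_term (c : 'rV[int]_d -> R) m b (z : 'rV[int]_d * 'rV[int]_d) (x : 'rV[R]_d) : R :=
  c z.1 * c z.2 / 2 * (rhom m x * cos (phase (z.1 - z.2) m x + 0) +
    rhom m x * cos (phase (z.1 + z.2) m x + 2 * b)).

Lemma gram_expand (s : seq 'rV[int]_d) (c : 'rV[int]_d -> R) m b x :
  rhom m x * (\sum_(n <- s) c n * cos (phase n m x + b)) ^+ 2 =
  \sum_(z <- [seq (n, n') | n <- s, n' <- s]) gram_term c m b z x.
Proof.
rewrite big_allpairs expr2 mulr_suml mulr_sumr; apply: eq_bigr => n _.
rewrite !mulr_sumr; apply: eq_bigr => n' _; rewrite /gram_term /=.
have -> : phase (n - n') m x + 0 = (phase n m x + b) - (phase n' m x + b).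
  have -> : phase n m x + b - (phase n' m x + b) = phase n m x - phase n' m x by ring.
  rewrite addr0 /phase -sumrB; apply: eq_bigr => i _.
  by rewrite !mxE rmorphB /=; ring.
have -> : phase (n + n') m x + 2 * b = (phase n m x + b) + (phase n' m x + b).
  rewrite addrACA -mulr2n mulr_natl; congr (_ + _).
  rewrite /phase -big_split; apply: eq_bigr => i _.
  by rewrite !mxE rmorphD /=; ring.
by move: (phase n m x + b) (phase n' m x + b) => A B; rewrite cosB cosD; field.
Qed.

(** Schur test: entries decay like [gsd] of the difference and of the sum of the indices, and every
    row or column sums to at most [cT^d]. *)
Lemma gram_bound M (c : 'rV[int]_d -> R) m b :
  intg (fun x => rhom m x * (\sum_(n <- zbox d M) c n * cos (phase n m x + b)) ^+ 2) /\
  Int (fun x => rhom m x * (\sum_(n <- zbox d M) c n * cos (phase n m x + b)) ^+ 2) <=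
  (2 * h) ^+ d * cT R ^+ d * \sum_(n <- zbox d M) c n ^+ 2.
Proof.
have ig z : intg (gram_term c m b z).
  apply: intgZ; apply: intgD; first by have [] := rhom_phase m (z.1 - z.2) 0.
  by have [] := rhom_phase m (z.1 + z.2) (2 * b).
have iS := intg_sum [seq (n, n') | n <- zbox d M, n' <- zbox d M] ig.
split; first by apply: (intg_eq (fun x => esym (gram_expand (zbox d M) c m b x))).
rewrite (Int_eq (gram_expand (zbox d M) c m b)) (Int_sum _ ig) big_allpairs.
have h0 : 0 < h := hk_gt0 k0.
set H := (2 * h) ^+ d; have H0 : 0 <= H by rewrite exprn_ge0// mulr_ge0// ltW.
(* The product [|c n * c n'|] is split by the arithmetic-geometric inequality into squares, so that
   each of the four sums runs freely over one index. *)
pose g n n' := H / 4 * (c n ^+ 2 * gsd (n' - n) + c n' ^+ 2 * gsd (n - n') +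
   (c n ^+ 2 * gsd (n' - (- n)) + c n' ^+ 2 * gsd (n - (- n')))).
have gsdN nu : gsd (- nu) = gsd nu.
  by apply: eq_bigr => i _; rewrite mxE rmorphN /= gsN.
have B n n' : Int (gram_term c m b (n, n')) <= g n n'.
  have [i1 b1] := rhom_phase m (n - n') 0; have [i2 b2] := rhom_phase m (n + n') (2 * b).
  rewrite (IntZ _ (intgD i1 i2)) (IntD i1 i2) /=.
  set I1 := Int _ in b1 *; set I2 := Int _ in b2 *.
  have -> : g n n' = (c n ^+ 2 + c n' ^+ 2) / 4 * (H * gsd (n - n') + H * gsd (n + n')).
    by rewrite /g !opprK -(gsdN (n' - n)) opprB [n' + n]addrC; field.
  set W := H * gsd _ + _.
  have W0 : 0 <= W by rewrite addr_ge0// mulr_ge0// gsd_ge0.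
  apply: (le_trans (ler_norm _)); rewrite normrM.
  have IW : `|I1 + I2| <= W by apply: (le_trans (ler_normD _ _)); exact: lerD.
  apply: ler_pM => //.
  rewrite normrM normrM (ger0_norm (_ : 0 <= 2^-1)) ?invr_ge0//.
  have := sqr_ge0 (`|c n| - `|c n'|).
  have := real_normK (num_real (c n)); have := real_normK (num_real (c n')); nra.
apply: (@le_trans _ _ (\sum_(n <- zbox d M) \sum_(n' <- zbox d M) g n n')).
  by apply: ler_sum => n _; apply: ler_sum => n' _; exact: B.
pose T := \sum_(n <- zbox d M) c n ^+ 2.
have S (nu : 'rV[int]_d -> 'rV[int]_d) :
   \sum_(n <- zbox d M) \sum_(n' <- zbox d M) c n ^+ 2 * gsd (n' - nu n) <= cT R ^+ d * T.
  rewrite mulr_sumr; apply: ler_sum => n _.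
  by rewrite -mulr_sumr mulrC ler_wpM2r ?sqr_ge0// gsd_sum.
have S' (nu : 'rV[int]_d -> 'rV[int]_d) :
   \sum_(n <- zbox d M) \sum_(n' <- zbox d M) c n' ^+ 2 * gsd (n - nu n') <= cT R ^+ d * T.
  by rewrite exchange_big; exact: S.
have -> : \sum_(n <- zbox d M) \sum_(n' <- zbox d M) g n n' = H / 4 * (
   \sum_(n <- zbox d M) \sum_(n' <- zbox d M) c n ^+ 2 * gsd (n' - n) +
   \sum_(n <- zbox d M) \sum_(n' <- zbox d M) c n' ^+ 2 * gsd (n - n') +
   (\sum_(n <- zbox d M) \sum_(n' <- zbox d M) c n ^+ 2 * gsd (n' - (- n)) +
   \sum_(n <- zbox d M) \sum_(n' <- zbox d M) c n' ^+ 2 * gsd (n - (- n')))).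
  rewrite -!big_split mulr_sumr; apply: eq_bigr => n _ /=.
  by rewrite -!big_split mulr_sumr; apply: eq_bigr => n' _.
have S1 := S id; have S2 := S -%R; have S1' := S' id; have S2' := S' -%R.
have -> : H * cT R ^+ d * T = H / 4 * (cT R ^+ d * T + cT R ^+ d * T + (cT R ^+ d * T + cT R ^+ d * T)).
  by field.
apply: ler_wpM2l; first by rewrite divr_ge0.
by rewrite !lerD.
Qed.

Variable P : 'I_d -> {poly R}.

Lemma continuous_poly_gh (p : {poly R}) : continuous (fun s => p.[s] * gh s).
Proof.
by apply: continuous_mulr; [exact: continuous_horner|exact: continuous_gh].
Qed.

Lemma mfun_sj j i : mfun (sj j i).
Proof.
apply: mfunB; last exact: mfun_cst.
by apply: mfunM; [exact: mfun_coord|exact: mfun_cst].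
Qed.

Lemma mfun_efam b j : mfun (efam P b j).
Proof.
apply: mfunM.
  apply: mfunM; first exact: mfun_cst.
  apply: mfun_prod => i; apply: (@mfun_comp R d (fun s => (P i).[s] * gh s)); last exact: mfun_sj.
  by apply: continuous_measurable_fun; exact: continuous_poly_gh.
apply: mfun_comp; first by apply: continuous_measurable_fun; exact: continuous_cos.
apply: mfunD; last exact: mfun_cst.
apply: mfun_sum => i; apply: mfunM; [exact: mfun_cst|exact: mfun_sj].
Qed.

(** [C^2] comes from the profiles, one [cT^d] from the overlap of the positions, and [2^d cT^d] from
    [gram_bound], whose [h^d] cancels the squared amplitude. The result is free of [k]. *)
Definition bessel_cst (C : R) := C ^+ 2 * 2 ^+ d * cT R ^+ d * cT R ^+ d.

Section bessel_bound.
Variable C : R.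
Hypothesis C0 : 0 <= C.
Hypothesis PC : forall s : 'I_d -> R,
  `|\prod_i ((P i).[s i] * gh (s i))| <= C * \prod_i rho (s i).

Lemma efam_le b j x : `|efam P b j x| <= amp d k * C * rhom j.1 x.
Proof.
rewrite /efam normrM normrM (ger0_norm (amp_ge0 _ _)).
apply: (@le_trans _ _ (amp d k * (C * rhom j.1 x) * 1)); last by rewrite mulr1 mulrA.
apply: ler_pM => //; last exact: norm_cos_le1.
  by rewrite mulr_ge0 ?amp_ge0.
by rewrite ler_wpM2l ?amp_ge0//; exact: PC.
Qed.

Lemma intg_rhom m : intg (@rhom m).
Proof.
have [h1 _] := rhom_phase m 0 0; apply: intg_eq h1 => x.
by rewrite /phase big1 ?add0r ?cos0 ?mulr1// => i _; rewrite mxE mulr0 mul0r.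
Qed.

Lemma sqi_efam b j : sqi (efam P b j).
Proof.
split; first exact: mfun_efam.
apply: (@intg_dom _ _ _ (fun x => (amp d k * C) ^+ 2 * rhom j.1 x)).
- exact: mfunX (mfun_efam b j).
- exact: intgZ (intg_rhom _).
move=> x; rewrite normrX; apply: (@le_trans _ _ ((amp d k * C * rhom j.1 x) ^+ 2)).
  by rewrite ler_pXn2r ?nnegrE ?efam_le// !mulr_ge0 ?amp_ge0 ?rhom_ge0.
rewrite exprMn ler_wpM2l ?sqr_ge0// expr2 ler_piMr ?rhom_ge0 ?rhom_le1//.
Qed.

(** Positions are separated pointwise, by Cauchy-Schwarz with the envelopes as weights; frequencies
    are separated after integration, by [gram_bound] for each fixed position. *)
Lemma bessel_box M b (c : gidx d -> R) :
  Int (fun x => (\sum_(j <- boxs d M) c j * efam P b j x) ^+ 2) <=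
  bessel_cst C * \sum_(j <- boxs d M) c j ^+ 2.
Proof.
have h0 : 0 < h := hk_gt0 k0.
pose T m x := \sum_(n <- zbox d M) c (m, n) * cos (phase n m x + b).
pose G (m : 'rV[int]_d) (x : 'rV[R]_d) := \prod_i ((P i).[x 0 i / h - (m 0 i)%:~R] * gh (x 0 i / h - (m 0 i)%:~R)).
have E x : \sum_(j <- boxs d M) c j * efam P b j x = amp d k * \sum_(m <- zbox d M) G m x * T m x.
  rewrite boxs_sum mulr_sumr; apply: eq_bigr => m _.
  rewrite /T !mulr_sumr; apply: eq_bigr => n _.
  by rewrite /efam /phase /sj /G /=; ring.
have B x : (\sum_(j <- boxs d M) c j * efam P b j x) ^+ 2 <=
    amp d k ^+ 2 * (C ^+ 2 * cT R ^+ d) * \sum_(m <- zbox d M) rhom m x * T m x ^+ 2.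
  rewrite E exprMn -mulrA ler_wpM2l ?sqr_ge0//.
  apply: (@le_trans _ _ ((C * \sum_(m <- zbox d M) rhom m x * `|T m x|) ^+ 2)).
    rewrite -real_normK ?num_real// ler_pXn2r ?nnegrE//; last first.
      by rewrite mulr_ge0// sumr_ge0// => m _; rewrite mulr_ge0// rhom_ge0.
    apply: (le_trans (ler_norm_sum _ _ _)); rewrite mulr_sumr.
    by apply: ler_sum => m _; rewrite normrM mulrA ler_wpM2r//; exact: PC.
  rewrite exprMn -mulrA ler_wpM2l ?sqr_ge0//.
  apply: (le_trans (weighted_Cauchy _ _ (fun m => rhom_ge0 m x))).
  apply: ler_pM.
  - by apply: sumr_ge0 => m _; exact: rhom_ge0.
  - by apply: sumr_ge0 => m _; rewrite mulr_ge0 ?rhom_ge0 ?sqr_ge0.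
  - exact: rhom_sum.
  by apply: ler_sum => m _; rewrite real_normK ?num_real.
have gb m := gram_bound M (fun n => c (m, n)) m b.
have iS : intg (fun x => \sum_(m <- zbox d M) rhom m x * T m x ^+ 2).
  by apply: intg_sum => m; have [] := gb m.
have s2 : sqi (fun x => \sum_(j <- boxs d M) c j * efam P b j x).
  by apply: sqi_sum => j; apply: sqiZ; exact: sqi_efam.
apply: (le_trans (le_Int s2.2 (intgZ _ iS) B)).
rewrite (IntZ _ iS) Int_sum; last by move=> m; have [] := gb m.
apply: (@le_trans _ _ (amp d k ^+ 2 * (C ^+ 2 * cT R ^+ d) *
   \sum_(m <- zbox d M) ((2 * h) ^+ d * cT R ^+ d * \sum_(n <- zbox d M) c (m, n) ^+ 2))).
  rewrite ler_wpM2l//; last by apply: ler_sum => m _; have [] := gb m.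
  apply: mulr_ge0; [exact: sqr_ge0|apply: mulr_ge0; [exact: sqr_ge0|]].
  by rewrite exprn_ge0// cT_ge0.
rewrite -mulr_sumr -(boxs_sum M (fun j => c j ^+ 2)) le_eqVlt; apply/orP; left; apply/eqP.
rewrite (amp2 d k0) /bessel_cst [(2 * h) ^+ d]exprMn.
have : h^-1 ^+ d * h ^+ d = 1 by rewrite -exprMn mulVf ?expr1n// gt_eqF.
set S := \sum_(j <- _) _; move=> e; transitivity ((h^-1 ^+ d * h ^+ d) *
  (C ^+ 2 * 2 ^+ d * cT R ^+ d * cT R ^+ d * S)); first by ring.
by rewrite e mul1r.
Qed.

Lemma bessel_cst_ge0 : 0 <= bessel_cst C.
Proof. by rewrite !mulr_ge0 ?sqr_ge0 ?exprn_ge0 ?cT_ge0. Qed.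

(** Duality: the sum [S] of the squared coefficients is the pairing of [f] with the synthesis of
    these coefficients, so [S^2] is at most the squared norm of [f] times [bessel_cst C * S]. *)
Lemma dual_bessel b (f : 'rV[R]_d -> R) : sqi f ->
  sumle (fun j => Int (fun x => f x * efam P b j x) ^+ 2)
    (bessel_cst C * Int (fun x => f x ^+ 2)).
Proof.
move=> sf s us; have [M hM] := boxs_exhaust s.
apply: (le_trans (sum_sub_le _ us hM)); first by move=> j; exact: sqr_ge0.
pose a j := Int (fun x => f x * efam P b j x).
set S := \sum_(j <- _) _; set N := Int _.
have S0 : 0 <= S by apply: sumr_ge0 => j _; exact: sqr_ge0.
have N0 : 0 <= N by apply: Int_ge0 => x; exact: sqr_ge0.
have ie j := sqi_mul sf (sqi_efam b j).
have SE : S = Int (fun x => f x * \sum_(j <- boxs d M) a j * efam P b j x).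
  rewrite (@Int_eq _ _ _ (fun x => \sum_(j <- boxs d M) a j * (f x * efam P b j x))).
    rewrite Int_sum; last by move=> j; exact: intgZ.
    by apply: eq_bigr => j _; rewrite (IntZ _ (ie j)) expr2.
  by move=> x; rewrite mulr_sumr; apply: eq_bigr => j _; rewrite mulrCA.
have s2 : sqi (fun x => \sum_(j <- boxs d M) a j * efam P b j x).
  by apply: sqi_sum => j; apply: sqiZ; exact: sqi_efam.
have := Cauchy_Schwarz sf s2; rewrite -SE => h.
have := bessel_box M b a; rewrite -/S => h2.
have h3 : S ^+ 2 <= N * (bessel_cst C * S) by apply: le_trans h _; rewrite ler_wpM2l.
have [SZ|Sn] := eqVneq S 0; first by rewrite SZ mulr_ge0// bessel_cst_ge0.
have Sp : 0 < S by rewrite lt_neqAle eq_sym Sn.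
rewrite -(ler_pM2r Sp) -expr2; apply: (le_trans h3).
by rewrite le_eqVlt; apply/orP; left; apply/eqP; ring.
Qed.

End bessel_bound.
End family.

Lemma profile_bound d (P : 'I_d -> {poly R}) : exists2 C, 0 <= C & forall s : 'I_d -> R,
  `|\prod_i ((P i).[s i] * gh (s i))| <= C * \prod_i rho (s i).
Proof.
have h i : exists C : R, 0 <= C /\ forall s, `|(P i).[s] * gh s| <= C * rho s.
  by have [C C0 hC] := poly_gh_bound (P i); exists C.
have [C hC] := choice h; exists (\prod_i C i).
  by apply: prodr_ge0 => i _; have [] := hC i.
move=> s; rewrite normr_prod -big_split; apply: ler_prod => i _.
by rewrite normr_ge0; have [_] := hC i; apply.
Qed.

End Bessel.

(** * Reconstruction with Cesaro weights *)

Section Reconstruction.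
Variable R : realType.
Local Notation C := R[i].
Local Notation leb := (@lebesgue_measure R).
Local Notation RT := (measurableTypeR R).

(** For a kernel of finite rank the exchange of sums and integrals is mere linearity. *)
Lemma bilinear_kernel (T : Type) (s : seq T) d (u g : 'rV[R]_d -> R) (c : T -> R)
    (al be : T -> 'rV[R]_d -> R) (B : R) :
  intg u -> intg g -> (forall j, mfun (al j)) -> (forall j, mfun (be j)) ->
  (forall j x, `|al j x| <= B) -> (forall j x, `|be j x| <= B) ->
  [/\ forall x, Int (fun y => u y * \sum_(j <- s) c j * (al j x * be j y)) =
        \sum_(j <- s) c j * Int (fun y => u y * be j y) * al j x,
      mfun (fun x => Int (fun y => u y * \sum_(j <- s) c j * (al j x * be j y)))
    & \sum_(j <- s) c j * (Int (fun y => u y * be j y) * Int (fun x => g x * al j x)) =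
      Int (fun x => g x * Int (fun y => u y * \sum_(j <- s) c j * (al j x * be j y)))].
Proof.
move=> iu ig ma mb aB bB.
have im f (F : T -> 'rV[R]_d -> R) : intg f -> (forall j, mfun (F j)) ->
    (forall j x, `|F j x| <= B) -> forall j, intg (fun y => f y * F j y).
  move=> fi mF FB j; apply: (intg_eq (fun x => mulrC (F j x) (f x))).
  exact: intg_bounded_mul (mF j) (FB j) fi.
have iub := im _ _ iu mb bB; have iga := im _ _ ig ma aB.
have E x : Int (fun y => u y * \sum_(j <- s) c j * (al j x * be j y)) =
    \sum_(j <- s) c j * Int (fun y => u y * be j y) * al j x.
  rewrite (@Int_eq _ _ _ (fun y => \sum_(j <- s) (c j * al j x) * (u y * be j y))).
    rewrite Int_sum; last by move=> j; exact: intgZ.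
    by apply: eq_bigr => j _; rewrite (IntZ _ (iub j)); ring.
  by move=> y; rewrite mulr_sumr; apply: eq_bigr => j _; ring.
split => //.
- rewrite (funext E); apply: mfun_sum => j; apply: mfunM => //; exact: mfun_cst.
- rewrite (@Int_eq _ _ _ (fun x => \sum_(j <- s) (c j * Int (fun y => u y * be j y)) *
     (g x * al j x))); last first.
    by move=> x; rewrite E mulr_sumr; apply: eq_bigr => j _; ring.
  rewrite Int_sum; last by move=> j; exact: intgZ.
  by apply: eq_bigr => j _; rewrite (IntZ _ (iga j)); ring.
Qed.

Section fixed.
Variables (d : nat) (k : R).
Hypothesis k0 : 0 < k.
Local Notation h := (hk k).

Definition pone : 'I_d -> {poly R} := fun=> 1.
Definition ec (j : gidx d) (x : 'rV[R]_d) : R := efam k pone 0 j x.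
Definition es (j : gidx d) (x : 'rV[R]_d) : R := efam k pone (- (pi / 2)) j x.

Lemma pone_bound (s : 'I_d -> R) :
  `|\prod_i ((pone i).[s i] * gh (s i))| <= 1 * \prod_i rho (s i).
Proof.
rewrite mul1r normr_prod; apply: ler_prod => i _; rewrite normr_ge0 /= hornerC mul1r.
by rewrite gh_rho ger0_norm ?mulr_ge0 ?rho_ge0// ler_piMr ?rho_ge0 ?rho_le1.
Qed.

Lemma PsiE (j : gidx d) x : Psi k j x = ec j x +i* es j x.
Proof.
rewrite (Psi_prod k0) /psi1 big_split /= -cis_sum -rmorph_prod /= mulrA -rmorphM /=.
rewrite /ec /es /efam /sj; under [in RHS]eq_bigr do rewrite /pone hornerC mul1r.
set S := \sum_i _; rewrite -[S - _]/(S - pi / 2).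
rewrite addr0 cosB cos_pihalf sin_pihalf mulr0 add0r mulr1.
by rewrite /cis; simpc.
Qed.

Lemma ec_le j x : `|ec j x| <= amp d k.
Proof.
have := @efam_le R d k pone 1 pone_bound 0 j x; move/le_trans; apply.
by rewrite mulr1 ler_piMr ?amp_ge0// rhom_le1.
Qed.

Lemma es_le j x : `|es j x| <= amp d k.
Proof.
have := @efam_le R d k pone 1 pone_bound (- (pi / 2)) j x; move/le_trans; apply.
by rewrite mulr1 ler_piMr ?amp_ge0// rhom_le1.
Qed.

Lemma mfun_ec j : mfun (ec j). Proof. exact: mfun_efam. Qed.
Lemma mfun_es j : mfun (es j). Proof. exact: mfun_efam. Qed.

Definition kap K (F : gidx d -> R) (j : gidx d) : R :=
  \sum_(f : kidx d K) kc f * F (kshift f j).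

Lemma kPsiE K (j : gidx d) x :
  kPsi k K j x = kap K (ec^~ x) j +i* kap K (es^~ x) j.
Proof.
rewrite /kPsi /kap; under eq_bigr do rewrite PsiE.
elim/big_rec3: _ => [//|f a b c _ ->]; by simpc.
Qed.

Lemma kap_Int K (u : 'rV[R]_d -> R) (F : gidx d -> 'rV[R]_d -> R) j :
  (forall i, intg (fun y => u y * F i y)) ->
  Int (fun y => u y * kap K (F^~ y) j) = kap K (fun i => Int (fun y => u y * F i y)) j.
Proof.
move=> iF; rewrite /kap.
rewrite (@Int_eq _ _ _ (fun y => \sum_(f : kidx d K) kc f * (u y * F (kshift f j) y))).
  rewrite Int_sum; last by move=> f; exact: intgZ.
  by apply: eq_bigr => f _; rewrite IntZ.
by move=> y; rewrite mulr_sumr; apply: eq_bigr => f _; ring.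
Qed.

Definition bc (u : 'rV[R]_d -> R) j := Int (fun y => u y * ec j y).
Definition bs (u : 'rV[R]_d -> R) j := Int (fun y => u y * es j y).

(* For real [u] and [g]: the real and imaginary parts of the product of the [K]-combination of the
   coefficients [(u, Psi_i)] with [(Psi_j, g)]. *)
Definition kterm (re : bool) K u g j : R :=
  if re then kap K (bc u) j * bc g j + kap K (bs u) j * bs g j
  else kap K (bc u) j * bs g j - kap K (bs u) j * bc g j.

Lemma kap_le K (F : gidx d -> R) B j : (forall i, `|F i| <= B) ->
  `|kap K F j| <= (\sum_(f : kidx d K) `|kc f|) * B.
Proof.
move=> FB; apply: (le_trans (ler_norm_sum _ _ _)); rewrite mulr_suml.
by apply: ler_sum => f _; rewrite normrM ler_wpM2l.
Qed.

(** The kernel computed in [frame_kernel] is real, hence the value 0 for the imaginary part. *)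
Definition ktarget (re : bool) (x y : 'rV[R]_d) M L K : R :=
  if re then \prod_i (h^-1 * kerM M L K (x 0 i / h) (y 0 i / h)) else 0.

Lemma frame_kernel_real re M L K eta x y : good_inverse K eta ->
  \sum_(j <- boxs d M) cesd R L j *
   (if re then ec j x * kap K (ec^~ y) j + es j x * kap K (es^~ y) j
    else es j x * kap K (ec^~ y) j - ec j x * kap K (es^~ y) j) = ktarget re x y M L K.
Proof.
move=> gK; have := frame_kernel k0 M L x y gK.
have -> : \sum_(j <- boxs d M) (cesd R L j)%:C * (Psi k j x * cj (kPsi k K j y)) =
  (\sum_(j <- boxs d M) cesd R L j * (ec j x * kap K (ec^~ y) j + es j x * kap K (es^~ y) j)) +i*
  (\sum_(j <- boxs d M) cesd R L j * (es j x * kap K (ec^~ y) j - ec j x * kap K (es^~ y) j)).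
  elim: (boxs d M) => [|j s IH]; first by rewrite !big_nil.
  rewrite !big_cons IH PsiE kPsiE /cj; simpc; congr (_ +i* _); ring.
by case: re => -[].
Qed.

Lemma kterm_sum re M L K eta u g : good_inverse K eta -> intg u -> intg g ->
  mfun (fun x => Int (fun y => u y * ktarget re x y M L K)) /\
  \sum_(j <- boxs d M) cesd R L j * kterm re K u g j =
  Int (fun x => g x * Int (fun y => u y * ktarget re x y M L K)).
Proof.
move=> gK iu ig.
(* The boolean separates the two products of which each real or imaginary part is made, so that one
   bilinear sum covers both cases of [re]. *)
pose s := [seq (j, b) | j <- boxs d M, b <- [:: true; false]].
pose c (z : gidx d * bool) := cesd R L z.1 * (if ~~ re && ~~ z.2 then -1 else 1).
pose al (z : gidx d * bool) x := if re == z.2 then ec z.1 x else es z.1 x.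
pose be (z : gidx d * bool) y := if z.2 then kap K (ec^~ y) z.1 else kap K (es^~ y) z.1.
pose B := amp d k + (\sum_(f : kidx d K) `|kc f|) * amp d k.
have n0 : 0 <= (\sum_(f : kidx d K) `|kc f|) * amp d k.
  by rewrite mulr_ge0 ?amp_ge0// sumr_ge0.
have aB z x : `|al z x| <= B.
  by rewrite /al; case: ifP => _; rewrite (le_trans (ec_le _ _), le_trans (es_le _ _))// lerDl.
have bB z x : `|be z x| <= B.
  rewrite /be; case: ifP => _.
    by apply: (le_trans (kap_le _ _ (fun i => ec_le i x))); rewrite lerDr amp_ge0.
  by apply: (le_trans (kap_le _ _ (fun i => es_le i x))); rewrite lerDr amp_ge0.
have ma z : mfun (al z) by rewrite /al; case: (re == z.2); exact: mfun_efam.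
have mb z : mfun (be z).
  rewrite /be /kap; case: z.2; apply: mfun_sum => f; apply: mfunM; try exact: mfun_cst;
  exact: mfun_efam.
have KE x y : \sum_(z <- s) c z * (al z x * be z y) = ktarget re x y M L K.
  rewrite -(frame_kernel_real re M L x y gK) big_allpairs; apply: eq_bigr => j _.
  by rewrite !big_cons big_nil /c /al /be /=; case: (re) => /=; ring.
have [_] := bilinear_kernel s c iu ig ma mb aB bB.
rewrite (_ : (fun x => Int (fun y => u y * (\sum_(j <- s) c j * (al j x * be j y)))) =
  (fun x => Int (fun y => u y * ktarget re x y M L K))); last first.
  by apply/funext => x; apply: Int_eq => y; rewrite KE.
move=> mE E; split; first exact: mE.
have ie (F : gidx d -> 'rV[R]_d -> R) : (forall j, mfun (F j)) ->
   (forall j x, `|F j x| <= amp d k) -> forall j, intg (fun y => u y * F j y).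
  move=> mF FB j; apply: (intg_eq (fun x => mulrC (F j x) (u x))).
  exact: intg_bounded_mul (mF j) (FB j) iu.
transitivity (\sum_(z <- s) c z * (Int (fun y => u y * be z y) * Int (fun x => g x * al z x))).
  rewrite [RHS]big_allpairs; apply: eq_bigr => j _.
  rewrite !big_cons big_nil /c /al /be /kterm /=.
  rewrite (kap_Int K j (ie _ mfun_ec ec_le)) (kap_Int K j (ie _ mfun_es es_le)).
  rewrite -!/(bc _) -!/(bs _); case: (re) => /=;
  rewrite -/(bc u) -/(bs u) -/(bc g j) -/(bs g j) /bc /bs; ring.
rewrite E; apply: Int_eq => x; congr (_ * _); apply: Int_eq => y; by rewrite KE.
Qed.

Lemma ktarget_bound re x y M L K : knorm K <= 9 -> (L <= M)%N ->
  `|ktarget re x y M L K| <= (h^-1 * ((2 * L).+1%:R * 9 * (9 * cT R))) ^+ d.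
Proof.
move=> K9 LM; have h1 : 0 <= h^-1 by rewrite invr_ge0 ltW// hk_gt0.
set A := _ * _; have A0 : 0 <= A by rewrite mulr_ge0// !mulr_ge0// cT_ge0.
case: re; last by rewrite normr0 exprn_ge0.
rewrite /ktarget normr_prod -[in leRHS](card_ord d) -prodr_const.
apply: ler_prod => i _; rewrite normr_ge0 /= normrM ger0_norm// ler_wpM2l//.
exact: kerM_bound.
Qed.

Lemma cvg_prodr (T : Type) (r : seq T) (F : T -> nat -> R) (l : T -> R) :
  (forall i, F i @ \oo --> l i) ->
  (fun n => \prod_(i <- r) F i n) @ \oo --> \prod_(i <- r) l i.
Proof.
move=> Fl; elim: r => [|a r IH].
  by rewrite big_nil; under eq_fun do rewrite big_nil; exact: cvg_cst.
rewrite big_cons; under eq_fun do rewrite big_cons.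
by apply: cvgM; [exact: Fl|exact: IH].
Qed.

Definition klimit (re : bool) (x y : 'rV[R]_d) L K : R :=
  if re then \prod_i ker h K L (x 0 i) (y 0 i) else 0.

Lemma ktarget_cvg re x y L K :
  (fun n => ktarget re x y (n + L) L K) @ \oo --> klimit re x y L K.
Proof.
case: re; last exact: cvg_cst.
apply: cvg_prodr => i; rewrite /ker; apply: cvgM; first exact: cvg_cst.
have hn : h != 0 := hk_neq0 k0.
have -> : (x 0 i - y 0 i) / (2 * h) = (x 0 i / h - y 0 i / h) / 2 by field.
exact: kerM_cvg.
Qed.

Lemma mfun_ktarget re x M L K : mfun (fun y => ktarget re x y M L K).
Proof.
case: re; last exact: mfun_cst.
apply: mfun_prod => i; apply: mfunM; first exact: mfun_cst.
apply: (@mfun_comp R d (kerM M L K (x 0 i / h)) (fun y => y 0 i / h)).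
  by apply: continuous_measurable_fun; exact: continuous_kerM.
by apply: mfunM; [exact: mfun_coord|exact: mfun_cst].
Qed.

Definition starget (re : bool) (u g : 'rV[R]_d -> R) : R :=
  if re then 2 ^+ d * Int (fun x => g x * u x) else 0.

(** For fixed [L] the kernels are bounded uniformly in the window, so dominated convergence applies
    first in [y], then in [x]. The dominating constant grows with [L], but the final error does not
    see it. *)
Lemma kterm_cesaro re L K eta u g B B1 : good_inverse K eta -> (0 < L)%N ->
  intg u -> (forall y, `|u y| <= B) -> lipc u B1 -> 0 <= B1 -> intg g ->
  exists2 S : R,
    (fun n => \sum_(j <- boxs d (n + L)) cesd R L j * kterm re K u g j) @ \oo --> S &
    `|S - starget re u g| <= cKd R d * (B + 2 * h * B1) * Int (fun x => `|g x|) *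
      (eta + (Num.sqrt L%:R)^-1).
Proof.
move=> gK L0 iu uB lu B10 ig; have [K9 _ _] := gK.
have mu := intg_mfun iu; have mg := intg_mfun ig.
set A := (h^-1 * ((2 * L).+1%:R * 9 * (9 * cT R))) ^+ d.
have kb n x y : `|ktarget re x y (n + L) L K| <= A.
  by apply: ktarget_bound => //; exact: leq_addl.
have A0 : 0 <= A by exact: le_trans (normr_ge0 _) (kb 0%N 0 0).
have inner x := @Int_dominated R d (fun n y => u y * ktarget re x y (n + L) L K)
  (fun y => u y * klimit re x y L K) (fun y => A * `|u y|)
  (fun n => mfunM mu (mfun_ktarget re x _ L K)) (intgZ A (intg_norm iu)).
have {}inner x : intg (fun y => u y * klimit re x y L K) /\
   (fun n => Int (fun y => u y * ktarget re x y (n + L) L K)) @ \oo -->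
   Int (fun y => u y * klimit re x y L K).
  apply: inner => [y|n y].
    by apply: cvgM; [exact: cvg_cst|exact: ktarget_cvg].
  by rewrite normrM mulrC ler_wpM2r.
have innerB n x : `|Int (fun y => u y * ktarget re x y (n + L) L K)| <= A * Int (fun y => `|u y|).
  rewrite -(IntZ _ (intg_norm iu)); apply: le_norm_Int_dom.
  - exact: mfunM mu (mfun_ktarget _ _ _ _ _).
  - exact: intgZ (intg_norm iu).
  by move=> y; rewrite normrM mulrC ler_wpM2r.
have [iG lG] := @Int_dominated R d
  (fun n x => g x * Int (fun y => u y * ktarget re x y (n + L) L K))
  (fun x => g x * Int (fun y => u y * klimit re x y L K))
  (fun x => A * Int (fun y => `|u y|) * `|g x|)
  (fun n => mfunM mg (kterm_sum re (n + L) L gK iu ig).1)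
  (intgZ _ (intg_norm ig))
  (fun x => cvgM (cvg_cst (g x)) (inner x).2)
  (fun n x => ltac:(by rewrite normrM mulrC ler_wpM2r)).
exists (Int (fun x => g x * Int (fun y => u y * klimit re x y L K))).
  by under eq_fun do rewrite (kterm_sum re _ L gK iu ig).2.
set E := (B + 2 * h * B1).
have r0 : 0 <= (Num.sqrt L%:R : R)^-1 by rewrite invr_ge0 sqrtr_ge0.
have eta0 : 0 <= eta by exact: le_trans (normr_ge0 _) (Qk_theta 0 gK).
have E0 : 0 <= E.
  have := le_trans (normr_ge0 _) (uB 0); have := hk_gt0 k0 => h0 b0.
  by rewrite addr_ge0// !mulr_ge0// ltW.
have n0 : 0 <= Int (fun x => `|g x|) by exact: Int_ge0.
have c0 := cKd_ge0 R d.
case: (re) iG => iG; last first.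
  rewrite (@Int_eq _ _ _ (fun=> 0)); last first.
    by move=> x; rewrite (@Int_eq _ _ _ (fun=> 0)) ?Int0 ?mulr0// => y; rewrite mulr0.
  rewrite Int0 /starget subr0 normr0; apply: mulr_ge0; last exact: addr_ge0.
  by rewrite !mulr_ge0.
have igu : intg (fun x => g x * u x).
  apply: (intg_eq (fun x => mulrC (u x) (g x))); exact: intg_bounded_mul mu uB ig.
rewrite /starget -(IntZ _ igu) -(IntB iG (intgZ _ igu)).
rewrite -mulrA [Int _ * _]mulrC mulrA -(IntZ _ (intg_norm ig)).
apply: le_norm_Int_dom.
- exact: intg_mfun (intgB iG (intgZ _ igu)).
- exact: intgZ (intg_norm ig).
move=> x; rewrite mulrCA -mulrBr normrM mulrC ler_wpM2r// -mulrA.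
by have := @tensor_ker_approx R h eta K L (hk_gt0 k0) gK L0 d u B B1 x mu uB lu B10.
Qed.

End fixed.
End Reconstruction.

(** * Removal of the Cesaro weights and general test functions *)

Section Weak_limit.
Variable R : realType.
Local Notation leb := (@lebesgue_measure R).
Local Notation RT := (measurableTypeR R).

(** The exponential weight of a multi-dimensional shift. Summed against [|kc f|] it gives
    [(knorm K)^(2 d) <= 81^d], as each coordinate carries a position and a frequency shift. *)
Definition kw d (K : seq (R * int)) (f : kidx d K) : R :=
  \prod_i (expR `|(nthK (f i).1).2|%:~R * expR `|(nthK (f i).2).2|%:~R).

Lemma kw_ge1 d K (f : kidx d K) : 1 <= kw f.
Proof.
rewrite /kw; elim/big_rec: _ => // i x _ x1.
by rewrite -[leLHS]mulr1 ler_pM// -[leLHS]mulr1 ler_pM// expR_absz_ge1.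
Qed.

Lemma kc_kw_sum d (K : seq (R * int)) : knorm K <= 9 -> \sum_(f : kidx d K) `|kc f| * kw f <= 81 ^+ d.
Proof.
move=> K9.
have := @kidx_prod R R d K (fun _ p q => `|p.1| * expR `|p.2|%:~R * (`|q.1| * expR `|q.2|%:~R)).
rewrite (eq_bigr (fun=> knorm K ^+ 2)); last first.
  move=> _ _; rewrite expr2 /knorm mulr_suml; apply: eq_bigr => p _.
  by rewrite mulr_sumr.
rewrite prodr_const card_ord => E.
have -> : \sum_(f : kidx d K) `|kc f| * kw f = knorm K ^+ 2 ^+ d.
  rewrite E; apply: eq_bigr => f _; rewrite /kc /kw normr_prod -big_split.
  by apply: eq_bigr => i _; rewrite normrM /=; ring.
have n0 : 0 <= knorm K by apply: sumr_ge0 => p _; rewrite mulr_ge0 ?expR_ge0.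
apply: lerXn2r; rewrite ?nnegrE ?sqr_ge0//.
have : knorm K ^+ 2 <= 9 ^+ 2 by rewrite ler_pXn2r ?nnegrE.
by rewrite expr2; lra.
Qed.

Lemma kc_sum d (K : seq (R * int)) : knorm K <= 9 -> \sum_(f : kidx d K) `|kc f| <= 81 ^+ d.
Proof.
move=> K9; apply: le_trans (kc_kw_sum d K9); apply: ler_sum => f _.
by rewrite ler_peMr// kw_ge1.
Qed.

Lemma kshift_inj d (K : seq (R * int)) (f : kidx d K) : injective (kshift f).
Proof. by move=> [a b] [a' b'] [] /addIr -> /addIr ->. Qed.

(** Cauchy-Schwarz with weights [|kc f|] costs one [81^d]. Moving [W] along a shift costs [kw f],
    which summed against the same weights costs another; shifts are injective on indices. *)
Lemma kap_l2 d K (F W : gidx d -> R) A Cw : knorm K <= 9 -> (forall j, 0 <= W j) -> 0 <= Cw ->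
  (forall (f : kidx d K) j, W j <= Cw * kw f * W (kshift f j)) ->
  sumle (fun j => W j * F j ^+ 2) A ->
  sumle (fun j => W j * kap K F j ^+ 2) (81 ^+ d * (81 ^+ d * Cw * A)).
Proof.
move=> K9 W0 Cw0 hW FA s us; have A0 := sumle_ge0 FA.
have c81 : 0 <= 81 ^+ d :> R by rewrite exprn_ge0.
apply: (@le_trans _ _ (\sum_(j <- s) W j * (81 ^+ d * \sum_(f : kidx d K) `|kc f| * F (kshift f j) ^+ 2))).
  apply: ler_sum => j _; rewrite ler_wpM2l//.
  apply: (@le_trans _ _ ((\sum_(f : kidx d K) `|kc f| * `|F (kshift f j)|) ^+ 2)).
    rewrite -[leLHS]real_normK ?num_real// ler_pXn2r ?nnegrE ?sumr_ge0//.
    apply: (le_trans (ler_norm_sum _ _ _)); apply: ler_sum => f _; by rewrite normrM.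
  apply: (le_trans (weighted_Cauchy _ _ (fun f => normr_ge0 _))).
  apply: ler_pM.
  - by apply: sumr_ge0.
  - by apply: sumr_ge0 => f _; rewrite mulr_ge0 ?sqr_ge0.
  - exact: kc_sum.
  by apply: ler_sum => f _; rewrite real_normK ?num_real.
under eq_bigr do rewrite mulrCA; rewrite -mulr_sumr ler_wpM2l//.
under eq_bigr do rewrite mulr_sumr; rewrite exchange_big /=.
apply: (@le_trans _ _ (\sum_(f : kidx d K) `|kc f| * kw f * (Cw * A))); last first.
  by rewrite -mulr_suml -mulrA ler_wpM2r ?mulr_ge0// kc_kw_sum.
apply: ler_sum => f _; rewrite -mulrA.
under eq_bigr do rewrite mulrCA; rewrite -mulr_sumr ler_wpM2l//.
apply: (@le_trans _ _ (\sum_(j <- s) Cw * kw f * (W (kshift f j) * F (kshift f j) ^+ 2))).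
  by apply: ler_sum => j _; rewrite [leRHS]mulrA ler_wpM2r ?sqr_ge0.
have k0 : 0 <= kw f by exact: le_trans ler01 (kw_ge1 f).
rewrite -mulr_sumr mulrA [kw f * _]mulrC ler_wpM2l ?mulr_ge0//.
exact: (sumle_inj (kshift_inj (f := f)) FA us).
Qed.

Lemma kap_l2_1 d K (F : gidx d -> R) A : knorm K <= 9 ->
  sumle (fun j => F j ^+ 2) A ->
  sumle (fun j => kap K F j ^+ 2) (81 ^+ d * (81 ^+ d * A)).
Proof.
move=> K9 FA; have := @kap_l2 d K F (fun=> 1) A 1 K9 (fun=> ler01) ler01.
rewrite mulr1 => h; apply: (@sumle_le _ _ _ (fun j => 1 * kap K F j ^+ 2)).
  by move=> j; rewrite mul1r.
apply: h => [f j|]; first by rewrite mul1r mulr1 kw_ge1.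
by apply: (sumle_le _ FA) => j; rewrite mul1r.
Qed.

Lemma cesd_bound d L (j : gidx d) : 0 <= cesd R L j <= 1.
Proof.
rewrite /cesd prodr_ge0/=; last by move=> i _; have /andP[] := ces_bound R L (j.2 0 i).
by apply: prodr_ile1 => i *; have /andP[-> ->] := ces_bound R L (j.2 0 i).
Qed.

Lemma boxs_split d M M1 (a : gidx d -> R) : (M1 <= M)%N ->
  \sum_(j <- boxs d M) a j = \sum_(j <- boxs d M1) a j +
    \sum_(j <- [seq j <- boxs d M | j \notin boxs d M1]) a j.
Proof.
move=> M1M; rewrite (bigID (mem (boxs d M1))) /= big_filter; congr (_ + _).
rewrite -big_filter; apply: perm_big; apply: uniq_perm.
- by rewrite filter_uniq ?uniq_boxs.
- exact: uniq_boxs.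
move=> j; rewrite mem_filter /=; case: (boolP (j \in boxs d M1)) => //= h.
by rewrite (boxs_mono M1M h).
Qed.

(** Absolute summability leaves little mass outside a fixed box, and inside it the Cesaro weights
    tend to 1; thus weighted and plain sums agree up to [e] for large boxes. *)
Lemma cesaro_removal d (a : gidx d -> R) A T X eta :
  sumle (fun j => `|a j|) A -> 0 <= X ->
  (forall L, (0 < L)%N -> exists2 S : R,
    (fun n => \sum_(j <- boxs d (n + L)) cesd R L j * a j) @ \oo --> S &
    `|S - T| <= X * (eta + (Num.sqrt L%:R)^-1)) ->
  forall e, 0 < e -> exists M0, forall M, (M0 <= M)%N ->
    `|\sum_(j <- boxs d M) a j - T| <= X * eta + e.
Proof.
move=> aA X0 hS e e0.
have e8 : 0 < e / 8 by lra.
have e4 : 0 < e / 4 by lra.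
have [M1 hM1] := sumle_tail (fun j => normr_ge0 (a j)) aA e8.
have cv : (fun L => \sum_(j <- boxs d M1) (1 - cesd R L j) * `|a j|) @ \oo --> 0.
  rewrite [X in _ --> X](_ : _ = \sum_(j <- boxs d M1) (1 - 1) * `|a j|); last first.
    by rewrite big1// => j _; rewrite subrr mul0r.
  apply: cvg_sumr => j; apply: cvgM; last exact: cvg_cst.
  apply: cvgB; first exact: cvg_cst.
  have -> : (1 : R) = \prod_(i < d) 1 by rewrite big1.
  apply: cvg_prodr => i; exact: ces_cvg.
have [L0 hL0] := sqrt_small X0 e4.
have [L1 _ hL1] : \forall L \near \oo, `|\sum_(j <- boxs d M1) (1 - cesd R L j) * `|a j| | < e / 4.
  by move/cvgr0Pnorm_lt: cv => /(_ _ e4).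
pose L := maxn L0 L1.
have [Lp hL] := hL0 L (leq_maxl _ _).
have [S cS hST] := hS L Lp.
have [N _ hN] : \forall n \near \oo,
    `|S - \sum_(j <- boxs d (n + L)) cesd R L j * a j| < e / 8.
  by move/cvgrPdist_lt: cS => /(_ _ e8).
exists (maxn M1 (N + L)) => M; rewrite geq_max => /andP[M1M NM].
have LM : (L <= M)%N by apply: leq_trans NM; exact: leq_addl.
have NL : (N <= M - L)%N by rewrite leq_subRL// addnC.
have := hN _ NL; rewrite /= subnK// => /ltW h1.
have h2 : `|\sum_(j <- boxs d M) a j - \sum_(j <- boxs d M) cesd R L j * a j| <= e / 4 + e / 8.
  rewrite -sumrB; apply: (le_trans (ler_norm_sum _ _ _)).
  rewrite (boxs_split _ M1M); apply: lerD.
    have := hL1 L (leq_maxr _ _); move=> /ltW; apply: le_trans.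
    rewrite ger0_norm; last first.
      by apply: sumr_ge0 => j _; rewrite mulr_ge0// subr_ge0; have /andP[] := cesd_bound L j.
    apply: ler_sum => j _; rewrite -{1}[a j]mul1r -mulrBl normrM ler_wpM2r//.
    by rewrite ger0_norm// subr_ge0; have /andP[] := cesd_bound L j.
  apply: le_trans (hM1 [seq j <- boxs d M | j \notin boxs d M1] _ _); last 2 first.
  - by rewrite filter_uniq ?uniq_boxs.
  - by move=> j; rewrite mem_filter => /andP[].
  apply: ler_sum => j _; rewrite -{1}[a j]mul1r -mulrBl normrM ler_piMl//.
  have /andP[c1 c2] := cesd_bound L j; rewrite ger0_norm ?subr_ge0//; lra.
set S1 := \sum_(j <- _) a j in h2 *; set S2 := \sum_(j <- _) _ in h1 h2 *.
have -> : S1 - T = (S1 - S2) - (S - S2) + (S - T) by ring.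
have t1 := ler_normD ((S1 - S2) - (S - S2)) (S - T).
have t2 := ler_normB (S1 - S2) (S - S2).
have hX : X * (eta + (Num.sqrt L%:R)^-1) <= X * eta + e / 4 by rewrite mulrDr lerD2l.
lra.
Qed.

(** [kterm_cesaro] needs an integrable test function, while those of the dual frame are only
    square-integrable. Multiplying by ever wider Gaussians bridges the gap. *)
Lemma truncation d (g : 'rV[R]_d -> R) e : sqi g -> 0 < e ->
  exists g', [/\ sqi g', intg g' & Int (fun x => (g x - g' x) ^+ 2) <= e].
Proof.
move=> sg e0; have [mg ig] := sg.
pose E (n : nat) (x : 'rV[R]_d) := \prod_i gs (x 0 i / n.+1%:R).
have E0 n x : 0 <= E n x by apply: prodr_ge0 => i _; exact: gs_ge0.
have E1 n x : E n x <= 1 by apply: prodr_ile1 => i; rewrite gs_ge0 gs_le1.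
have iE n : intg (E n).
  have c0 : (n.+1%:R : R)^-1 != 0 by rewrite invr_eq0 pnatr_eq0.
  have := Int_prod (f := fun _ : 'I_d => fun t : R => gs (n.+1%:R^-1 * t))
    (fun i => integ_scale c0 (@integ_gs R)).
  move=> [h _]; apply: intg_eq h => x; by apply: eq_bigr => i _; rewrite mulrC.
have sE n : sqi (E n).
  split; first exact: intg_mfun.
  apply: (intg_dom _ (iE n)); first exact: mfunX (intg_mfun (iE n)).
  by move=> x; rewrite ger0_norm ?sqr_ge0// expr2 ler_piMr.
have mE n := intg_mfun (iE n).
have cE x : E ^~ x @ \oo --> (1 : R).
  have -> : (1 : R) = \prod_(i < d) 1 by rewrite big1.
  apply: cvg_prodr => i.
  rewrite [X in _ --> X](_ : _ = gs 0); last by rewrite /gs expr0n mulr0 oppr0 expR0.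
  have l0 : (fun n => x 0 i / n.+1%:R) @ \oo --> (0 : R).
    rewrite -[X in _ --> X](mulr0 (x 0 i)); apply: cvgM; first exact: cvg_cst.
    exact: cvg_harmonic.
  exact: (continuous_cvg _ (@continuous_gs R 0) l0).
have lim x : (fun n => (g x - g x * E n x) ^+ 2) @ \oo --> 0.
  have l1 : (fun n => g x - g x * E n x) @ \oo --> g x - g x * 1.
    by apply: cvgB; [exact: cvg_cst|apply: cvgM; [exact: cvg_cst|exact: cE]].
  rewrite mulr1 subrr in l1; rewrite -[X in _ --> X](mulr0 0); exact: cvgM.
have dom n x : `|(g x - g x * E n x) ^+ 2| <= g x ^+ 2.
  have -> : g x - g x * E n x = g x * (1 - E n x) by ring.
  rewrite ger0_norm ?sqr_ge0// exprMn ler_piMr ?sqr_ge0// expr_le1 ?subr_ge0//.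
  by rewrite lerBlDr lerDl.
have [_] := @Int_dominated R d (fun n x => (g x - g x * E n x) ^+ 2) (fun=> 0)
  (fun x => g x ^+ 2) (fun n => mfunX 2 (mfunB mg (mfunM mg (mE n)))) ig lim dom.
rewrite Int0 => /cvgrPdist_le /(_ _ e0) [N _ hN].
have := hN N (leqnn N); rewrite /= sub0r normrN => hN'.
exists (fun x => g x * E N x); split.
- split; first exact: mfunM.
  apply: (intg_dom _ ig); first exact: mfunX (mfunM mg (mE N)).
  move=> x; rewrite ger0_norm ?sqr_ge0// exprMn ler_piMr ?sqr_ge0// expr_le1//.
- exact: sqi_mul.
exact: le_trans (ler_norm _) hN'.
Qed.

Section fixed.
Variables (d : nat) (k : R).
Hypothesis k0 : 0 < k.
Local Notation h := (hk k).

Definition cB : R := bessel_cst d (1 : R).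

Lemma cB_ge0 : 0 <= cB.
Proof. exact: bessel_cst_ge0. Qed.

Lemma bessel_bc (f : 'rV[R]_d -> R) : sqi f -> sumle (fun j => bc k f j ^+ 2) (cB * Int (fun x => f x ^+ 2)).
Proof. by move=> sf; exact: (dual_bessel k0 ler01 (@pone_bound R d)). Qed.

Lemma bessel_bs (f : 'rV[R]_d -> R) : sqi f -> sumle (fun j => bs k f j ^+ 2) (cB * Int (fun x => f x ^+ 2)).
Proof. by move=> sf; exact: (dual_bessel k0 ler01 (@pone_bound R d)). Qed.

Lemma sqi_ec j : sqi (@ec R d k j).
Proof. exact: (sqi_efam k0 ler01 (@pone_bound R d)). Qed.
Lemma sqi_es j : sqi (@es R d k j).
Proof. exact: (sqi_efam k0 ler01 (@pone_bound R d)). Qed.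

Lemma amgm (t a b : R) : 0 < t -> `|a * b| <= (t * a ^+ 2 + t^-1 * b ^+ 2) / 2.
Proof.
move=> t0; rewrite normrM -[a ^+ 2]real_normK ?num_real// -[b ^+ 2]real_normK ?num_real//.
move: `|a| `|b| => x y.
have : 0 <= t * (x - t^-1 * y) ^+ 2 by rewrite mulr_ge0 ?sqr_ge0// ltW.
have -> : t * (x - t^-1 * y) ^+ 2 = t * x ^+ 2 + t^-1 * y ^+ 2 - 2 * (x * y).
  by field; rewrite gt_eqF.
lra.
Qed.

(** The free parameter [t] balances a fixed [u] against a small [g]. *)
Lemma kterm_sumle re K (u g : 'rV[R]_d -> R) t : knorm K <= 9 -> sqi u -> sqi g -> 0 < t ->
  sumle (fun j => `|kterm k re K u g j|)
    (t * (81 ^+ d * (81 ^+ d * (cB * Int (fun x => u x ^+ 2)))) +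
     t^-1 * (cB * Int (fun x => g x ^+ 2))).
Proof.
move=> K9 su sg t0; have tV : 0 < t^-1 by rewrite invr_gt0.
have ku := kap_l2_1 K9 (bessel_bc su); have kv := kap_l2_1 K9 (bessel_bs su).
have S1 := sumleZ (ltW t0) ku; have S2 := sumleZ (ltW t0) kv.
have S3 := sumleZ (ltW tV) (bessel_bc sg); have S4 := sumleZ (ltW tV) (bessel_bs sg).
have h2 : 0 <= 2^-1 :> R by rewrite invr_ge0.
have := sumleZ h2 (sumleD (sumleD S1 S2) (sumleD S3 S4)).
rewrite (_ : 2^-1 * _ = t * (81 ^+ d * (81 ^+ d * (cB * Int (fun x => u x ^+ 2)))) +
     t^-1 * (cB * Int (fun x => g x ^+ 2))); last by field; rewrite gt_eqF.
apply: sumle_le => j; rewrite /kterm.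
have a1 := amgm (kap K (bc k u) j) (bc k g j) t0; have a2 := amgm (kap K (bs k u) j) (bs k g j) t0.
have a3 := amgm (kap K (bc k u) j) (bs k g j) t0; have a4 := amgm (kap K (bs k u) j) (bc k g j) t0.
case: (re).
  by apply: (le_trans (ler_normD _ _)); lra.
by apply: (le_trans (ler_normB _ _)); lra.
Qed.

Lemma bcB (u v : 'rV[R]_d -> R) : sqi u -> sqi v -> forall j, bc k (fun x => u x - v x) j = bc k u j - bc k v j.
Proof.
move=> su sv j; rewrite /bc -IntB; [|exact: sqi_mul su (sqi_ec j)|exact: sqi_mul sv (sqi_ec j)].
by apply: Int_eq => x; ring.
Qed.

Lemma bsB (u v : 'rV[R]_d -> R) : sqi u -> sqi v -> forall j, bs k (fun x => u x - v x) j = bs k u j - bs k v j.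
Proof.
move=> su sv j; rewrite /bs -IntB; [|exact: sqi_mul su (sqi_es j)|exact: sqi_mul sv (sqi_es j)].
by apply: Int_eq => x; ring.
Qed.

(** The error of [kterm_cesaro] contains the [L^1] norm of the truncated test function [g'], so [g']
    is fixed before [eta]. This is possible because the remainder [g - g'] is controlled by
    [knorm K <= 9] alone. *)
Lemma kterm_limit re u g B B1 : intg u -> sqi u -> (forall y, `|u y| <= B) -> lipc u B1 ->
  0 <= B1 -> sqi g -> forall e, 0 < e ->
  exists2 eta0, 0 < eta0 & forall K eta, eta <= eta0 -> good_inverse K eta ->
  exists M0, forall M, (M0 <= M)%N ->
    `|\sum_(j <- boxs d M) kterm k re K u g j - starget re u g| <= e.
Proof.
move=> iu su uB lu B10 sg e e0.
set Nu := Int (fun x => u x ^+ 2); have Nu0 : 0 <= Nu by apply: Int_ge0 => x; exact: sqr_ge0.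
have b0 := cB_ge0; have c2 : 0 <= 2 ^+ d :> R by rewrite exprn_ge0.
set A := 81 ^+ d * (81 ^+ d * cB) + 2 ^+ d.
have c81 : 0 <= 81 ^+ d :> R by rewrite exprn_ge0.
have A0 : 0 <= A by apply: addr_ge0 => //; apply: mulr_ge0 => //; exact: mulr_ge0.
(* With this [t] the part quadratic in [u] costs at most [e / 4]; then [del] is taken so small that
   the part in [g - g'] costs [e / 4] as well. The other two quarters go to [eta] and to
   [cesaro_removal]. *)
pose t := e / (4 * (A * Nu + 1)).
have q1 : 0 < A * Nu + 1 by have := mulr_ge0 A0 Nu0; lra.
have t0 : 0 < t by rewrite divr_gt0// mulr_gt0.
have tA : t * (A * Nu) <= e / 4.
  rewrite /t -mulrA; have -> : (4 * (A * Nu + 1))^-1 * (A * Nu) = 1/4 * ((A * Nu) / (A * Nu + 1)).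
    by field; rewrite gt_eqF.
  have : A * Nu / (A * Nu + 1) <= 1 by rewrite ler_pdivrMr//; lra.
  by move=> /(ler_wpM2l (ltW e0)); lra.
pose q := cB + 2 ^+ d + 1; have q0 : 0 < q by rewrite /q; lra.
pose del := t * e / (4 * q).
have del0 : 0 < del by rewrite divr_gt0// mulr_gt0.
have [g' [sg' ig' hg']] := truncation sg del0.
have sgg := sqiB sg sg'.
set Ng := Int _ in hg'.
have tN : t^-1 * ((cB + 2 ^+ d) * Ng) <= e / 4.
  apply: (@le_trans _ _ (t^-1 * (q * del))).
    rewrite ler_wpM2l ?invr_ge0 ?(ltW t0)// ler_pM// /q; [lra| |lra].
    by apply: Int_ge0 => x; exact: sqr_ge0.
  by rewrite le_eqVlt; apply/orP; left; apply/eqP; rewrite /del; field; rewrite !gt_eqF.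
pose X := cKd R d * (B + 2 * h * B1) * Int (fun x => `|g' x|).
have X0 : 0 <= X.
  have := le_trans (normr_ge0 _) (uB 0); have := hk_gt0 k0 => h0 bb.
  rewrite mulr_ge0 ?Int_ge0// mulr_ge0 ?cKd_ge0// addr_ge0// !mulr_ge0// ltW//.
exists (e / (4 * (X + 1))); first by rewrite divr_gt0// mulr_gt0//; lra.
move=> K eta he gK; have [K9 _ _] := gK.
have Xe : X * eta <= e / 4.
  apply: (@le_trans _ _ (X * (e / (4 * (X + 1))))); first by rewrite ler_wpM2l.
  have x1 : 0 < X + 1 by lra.
  have : X / (X + 1) <= 1 by rewrite ler_pdivrMr//; lra.
  move=> /(ler_wpM2l (ltW e0)) hx.
  have -> : X * (e / (4 * (X + 1))) = 1/4 * (e * (X / (X + 1))) by field; rewrite gt_eqF.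
  lra.
have e4 : 0 < e / 4 by lra.
have [M0 hM0] := @cesaro_removal d (kterm k re K u g') _ (starget re u g') X eta
  (kterm_sumle re K9 su sg' ltr01) X0
    (fun L L0 => @kterm_cesaro R d k k0 re L K eta u g' B B1 gK L0 iu uB lu B10 ig') _ e4.
exists M0 => M /hM0 h1.
have h2 : `|\sum_(j <- boxs d M) kterm k re K u (fun x => g x - g' x) j| <=
    t * (81 ^+ d * (81 ^+ d * (cB * Nu))) + t^-1 * (cB * Ng).
  apply: (le_trans (ler_norm_sum _ _ _)).
  exact: (kterm_sumle re K9 su sgg t0 (uniq_boxs d M)).
have E : \sum_(j <- boxs d M) kterm k re K u g j = \sum_(j <- boxs d M) kterm k re K u g' j +
   \sum_(j <- boxs d M) kterm k re K u (fun x => g x - g' x) j.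
  rewrite -big_split; apply: eq_bigr => j _; rewrite /kterm (bcB sg sg') (bsB sg sg').
  by case: (re) => /=; ring.
have Es : `|starget re u g' - starget re u g| <= t * (2 ^+ d * Nu) + t^-1 * (2 ^+ d * Ng).
  have r0 : 0 <= t * (2 ^+ d * Nu) + t^-1 * (2 ^+ d * Ng).
    have Ng0 : 0 <= Ng by apply: Int_ge0 => x; exact: sqr_ge0.
    have tv : 0 <= t^-1 by rewrite invr_ge0 ltW.
    apply: addr_ge0; first by apply: mulr_ge0; [exact: ltW|exact: mulr_ge0].
    by apply: mulr_ge0 => //; exact: mulr_ge0.
  rewrite /starget; case: (re); last by rewrite subrr normr0.
  rewrite -mulrBr -(IntB (sqi_mul sg' su) (sqi_mul sg su)) normrM ger0_norm//.
  have -> : t * (2 ^+ d * Nu) + t^-1 * (2 ^+ d * Ng) = 2 ^+ d * (t * Nu + t^-1 * Ng) by ring.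
  rewrite ler_wpM2l// -(IntZ _ su.2) -(IntZ _ sgg.2) -(IntD (intgZ _ su.2) (intgZ _ sgg.2)).
  apply: le_norm_Int_dom.
  - exact: mfunB (mfunM sg'.1 su.1) (mfunM sg.1 su.1).
  - exact: intgD (intgZ _ su.2) (intgZ _ sgg.2).
  move=> x; have -> : g' x * u x - g x * u x = - (u x * (g x - g' x)) by ring.
  rewrite normrN; apply: (le_trans (amgm _ _ t0)).
  have := mulr_ge0 (ltW t0) (sqr_ge0 (u x)).
  have : 0 <= t^-1 * (g x - g' x) ^+ 2 by rewrite mulr_ge0 ?sqr_ge0// invr_ge0 ltW.
  lra.
rewrite E; set S1 := \sum_(j <- _) _ in h1 *; set S2 := \sum_(j <- _) _ in h2 *.
have -> : S1 + S2 - starget re u g = (S1 - starget re u g') + S2 + (starget re u g' - starget re u g).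
  by ring.
have t1 := ler_normD ((S1 - starget re u g') + S2) (starget re u g' - starget re u g).
have t2 := ler_normD (S1 - starget re u g') S2.
have E1 : t * (A * Nu) = t * (81 ^+ d * (81 ^+ d * (cB * Nu))) + t * (2 ^+ d * Nu).
  by rewrite /A; ring.
have E2 : t^-1 * ((cB + 2 ^+ d) * Ng) = t^-1 * (cB * Ng) + t^-1 * (2 ^+ d * Ng) by ring.
lra.
Qed.

End fixed.
End Weak_limit.

(** * Schwartz functions and weighted norms *)

Section Schwartz.
Variable R : realType.
Local Notation leb := (@lebesgue_measure R).
Local Notation RT := (measurableTypeR R).

Definition dir d (i : 'I_d) : 'rV[R]_d := delta_mx 0 i.

Lemma dirE d (i j : 'I_d) : dir i 0 j = (j == i)%:R.
Proof. by rewrite mxE eqxx. Qed.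

Lemma line_derive d (f : 'rV[R]_d -> R) x v (t : R) : derivable f (x + t *: v) v ->
  is_derive t 1 (fun s : R => f (x + s *: v)) ('D_v f (x + t *: v)).
Proof.
move=> df.
have E : (fun h : R => h^-1 *: (f (x + (h *: 1 + t) *: v) - f (x + t *: v))) =
    (fun h : R => h^-1 *: (f (h *: v + (x + t *: v)) - f (x + t *: v))).
  apply/funext => h; congr (_ *: (f _ - _)).
  by rewrite scalerDl addrCA [h *: 1]mulr1.
apply: DeriveDef.
  by rewrite /derivable /=; move: df; rewrite /derivable /= -E.
by rewrite /derive /= E.
Qed.

Lemma derivable_line d (f : 'rV[R]_d -> R) x v df :
  is_derive (0 : R) 1 (fun s : R => f (x + s *: v)) df ->
  derivable f x v /\ 'D_v f x = df.
Proof.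
move=> [H <-].
have E : (fun h : R => h^-1 *: (f (x + (h *: 1 + 0) *: v) - f (x + 0 *: v))) =
    (fun h : R => h^-1 *: (f (h *: v + x) - f x)).
  apply/funext => h; rewrite scale0r !addr0; congr (_ *: (f _ - _)).
  by rewrite addrC [h *: 1]mulr1.
split; first by move: H; rewrite /derivable /= E.
by rewrite /derive /= E.
Qed.

(** Derivatives along all lines parallel to one axis reduce the calculus to one variable; no joint
    differentiability is involved. *)
Definition lder d (i : 'I_d) (F G : 'rV[R]_d -> R) := forall x (t : R),
  is_derive t 1 (fun s : R => F (x + s *: dir i)) (G (x + t *: dir i)).

Lemma lder_pd d (i : 'I_d) F G : lder i F G ->
  (forall x, derivable F x (dir i)) /\ pd i F = G.
Proof.
move=> h; have h0 x : derivable F x (dir i) /\ 'D_(dir i) F x = G x.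
  apply: derivable_line; have := h x 0; by rewrite scale0r addr0.
split=> [x|]; first by have [] := h0 x.
by apply/funext => x; have [] := h0 x.
Qed.

Lemma pd_lder d (i : 'I_d) F : (forall x, derivable F x (dir i)) -> lder i F (pd i F).
Proof. by move=> h x t; exact: line_derive. Qed.

Lemma lderD d (i : 'I_d) F G F' G' : lder i F G -> lder i F' G' ->
  lder i (fun x => F x + F' x) (fun x => G x + G' x).
Proof. by move=> h1 h2 x t; apply: is_deriveD; [exact: h1|exact: h2]. Qed.

Lemma lderM d (i : 'I_d) F G F' G' : lder i F G -> lder i F' G' ->
  lder i (fun x => F x * F' x) (fun x => G x * F' x + F x * G' x).
Proof.
move=> h1 h2 x t.
exact: (@is_derive_mul1 R (fun s => F (x + s *: dir i)) (fun s => F' (x + s *: dir i)) t _ _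
  (h1 x t) (h2 x t)).
Qed.

Lemma lder_cst d (i : 'I_d) c : lder i (fun=> c) (fun=> 0).
Proof. by move=> x t; exact: is_derive_cst. Qed.

Lemma lder_coord d (i j : 'I_d) : lder i (fun x => x 0 j) (fun=> (j == i)%:R).
Proof.
move=> x t; rewrite (_ : (fun s : R => _) = (fun s : R => (j == i)%:R * s + x 0 j)).
  exact: is_derive_lin.
by apply/funext => s; rewrite !mxE eqxx /= addrC mulrC.
Qed.

Lemma lderZ d (i : 'I_d) c F G : lder i F G -> lder i (fun x => c * F x) (fun x => c * G x).
Proof.
move=> h; have := lderM (lder_cst i c) h.
by rewrite (_ : (fun x => 0 * F x + c * G x) = (fun x => c * G x))//;
  apply/funext => x; rewrite mul0r add0r.
Qed.

(** A coinduction principle: all iterated derivatives stay in a class that is closed under one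
    derivative, so decay only has to be shown for members of the class. *)
Lemma schwartzR_class d (P : ('rV[R]_d -> R) -> Prop) :
  (forall f j, P f -> exists2 g, lder j f g & P g) ->
  (forall f q, P f -> exists M, forall x, euc x ^+ q * `|f x| <= M) ->
  forall f, P f -> schwartzR f.
Proof.
move=> hd hb f Pf.
have pP g j : P g -> (forall x, derivable g x (dir j)) /\ P (pd j g).
  by move=> Pg; have [g' /lder_pd[h1 ->]] := hd g j Pg.
have Ps s : P (pdw s f) by elim: s => //= j s IH; have [] := pP _ j IH.
split=> [s j x|s q]; last exact: hb.
by have [h _] := pP _ j (Ps s); exact: h.
Qed.

Lemma schwartzR_lder d (f : 'rV[R]_d -> R) j : schwartzR f -> lder j f (pd j f).
Proof. by move=> [h _]; apply: pd_lder => x; exact: (h [::]). Qed.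

Lemma schwartzR_pd d (f : 'rV[R]_d -> R) j : schwartzR f -> schwartzR (pd j f).
Proof.
move=> [h1 h2]; have E s : pdw s (pd j f) = pdw (rcons s j) f by rewrite /pdw foldr_rcons.
by split=> s; rewrite E; [exact: h1|exact: h2].
Qed.

Lemma schwartzR_decay d (f : 'rV[R]_d -> R) q : schwartzR f ->
  exists M, forall x, euc x ^+ q * `|f x| <= M.
Proof. by move=> [_ h]; exact: (h [::]). Qed.

Lemma schwartzRD d (f g : 'rV[R]_d -> R) : schwartzR f -> schwartzR g ->
  schwartzR (fun x => f x + g x).
Proof.
move=> sf sg.
apply: (@schwartzR_class d (fun F => exists f g, [/\ schwartzR f, schwartzR g &
   F = fun x => f x + g x])); last by exists f, g.
  move=> _ j [f' [g' [sf' sg' ->]]].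
  exists (fun x => pd j f' x + pd j g' x); first by apply: lderD; exact: schwartzR_lder.
  by exists (pd j f'), (pd j g'); split => //; exact: schwartzR_pd.
move=> _ q [f' [g' [sf' sg' ->]]].
have [M1 h1] := schwartzR_decay q sf'; have [M2 h2] := schwartzR_decay q sg'.
exists (M1 + M2) => x; apply: le_trans (lerD (h1 x) (h2 x)).
by rewrite -mulrDr ler_wpM2l ?ler_normD// exprn_ge0// sqrtr_ge0.
Qed.

Lemma euc_ge0 d (x : 'rV[R]_d) : 0 <= euc x. Proof. exact: sqrtr_ge0. Qed.

Lemma euc_sqr d (x : 'rV[R]_d) : euc x ^+ 2 = \sum_i x 0 i ^+ 2.
Proof. by rewrite sqr_sqrtr// sumr_ge0// => i _; exact: sqr_ge0. Qed.

Lemma coord_le_euc d (x : 'rV[R]_d) i : `|x 0 i| <= euc x.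
Proof.
rewrite -(@ler_pXn2r R 2) ?nnegrE ?euc_ge0// real_normK ?num_real// euc_sqr.
by rewrite (bigD1 i)//= lerDl sumr_ge0// => j _; exact: sqr_ge0.
Qed.

Lemma schwartzRZ d (f : 'rV[R]_d -> R) c : schwartzR f -> schwartzR (fun x => c * f x).
Proof.
move=> sf; apply: (@schwartzR_class d (fun F => exists2 f, schwartzR f &
   F = fun x => c * f x)); last by exists f.
  move=> _ j [f' sf' ->]; exists (fun x => c * pd j f' x).
    by apply: lderZ; exact: schwartzR_lder.
  by exists (pd j f') => //; exact: schwartzR_pd.
move=> _ q [f' sf' ->]; have [M hM] := schwartzR_decay q sf'.
exists (`|c| * M) => x; rewrite normrM mulrCA ler_wpM2l//.
Qed.

Lemma schwartzR0 d : schwartzR (fun _ : 'rV[R]_d => 0 : R).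
Proof.
apply: (@schwartzR_class d (fun F => F = fun=> 0)) => //.
  by move=> _ j ->; exists (fun=> 0) => //; exact: lder_cst.
by move=> _ q ->; exists 0 => x; rewrite normr0 mulr0.
Qed.

Lemma schwartzRB d (f g : 'rV[R]_d -> R) : schwartzR f -> schwartzR g ->
  schwartzR (fun x => f x - g x).
Proof.
move=> sf sg; have := schwartzRD sf (schwartzRZ (-1) sg).
by under eq_fun do rewrite mulN1r.
Qed.

Lemma schwartzR_sum d (T : Type) (s : seq T) (F : T -> 'rV[R]_d -> R) :
  (forall i, schwartzR (F i)) -> schwartzR (fun x => \sum_(i <- s) F i x).
Proof.
move=> sF; elim: s => [|a s IH].
  by under eq_fun do rewrite big_nil; exact: schwartzR0.
by under eq_fun do rewrite big_cons; exact: schwartzRD.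
Qed.

Lemma schwartzRx d (f : 'rV[R]_d -> R) i : schwartzR f -> schwartzR (fun x => x 0 i * f x).
Proof.
(* Products [x_i g] alone are not stable under differentiation, since the product rule leaves [g]
   behind; adding a Schwartz summand closes the class. *)
move=> sf; apply: (@schwartzR_class d (fun F => exists f g, [/\ schwartzR f, schwartzR g &
   F = fun x => f x + x 0 i * g x])); last first.
  exists (fun=> 0), f; split => //; first exact: schwartzR0.
  by apply/funext => x; rewrite add0r.
  move=> _ q [f' [g' [sf' sg' ->]]].
  have [M1 h1] := schwartzR_decay q sf'; have [M2 h2] := schwartzR_decay q.+1 sg'.
  exists (M1 + M2) => x; apply: le_trans (lerD (h1 x) (h2 x)).
  rewrite exprSr -mulrA -mulrDr ler_wpM2l ?exprn_ge0 ?euc_ge0//.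
  apply: (le_trans (ler_normD _ _)); rewrite lerD2l normrM ler_wpM2r//.
  exact: coord_le_euc.
move=> _ j [f' [g' [sf' sg' ->]]].
exists (fun x => pd j f' x + ((i == j)%:R * g' x + x 0 i * pd j g' x)).
  apply: lderD; first exact: schwartzR_lder.
  by apply: lderM; [exact: lder_coord|exact: schwartzR_lder].
exists (fun x => pd j f' x + (i == j)%:R * g' x), (pd j g'); split.
- by apply: schwartzRD; [exact: schwartzR_pd|exact: schwartzRZ].
- exact: schwartzR_pd.
by apply/funext => x; rewrite addrA.
Qed.

Lemma schwartzR_euc2 d (f : 'rV[R]_d -> R) q : schwartzR f ->
  schwartzR (fun x => euc x ^+ (2 * q) * f x).
Proof.
move=> sf; elim: q => [|q IH].
  by under eq_fun do rewrite muln0 expr0 mul1r.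
have := schwartzR_sum (index_enum 'I_d) (fun i => schwartzRx i (schwartzRx i IH)).
rewrite (_ : (fun x => \sum_i _) = (fun x => euc x ^+ (2 * q.+1) * f x))//.
apply/funext => x; rewrite mulnS exprD euc_sqr !mulr_suml.
by apply: eq_bigr => i _; rewrite mulrA -expr2 mulrA.
Qed.

(** An integrable envelope in product form, so that a slice is again dominated by an envelope. *)
Definition env d (x : 'rV[R]_d) : R := \prod_i (1 + x 0 i ^+ 2)^-1.

Lemma env1_gt0 (t : R) : 0 < (1 + t ^+ 2)^-1.
Proof. by rewrite invr_gt0; have := sqr_ge0 t; lra. Qed.

Lemma env_gt0 d (x : 'rV[R]_d) : 0 < env x.
Proof. by apply: prodr_gt0 => i _; exact: env1_gt0. Qed.

Lemma env1_le1 (t : R) : (1 + t ^+ 2)^-1 <= 1.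
Proof. by rewrite invf_le1; have := sqr_ge0 t; lra. Qed.

Lemma env_le1 d (x : 'rV[R]_d) : env x <= 1.
Proof. by apply: prodr_ile1 => i *; rewrite ltW ?env1_gt0 ?env1_le1. Qed.

Lemma env_rowc d t (y : 'rV[R]_d) : env (rowc t y) = (1 + t ^+ 2)^-1 * env y.
Proof.
rewrite /env big_ord_recl rowc0; congr (_ * _).
by apply: eq_bigr => i _; rewrite rowcS.
Qed.

Lemma intg_env d : intg (@env d).
Proof. by have [] := Int_prod (f := fun _ : 'I_d => fun t : R => (1 + t ^+ 2)^-1)
  (fun i => @integ_oneDsqrV R). Qed.

Lemma schwartzR_env d (f : 'rV[R]_d -> R) : schwartzR f ->
  exists2 M, 0 <= M & forall x, `|f x| <= M * env x.
Proof.
move=> sf; have [M1 h1] := schwartzR_decay 0 sf; have [M2 h2] := schwartzR_decay (2 * d) sf.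
exists (2 ^+ d * (M1 + M2)).
  have := le_trans _ (h1 0); rewrite expr0 mul1r => /(_ 0 (normr_ge0 _)) m1.
  have := le_trans _ (h2 0); move=> /(_ 0 (mulr_ge0 (exprn_ge0 _ (euc_ge0 _)) (normr_ge0 _))) m2.
  by rewrite mulr_ge0 ?exprn_ge0// addr_ge0.
move=> x; have e0 := env_gt0 x; rewrite -ler_pdivrMr// /env -prodfV.
set P := \prod_i _; have e1 := sqr_ge0 (euc x).
have P1 : P <= (1 + euc x ^+ 2) ^+ d.
  have -> : (1 + euc x ^+ 2) ^+ d = \prod_(i < d) (1 + euc x ^+ 2).
    by rewrite prodr_const card_ord.
  apply: ler_prod => i _; rewrite invrK.
  apply/andP; split; first by have := sqr_ge0 (x 0 i); lra.
  by rewrite lerD2l -real_normK ?num_real// ler_pXn2r ?nnegrE ?euc_ge0// coord_le_euc.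
have P2 : (1 + euc x ^+ 2) ^+ d <= 2 ^+ d * (1 + euc x ^+ (2 * d)).
  rewrite exprM; move: (euc x ^+ 2) e1 => y y0.
  have [y1|y1] := leP y 1.
    apply: (@le_trans _ _ (2 ^+ d * 1)).
      by rewrite mulr1; apply: lerXn2r; rewrite ?nnegrE; lra.
    by rewrite ler_wpM2l ?exprn_ge0// lerDl exprn_ge0.
  apply: (@le_trans _ _ ((2 * y) ^+ d)).
    by apply: lerXn2r; rewrite ?nnegrE; lra.
  by rewrite exprMn ler_wpM2l ?exprn_ge0// lerDr.
apply: (@le_trans _ _ (`|f x| * (2 ^+ d * (1 + euc x ^+ (2 * d))))).
  by rewrite ler_wpM2l// (le_trans P1).
have := h1 x; have := h2 x; rewrite expr0 mul1r => a1 a2.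
rewrite mulrCA ler_wpM2l ?exprn_ge0// mulrDr mulr1 [`|f x| * _]mulrC; lra.
Qed.

Lemma lipc_bounded_lder d (F : 'rV[R]_d -> R) (G : 'I_d -> 'rV[R]_d -> R) B :
  (forall i, lder i F (G i)) -> (forall i x, `|G i x| <= B) -> lipc F B.
Proof.
move=> FG GB x y i xy.
have -> : x = y + (x 0 i - y 0 i) *: dir i.
  apply/rowP => j; rewrite mxE mxE dirE; have [->|ji] := eqVneq j i.
    by rewrite mulr1 addrCA subrr addr0.
  by rewrite mulr0 addr0 xy.
set s := x 0 i - y 0 i.
have -> : (y + s *: dir i) 0 i - y 0 i = s by rewrite mxE mxE dirE eqxx mulr1 addrC addKr.
pose f t := F (y + t *: dir i); pose g t := G i (y + t *: dir i).
have fg (t : R) : is_derive t 1 f (g t) by exact: FG.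
have cf : continuous f := is_derive_continuous fg.
have lip (a b : R) : a < b -> `|f b - f a| <= B * `|b - a|.
  move=> ab; have [|c _ ->] := @MVT R f g a b ab (fun t _ => fg t).
    exact: continuous_subspaceT.
  by rewrite normrM ler_wpM2r// GB.
have := lip 0 s; have := lip s 0; rewrite /f scale0r addr0 sub0r normrN subr0 distrC.
by case: (ltgtP s 0) => [s0 h _|s0 _ h|-> _ _]; rewrite ?h// scale0r addr0 subrr !normr0 mulr0.
Qed.

Lemma schwartzR_bounded d (f : 'rV[R]_d -> R) : schwartzR f ->
  exists2 M, 0 <= M & forall x, `|f x| <= M.
Proof.
move=> /schwartzR_env[M M0 hM]; exists M => // x; apply: (le_trans (hM x)).
by rewrite ler_piMr// env_le1.
Qed.

Lemma schwartzR_lipc d (f : 'rV[R]_d -> R) : schwartzR f -> exists2 B, 0 <= B & lipc f B.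
Proof.
move=> sf.
have h i : exists M, 0 <= M /\ forall x, `|pd i f x| <= M.
  by have [M M0 hM] := schwartzR_bounded (schwartzR_pd i sf); exists M.
have [M hM] := choice h; exists (\sum_i M i).
  by apply: sumr_ge0 => i _; have [] := hM i.
apply: (@lipc_bounded_lder d f (fun i => pd i f)) => [i|i x]; first exact: schwartzR_lder.
have [_ /(_ x)/le_trans] := hM i; apply.
by rewrite (bigD1 i)//= lerDl sumr_ge0// => j _; have [] := hM j.
Qed.

Lemma mfun_lim d (F : nat -> 'rV[R]_d -> R) f : (forall n, mfun (F n)) ->
  (forall x, F ^~ x @ \oo --> f x) -> mfun f.
Proof.
by move=> mF Ff; apply: (measurable_fun_cvg mF) => z _; exact: Ff.
Qed.

Lemma mfun_rtail d (f : 'rV[R]_d -> R) : mfun f -> mfun (fun x => f (rtail x)).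
Proof.
move=> mf; rewrite /mfun.
rewrite (_ : _ \o _ = (f \o @evec R d) \o (snd : RT * espace R d -> espace R d)).
  exact: (measurableT_comp mf measurable_snd).
by apply/funext => z /=; rewrite rtail_rowc.
Qed.

Lemma cell_delta (t : R) (s : int) : cell (t - s%:~R) = (s == - Num.floor (1/2 - t))%:R.
Proof.
set n := Num.floor (1/2 - t).
have /andP[n1 n2] := floor_itv (1/2 - t); rewrite -/n in n1 n2.
rewrite cellE; congr (_%:R); congr nat_of_bool.
apply/idP/eqP => [/andP[h1 h2]|->]; last first.
  by move: n2; rewrite intrD rmorphN /= => n2; apply/andP; split; lra.
move: n2; rewrite intrD => n2.
have a1 : (s + n)%:~R < 1%:~R :> R by rewrite intrD; lra.
have a2 : (- 1)%:~R < (s + n)%:~R :> R by rewrite intrD rmorphN /=; lra.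
by move: a1 a2; rewrite !ltr_int; lia.
Qed.

(* Rounding the first coordinate to the grid $n^{-1}\mathbb Z$ makes the function a countable sum of
   tensor products. *)
Lemma mfun_lipc d (f : 'rV[R]_d -> R) B : lipc f B -> mfun f.
Proof.
elim: d f => [|d IH] f lf.
  rewrite (_ : f = fun=> f 0); first exact: mfun_cst.
  by apply/funext => x; rewrite [x]row0E.
pose z (n : nat) (t : R) : int := - Num.floor (1/2 - n.+1%:R * t).
apply: (@mfun_lim _ (fun n x => f (rowc ((z n (x 0 ord0))%:~R / n.+1%:R) (rtail x)))).
  move=> n; apply: (@mfun_lim _ (fun M x => zsum M (fun s =>
    cell (n.+1%:R * x 0 ord0 - s%:~R) * f (rowc (s%:~R / n.+1%:R) (rtail x))))).
    move=> M; apply: mfun_sum => i; apply: mfunM.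
      apply: (@mfun_comp R _ (fun t => cell (n.+1%:R * t - (zi i)%:~R)) (fun x => x 0 ord0)).
        apply: (@measurableT_comp _ _ _ RT RT _ (@cell R)); first exact: measurable_cell.
        apply: measurable_funB; last exact: measurable_cst.
        by apply: measurable_funM; [exact: measurable_cst|exact: measurable_id].
      exact: mfun_coord.
    by apply: (@mfun_rtail d (fun y => f (rowc _ y))); apply: IH; exact: lipc_rowc.
  move=> x; apply: cvg_near_cst; near=> M.
  rewrite (@zsum_eq_delta _ M (z n (x 0 ord0))).
  - by rewrite cell_delta eqxx mul1r.
  - have : (`|z n (x 0%R ord0)|%N <= M)%N by near: M; exact: nbhs_infty_ge.
    by lia.
  by move=> s sz; rewrite cell_delta (negbTE sz) mul0r.
move=> x; rewrite [X in _ --> f X]rowcE.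
have bd n : `|f (rowc (x 0 ord0) (rtail x)) -
    f (rowc ((z n (x 0 ord0))%:~R / n.+1%:R) (rtail x))| <= `|B| * n.+1%:R^-1.
  apply: (le_trans (lipc_rowc0 _ _ _ lf)).
  apply: (@le_trans _ _ (`|B| * `|x 0 ord0 - (z n (x 0 ord0))%:~R / n.+1%:R|)).
    by rewrite ler_wpM2r// ler_norm.
  rewrite ler_wpM2l//; have n0 : 0 < n.+1%:R :> R by rewrite ltr0n.
  rewrite -[leRHS]mul1r ler_pdivlMr// -[X in _ * X]ger0_norm ?(ltW n0)// -normrM.
  rewrite mulrBl divfK ?gt_eqF// mulrC.
  have /andP[h1 h2] := floor_itv (1/2 - n.+1%:R * x 0 ord0).
  rewrite /z rmorphN /= opprK; move: h2; rewrite intrD => h2.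
  by rewrite ler_norml; apply/andP; split; lra.
apply/cvgrPdist_le => e e0; near=> n; apply: (le_trans (bd n)).
have : `| `|B| * n.+1%:R^-1 | <= e.
  near: n; have c : (fun n => `|B| * n.+1%:R^-1) @ \oo --> (0 : R).
    rewrite -[X in _ --> X](mulr0 `|B|); apply: cvgM; [exact: cvg_cst|exact: cvg_harmonic].
  by move/cvgr0Pnorm_le: c; apply.
by apply: le_trans; exact: ler_norm.
Unshelve. all: by end_near. Qed.

(** The definition provides only directional derivatives. Being bounded, they make [f] Lipschitz in
    each coordinate, and this yields measurability. *)
Lemma mfun_schwartz d (f : 'rV[R]_d -> R) : schwartzR f -> mfun f.
Proof. by move=> /schwartzR_lipc[B _]; exact: mfun_lipc. Qed.

Lemma intg_schwartz d (f : 'rV[R]_d -> R) : schwartzR f -> intg f.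
Proof.
move=> sf; have [M M0 hM] := schwartzR_env sf.
exact: intg_dom (mfun_schwartz sf) (intgZ M (@intg_env d)) hM.
Qed.

Lemma sqi_schwartz d (f : 'rV[R]_d -> R) : schwartzR f -> sqi f.
Proof.
move=> sf; split; first exact: mfun_schwartz.
have [M M0 hM] := schwartzR_bounded sf.
apply: (intg_eq (f := fun x => f x * f x)); first by move=> x; rewrite expr2.
exact: intg_bounded_mul (mfun_schwartz sf) hM (intg_schwartz sf).
Qed.

Lemma addZdirE d (x : 'rV[R]_d) s i j : (x + s *: dir i) 0 j = x 0 j + s * (j == i)%:R.
Proof. by rewrite !mxE eqxx. Qed.

Lemma dir_rowc0 d t s (y : 'rV[R]_d) : rowc t y + s *: dir ord0 = rowc (t + s) y.
Proof.
apply/rowP => i; rewrite addZdirE.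
case: (unliftP ord0 i) => [j|] ->; first by rewrite !rowcS /= mulr0 addr0.
by rewrite !rowc0 eqxx mulr1.
Qed.

Lemma dir_rowcS d t s (y : 'rV[R]_d) i :
  rowc t y + s *: dir (lift ord0 i) = rowc t (y + s *: dir i).
Proof.
apply/rowP => j; rewrite addZdirE.
case: (unliftP ord0 j) => [l|] ->; last by rewrite !rowc0 /= mulr0 addr0.
by rewrite !rowcS addZdirE (inj_eq lift_inj).
Qed.

(** If the direction is not the first coordinate, induction applies to every slice. Otherwise Fubini
    in the other order leaves one-dimensional integrals of derivatives, which vanish by decay. *)
Lemma Int_lder0 d i (F G : 'rV[R]_d -> R) C B : lder i F G -> mfun F ->
  (forall x, `|F x| <= C * env x) -> (forall x, `|G x| <= C * env x) -> lipc G B ->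
  Int G = 0.
Proof.
elim: d i F G C => [[]//|d IH] i F G C FG mF FC GC lG.
have C0 (D : nat) (H : 'rV[R]_D -> R) A : (forall x, `|H x| <= A * env x) -> 0 <= A.
  move=> h; have := le_trans (normr_ge0 _) (h 0).
  by rewrite pmulr_lge0// env_gt0.
have iG : intg G := intg_dom (mfun_lipc lG) (intgZ C (@intg_env _)) GC.
have slice (H : 'rV[R]_d.+1 -> R) t : (forall x, `|H x| <= C * env x) ->
   forall y, `|H (rowc t y)| <= C * (1 + t ^+ 2)^-1 * env y.
  by move=> h y; have := h (rowc t y); rewrite env_rowc mulrA.
have igs t : intg (fun y => G (rowc t y)).
  apply: intg_dom (mfun_rowc t (mfun_lipc lG)) (intgZ _ (@intg_env d)) (slice G t GC).
case: (unliftP ord0 i) => [j|] iE.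
  have [_ ->] := Int_rowc iG igs.
  rewrite (_ : (fun t => _) = fun=> 0) ?Rintegral_cst0//; last first.
    apply/funext => t; apply: (IH j (fun y => F (rowc t y)) _ (C * (1 + t ^+ 2)^-1)).
    - move=> y s; have := FG (rowc t y) s; rewrite iE dir_rowcS.
      by rewrite (_ : (fun s => F (rowc t y + s *: dir (lift ord0 j))) =
        (fun s => F (rowc t (y + s *: dir j))))//; apply/funext => s'; rewrite dir_rowcS.
    - exact: mfun_rowc.
    - exact: slice.
    - exact: slice.
    - exact: lipc_rowc.
  by rewrite /Rintegral integral0.
have tb (H : 'rV[R]_d.+1 -> R) y : (forall x, `|H x| <= C * env x) ->
   forall t, `|H (rowc t y)| <= C * env y * (1 + t ^+ 2)^-1.
  by move=> h t; have := h (rowc t y); rewrite env_rowc -mulrA [env y * _]mulrC.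
have cG y : continuous (fun t => G (rowc t y)).
  by apply: (@lip_continuous R _ B) => s t; exact: lipc_rowc0.
have ig1 y : integ (fun t => G (rowc t y)).
  apply: integ_continuous_dom (cG y) _ (tb G y GC).
  by apply: integZ; exact: integ_oneDsqrV.
rewrite (Int_rowc' iG ig1) (@Int_eq _ _ _ (fun=> 0)) ?Int0// => y.
have [l1 l2] := @cvg_decay R (fun t => F (rowc t y)) (C * env y) (tb F y FC).
apply: (@Rintegral_deriv0 R (fun t => F (rowc t y))) => // t.
have := FG (rowc 0 y) t; rewrite iE dir_rowc0 add0r.
by rewrite (_ : (fun s => F (rowc 0 y + s *: dir ord0)) = (fun s => F (rowc s y)))//;
  apply/funext => s; rewrite dir_rowc0 add0r.
Qed.

Lemma lipcM d (f g : 'rV[R]_d -> R) A B A1 B1 : (forall x, `|f x| <= A) -> lipc f A1 ->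
  (forall x, `|g x| <= B) -> lipc g B1 -> lipc (fun x => f x * g x) (A * B1 + A1 * B).
Proof.
move=> fA lf gB lg x y i xy.
have -> : f x * g x - f y * g y = f x * (g x - g y) + (f x - f y) * g y by ring.
apply: (le_trans (ler_normD _ _)); rewrite !normrM mulrDl; apply: lerD.
  by rewrite -mulrA ler_pM// lg.
by rewrite mulrAC ler_pM// lf.
Qed.

Lemma lipcD d (f g : 'rV[R]_d -> R) A1 B1 : lipc f A1 -> lipc g B1 ->
  lipc (fun x => f x + g x) (A1 + B1).
Proof.
move=> lf lg x y i xy; rewrite opprD addrACA mulrDl.
by apply: (le_trans (ler_normD _ _)); rewrite lerD ?lf ?lg.
Qed.

Lemma Int_by_parts d i (f g : 'rV[R]_d -> R) : schwartzR f -> schwartzR g ->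
  Int (fun x => pd i f x * g x) = - Int (fun x => f x * pd i g x).
Proof.
move=> sf sg; have sf' := schwartzR_pd i sf; have sg' := schwartzR_pd i sg.
have [A A0 fA] := schwartzR_bounded sf; have [B B0 gB] := schwartzR_env sg.
have [A' A'0 fA'] := schwartzR_bounded sf'; have [B' B'0 gB'] := schwartzR_env sg'.
have [a a0 la] := schwartzR_lipc sf; have [b b0 lb] := schwartzR_lipc sg.
have [a' a'0 la'] := schwartzR_lipc sf'; have [b' b'0 lb'] := schwartzR_lipc sg'.
have bd (M : R) (H : 'rV[R]_d -> R) : 0 <= M -> (forall x, `|H x| <= M * env x) ->
    forall x, `|H x| <= M.
  by move=> M0 h x; apply: (le_trans (h x)); rewrite ler_piMr// env_le1.
have gb := bd _ _ B0 gB; have gb' := bd _ _ B'0 gB'.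
have i1 := sqi_mul (sqi_schwartz sf') (sqi_schwartz sg).
have i2 := sqi_mul (sqi_schwartz sf) (sqi_schwartz sg').
apply/eqP; rewrite -subr_eq0 opprK -(IntD i1 i2); apply/eqP.
have e0 x : 0 <= env x :> R by exact: ltW (env_gt0 x).
apply: (@Int_lder0 d i (fun x => f x * g x) _ (A * B + A' * B + A * B')).
- exact: lderM (schwartzR_lder i sf) (schwartzR_lder i sg).
- exact: mfunM (mfun_schwartz sf) (mfun_schwartz sg).
- move=> x; rewrite normrM; apply: (@le_trans _ _ (A * (B * env x))); first exact: ler_pM.
  by rewrite mulrA ler_wpM2r// -addrA lerDl addr_ge0// mulr_ge0.
- move=> x; apply: (le_trans (ler_normD _ _)); rewrite !normrM.
  apply: (@le_trans _ _ (A' * (B * env x) + A * (B' * env x))).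
    by apply: lerD; exact: ler_pM.
  by rewrite !mulrA -mulrDl ler_wpM2r// -addrA lerDr mulr_ge0.
exact: lipcD (lipcM fA' la' gb lb) (lipcM fA la gb' lb').
Qed.

End Schwartz.

(** * Families of Gaussians stable under coordinates and derivatives *)

Section Families.
Variable R : realType.

Definition dprof (p : {poly R}) : {poly R} := p^`() - pi%:P * ('X * p).

Lemma is_derive_poly_gh (p : {poly R}) (t : R) :
  is_derive t 1 (fun s => p.[s] * gh s) ((dprof p).[t] * gh t).
Proof.
have H1 := @is_derive_comp1 R expR (fun t => - (pi / 2) * t ^+ 2) t _ _
  (is_derive_expR _) (is_derive_sqr (- (pi / 2)) t).
have H2 : is_derive t 1 (@gh R) (gh t * (- pi * t)).
  rewrite (_ : @gh R = fun x => expR (- (pi / 2) * x ^+ 2)); last first.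
    by apply/funext => x; rewrite /gh mulNr.
  by apply: (is_derive_eq H1); congr (_ * _); field.
have H := is_derive_mul1 (is_derive_poly p t) H2; apply: (is_derive_eq H).
by rewrite /dprof hornerD hornerN !hornerM hornerC hornerX; ring.
Qed.

Definition upd d (P : 'I_d -> {poly R}) (i : 'I_d) (p : {poly R}) : 'I_d -> {poly R} :=
  fun i' => if i' == i then p else P i'.

Section one_frame.
Variables (d : nat) (k : R).
Hypothesis k0 : 0 < k.
Local Notation h := (hk k).

Lemma efam_upd P i p b j (x : 'rV[R]_d) : efam k (upd P i p) b j x =
  amp d k * (p.[sj k j i x] * gh (sj k j i x) *
    \prod_(i' | i' != i) ((P i').[sj k j i' x] * gh (sj k j i' x))) *
  cos (\sum_i' pi * (j.2 0 i')%:~R * sj k j i' x + b).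
Proof.
rewrite /efam (bigD1 i)//= /upd eqxx; congr (_ * (_ * _) * _).
by apply: eq_bigr => i' /negbTE ->.
Qed.

Lemma efam_upd_id P i b j (x : 'rV[R]_d) : efam k P b j x = efam k (upd P i (P i)) b j x.
Proof. by rewrite efam_upd /efam (bigD1 i). Qed.

Lemma efam_coord P b j i (x : 'rV[R]_d) :
  x 0 i * efam k P b j x = h * efam k (upd P i ('X * P i)) b j x + xk k j.1 0 i * efam k P b j x.
Proof.
have xE : x 0 i = h * sj k j i x + xk k j.1 0 i.
  by rewrite /sj mxE -/h; field; exact: hk_neq0.
rewrite {1}xE (efam_upd_id P i b j x) !efam_upd hornerM hornerX; ring.
Qed.

(** Differentiating the envelope changes one profile. Differentiating the phase brings out [k] times
    the momentum and advances the phase by [pi / 2], so the result stays within the families. *)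
Lemma lder_efam P b j i : lder i (efam k P b j : 'rV[R]_d -> R)
  (fun x => h^-1 * efam k (upd P i (dprof (P i))) b j x +
    k * xk k j.2 0 i * efam k P (b + pi / 2) j x).
Proof.
have hn : h != 0 := hk_neq0 k0.
move=> x t.
have sE (s : R) i' : sj k j i' (x + s *: dir R i) = sj k j i' x + (i' == i)%:R * (h^-1 * s).
  by rewrite /sj addZdirE mulrDl; ring.
pose A := amp d k * \prod_(i' | i' != i) ((P i').[sj k j i' x] * gh (sj k j i' x)).
pose a := sj k j i x; pose be := pi * (j.2 0 i)%:~R / h.
pose ga := \sum_i' pi * (j.2 0 i')%:~R * sj k j i' x + b.
have phE (s : R) c : \sum_i' pi * (j.2 0 i')%:~R * sj k j i' (x + s *: dir R i) + (b + c) =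
    be * s + (ga + c).
  rewrite /ga /be !(bigD1 i (P := predT))//= sE eqxx mul1r.
  rewrite (eq_bigr (fun i' => pi * (j.2 0 i')%:~R * sj k j i' x)); first by ring.
  by move=> i' /negbTE ii; rewrite sE ii mul0r addr0.
have prE (s : R) : \prod_(i' | i' != i) ((P i').[sj k j i' (x + s *: dir R i)] *
    gh (sj k j i' (x + s *: dir R i))) = \prod_(i' | i' != i) ((P i').[sj k j i' x] * gh (sj k j i' x)).
  by apply: eq_bigr => i' /negbTE ii; rewrite sE ii mul0r addr0.
have fE : (fun s : R => efam k P b j (x + s *: dir R i)) =
    (fun s : R => A * ((P i).[h^-1 * s + a] * gh (h^-1 * s + a) * cos (be * s + ga))).
  apply/funext => s; rewrite (efam_upd_id P i) efam_upd prE sE eqxx mul1r.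
  have := phE s 0; rewrite !addr0 => ->; rewrite /A /a [h^-1 * s + _]addrC; ring.
rewrite fE.
have H1 := @is_derive_comp1 R (fun s => (P i).[s] * gh s) (fun s => h^-1 * s + a) t _ _
   (is_derive_poly_gh (P i) _) (is_derive_lin h^-1 a t).
have H2 := is_derive_mul1 H1 (is_derive_cosM be ga t).
have H3 := is_derive_mul1 (is_derive_cst A t (1 : R)) H2; apply: (is_derive_eq H3).
rewrite !efam_upd (efam_upd_id P i (b + pi / 2)) efam_upd prE sE eqxx mul1r.
rewrite phE -[X in cos (X + b)]addr0; have := phE t 0; rewrite !addr0 => ->.
have -> : cos (be * t + (ga + pi / 2)) = - sin (be * t + ga).
  by rewrite addrA cosD cos_pihalf sin_pihalf; ring.
have -> : k * xk k j.2 0 i = be.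
  by rewrite mxE -/h /be -(k_hk2 k0); field.
rewrite -[cst A t]/A /A /a [sj k j i x + _]addrC.
by move: (\prod_(i' | i' != i) _) => pr; ring.
Qed.

End one_frame.

(** Serves as stable class in [schwartzR_class]; [k] and [j] are fixed and no uniformity is
    recorded. *)
Inductive espan d (k : R) (j : gidx d) : ('rV[R]_d -> R) -> Prop :=
| espan_efam c P b : espan k j (fun x => c * efam k P b j x)
| espan_add F G : espan k j F -> espan k j G -> espan k j (fun x => F x + G x).

Lemma espanZ d k (j : gidx d) c F : espan k j F -> espan k j (fun x => c * F x).
Proof.
elim=> [c' P b|F' G _ h1 _ h2].
  by under eq_fun do rewrite mulrA; exact: espan_efam.
by under eq_fun do rewrite mulrDr; exact: espan_add.
Qed.

Lemma espan_coord d k (j : gidx d) i F : 0 < k -> espan k j F -> espan k j (fun x => x 0 i * F x).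
Proof.
move=> k0; elim=> [c P b|F' G _ h1 _ h2]; last first.
  by under eq_fun do rewrite mulrDr; exact: espan_add.
under eq_fun do rewrite mulrCA efam_coord// mulrDr.
by apply: espan_add; apply: espanZ; exact: espan_efam.
Qed.

Lemma espan_lder d k (j : gidx d) i F : 0 < k -> espan k j F ->
  exists2 G, lder i F G & espan k j G.
Proof.
move=> k0; elim=> [c P b|F' G' _ [F1 l1 e1] _ [G1 l2 e2]].
  eexists; first by apply: lderZ; exact: lder_efam.
  by apply: espanZ; apply: espan_add; exact: espan_efam.
by exists (fun x => F1 x + G1 x); [exact: lderD|exact: espan_add].
Qed.

Lemma espan_bounded d k (j : gidx d) F : espan k j F -> exists M, forall x, `|F x| <= M.
Proof.
elim=> [c P b|F' G _ [M1 h1] _ [M2 h2]].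
  have [C C0 hC] := profile_bound P; exists (`|c| * (amp d k * C)) => x.
  rewrite normrM ler_wpM2l//; apply: (le_trans (@efam_le R d k P C hC b j x)).
  by rewrite ler_piMr ?mulr_ge0 ?amp_ge0 ?rhom_le1.
by exists (M1 + M2) => x; apply: (le_trans (ler_normD _ _)); exact: lerD.
Qed.

Lemma espan_sum d k (j : gidx d) (T : Type) (s : seq T) F :
  (forall i, espan k j (F i)) -> espan k j (fun x => \sum_(i <- s) F i x).
Proof.
move=> eF; elim: s => [|a s IH]; last by under eq_fun do rewrite big_cons; exact: espan_add.
rewrite (_ : (fun x => _) = fun x : 'rV[R]_d => 0 * efam k (fun=> 0) 0 j x).
  exact: espan_efam.
by apply/funext => x; rewrite big_nil mul0r.
Qed.

Lemma schwartzR_espan d k (j : gidx d) F : 0 < k -> espan k j F -> schwartzR F.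
Proof.
move=> k0; apply: schwartzR_class => [f i|f q]; first exact: espan_lder.
(* Even powers of the norm are polynomials in the coordinates and preserve the span; the power [q]
   then follows from [y <= 1 + y^2]. *)
move=> ef; have e2 : espan k j (fun x => euc x ^+ (2 * q) * f x).
  elim: q => [|q IH]; first by under eq_fun do rewrite muln0 expr0 mul1r.
  rewrite (_ : (fun x => _) = fun x : 'rV[R]_d => \sum_i x 0 i * (x 0 i * (euc x ^+ (2 * q) * f x))).
    by apply: espan_sum => i; do 2 apply: espan_coord => //.
  apply/funext => x; rewrite mulnS exprD euc_sqr !mulr_suml.
  by apply: eq_bigr => i _; rewrite mulrA -expr2 mulrA.
have [M1 h1] := espan_bounded ef; have [M2 h2] := espan_bounded e2.
exists (M1 + M2) => x; apply: (@le_trans _ _ ((1 + euc x ^+ (2 * q)) * `|f x|)).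
  rewrite ler_wpM2r// mulnC exprM; move: (euc x ^+ q) (exprn_ge0 q (euc_ge0 x)) => y y0.
  by have := sqr_ge0 (y - 1); nra.
rewrite mulrDl mul1r lerD//; apply: le_trans (h2 x).
by rewrite normrM ger0_norm// exprn_ge0// euc_ge0.
Qed.

Lemma schwartzR_efam d k (j : gidx d) P b : 0 < k -> schwartzR (efam k P b j : 'rV[R]_d -> R).
Proof.
move=> k0; apply: (schwartzR_espan k0 (j := j)).
rewrite (_ : efam k P b j = fun x => 1 * efam k P b j x); first exact: espan_efam.
by apply/funext => x; rewrite mul1r.
Qed.

Definition wt d (k : R) (j : gidx d) : R :=
  1 + \sum_i xk k j.1 0 i ^+ 2 + \sum_i xk k j.2 0 i ^+ 2.

Lemma wt_ge1 d k (j : gidx d) : 1 <= wt k j.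
Proof. by rewrite /wt -addrA lerDl addr_ge0// sumr_ge0// => i _; exact: sqr_ge0. Qed.

Lemma wt_ge0 d k (j : gidx d) : 0 <= wt k j.
Proof. exact: le_trans ler01 (wt_ge1 k j). Qed.

Lemma xk_le_wt d k (j : gidx d) i :
  `|xk k j.1 0 i| <= Num.sqrt (wt k j) /\ `|xk k j.2 0 i| <= Num.sqrt (wt k j).
Proof.
have s1 : 0 <= \sum_i xk k j.1 0 i ^+ 2 by apply: sumr_ge0 => i' _; exact: sqr_ge0.
have s2 : 0 <= \sum_i xk k j.2 0 i ^+ 2 by apply: sumr_ge0 => i' _; exact: sqr_ge0.
split; rewrite -sqrtr_sqr ler_wsqrtr// /wt.
  have : xk k j.1 0 i ^+ 2 <= \sum_i xk k j.1 0 i ^+ 2; last by lra.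
  by rewrite (bigD1 i)//= lerDl sumr_ge0// => i' _; exact: sqr_ge0.
have : xk k j.2 0 i ^+ 2 <= \sum_i xk k j.2 0 i ^+ 2; last by lra.
by rewrite (bigD1 i)//= lerDl sumr_ge0// => i' _; exact: sqr_ge0.
Qed.

(* [fam d l F]: [F k] is a combination of Gaussian families whose coefficients grow like the
   [l]-th power of the phase space distance, uniformly in [k]. *)
Inductive fam d : nat -> (R -> gidx d -> 'rV[R]_d -> R) -> Prop :=
| fam_efam l (om : R -> gidx d -> R) P b C :
    (forall k j, 1 <= k -> `|om k j| <= C * Num.sqrt (wt k j) ^+ l) ->
    fam l (fun k j x => om k j * efam k P b j x)
| fam_add l F G : fam l F -> fam l G -> fam l (fun k j x => F k j x + G k j x).

Lemma fam_scale d l (F : R -> gidx d -> 'rV[R]_d -> R) n (om : R -> gidx d -> R) C : fam l F ->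
  (forall k j, 1 <= k -> `|om k j| <= C * Num.sqrt (wt k j) ^+ n) ->
  fam (n + l) (fun k j x => om k j * F k j x).
Proof.
move=> fF ho; elim: fF => [l' om' P b C' h'|l' F' G _ h1 _ h2].
  rewrite (_ : (fun k j x => _) = (fun k j x => (om k j * om' k j) * efam k P b j x)).
    apply: (@fam_efam _ _ (fun k j => om k j * om' k j) P b (C * C')) => k j k1.
    by rewrite normrM exprD mulrACA ler_pM ?ho ?h'.
  by apply/funext => k; apply/funext => j; apply/funext => x; rewrite mulrA.
rewrite (_ : (fun k j x => _) = (fun k j x => om k j * F' k j x + om k j * G k j x)).
  exact: fam_add.
by apply/funext => k; apply/funext => j; apply/funext => x; rewrite mulrDr.
Qed.

Lemma hk_le2 (k : R) : 1 <= k -> hk k <= 2.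
Proof.
move=> k1; have k0 : 0 < k by lra.
rewrite -(@ler_pXn2r R 2) ?nnegrE ?sqrtr_ge0// sqr_sqrtr; last first.
  by rewrite divr_ge0 ?pi_ge0// ltW.
rewrite ler_pdivrMr//; have /andP[_ p2] := @pihalf_02 R; nra.
Qed.

Lemma sqrt_wt_ge1 d k (j : gidx d) : 1 <= Num.sqrt (wt k j).
Proof. by rewrite -[leLHS]sqrtr1 ler_wsqrtr// wt_ge1. Qed.

Lemma fam_coord d l (F : R -> gidx d -> 'rV[R]_d -> R) i : fam l F ->
  exists2 G, fam l.+1 G & forall k j (x : 'rV[R]_d), 1 <= k -> x 0 i * F k j x = G k j x.
Proof.
elim=> [l' om P b C ho|l' F' G _ [F1 f1 e1] _ [G1 g1 e2]]; last first.
  exists (fun k j x => F1 k j x + G1 k j x); first exact: fam_add.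
  by move=> k j x k1; rewrite mulrDr e1// e2.
have fP Q : fam l' (fun k j x => om k j * efam k Q b j x) by exact: (fam_efam Q b ho).
exists (fun k j x => hk k * (om k j * efam k (upd P i ('X * P i)) b j x) +
    xk k j.1 0 i * (om k j * efam k P b j x)).
  apply: fam_add.
    apply: (@fam_scale _ _ _ 1 (fun k _ => hk k) 2 (fP _)) => k j k1.
    rewrite ger0_norm ?sqrtr_ge0// expr1; have := hk_le2 k1; have := sqrt_wt_ge1 k j; lra.
  apply: (@fam_scale _ _ _ 1 (fun k j => xk k j.1 0 i) 1 (fP _)) => k j k1.
  by rewrite mul1r expr1; have [] := xk_le_wt k j i.
move=> k j x k1; have k0 : 0 < k by lra.
by rewrite mulrCA (efam_coord k0) mulrDr; ring.
Qed.

(** The factor [k] pulled out of each derivative is the one compensated in the norm. What remains is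
    uniform in [k >= 1]: since [h^-1 = k (h / pi)], the profile term keeps only [h / pi], and the
    phase term keeps the momentum. *)
Lemma fam_lder d l (F : R -> gidx d -> 'rV[R]_d -> R) i : fam l F ->
  exists2 G, fam l.+1 G & forall k j, 1 <= k -> lder i (F k j) (fun x => k * G k j x).
Proof.
elim=> [l' om P b C ho|l' F' G _ [F1 f1 e1] _ [G1 g1 e2]]; last first.
  exists (fun k j x => F1 k j x + G1 k j x); first exact: fam_add.
  move=> k j k1; have := lderD (e1 k j k1) (e2 k j k1).
  rewrite (_ : (fun x => k * F1 k j x + k * G1 k j x) = (fun x => k * (F1 k j x + G1 k j x)))//.
  by apply/funext => x; rewrite mulrDr.
have fP Q b' : fam l' (fun k j x => om k j * efam k Q b' j x) by exact: (fam_efam Q b' ho).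
exists (fun k j x => hk k / pi * (om k j * efam k (upd P i (dprof (P i))) b j x) +
    xk k j.2 0 i * (om k j * efam k P (b + pi / 2) j x)).
  apply: fam_add.
    apply: (@fam_scale _ _ _ 1 (fun k _ => hk k / pi) 1 (fP _ _)) => k j k1.
    rewrite ger0_norm ?divr_ge0 ?sqrtr_ge0 ?pi_ge0// expr1 mul1r ler_pdivrMr ?pi_gt0//.
    have := hk_le2 k1; have := sqrt_wt_ge1 k j; have := pi_ge2 R; nra.
  apply: (@fam_scale _ _ _ 1 (fun k j => xk k j.2 0 i) 1 (fP _ _)) => k j k1.
  by rewrite mul1r expr1; have [] := xk_le_wt k j i.
move=> k j k1; have k0 : 0 < k by lra.
have H := lderZ (om k j) (lder_efam k0 P b j i).
have E : (fun x => om k j * ((hk k)^-1 * efam k (upd P i (dprof (P i))) b j x +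
    k * xk k j.2 0 i * efam k P (b + pi / 2) j x)) =
  (fun x => k * (hk k / pi * (om k j * efam k (upd P i (dprof (P i))) b j x) +
    xk k j.2 0 i * (om k j * efam k P (b + pi / 2) j x))).
  apply/funext => x; have hn := hk_neq0 k0.
  have -> : (hk k)^-1 = k * (hk k / pi).
    by rewrite -(k_hk2 k0); field; rewrite hn gt_eqF.
  by move: (efam _ _ _ _ _) (efam _ _ _ _ _) => e1 e2; ring.
by rewrite E in H.
Qed.

Lemma fam_bessel d l (F : R -> gidx d -> 'rV[R]_d -> R) : fam l F ->
  exists2 C, 0 <= C & forall k, 1 <= k -> (forall j, schwartzR (F k j)) /\
  forall M (c : gidx d -> R), Int (fun x => (\sum_(j <- boxs d M) c j * F k j x) ^+ 2) <=
    C * \sum_(j <- boxs d M) c j ^+ 2 * wt k j ^+ l.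
Proof.
elim=> [l' om P b C ho|l' F' G _ [C1 c1 h1] _ [C2 c2 h2]]; last first.
  exists (2 * (C1 + C2)); first by rewrite mulr_ge0// addr_ge0.
  move=> k k1; have [s1 b1] := h1 k k1; have [s2 b2] := h2 k k1; split.
    by move=> j; exact: schwartzRD.
  move=> M c; have q1 : sqi (fun x => \sum_(j <- boxs d M) c j * F' k j x).
    by apply: sqi_sum => j; apply: sqiZ; exact: sqi_schwartz.
  have q2 : sqi (fun x => \sum_(j <- boxs d M) c j * G k j x).
    by apply: sqi_sum => j; apply: sqiZ; exact: sqi_schwartz.
  apply: (@le_trans _ _ (Int (fun x => 2 * (\sum_(j <- boxs d M) c j * F' k j x) ^+ 2 +
     2 * (\sum_(j <- boxs d M) c j * G k j x) ^+ 2))).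
    apply: le_Int.
    - have := (sqiD q1 q2).2; apply: intg_eq => x; rewrite -big_split; congr (_ ^+ _).
      by apply: eq_bigr => j _; rewrite mulrDr.
    - by apply: intgD; apply: intgZ; [exact: q1.2|exact: q2.2].
    move=> x; rewrite (eq_bigr _ (fun j _ => mulrDr (c j) (F' k j x) (G k j x))) big_split /=.
    move: (\sum_(j <- _) _) (\sum_(j <- _) _) => a e; have := sqr_ge0 (a - e); nra.
  rewrite (IntD (intgZ _ q1.2) (intgZ _ q2.2)) (IntZ _ q1.2) (IntZ _ q2.2).
  by have := b1 M c; have := b2 M c; lra.
have [D D0 hD] := profile_bound P; exists (bessel_cst d D * C ^+ 2).
  by rewrite mulr_ge0 ?sqr_ge0// bessel_cst_ge0.
move=> k k1; have k0 : 0 < k by lra.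
split=> [j|M c]; first by apply: schwartzRZ; exact: schwartzR_efam.
have := bessel_box k0 D0 hD M b (fun j => c j * om k j).
rewrite (_ : (fun x => _) = (fun x => (\sum_(j <- boxs d M) c j * (om k j * efam k P b j x)) ^+ 2)).
  move=> h; apply: (le_trans h); rewrite -[leRHS]mulrA ler_wpM2l ?bessel_cst_ge0// mulr_sumr.
  apply: ler_sum => j _; rewrite exprMn [leRHS]mulrCA ler_wpM2l ?sqr_ge0//.
  rewrite -real_normK ?num_real//.
  have -> : C ^+ 2 * wt k j ^+ l' = (C * Num.sqrt (wt k j) ^+ l') ^+ 2.
    by rewrite exprMn -exprM mulnC exprM sqr_sqrtr ?wt_ge0.
  rewrite ler_pXn2r ?nnegrE ?ho//; exact: le_trans (normr_ge0 _) (ho k j k1).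
apply/funext => x; congr (_ ^+ _); apply: eq_bigr => j _; by rewrite mulrA.
Qed.

End Families.

(** * Weighted bounds for synthesis and analysis *)

Section Weighted_bounds.
Variable R : realType.

Section calculus.
Variable d : nat.
Implicit Types f g : 'rV[R]_d -> R.

(** [dmulti] with a variable list instead of the enumeration of all directions, as induction
    requires. *)
Definition pdlist (a : 'I_d -> nat) (s : seq 'I_d) f :=
  foldr (fun j g => iter (a j) (@pd R d j) g) f s.

Lemma schwartzR_iter f i n : schwartzR f -> schwartzR (iter n (@pd R d i) f).
Proof. by move=> sf; elim: n => //= n; exact: schwartzR_pd. Qed.

Lemma schwartzR_pdlist a s f : schwartzR f -> schwartzR (pdlist a s f).
Proof. by move=> sf; elim: s => //= j s; exact: schwartzR_iter. Qed.

Lemma schwartzR_dmulti a f : schwartzR f -> schwartzR (dmulti a f).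
Proof. exact: schwartzR_pdlist. Qed.

Lemma pd_sum (T : Type) (s : seq T) i (c : T -> R) (F : T -> 'rV[R]_d -> R) :
  (forall t, schwartzR (F t)) ->
  pd i (fun x => \sum_(t <- s) c t * F t x) = fun x => \sum_(t <- s) c t * pd i (F t) x.
Proof.
move=> sF; suff H : lder i (fun x => \sum_(t <- s) c t * F t x)
    (fun x => \sum_(t <- s) c t * pd i (F t) x) by have [] := lder_pd H.
elim: s => [|t s IH].
  rewrite (_ : (fun x => _) = fun=> 0); last by apply/funext => x; rewrite big_nil.
  rewrite (_ : (fun x => \sum_(t <- [::]) _) = fun=> 0); last by apply/funext => x; rewrite big_nil.
  exact: lder_cst.
rewrite (_ : (fun x => _) = fun x => c t * F t x + \sum_(t <- s) c t * F t x); last first.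
  by apply/funext => x; rewrite big_cons.
rewrite (_ : (fun x => \sum_(t <- _ :: _) _) =
    fun x => c t * pd i (F t) x + \sum_(t <- s) c t * pd i (F t) x); last first.
  by apply/funext => x; rewrite big_cons.
by apply: lderD IH; apply: lderZ; exact: schwartzR_lder.
Qed.

Lemma iter_pd_sum (T : Type) (s : seq T) i n (c : T -> R) (F : T -> 'rV[R]_d -> R) :
  (forall t, schwartzR (F t)) ->
  iter n (@pd R d i) (fun x => \sum_(t <- s) c t * F t x) =
  fun x => \sum_(t <- s) c t * iter n (@pd R d i) (F t) x.
Proof.
move=> sF; elim: n => //= n ->.
by rewrite pd_sum// => t; exact: schwartzR_iter.
Qed.

Lemma dmulti_sum (T : Type) (s : seq T) a (c : T -> R) (F : T -> 'rV[R]_d -> R) :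
  (forall t, schwartzR (F t)) ->
  dmulti a (fun x => \sum_(t <- s) c t * F t x) =
  fun x => \sum_(t <- s) c t * dmulti a (F t) x.
Proof.
move=> sF; rewrite /dmulti -!/(pdlist _ _ _); elim: (enum 'I_d) => //= j l ->.
by rewrite iter_pd_sum// => t; exact: schwartzR_pdlist.
Qed.

Lemma iter_pdZ i n c f : schwartzR f ->
  iter n (@pd R d i) (fun x => c * f x) = fun x => c * iter n (@pd R d i) f x.
Proof.
move=> sf; have := @iter_pd_sum _ [:: tt] i n (fun=> c) (fun=> f) (fun=> sf).
under eq_fun do rewrite big_seq1; move=> ->.
by apply/funext => x; rewrite big_seq1.
Qed.

Lemma fam_iter l F i n : @fam R d l F ->
  exists2 G, fam (n + l) G & forall k j, 1 <= k ->
    iter n (@pd R d i) (F k j) = fun x => k ^+ n * G k j x.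
Proof.
move=> fF; elim: n => [|n [G fG hG]].
  exists F => // k j _; by apply/funext => x; rewrite expr0 mul1r.
have [G1 f1 h1] := fam_lder i fG; exists G1 => // k j k1.
rewrite /= hG//; have [_ ->] := lder_pd (lderZ (k ^+ n) (h1 k j k1)).
by apply/funext => x; rewrite exprSr mulrA.
Qed.

Lemma fam_schwartz l F k j : @fam R d l F -> 1 <= k -> schwartzR (F k j).
Proof. by move=> /fam_bessel[C C0 h] k1; have [] := h k k1. Qed.

Lemma fam_dmulti l F a : @fam R d l F ->
  exists2 G, fam (\sum_i a i + l)%N G & forall k j, 1 <= k ->
    dmulti a (F k j) = fun x => k ^+ (\sum_i a i)%N * G k j x.
Proof.
move=> fF; rewrite /dmulti.
have -> : (\sum_i a i)%N = (\sum_(i <- enum 'I_d) a i)%N by rewrite big_enum.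
elim: (enum 'I_d) => [|i s [G fG hG]] /=.
  exists F; first by rewrite big_nil.
  by move=> k j _; apply/funext => x; rewrite big_nil expr0 mul1r.
have [G1 f1 h1] := fam_iter i (a i) fG; exists G1; first by rewrite big_cons -addnA.
move=> k j k1; rewrite hG// iter_pdZ; last exact: fam_schwartz fG k1.
by rewrite h1//; apply/funext => x; rewrite big_cons exprD mulrA [k ^+ _ * k ^+ _]mulrC.
Qed.

Lemma fam_coordX l F i n : @fam R d l F ->
  exists2 G, fam (n + l) G & forall k j (x : 'rV[R]_d), 1 <= k -> x 0 i ^+ n * F k j x = G k j x.
Proof.
move=> fF; elim: n => [|n [G fG hG]].
  by exists F => // k j x _; rewrite expr0 mul1r.
have [G1 f1 h1] := fam_coord i fG; exists G1 => // k j x k1.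
by rewrite exprS -mulrA hG// h1.
Qed.

Definition hterm (k : R) (a : 'I_d -> nat) q f : R :=
  Int (fun x => (euc x ^+ q * dmulti a f x) ^+ 2).

Definition hs (k : R) (p : nat) f : R :=
  \sum_(a : {ffun 'I_d -> 'I_p.+1} | (mlen a <= p)%N)
    \sum_(q < (p - mlen a).+1) k ^- (2 * mlen a) * hterm k (fun j => a j : nat) q f.

Lemma hterm_ge0 k a q f : 0 <= hterm k a q f.
Proof. by apply: Int_ge0 => x; exact: sqr_ge0. Qed.

Lemma hs_summand_ge0 k p (a : {ffun 'I_d -> 'I_p.+1}) q f : 1 <= k ->
  0 <= k ^- (2 * mlen a) * hterm k (fun j => a j : nat) q f.
Proof.
by move=> k1; rewrite mulr_ge0 ?hterm_ge0// invr_ge0 exprn_ge0//; lra.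
Qed.

Lemma hs_ge0 k p f : 1 <= k -> 0 <= hs k p f.
Proof.
by move=> k1; apply: sumr_ge0 => a _; apply: sumr_ge0 => q _; exact: hs_summand_ge0.
Qed.

Lemma hterm_le_hs k p (a : {ffun 'I_d -> 'I_p.+1}) q f : 1 <= k -> (mlen a + q <= p)%N ->
  k ^- (2 * mlen a) * hterm k (fun j => a j : nat) q f <= hs k p f.
Proof.
move=> k1 aq; have ap : (mlen a <= p)%N by apply: leq_trans aq; exact: leq_addr.
have qp : (q < (p - mlen a).+1)%N by rewrite ltnS leq_subRL.
rewrite /hs (bigD1 a)//= (bigD1 (Ordinal qp))//= -addrA lerDl addr_ge0//.
  by apply: sumr_ge0 => i _; exact: hs_summand_ge0.
by apply: sumr_ge0 => b _; apply: sumr_ge0 => i _; exact: hs_summand_ge0.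
Qed.

Lemma sqi_euc q f : schwartzR f -> sqi (fun x => euc x ^+ q * f x).
Proof.
move=> sf; have m : mfun (fun x : 'rV[R]_d => euc x).
  apply: (@mfun_lipc R d _ 1) => x y i xy; rewrite mul1r.
  wlog : x y xy / euc y <= euc x.
    move=> h; have [/h|/ltW h'] := leP (euc y) (euc x); first exact.
    by rewrite distrC [leRHS]distrC; apply: h => // l li; rewrite xy.
  move=> yx; rewrite ger0_norm ?subr_ge0//.
  have [x0|x0] := eqVneq (euc x) 0.
    have -> : euc y = 0 by apply/eqP; rewrite eq_le euc_ge0 -x0 yx.
    by rewrite x0 subrr.
  have xp : 0 < euc x by rewrite lt_neqAle eq_sym x0 euc_ge0.
  rewrite lerBlDr; rewrite -(@ler_pXn2r R 2) ?nnegrE ?euc_ge0 ?addr_ge0 ?euc_ge0//.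
  rewrite sqrrD !euc_sqr (bigD1 i)//= [\sum_i y 0 i ^+ 2](bigD1 i)//=.
  rewrite (eq_bigr (fun l => y 0 l ^+ 2)); last by move=> l li; rewrite xy.
  rewrite addrA lerD2r real_normK ?num_real//.
  have := coord_le_euc y i; have := ler_norm (x 0 i - y 0 i).
  set u := `|x 0 i - y 0 i|; have u0 : 0 <= u by exact: normr_ge0.
  have e0 := euc_ge0 y; rewrite ler_norml => h1 /andP[h2 h3].
  have : (x 0 i) ^+ 2 = (x 0 i - y 0 i) ^+ 2 + 2 * (x 0 i - y 0 i) * y 0 i + y 0 i ^+ 2 by ring.
  have : (x 0 i - y 0 i) * y 0 i <= u * euc y.
    apply: (le_trans (ler_norm _)); rewrite normrM ler_wpM2l// coord_le_euc//.
  by move=> h4 ->; rewrite mulr2n; lra.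
split; first by apply: mfunM; [exact: mfunX|exact: mfun_schwartz].
(* Odd powers of the norm are not smooth, so the square is written as the product of [|x|^(2 q) f]
   and [f]. *)
have := sqi_mul (sqi_schwartz (schwartzR_euc2 q sf)) (sqi_schwartz sf).
by apply: intg_eq => x; rewrite mulnC exprM exprMn; ring.
Qed.

(** The sum is at most its length times its largest term, whose power is one of the summands on the
    right. *)
Lemma pow_sum_le (T : Type) (s : seq T) (y : T -> R) q : (0 < size s)%N -> (forall i, 0 <= y i) ->
  (\sum_(i <- s) y i) ^+ q <= (size s)%:R ^+ q * \sum_(i <- s) y i ^+ q.
Proof.
move=> s0 y0.
have [i0 h1 h2] : exists2 i0, \sum_(i <- s) y i <= (size s)%:R * y i0 &
    y i0 ^+ q <= \sum_(i <- s) y i ^+ q.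
  case: s s0 => // a s _; elim: s a => [|b s IH] a.
    by exists a; rewrite big_seq1 ?mul1r.
  have [i0 h1 h2] := IH b.
  have p0 : 0 <= \sum_(i <- b :: s) y i ^+ q by apply: sumr_ge0 => i _; exact: exprn_ge0.
  have sz : (size [:: a, b & s])%:R = 1 + (size (b :: s))%:R :> R by rewrite /= -natr1 addrC.
  have [ai|ia] := leP (y a) (y i0).
    exists i0; first by rewrite big_cons sz mulrDl mul1r lerD.
    by apply: (le_trans h2); rewrite [leRHS]big_cons lerDr exprn_ge0.
  exists a; last by rewrite [leRHS]big_cons lerDl.
  rewrite big_cons sz mulrDl mul1r lerD2l; apply: (le_trans h1).
  by rewrite ler_wpM2l// ltW.
apply: (@le_trans _ _ (((size s)%:R * y i0) ^+ q)).
  by apply: lerXn2r; rewrite ?nnegrE ?sumr_ge0 ?mulr_ge0.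
by rewrite exprMn ler_wpM2l// exprn_ge0.
Qed.

Lemma euc_pow_le q (x : 'rV[R]_d) : (0 < d)%N ->
  euc x ^+ (2 * q) <= d%:R ^+ q * \sum_i (x 0 i ^+ q) ^+ 2.
Proof.
move=> d0; rewrite exprM euc_sqr.
have := @pow_sum_le _ (index_enum 'I_d) (fun i => x 0 i ^+ 2) q _ (fun i => sqr_ge0 _).
have -> : size (index_enum 'I_d) = d by rewrite /index_enum -enumT size_enum_ord.
move=> /(_ d0) h; apply: (le_trans h); rewrite le_eqVlt; apply/orP; left; apply/eqP.
by congr (_ * _); apply: eq_bigr => i _; rewrite -!exprM mulnC.
Qed.

End calculus.

Section synthesis.
Variable d : nat.
Hypothesis d0 : (0 < d)%N.

(** Each derivative and each coordinate costs one power of the phase space distance, [p] in all, and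
    the powers of [k] from the derivatives cancel against the prefactor. The Bessel bound for the
    resulting family concludes. *)
Lemma fam_hterm_bound F a q p : @fam R d 0 F -> (\sum_i a i + q <= p)%N ->
  exists2 C, 0 <= C & forall k, 1 <= k -> forall M (c : gidx d -> R),
    k ^- (2 * \sum_i a i) * hterm k a q (fun x => \sum_(j <- boxs d M) c j * F k j x) <=
    C * \sum_(j <- boxs d M) c j ^+ 2 * wt k j ^+ p.
Proof.
move=> fF aq; set A := (\sum_i a i)%N.
have [G fG hG] := fam_dmulti a fF; rewrite -/A in hG.
have h i : exists Gi, fam (q + (A + 0)) Gi /\
    forall k j (x : 'rV[R]_d), 1 <= k -> x 0 i ^+ q * G k j x = Gi k j x.
  by have [Gi ? ?] := fam_coordX i q fG; exists Gi.
have [Gs hGs] := choice h.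
have h2 i : exists C : R, 0 <= C /\ forall k, 1 <= k -> forall M (c : gidx d -> R),
   Int (fun x => (\sum_(j <- boxs d M) c j * Gs i k j x) ^+ 2) <=
    C * \sum_(j <- boxs d M) c j ^+ 2 * wt k j ^+ (q + (A + 0)).
  have [fi _] := hGs i; have [C C0 hC] := fam_bessel fi.
  by exists C; split => // k k1; have [] := hC k k1.
have [Cs hCs] := choice h2.
exists (d%:R ^+ q * \sum_i Cs i).
  by rewrite mulr_ge0 ?exprn_ge0// sumr_ge0// => i _; have [] := hCs i.
move=> k k1 M c; have k0 : 0 < k by lra.
have sF j : schwartzR (F k j) := fam_schwartz j fF k1.
pose S (i : 'I_d) x := \sum_(j <- boxs d M) c j * Gs i k j x.
have sS i : sqi (S i).
  apply: sqi_sum => j; apply: sqiZ; apply: sqi_schwartz.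
  by have [fi _] := hGs i; exact: fam_schwartz fi k1.
have E x : (euc x ^+ q * dmulti a (fun x => \sum_(j <- boxs d M) c j * F k j x) x) ^+ 2 =
    k ^+ (2 * A) * (euc x ^+ (2 * q) * (\sum_(j <- boxs d M) c j * G k j x) ^+ 2).
  rewrite (dmulti_sum _ _ _ sF) (eq_bigr (fun j => k ^+ A * (c j * G k j x))).
    by rewrite -mulr_sumr mulnC exprM (mulnC 2 q) exprM; ring.
  by move=> j _; rewrite hG// mulrCA.
have B x : euc x ^+ (2 * q) * (\sum_(j <- boxs d M) c j * G k j x) ^+ 2 <=
    \sum_i d%:R ^+ q * S i x ^+ 2.
  apply: (@le_trans _ _ (d%:R ^+ q * \sum_i (x 0 i ^+ q) ^+ 2 *
      (\sum_(j <- boxs d M) c j * G k j x) ^+ 2)).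
    by rewrite -mulr_suml mulrA ler_wpM2r ?sqr_ge0// euc_pow_le.
  rewrite mulr_sumr; apply: ler_sum => i _; rewrite -exprMn mulr_sumr /S.
  rewrite (eq_bigr (fun j => c j * Gs i k j x))// => j _.
  by have [_ e] := hGs i; rewrite mulrCA e.
have sD : schwartzR (dmulti a (fun x => \sum_(j <- boxs d M) c j * F k j x)).
  by apply: schwartzR_dmulti; apply: schwartzR_sum => j; exact: schwartzRZ.
have iE := (sqi_euc q sD).2.
have kA : 0 < k ^+ (2 * A) by rewrite exprn_gt0.
have iE' : intg (fun x => euc x ^+ (2 * q) * (\sum_(j <- boxs d M) c j * G k j x) ^+ 2).
  have := intgZ (k ^+ (2 * A))^-1 iE; apply: intg_eq => x.
  by rewrite E mulrA mulVf ?mul1r// gt_eqF.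
rewrite /hterm (Int_eq E) (IntZ _ iE') mulrA mulVf ?gt_eqF// mul1r.
have iS : intg (fun x => \sum_i d%:R ^+ q * S i x ^+ 2).
  by apply: intg_sum => i; apply: intgZ; exact: (sS i).2.
apply: (le_trans (le_Int iE' iS B)).
rewrite Int_sum; last by move=> i; apply: intgZ; exact: (sS i).2.
rewrite -mulrA mulr_suml mulr_sumr; apply: ler_sum => i _.
rewrite (IntZ _ (sS i).2) ler_wpM2l ?exprn_ge0//.
have [C0 hC] := hCs i; apply: (le_trans (hC k k1 M c)); rewrite ler_wpM2l//.
apply: ler_sum => j _; rewrite ler_wpM2l ?sqr_ge0// ler_weXn2l ?wt_ge1//.
by rewrite addn0 addnC.
Qed.

Lemma fam_hs_bound F p : @fam R d 0 F ->
  exists2 C, 0 <= C & forall k, 1 <= k -> forall M (c : gidx d -> R),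
    hs k p (fun x => \sum_(j <- boxs d M) c j * F k j x) <=
    C * \sum_(j <- boxs d M) c j ^+ 2 * wt k j ^+ p.
Proof.
move=> fF.
(* The range of [q] depends on [a]; constants are therefore chosen for all pairs, with value 0
   outside the range. *)
have h (z : {ffun 'I_d -> 'I_p.+1} * nat) : exists C : R, 0 <= C /\
   ((mlen z.1 + z.2 <= p)%N -> forall k, 1 <= k -> forall M (c : gidx d -> R),
    k ^- (2 * mlen z.1) * hterm k (fun i => z.1 i : nat) z.2 (fun x => \sum_(j <- boxs d M) c j * F k j x) <=
    C * \sum_(j <- boxs d M) c j ^+ 2 * wt k j ^+ p).
  have [le|] := boolP (mlen z.1 + z.2 <= p)%N; last by exists 0.
  by have [C C0 hC] := fam_hterm_bound fF le; exists C.
have [C hC] := choice h.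
exists (\sum_(a : {ffun 'I_d -> 'I_p.+1} | (mlen a <= p)%N) \sum_(q < (p - mlen a).+1) C (a, q : nat)).
  by apply: sumr_ge0 => a _; apply: sumr_ge0 => q _; have [] := hC (a, q : nat).
move=> k k1 M c; rewrite mulr_suml; apply: ler_sum => a ap.
rewrite mulr_suml; apply: ler_sum => q _.
have [_] := hC (a, q : nat); apply => //=.
by have := ltn_ord q; rewrite ltnS leq_subRL.
Qed.

End synthesis.

Section analysis.
Variable d : nat.
Hypothesis d0 : (0 < d)%N.

Definition coef k (f : 'rV[R]_d -> R) P b (j : gidx d) : R := Int (fun x => f x * efam k P b j x).

(** Here [z] is one phase space coordinate of the index and [D] the corresponding operator,
    multiplication by [x_i] or [k^-1] times a derivative. Each factor [z] is traded for [D] on [f]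
    plus a change of profile, so profiles and phases stay quantified in the induction. *)
Lemma moment_bound (z : R -> gidx d -> R) (D : R -> ('rV[R]_d -> R) -> 'rV[R]_d -> R) :
  (forall k f, schwartzR f -> schwartzR (D k f)) ->
  (forall P b, exists P2 b1 b2, forall k f j, 1 <= k -> schwartzR f -> exists e c,
    [/\ `|e| <= 1, `|c| <= 2 &
      z k j * coef k f P b j = e * coef k (D k f) P b1 j + c * coef k f P2 b2 j]) ->
  forall q P b, exists2 C, 0 <= C & forall k f, 1 <= k -> schwartzR f ->
    sumle (fun j => (z k j ^+ q * coef k f P b j) ^+ 2)
      (C * \sum_(l < q.+1) Int (fun x => iter l (D k) f x ^+ 2)).
Proof.
move=> sD hz; elim=> [|q IH] P b.
  have [C C0 hC] := profile_bound P; exists (bessel_cst d C); first exact: bessel_cst_ge0.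
  move=> k f k1 sf; have k0 : 0 < k by lra.
  rewrite big_ord1 /=; apply: sumle_le (dual_bessel k0 C0 hC b (sqi_schwartz sf)) => j.
  by rewrite expr0 mul1r.
have [P2 [b1 [b2 h]]] := hz P b.
have [C1 c1 h1] := IH P b1; have [C2 c2 h2] := IH P2 b2.
(* From [(e a + c g)^2 <= 2 e^2 a^2 + 2 c^2 g^2] with [|e| <= 1] and [|c| <= 2]. *)
exists (2 * C1 + 8 * C2); first by rewrite addr_ge0// mulr_ge0.
move=> k f k1 sf; have e2 : 0 <= 2 :> R by []. have e8 : 0 <= 8 :> R by [].
have S1 := sumleZ e2 (h1 k _ k1 (sD k f sf)); have S2 := sumleZ e8 (h2 k f k1 sf).
have Ig l : 0 <= Int (fun x => iter l (D k) f x ^+ 2) by apply: Int_ge0 => x; exact: sqr_ge0.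
have n1 : \sum_(l < q.+1) Int (fun x => iter l (D k) (D k f) x ^+ 2) <=
    \sum_(l < q.+2) Int (fun x => iter l (D k) f x ^+ 2).
  rewrite [leRHS]big_ord_recl -[leLHS]add0r lerD//.
  by apply: ler_sum => l _; rewrite -iterSr.
have n2 : \sum_(l < q.+1) Int (fun x => iter l (D k) f x ^+ 2) <=
    \sum_(l < q.+2) Int (fun x => iter l (D k) f x ^+ 2).
  by rewrite [leRHS]big_ord_recr lerDl.
move=> s us; have := sumleD S1 S2 us.
set N1 := \sum_(l < q.+1) _ in n1 *; set N2 := \sum_(l < q.+1) _ in n2 *.
set N := \sum_(l < q.+2) _ in n1 n2 *.
have m1 : C1 * N1 <= C1 * N by rewrite ler_wpM2l.
have m2 : C2 * N2 <= C2 * N by rewrite ler_wpM2l.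
move=> S; apply: (@le_trans _ _ (2 * (C1 * N1) + 8 * (C2 * N2))); last by lra.
apply: le_trans S; apply: ler_sum => j _.
have [e [c [e1 c1' E1]]] := h k f j k1 sf; rewrite [z k j ^+ q.+1]exprSr -[_ * z k j * _]mulrA E1.
move: (coef _ _ _ _ _) (coef _ _ _ _ _) (z k j ^+ q) => g a y.
have ee : e ^+ 2 <= 1 by rewrite -real_normK ?num_real// expr_le1.
have cc : c ^+ 2 <= 4.
  rewrite -real_normK ?num_real//; have : `|c| ^+ 2 <= 2 ^+ 2 by rewrite ler_pXn2r ?nnegrE.
  by rewrite -[2 ^+ 2]/(2 * 2); lra.
have : (y * (e * a + c * g)) ^+ 2 <= 2 * (e ^+ 2 * (y * a) ^+ 2) + 2 * (c ^+ 2 * (y * g) ^+ 2).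
  have := sqr_ge0 (y * (e * a - c * g)).
  have -> : (y * (e * a + c * g)) ^+ 2 = 2 * (e ^+ 2 * (y * a) ^+ 2) + 2 * (c ^+ 2 * (y * g) ^+ 2) -
    (y * (e * a - c * g)) ^+ 2 by ring.
  by lra.
have : e ^+ 2 * (y * a) ^+ 2 <= 1 * (y * a) ^+ 2 by rewrite ler_wpM2r ?sqr_ge0.
have : c ^+ 2 * (y * g) ^+ 2 <= 4 * (y * g) ^+ 2 by rewrite ler_wpM2r ?sqr_ge0.
lra.
Qed.

Lemma intg_coef k (f : 'rV[R]_d -> R) P b (j : gidx d) : 0 < k -> schwartzR f -> intg (fun x => f x * efam k P b j x).
Proof.
by move=> k0 sf; apply: sqi_mul; apply: sqi_schwartz => //; exact: schwartzR_efam.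
Qed.

Definition mulcoord i (f : 'rV[R]_d -> R) := fun x : 'rV[R]_d => x 0 i * f x.
Definition momentum k i (f : 'rV[R]_d -> R) := fun x : 'rV[R]_d => k^-1 * pd i f x.

Lemma coef_position i P b : exists P2 b1 b2, forall k f (j : gidx d), 1 <= k -> schwartzR f ->
  exists e c, [/\ `|e| <= 1, `|c| <= 2 & xk k j.1 0 i * coef k f P b j =
     e * coef k (mulcoord i f) P b1 j + c * coef k f P2 b2 j].
Proof.
exists (upd P i ('X * P i)), b, b => k f j k1 sf; have k0 : 0 < k by lra.
exists 1, (- hk k); rewrite normr1 normrN ger0_norm ?sqrtr_ge0//; split => //; first exact: hk_le2.
rewrite /coef mul1r (@Int_eq _ _ (fun x => x 0 i * f x * efam k P b j x)
  (fun x => hk k * (f x * efam k (upd P i ('X * P i)) b j x) +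
    xk k j.1 0 i * (f x * efam k P b j x))); last first.
  by move=> x; rewrite mulrAC (efam_coord k0); ring.
rewrite (IntD (intgZ _ (intg_coef _ _ _ k0 sf)) (intgZ _ (intg_coef _ _ _ k0 sf))).
rewrite (IntZ _ (intg_coef _ _ _ k0 sf)) (IntZ _ (intg_coef _ _ _ k0 sf)); ring.
Qed.

Lemma coef_momentum i P b : exists P2 b1 b2, forall k f (j : gidx d), 1 <= k -> schwartzR f ->
  exists e c, [/\ `|e| <= 1, `|c| <= 2 & xk k j.2 0 i * coef k f P b j =
     e * coef k (momentum k i f) P b1 j + c * coef k f P2 b2 j].
Proof.
(* The function to differentiate has phase [b - pi / 2], as its derivative contains the momentum
   times the family of phase [b]. Integration by parts gives [e = -1], and dividing [h^-1] by [k]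
   gives [h / pi]. *)
exists (upd P i (dprof (P i))), (b - pi / 2), (b - pi / 2) => k f j k1 sf; have k0 : 0 < k by lra.
have h0 := hk_gt0 k0; have kn : k != 0 by rewrite gt_eqF.
exists (-1), (- (hk k / pi)); split.
- by rewrite normrN normr1.
- have hp : 0 <= hk k / pi by rewrite divr_ge0 ?pi_ge0// ltW.
  rewrite normrN ger0_norm// ler_pdivrMr ?pi_gt0//.
  by have := hk_le2 k1; have := pi_ge2 R; nra.
have sE := schwartzR_efam j P (b - pi / 2) k0.
have E := Int_by_parts i sf sE.
have [_ pE] := lder_pd (lder_efam k0 P (b - pi / 2) j i).
have i1 := intg_coef (upd P i (dprof (P i))) (b - pi / 2) j k0 sf.
have i2 := intg_coef P b j k0 sf.
have E2 : Int (fun x => f x * pd i (efam k P (b - pi / 2) j) x) =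
   (hk k)^-1 * coef k f (upd P i (dprof (P i))) (b - pi / 2) j + k * xk k j.2 0 i * coef k f P b j.
  rewrite -(IntZ _ i1) -(IntZ _ i2) -(IntD (intgZ _ i1) (intgZ _ i2)).
  by apply: Int_eq => x; rewrite pE subrK; ring.
have E3 : coef k (momentum k i f) P (b - pi / 2) j =
   k^-1 * Int (fun x => pd i f x * efam k P (b - pi / 2) j x).
  rewrite -(IntZ _ (intg_coef _ _ _ k0 (schwartzR_pd i sf))).
  by apply: Int_eq => x; rewrite mulrA.
rewrite E3 E E2.
have -> : (hk k)^-1 = k * (hk k / pi).
  by rewrite -(k_hk2 k0); field; rewrite kn gt_eqF.

move: (coef _ _ _ _ _) (coef _ _ _ _ _) (hk k / pi) (xk _ _ _ _) => a e y xi.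
transitivity (k^-1 * k * (y * a + xi * e) - y * a); last by ring.
by rewrite mulVf//; ring.
Qed.

Lemma iter_coord i l (f : 'rV[R]_d -> R) :
  iter l (mulcoord i) f = fun x => x 0 i ^+ l * f x.
Proof.
elim: l => [|l IH]; first by apply/funext => x; rewrite expr0 mul1r.
by rewrite iterS IH; apply/funext => x; rewrite /mulcoord exprS mulrA.
Qed.

Lemma iter_momentum k i l (f : 'rV[R]_d -> R) : schwartzR f ->
  iter l (momentum k i) f = fun x => k ^- l * iter l (@pd R d i) f x.
Proof.
move=> sf; elim: l => [|l IH]; first by apply/funext => x; rewrite expr0 invr1 mul1r.
have E : pd i _ = _ := iter_pdZ i 1 (k ^- l) (schwartzR_iter i l sf).
rewrite iterS IH /momentum E.
by apply/funext => x; rewrite exprS invfM mulrA.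
Qed.

Definition single p l (lp : (l <= p)%N) (i : 'I_d) : {ffun 'I_d -> 'I_p.+1} :=
  [ffun j => if j == i then Ordinal (n:=p.+1) (m:=l) lp else ord0].

Lemma mlen_single p l (lp : (l <= p)%N) i : mlen (single lp i) = l.
Proof.
rewrite /mlen (bigD1 i)//= ffunE eqxx /= big1 ?addn0// => j /negbTE ji.
by rewrite ffunE ji.
Qed.

Lemma dmulti_single p l (lp : (l <= p)%N) i (f : 'rV[R]_d -> R) :
  dmulti (fun j => single lp i j : nat) f = iter l (@pd R d i) f.
Proof.
rewrite /dmulti.
have E (s : seq 'I_d) : uniq s -> foldr (fun j g => iter (single lp i j) (@pd R d j) g) f s =
    if i \in s then iter l (@pd R d i) f else f.
  elim: s => //= j s IH /andP[js us]; rewrite IH// inE ffunE.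
  rewrite [i == j]eq_sym; have [ji|//] := eqVneq j i.
  by subst j; rewrite (negbTE js).
by rewrite E ?enum_uniq// mem_enum.
Qed.

Lemma dmulti0 p (f : 'rV[R]_d -> R) :
  dmulti (fun j => [ffun _ : 'I_d => ord0 : 'I_p.+1] j : nat) f = f.
Proof.
rewrite /dmulti; elim: (enum 'I_d) => //= j s ->.
by rewrite ffunE.
Qed.

Lemma position_le_hs k q l i (f : 'rV[R]_d -> R) : 1 <= k -> (l <= q)%N -> schwartzR f ->
  Int (fun x => iter l (mulcoord i) f x ^+ 2) <= hs k q f.
Proof.
move=> k1 lq sf.
have m0 : mlen ([ffun=> ord0] : {ffun 'I_d -> 'I_q.+1}) = 0%N.
  by rewrite /mlen big1// => j _; rewrite ffunE.
have := @hterm_le_hs d k q [ffun=> ord0] l f k1; rewrite m0 => /(_ lq).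
apply: le_trans; rewrite muln0 expr0 invr1 mul1r /hterm dmulti0.
have sc : schwartzR (iter l (mulcoord i) f).
  by elim: {lq} l => //= l; exact: schwartzRx.
apply: le_Int; [exact: (sqi_schwartz sc).2|exact: (sqi_euc l sf).2|].
move=> x; rewrite iter_coord !exprMn ler_wpM2r ?sqr_ge0// -real_normK ?num_real//.
rewrite ler_pXn2r ?nnegrE ?exprn_ge0 ?euc_ge0// normrX.
by apply: lerXn2r; rewrite ?nnegrE ?euc_ge0 ?coord_le_euc.
Qed.

Lemma momentum_le_hs k q l i (f : 'rV[R]_d -> R) : 1 <= k -> (l <= q)%N -> schwartzR f ->
  Int (fun x => iter l (momentum k i) f x ^+ 2) <= hs k q f.
Proof.
move=> k1 lq sf.
have := @hterm_le_hs d k q (single lq i) 0 f k1; rewrite mlen_single addn0 => /(_ lq).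
apply: le_trans; rewrite /hterm dmulti_single iter_momentum//.
have sc := schwartzR_iter i l sf.
rewrite le_eqVlt; apply/orP; left; apply/eqP.
rewrite -(IntZ _ (sqi_euc 0 sc).2); apply: Int_eq => x.
by rewrite expr0 mul1r exprMn mulnC exprM exprVn.
Qed.

(** The weight to the power [q] is dominated by 1 plus the [2 q]-th powers of the single phase space
    coordinates, and [moment_bound] moves each of these onto [f]. *)
Lemma coef_weighted P b q : exists2 C, 0 <= C & forall k f, 1 <= k -> schwartzR f ->
  sumle (fun j => wt k j ^+ q * coef k f P b j ^+ 2) (C * hs k q f).
Proof.
have [C1 c1 h1] : exists2 C, 0 <= C & forall k f, 1 <= k -> schwartzR f ->
    sumle (fun j => coef k f P b j ^+ 2) (C * hs k q f).
  have [C C0 hC] := profile_bound P; exists (bessel_cst d C); first exact: bessel_cst_ge0.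
  move=> k f k1 sf s us; have k0 : 0 < k by lra.
  apply: (le_trans (dual_bessel k0 C0 hC b (sqi_schwartz sf) us)).
  rewrite ler_wpM2l ?bessel_cst_ge0//.
  (* The plain squared norm is the position moment of order zero along any coordinate. *)
  pose i0 : 'I_d := Ordinal d0.
  exact: (@position_le_hs k q 0 i0 f k1 (leq0n q) sf).
have hx i : exists C : R, 0 <= C /\ forall k f, 1 <= k -> schwartzR f ->
    sumle (fun j => (xk k j.1 0 i ^+ q * coef k f P b j) ^+ 2) (C * hs k q f).
  have [C C0 hC] := @moment_bound (fun k j => xk k j.1 0 i) (fun _ => mulcoord i)
    (fun _ f => @schwartzRx R d f i) (coef_position i) q P b.
  exists (C * q.+1%:R); split; first by rewrite mulr_ge0.
  move=> k f k1 sf s us; apply: (le_trans (hC k f k1 sf s us)).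
  rewrite -mulrA ler_wpM2l// mulr_natl -[X in _ *+ X](card_ord q.+1) -sumr_const.
  by apply: ler_sum => l _; apply: position_le_hs => //; rewrite -ltnS.
have hxi i : exists C : R, 0 <= C /\ forall k f, 1 <= k -> schwartzR f ->
    sumle (fun j => (xk k j.2 0 i ^+ q * coef k f P b j) ^+ 2) (C * hs k q f).
  have [C C0 hC] := @moment_bound (fun k j => xk k j.2 0 i) (fun k => momentum k i)
    (fun k f sf => schwartzRZ k^-1 (schwartzR_pd i sf)) (coef_momentum i) q P b.
  exists (C * q.+1%:R); split; first by rewrite mulr_ge0.
  move=> k f k1 sf s us; apply: (le_trans (hC k f k1 sf s us)).
  rewrite -mulrA ler_wpM2l// mulr_natl -[X in _ *+ X](card_ord q.+1) -sumr_const.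
  by apply: ler_sum => l _; apply: momentum_le_hs => //; rewrite -ltnS.
have [Cx hCx] := choice hx; have [Cy hCy] := choice hxi.
pose T := 3 ^+ q * (C1 + (d%:R ^+ q * \sum_i Cx i + d%:R ^+ q * \sum_i Cy i)).
have x0 : 0 <= \sum_i Cx i by apply: sumr_ge0 => i _; have [] := hCx i.
have y0 : 0 <= \sum_i Cy i by apply: sumr_ge0 => i _; have [] := hCy i.
exists T; first by rewrite mulr_ge0 ?exprn_ge0// !addr_ge0 ?mulr_ge0 ?exprn_ge0.
move=> k f k1 sf; have dq : 0 <= d%:R ^+ q :> R by rewrite exprn_ge0.
have t3 : 0 <= 3 ^+ q :> R by rewrite exprn_ge0.
have S1 := h1 k f k1 sf.
have S2 := sumleZ dq (sumle_sum (index_enum 'I_d) (fun i => (hCx i).2 k f k1 sf)).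
have S3 := sumleZ dq (sumle_sum (index_enum 'I_d) (fun i => (hCy i).2 k f k1 sf)).
have := sumleZ t3 (sumleD S1 (sumleD S2 S3)).
rewrite (_ : 3 ^+ q * _ = T * hs k q f); last by rewrite /T -!mulr_suml; ring.
apply: sumle_le => j.
pose A := \sum_i xk k j.1 0 i ^+ 2; pose B := \sum_i xk k j.2 0 i ^+ 2.
have A0 : 0 <= A by apply: sumr_ge0 => i _; exact: sqr_ge0.
have B0 : 0 <= B by apply: sumr_ge0 => i _; exact: sqr_ge0.
have w1 : wt k j ^+ q <= 3 ^+ q * (1 + (A ^+ q + B ^+ q)).
  have := @pow_sum_le _ [:: 0; 1; 2]%N (fun n => nth 0 [:: 1; A; B] n) q isT.
  rewrite !big_cons !big_nil /= !addr0 expr1n /wt -/A -/B -addrA; apply.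
  by case=> [|[|[|n]]] //=; rewrite nth_nil.
have pw (v : 'rV[R]_d) : (\sum_i v 0 i ^+ 2) ^+ q <= d%:R ^+ q * \sum_i (v 0 i ^+ q) ^+ 2.
  by rewrite -euc_sqr -exprM; exact: euc_pow_le.
set c := coef k f P b j.
have cc : 0 <= c ^+ 2 by exact: sqr_ge0.
apply: (@le_trans _ _ (3 ^+ q * (1 + (d%:R ^+ q * \sum_i (xk k j.1 0 i ^+ q) ^+ 2 +
   d%:R ^+ q * \sum_i (xk k j.2 0 i ^+ q) ^+ 2)) * c ^+ 2)).
  rewrite ler_wpM2r//; apply: (le_trans w1); rewrite ler_wpM2l// lerD2l.
  by apply: lerD; exact: pw.
rewrite le_eqVlt; apply/orP; left; apply/eqP; rewrite -mulrA; congr (_ * _).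
rewrite !mulrDl mul1r -!mulrA !mulr_suml; congr (_ + (_ * _ + _ * _)).
  by apply: eq_bigr => i _; rewrite exprMn.
by apply: eq_bigr => i _; rewrite exprMn.
Qed.

(** With [n = 2 q], [1 + T^2 <= (1 + T)^2] and [1 + T <= n (1 + T / n) <= n exp(T / n)]. *)
Lemma sqr_exp_bound q : exists2 C : R, 0 <= C & forall T, 0 <= T -> (1 + T ^+ 2) ^+ q <= C * expR T.
Proof.
have [->|q0] := posnP q.
  by exists 1 => // T T0; rewrite expr0 mul1r -expR0 ler_expR.
exists ((2 * q)%:R ^+ (2 * q)); first by rewrite exprn_ge0.
move=> T T0; pose n : R := (2 * q)%:R.
have n1 : 1 <= n by rewrite ler1n muln_gt0.
have e1 : 1 + T / n <= expR (T / n) := expR_ge1Dx _.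
have -> : expR T = expR (T / n) ^+ (2 * q).
  by rewrite -expRM_natl mulrC divfK// gt_eqF; lra.
rewrite -exprMn exprM; apply: lerXn2r; rewrite ?nnegrE ?sqr_ge0//.
  by rewrite addr_ge0 ?sqr_ge0.
apply: (@le_trans _ _ ((1 + T) ^+ 2)).
  have -> : (1 + T) ^+ 2 = 1 + T ^+ 2 + 2 * T by ring.
  lra.
have t0 : 0 <= T / n by rewrite divr_ge0//; lra.
apply: lerXn2r; rewrite ?nnegrE; [lra|by rewrite mulr_ge0 ?expR_ge0; lra|].
apply: (@le_trans _ _ (n * (1 + T / n))); last by rewrite ler_wpM2l//; lra.
rewrite mulrDr mulr1 mulrCA divff ?mulr1 ?lerD2r//.
by rewrite gt_eqF; lra.
Qed.

(** A shift changes the weight by a polynomial factor in its length, which the exponential [kw f]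
    dominates. *)
Lemma wt_shift q : exists2 Cw : R, 0 <= Cw & forall k K (f : kidx d K) j, 1 <= k ->
  wt k j ^+ q <= Cw * kw f * wt k (kshift f j) ^+ q.
Proof.
have [C C0 hC] := sqr_exp_bound q; exists (34 ^+ q * C); first by rewrite mulr_ge0 ?exprn_ge0.
move=> k K f j k1; have k0 : 0 < k by lra.
have h2 := hk_le2 k1; have h0 := ltW (hk_gt0 k0).
pose u i : R := `|(nthK (f i).1).2|%:~R; pose v i : R := `|(nthK (f i).2).2|%:~R.
have u0 i : 0 <= u i by rewrite /u intr_norm.
have v0 i : 0 <= v i by rewrite /v intr_norm.
pose T := \sum_i (u i + v i).
have T0 : 0 <= T by apply: sumr_ge0 => i _; rewrite addr_ge0.
have kwE : kw f = expR T.
  by rewrite expR_sum; apply: eq_bigr => i _; rewrite expRD.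
pose S := \sum_i (u i ^+ 2 + v i ^+ 2).
have ST : S <= T ^+ 2.
  rewrite expr2 {1}/T mulr_suml; apply: ler_sum => i _.
  have : u i + v i <= T by rewrite /T (bigD1 i)//= lerDl sumr_ge0// => l _; rewrite addr_ge0.
  move=> uT; apply: (@le_trans _ _ ((u i + v i) * (u i + v i))).
    by have := mulr_ge0 (u0 i) (v0 i); nra.
  by rewrite ler_wpM2l// addr_ge0.
have S0 : 0 <= S by apply: sumr_ge0 => i _; rewrite addr_ge0 ?sqr_ge0.
(* From [h <= 2], a shift of [2 h a] has square at most [16 a^2]; doubled this is 32, and
   [34 = 2 + 32]. *)
have sq (a : int) (x y : R) : y = x + hk k * (2 * a)%:~R -> x ^+ 2 <= 2 * y ^+ 2 + 32 * (`|a|%:~R) ^+ 2.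
  move=> ->; rewrite intr_norm real_normK ?num_real// intrM; move: (a%:~R) => c.
  have : (hk k * (2%:~R * c)) ^+ 2 <= 16 * c ^+ 2.
    have -> : (hk k * (2%:~R * c)) ^+ 2 = (4 * hk k ^+ 2) * c ^+ 2 by ring.
    rewrite ler_wpM2r ?sqr_ge0//; have : hk k ^+ 2 <= 2 ^+ 2 by rewrite ler_pXn2r ?nnegrE.
    by rewrite -[2 ^+ 2]/(2 * 2); lra.
  have := sqr_ge0 (x + 2 * (hk k * (2%:~R * c))).
  move: (hk k * (2%:~R * c)) => e; nra.
have W : wt k j <= 34 * (1 + T ^+ 2) * wt k (kshift f j).
  have b1 : \sum_i xk k j.1 0 i ^+ 2 <= 2 * \sum_i xk k (kshift f j).1 0 i ^+ 2 + 32 * \sum_i u i ^+ 2.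
    rewrite !mulr_sumr -big_split; apply: ler_sum => i _; apply: sq.
    by rewrite !mxE -/(hk k) intrD mulrDr.
  have b2 : \sum_i xk k j.2 0 i ^+ 2 <= 2 * \sum_i xk k (kshift f j).2 0 i ^+ 2 + 32 * \sum_i v i ^+ 2.
    rewrite !mulr_sumr -big_split; apply: ler_sum => i _; apply: sq.
    by rewrite !mxE -/(hk k) intrD mulrDr.
  have SE : S = \sum_i u i ^+ 2 + \sum_i v i ^+ 2 by rewrite /S big_split.
  have w1 := wt_ge1 k (kshift f j).
  have : wt k j <= 2 * wt k (kshift f j) + 32 * S by rewrite SE {1 2}/wt; lra.
  have : S * 1 <= T ^+ 2 * wt k (kshift f j) by rewrite ler_pM.
  have : 0 <= T ^+ 2 * wt k (kshift f j) by rewrite mulr_ge0 ?sqr_ge0 ?wt_ge0.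
  lra.
apply: (@le_trans _ _ ((34 * (1 + T ^+ 2) * wt k (kshift f j)) ^+ q)).
  apply: lerXn2r; rewrite ?nnegrE ?wt_ge0//.
  by rewrite !mulr_ge0 ?wt_ge0// addr_ge0 ?sqr_ge0.
rewrite !exprMn ler_wpM2r ?exprn_ge0 ?wt_ge0// -mulrA ler_wpM2l ?exprn_ge0// kwE.
exact: hC.
Qed.

Lemma kap_weighted q : exists2 C, 0 <= C & forall k K (f : 'rV[R]_d -> R), 1 <= k -> knorm K <= 9 -> schwartzR f ->
  sumle (fun j => wt k j ^+ q * kap K (bc k f) j ^+ 2) (C * hs k q f) /\
  sumle (fun j => wt k j ^+ q * kap K (bs k f) j ^+ 2) (C * hs k q f).
Proof.
have [C1 c1 h1] := coef_weighted (@pone R d) 0 q.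
have [C2 c2 h2] := coef_weighted (@pone R d) (- (pi / 2)) q.
have [Cw cw hw] := wt_shift q.
have c8 : 0 <= 81 ^+ d :> R by rewrite exprn_ge0.
exists (81 ^+ d * (81 ^+ d * Cw * (C1 + C2))).
  by apply: mulr_ge0 => //; apply: mulr_ge0; [exact: mulr_ge0|exact: addr_ge0].
move=> k K f k1 K9 sf; have h0 := hs_ge0 q f k1.
have E (C : R) : C <= C1 + C2 -> 81 ^+ d * (81 ^+ d * Cw * (C * hs k q f)) <=
   81 ^+ d * (81 ^+ d * Cw * (C1 + C2)) * hs k q f.
  move=> CC; rewrite -[leRHS]mulrA ler_wpM2l// -[leRHS]mulrA ler_wpM2l//; first exact: mulr_ge0.
  by rewrite ler_wpM2r.
split=> s us; (apply: le_trans; last (apply: E; first [exact: lerDl|idtac])).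
- apply: (kap_l2 K9 _ cw (fun f j => hw k K f j k1) (h1 k f k1 sf) us) => j.
  by rewrite exprn_ge0 ?wt_ge0.
- by rewrite lerDl.
- apply: (kap_l2 K9 _ cw (fun f j => hw k K f j k1) (h2 k f k1 sf) us) => j.
  by rewrite exprn_ge0 ?wt_ge0.
by rewrite lerDr.
Qed.

End analysis.
End Weighted_bounds.

(** * The dual frame and the truncation error *)

Section Complex_parts.
Variable R : realType.
Local Notation C := R[i].
Variable d : nat.
Implicit Types u v g : 'rV[R]_d -> C.

Lemma L2_sqi u : L2 u <-> sqi (reP u) /\ sqi (imP u).
Proof.
have cE x : cabs2 (u x) = reP u x ^+ 2 + imP u x ^+ 2 by [].
split=> [[[m1 m2] fin]|[[m1 i1] [m2 i2]]].
  have m1' : mfun (reP u) by apply/mfun_tupleP.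
  have m2' : mfun (imP u) by apply/mfun_tupleP.
  have m : mfun (fun x => cabs2 (u x)) by apply: mfunD; exact: mfunX.
  have c0 x : 0 <= cabs2 (u x) by rewrite cE addr_ge0 ?sqr_ge0.
  have /(ge0_intgP m c0) ic := fin.
  split; split => //; apply: (intg_dom _ ic); try exact: mfunX;
    by move=> x; rewrite ger0_norm ?sqr_ge0// cE ?lerDl ?lerDr ?sqr_ge0.
have t1 := (mfun_tupleP (reP u)).2 m1; have t2 := (mfun_tupleP (imP u)).2 m2.
split; first by split.
rewrite /L2sq; have ic : intg (fun x => cabs2 (u x)) by apply: (intgD i1 i2).
by rewrite (iint_Int ic) ltry.
Qed.

Lemma L2sqE u : L2 u ->
  L2sq u = (Int (fun x => reP u x ^+ 2) + Int (fun x => imP u x ^+ 2))%:E.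
Proof.
move=> /L2_sqi[[m1 i1] [m2 i2]]; rewrite -(IntD i1 i2).
by rewrite /L2sq; exact: (iint_Int (intgD i1 i2)).
Qed.

Lemma ip_parts u v : L2 u -> L2 v ->
  complex.Re (ip u v) = Int (fun x => reP u x * reP v x) + Int (fun x => imP u x * imP v x) /\
  complex.Im (ip u v) = Int (fun x => imP u x * reP v x) - Int (fun x => reP u x * imP v x).
Proof.
move=> /L2_sqi[s1 s2] /L2_sqi[t1 t2].
have i1 := sqi_mul s1 t1; have i2 := sqi_mul s2 t2.
have i3 := sqi_mul s2 t1; have i4 := sqi_mul s1 t2.
rewrite -(IntD i1 i2) -(IntB i3 i4) /ip /cint.
rewrite (_ : (fun x => (complex.Re (u x * (v x)^*))%:E) =
  (fun x => (reP u x * reP v x + imP u x * imP v x)%:E)); last first.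
  apply/funext => x; rewrite /reP /imP; case: (u x) (v x) => [a b] [c e] /=.
  by rewrite mulrN opprK.
rewrite (_ : (fun x => (complex.Im (u x * (v x)^*))%:E) =
  (fun x => (imP u x * reP v x - reP u x * imP v x)%:E)); last first.
  apply/funext => x; rewrite /reP /imP; case: (u x) (v x) => [a b] [c e] /=.
  by rewrite mulrN addrC.
rewrite (iint_Int (intgD i1 i2)) (iint_Int (intgB i3 i4)) /=; simpc; split => //=.
all: by rewrite ?mul0r ?mulr0 ?mul1r ?subr0 ?add0r ?addr0.
Qed.

Definition hS (k : R) p u : R := hs k p (reP u) + hs k p (imP u).

Lemma L2_schwartz u : schwartz u -> L2 u.
Proof. by move=> [s1 s2]; apply/L2_sqi; split; exact: sqi_schwartz. Qed.

Lemma HsqE (k : R) p u : schwartz u -> Hsq k p u = (hS k p u)%:E.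
Proof.
move=> [s1 s2].
have E a q : L2sq (fun x => ((euc x ^+ q)%:C * cdmulti a u x)%R) =
    (hterm k a q (reP u) + hterm k a q (imP u))%:E.
  have q1 := sqi_euc q (schwartzR_dmulti a s1); have q2 := sqi_euc q (schwartzR_dmulti a s2).
  have re : reP (fun x => (euc x ^+ q)%:C * cdmulti a u x) = fun x => euc x ^+ q * dmulti a (reP u) x.
    by apply/funext => x; rewrite /reP /cdmulti; simpc.
  have im : imP (fun x => (euc x ^+ q)%:C * cdmulti a u x) = fun x => euc x ^+ q * dmulti a (imP u) x.
    by apply/funext => x; rewrite /imP /cdmulti; simpc.
  by rewrite L2sqE; [rewrite re im|apply/L2_sqi; rewrite re im].
rewrite /Hsq /hS /hs -big_split -sumEFin; apply: eq_bigr => a _.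
rewrite -big_split -sumEFin; apply: eq_bigr => q _.
by rewrite E -EFinM mulrDr.
Qed.

Lemma hS_ge0 k p u : 1 <= k -> 0 <= hS k p u.
Proof. by move=> k1; rewrite addr_ge0 ?hs_ge0. Qed.

Variable k : R.
Hypothesis k1 : 1 <= k.

Let k0 : 0 < k. Proof. exact: lt_le_trans ltr01 k1. Qed.

Lemma reP_Psi (j : gidx d) : reP (Psi k j) = ec k j.
Proof. by apply/funext => x; rewrite /reP PsiE. Qed.

Lemma imP_Psi (j : gidx d) : imP (Psi k j) = es k j.
Proof. by apply/funext => x; rewrite /imP PsiE. Qed.

Lemma schwartz_Psi (j : gidx d) : schwartz (Psi k j).
Proof. by split; rewrite ?reP_Psi ?imP_Psi; exact: schwartzR_efam. Qed.

Lemma L2_Psi (j : gidx d) : L2 (Psi k j).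
Proof. exact: L2_schwartz (schwartz_Psi j). Qed.

Lemma ip_Psi_r u j : L2 u ->
  complex.Re (ip u (Psi k j)) = bc k (reP u) j + bs k (imP u) j /\
  complex.Im (ip u (Psi k j)) = bc k (imP u) j - bs k (reP u) j.
Proof. by move=> Lu; have [-> ->] := ip_parts Lu (L2_Psi j); rewrite reP_Psi imP_Psi. Qed.

Lemma ip_Psi_l u j : L2 u ->
  complex.Re (ip (Psi k j) u) = bc k (reP u) j + bs k (imP u) j /\
  complex.Im (ip (Psi k j) u) = bs k (reP u) j - bc k (imP u) j.
Proof.
move=> Lu; have [-> ->] := ip_parts (L2_Psi j) Lu; rewrite reP_Psi imP_Psi.
by split; congr (_ + _); rewrite ?[bc _ _ _]/(Int _); try congr (- _);
  apply: Int_eq => x; exact: mulrC.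
Qed.

(** With [kim], the real and imaginary parts of the [K]-combination of the coefficients [(u, Psi_i)]
    at [j]. *)
Definition kre K u j := kap K (bc k (reP u)) j + kap K (bs k (imP u)) j.
Definition kim K u j := kap K (bc k (imP u)) j - kap K (bs k (reP u)) j.

Section shifted.
Variables (K : seq (R * int)) (f : kidx d K).
Local Notation h := (hk k).

Definition kdelta : 'rV[R]_d := \row_i (h * (2 * (nthK (f i).1).2)%:~R).
Definition keta (x : 'rV[R]_d) : R := \sum_i 2 * pi * ((nthK (f i).2).2)%:~R * (x 0 i / h).

(** Translation by an even lattice vector permutes the states: the phase left over is [2 pi] times
    an integer, and the modulation [cis (keta x)] does not depend on [j]. *)
Lemma kshift_frame j x :
  ec k (kshift f j) (x + kdelta) = cos (keta x) * ec k j x - sin (keta x) * es k j x /\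
  es k (kshift f j) (x + kdelta) = sin (keta x) * ec k j x + cos (keta x) * es k j x.
Proof.
have hn := hk_neq0 k0.
have E : Psi k (kshift f j) (x + kdelta) = cis (keta x) * Psi k j x.
  rewrite !(Psi_prod k0) mulrCA; congr (_ * _).
  rewrite cis_sum -big_split; apply: eq_bigr => i _ /=.
  rewrite /psi1 !mxE mulrCA.
  have -> : (x 0 i + h * (2 * (nthK (f i).1).2)%:~R) / h -
      (j.1 0 i + 2 * (nthK (f i).1).2)%:~R = x 0 i / h - (j.1 0 i)%:~R.
    by rewrite !(intrD, intrM); field.
  congr (_ * _); rewrite -cisD -[RHS]mulr1 -(cis_2piz R (- ((nthK (f i).2).2 * j.1 0 i))) -cisD.
  by congr cis; rewrite !(intrD, intrM, rmorphN) /=; ring.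
by move: E; rewrite !PsiE// /cis; simpc => -[-> ->]; split; ring.
Qed.

(** The translate of [u] by [kdelta] times [cis (- keta x)], which transfers the index shift from
    the state to [u]. *)
Definition kmod u x : C :=
  (reP u (x + kdelta) * cos (keta x) + imP u (x + kdelta) * sin (keta x)) +i*
  (imP u (x + kdelta) * cos (keta x) - reP u (x + kdelta) * sin (keta x)).

Lemma mfun_keta : mfun keta.
Proof.
apply: mfun_sum => i; apply: mfunM; first exact: mfun_cst.
by apply: mfunM; [exact: mfun_coord|exact: mfun_cst].
Qed.

Lemma sqi_modulated (t : 'rV[R]_d -> R) (c : R -> R) : continuous c -> (forall s, `|c s| <= 1) ->
  sqi t -> sqi (fun x => t (x + kdelta) * c (keta x)).
Proof.
move=> cc c1 [mt it].
have ms := mfun_shift kdelta mt.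
have m : mfun (fun x => t (x + kdelta) * c (keta x)).
  by apply: mfunM => //; apply: mfun_comp mfun_keta; exact: continuous_measurable_fun.
split => //; apply: (intg_dom _ (intg_shift kdelta it)); first exact: mfunX.
move=> x; rewrite ger0_norm ?sqr_ge0// exprMn ler_piMr ?sqr_ge0//.
by rewrite -real_normK ?num_real// expr_le1.
Qed.

Lemma coef_kshift (t : 'rV[R]_d -> R) j : sqi t ->
  bc k t (kshift f j) = bc k (fun x => t (x + kdelta) * cos (keta x)) j -
    bs k (fun x => t (x + kdelta) * sin (keta x)) j /\
  bs k t (kshift f j) = bc k (fun x => t (x + kdelta) * sin (keta x)) j +
    bs k (fun x => t (x + kdelta) * cos (keta x)) j.
Proof.
move=> st.
have sc := sqi_modulated (@continuous_cos R) (@norm_cos_le1 R) st.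
have ss := sqi_modulated (@continuous_sin R) (@norm_sin_le1 R) st.
have se := sqi_ec k0 j; have sf := sqi_es k0 j.
have m1 : mfun (fun x => t x * ec k (kshift f j) x) by exact: mfunM st.1 (mfun_ec _ _).
have m2 : mfun (fun x => t x * es k (kshift f j) x) by exact: mfunM st.1 (mfun_es _ _).
rewrite /bc /bs -(Int_shift kdelta m1) -(Int_shift kdelta m2).
rewrite -(IntB (sqi_mul sc se) (sqi_mul ss sf)) -(IntD (sqi_mul ss se) (sqi_mul sc sf)).
by split; apply: Int_eq => x; have [e1 e2] := kshift_frame j x; rewrite ?e1 ?e2; ring.
Qed.

End shifted.

(* Shifting [u] in phase space instead of shifting the indices: this is the test function to which the
   weak equation defining the dual frame is applied. *)
Definition kdual K u x : C := \sum_(f : kidx d K) (kc f)%:C * kmod f u x.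

Lemma kdual_parts K u x :
  reP (kdual K u) x = \sum_(f : kidx d K) kc f * reP (kmod f u) x /\
  imP (kdual K u) x = \sum_(f : kidx d K) kc f * imP (kmod f u) x.
Proof.
rewrite /reP /imP /kdual; elim/big_rec3: _ => // f a b c _ [<- <-].
by split; case: c => c e; rewrite /kmod; simpc.
Qed.

Lemma kmod_L2 K (f : kidx d K) u : L2 u -> L2 (kmod f u).
Proof.
move=> /L2_sqi[s1 s2].
have c1 := sqi_modulated f (@continuous_cos R) (@norm_cos_le1 R).
have c2 := sqi_modulated f (@continuous_sin R) (@norm_sin_le1 R).
by apply/L2_sqi; split; [apply: sqiD|apply: sqiB]; [exact: c1|exact: c2|exact: c1|exact: c2].
Qed.

Lemma kdual_L2 K u : L2 u -> L2 (kdual K u).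
Proof.
move=> Lu; have sf (f : kidx d K) := (L2_sqi _).1 (kmod_L2 f Lu).
apply/L2_sqi; rewrite (_ : reP _ = fun x => \sum_(f : kidx d K) kc f * reP (kmod f u) x); last first.
  by apply/funext => x; have [] := kdual_parts K u x.
rewrite (_ : imP _ = fun x => \sum_(f : kidx d K) kc f * imP (kmod f u) x); last first.
  by apply/funext => x; have [] := kdual_parts K u x.
by split; apply: sqi_sum => f; apply: sqiZ; have [] := sf f.
Qed.

Lemma bcD (s t : 'rV[R]_d -> R) j : sqi s -> sqi t ->
  bc k (fun x => s x + t x) j = bc k s j + bc k t j /\
  bs k (fun x => s x + t x) j = bs k s j + bs k t j.
Proof.
move=> ss st; have se := sqi_ec k0 j; have sf := sqi_es k0 j.
rewrite /bc /bs -(IntD (sqi_mul ss se) (sqi_mul st se)) -(IntD (sqi_mul ss sf) (sqi_mul st sf)).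
by split; apply: Int_eq => x; ring.
Qed.

Lemma bc_sum (T : Type) (s : seq T) (c : T -> R) (F : T -> 'rV[R]_d -> R) j :
  (forall i, sqi (F i)) ->
  bc k (fun x => \sum_(i <- s) c i * F i x) j = \sum_(i <- s) c i * bc k (F i) j /\
  bs k (fun x => \sum_(i <- s) c i * F i x) j = \sum_(i <- s) c i * bs k (F i) j.
Proof.
move=> sF; have se := sqi_ec k0 j; have sf := sqi_es k0 j.
have E (w : 'rV[R]_d -> R) : sqi w -> Int (fun x => (\sum_(i <- s) c i * F i x) * w x) =
    \sum_(i <- s) c i * Int (fun x => F i x * w x).
  move=> sw; rewrite (@Int_eq _ _ _ (fun x => \sum_(i <- s) c i * (F i x * w x))); last first.
    by move=> x; rewrite mulr_suml; apply: eq_bigr => i _; rewrite mulrA.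
  rewrite Int_sum; last by move=> i; apply: intgZ; exact: sqi_mul.
  by apply: eq_bigr => i _; rewrite IntZ//; exact: sqi_mul.
by split; apply: E.
Qed.

(** Translation invariance of the integral moves every index shift onto [u]. The minus sign is a
    conjugation, since [u] now stands in the second slot of the inner product. *)
Lemma ip_kdual K u j : L2 u ->
  complex.Re (ip (Psi k j) (kdual K u)) = kre K u j /\
  complex.Im (ip (Psi k j) (kdual K u)) = - kim K u j.
Proof.
move=> Lu; have [s1 s2] := (L2_sqi _).1 Lu.
have sf (f : kidx d K) := (L2_sqi _).1 (kmod_L2 f Lu).
have [-> ->] := ip_Psi_l j (kdual_L2 K Lu).
rewrite (_ : reP (kdual K u) = fun x => \sum_(f : kidx d K) kc f * reP (kmod f u) x); last first.
  by apply/funext => x; have [] := kdual_parts K u x.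
rewrite (_ : imP (kdual K u) = fun x => \sum_(f : kidx d K) kc f * imP (kmod f u) x); last first.
  by apply/funext => x; have [] := kdual_parts K u x.
have [-> ->] := bc_sum (index_enum (kidx d K)) (@kc R d K) j (fun f => (sf f).1).
have [-> ->] := bc_sum (index_enum (kidx d K)) (@kc R d K) j (fun f => (sf f).2).
have E (f : kidx d K) :
   bc k (reP (kmod f u)) j + bs k (imP (kmod f u)) j =
     bc k (reP u) (kshift f j) + bs k (imP u) (kshift f j) /\
   bs k (reP (kmod f u)) j - bc k (imP (kmod f u)) j =
     - (bc k (imP u) (kshift f j) - bs k (reP u) (kshift f j)).
  have [-> ->] := coef_kshift f j s1; have [-> ->] := coef_kshift f j s2.
  have c1 := sqi_modulated f (@continuous_cos R) (@norm_cos_le1 R) s1.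
  have c2 := sqi_modulated f (@continuous_sin R) (@norm_sin_le1 R) s2.
  have c3 := sqi_modulated f (@continuous_cos R) (@norm_cos_le1 R) s2.
  have c4 := sqi_modulated f (@continuous_sin R) (@norm_sin_le1 R) s1.
  have [e1 e2] := bcD j c1 c2.
  have e3 := bcB k0 c3 c4 j; have e4 := bsB k0 c3 c4 j.
  have -> : reP (kmod f u) = fun x => reP u (x + kdelta f) * cos (keta f x) +
    imP u (x + kdelta f) * sin (keta f x) by [].
  have -> : imP (kmod f u) = fun x => imP u (x + kdelta f) * cos (keta f x) -
    reP u (x + kdelta f) * sin (keta f x) by [].
  by rewrite e1 e2 e3 e4; split; ring.
split; rewrite /kre /kim /kap; [rewrite -!big_split|rewrite -!sumrB -sumrN];
  apply: eq_bigr => f _ /=.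
  by rewrite -!mulrDr; have [-> _] := E f.
by rewrite -!mulrBr -mulrN; have [_ ->] := E f.
Qed.

End Complex_parts.

(** * Dual coefficients as limits, and weak reconstruction *)

Section Dual_coefficients.
Variable R : realType.
Local Notation C := R[i].

(** Entrywise convergence with uniform [l^2] bounds is weak convergence: the tail of the fixed
    sequence [(b, c)] is small uniformly in [n], and only finitely many entries remain. The
    threshold [M0] may depend on [n], as a single large [n] is used. *)
Lemma weak_passage d (X Y : nat -> gidx d -> R) (x y b c : gidx d -> R) A B T :
  (forall j, X ^~ j @ \oo --> x j) -> (forall j, Y ^~ j @ \oo --> y j) ->
  (forall n, sumle (fun j => X n j ^+ 2 + Y n j ^+ 2) A) ->
  sumle (fun j => x j ^+ 2 + y j ^+ 2) A ->
  sumle (fun j => b j ^+ 2 + c j ^+ 2) B ->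
  (forall e, 0 < e -> \forall n \near \oo, exists M0, forall M, (M0 <= M)%N ->
     `|\sum_(j <- boxs d M) (X n j * b j + Y n j * c j) - T| <= e) ->
  (fun M => \sum_(j <- boxs d M) (x j * b j + y j * c j)) @ \oo --> T.
Proof.
move=> Xx Yy XA xA bB h; have A0 := sumle_ge0 xA.
apply/cvgrPdist_le => e e0.
have e4 : 0 < e / 4 by lra.
(* In the tail, the entries of the sequence and of its limit together contribute [2 A t <= e / 4];
   the tail of [(b, c)] is then required to be below [t e / 2]. *)
pose t := e / (8 * (A + 1)); have t0 : 0 < t by rewrite divr_gt0//; lra.
have tV : 0 < t^-1 by rewrite invr_gt0.
have te : 0 < t * (e / 2) by rewrite mulr_gt0//; lra.
have [M1 hM1] := sumle_tail (fun j => addr_ge0 (sqr_ge0 (b j)) (sqr_ge0 (c j))) bB te.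
have cv : (fun n => \sum_(j <- boxs d M1) (`|x j - X n j| * `|b j| + `|y j - Y n j| * `|c j|)) @ \oo --> 0.
  rewrite [X in _ --> X](_ : _ = \sum_(j <- boxs d M1) (`|x j - x j| * `|b j| + `|y j - y j| * `|c j|)).
    apply: cvg_sumr => j; apply: cvgD; (apply: cvgM; last exact: cvg_cst);
      by apply: cvg_norm; apply: cvgB; [exact: cvg_cst|].
  by rewrite big1// => j _; rewrite !subrr normr0 !mul0r addr0.
have n1 := h _ e4.
have n2 : \forall n \near \oo, `|\sum_(j <- boxs d M1) (`|x j - X n j| * `|b j| + `|y j - Y n j| * `|c j|)| <= e / 4.
  by move/cvgr0Pnorm_le: cv; apply.
have [N1 _ h1] := n1; have [N2 _ h2] := n2; pose n := maxn N1 N2.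
have [M0 hn1] := h1 n (leq_maxl _ _); have hn2 := h2 n (leq_maxr _ _).
near=> M.
have M1M : (M1 <= M)%N by near: M; exact: nbhs_infty_ge.
have M0M : (M0 <= M)%N by near: M; exact: nbhs_infty_ge.
have b1 := hn1 M M0M.
pose D j := (x j - X n j) * b j + (y j - Y n j) * c j.
have DE : \sum_(j <- boxs d M) (x j * b j + y j * c j) =
    \sum_(j <- boxs d M) (X n j * b j + Y n j * c j) + \sum_(j <- boxs d M) D j.
  by rewrite -big_split; apply: eq_bigr => j _; rewrite /D /=; ring.
have D1 j : `|D j| <= `|x j - X n j| * `|b j| + `|y j - Y n j| * `|c j|.
  by apply: (le_trans (ler_normD _ _)); rewrite !normrM.
have D2 j : `|D j| <= t * (x j ^+ 2 + y j ^+ 2 + (X n j ^+ 2 + Y n j ^+ 2)) +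
    2^-1 * t^-1 * (b j ^+ 2 + c j ^+ 2).
  have a1 := amgm (x j - X n j) (b j) t0; have a2 := amgm (y j - Y n j) (c j) t0.
  have q1 : (x j - X n j) ^+ 2 <= 2 * (x j ^+ 2 + X n j ^+ 2).
    by have := sqr_ge0 (x j + X n j); nra.
  have q2 : (y j - Y n j) ^+ 2 <= 2 * (y j ^+ 2 + Y n j ^+ 2).
    by have := sqr_ge0 (y j + Y n j); nra.
  have := ler_wpM2l (ltW t0) q1; have := ler_wpM2l (ltW t0) q2.
  have := D1 j; rewrite -!normrM; lra.
have Dsum : `|\sum_(j <- boxs d M) D j| <= 3 * (e / 4).
  rewrite (boxs_split _ M1M); apply: (le_trans (ler_normD _ _)).
  set s := [seq j <- boxs d M | j \notin boxs d M1].
  have us : uniq s by rewrite filter_uniq ?uniq_boxs.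
  have p1 : `|\sum_(j <- boxs d M1) D j| <= e / 4.
    apply: le_trans hn2; apply: (le_trans (ler_norm_sum _ _ _)).
    by apply: le_trans (ler_norm _); apply: ler_sum => j _; exact: D1.
  have p2 : `|\sum_(j <- s) D j| <= t * (A + A) + 2^-1 * t^-1 * (t * (e / 2)).
    apply: (le_trans (ler_norm_sum _ _ _)).
    apply: (@le_trans _ _ (\sum_(j <- s) (t * (x j ^+ 2 + y j ^+ 2 + (X n j ^+ 2 + Y n j ^+ 2)) +
       2^-1 * t^-1 * (b j ^+ 2 + c j ^+ 2)))); first by apply: ler_sum => j _; exact: D2.
    rewrite big_split /= -!mulr_sumr; apply: lerD; rewrite ler_pM2l//.
    - by rewrite big_split; apply: lerD; [exact: xA|exact: XA].
    - by apply: hM1 => // j; rewrite mem_filter => /andP[].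
    by rewrite mulr_gt0// invr_gt0.
  have tA : t * (A + A) <= e / 4.
    rewrite /t; have -> : e / (8 * (A + 1)) * (A + A) = e / 4 * (A / (A + 1)) by field; lra.
    rewrite -[leRHS]mulr1 ler_wpM2l//; first exact: ltW.
    by rewrite ler_pdivrMr; lra.
  have t4 : 2^-1 * t^-1 * (t * (e / 2)) = e / 4 by field; rewrite gt_eqF.
  rewrite t4 in p2.
  lra.
rewrite DE distrC -addrA [\sum_(j <- _) D j - T]addrC addrA.
by apply: (le_trans (ler_normD _ _)); lra.
Unshelve. all: by end_near. Qed.

Lemma inverse_seq_exists (n : nat) : exists K, good_inverse K (n.+1%:R^-1 : R).
Proof. by apply: good_inverse_exists; rewrite invr_gt0 ltr0n. Qed.

Definition Kn (n : nat) : seq (R * int) := projT1 (cid (inverse_seq_exists n)).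

Lemma KnP n : good_inverse (Kn n) (n.+1%:R^-1 : R).
Proof. exact: projT2 (cid (inverse_seq_exists n)). Qed.

Lemma Kn9 n : knorm (Kn n) <= 9.
Proof. by have [] := KnP n. Qed.

Section fixed.
Variables (d : nat) (k : R).
Hypothesis d0 : (0 < d)%N.
Hypothesis k1 : 1 <= k.
Let k0 : 0 < k. Proof. exact: lt_le_trans ltr01 k1. Qed.

Lemma kterm_near re (u g : 'rV[R]_d -> R) e : schwartzR u -> sqi g -> 0 < e ->
  \forall n \near \oo, exists M0, forall M, (M0 <= M)%N ->
    `|\sum_(j <- boxs d M) kterm k re (Kn n) u g j - starget re u g| <= e.
Proof.
move=> su sg e0; have [B B0 hB] := schwartzR_bounded su.
have [B1 B10 hB1] := schwartzR_lipc su.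
have [eta0 eta00 h] := kterm_limit k0 re (intg_schwartz su) (sqi_schwartz su) hB hB1 B10 sg e0.
near=> n; apply: (h _ (n.+1%:R^-1)); last exact: KnP.
have : `|n.+1%:R^-1 : R| <= eta0.
  by near: n; have := @cvg_harmonic R; move/cvgr0Pnorm_le; apply.
by apply: le_trans; exact: ler_norm.
Unshelve. all: by end_near. Qed.

Implicit Types u g : 'rV[R]_d -> C.

Lemma dual_coef_cvg u g j0 : schwartz u -> dual_elem k j0 g ->
  (fun n => kre k (Kn n) u j0) @ \oo --> 2 ^+ d * complex.Re (ip u g) /\
  (fun n => kim k (Kn n) u j0) @ \oo --> 2 ^+ d * complex.Im (ip u g).
Proof.
move=> [su1 su2] [Lg hg]; have [sg1 sg2] := (L2_sqi _).1 Lg.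
have Lu : L2 u by apply: L2_schwartz.
have [-> ->] := ip_parts Lu Lg.
(* Real and imaginary parts of the tested sum, split into the four pairings of parts of [u] with
   parts of [g]; the conjugation accounts for the sign of [Sim]. *)
pose Sre n M := \sum_(j <- boxs d M) (kterm k true (Kn n) (reP u) (reP g) j -
  kterm k false (Kn n) (imP u) (reP g) j + kterm k false (Kn n) (reP u) (imP g) j +
  kterm k true (Kn n) (imP u) (imP g) j).
pose Sim n M := - \sum_(j <- boxs d M) (kterm k true (Kn n) (imP u) (reP g) j +
  kterm k false (Kn n) (reP u) (reP g) j - kterm k true (Kn n) (reP u) (imP g) j +
  kterm k false (Kn n) (imP u) (imP g) j).
have SE n M : \sum_(j \in box M) (ip g (Psi k j) * ip (Psi k j) (kdual k (Kn n) u)) =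
    Sre n M +i* Sim n M.
  rewrite fsum_box /Sre /Sim; elim: (boxs d M) => [|j s IH]; first by rewrite !big_nil oppr0.
  rewrite !big_cons IH {IH}.
  have [a1 a2] := ip_Psi_r k1 j Lg; have [b1 b2] := ip_kdual k1 (Kn n) j Lu.
  move: a1 a2 b1 b2; case: (ip g _) => [p q]; case: (ip _ _) => [p' q'] /= -> -> -> ->.
  by simpc; rewrite /kterm /kre /kim; congr (_ +i* _); ring.
have lim n : Sre n @ \oo --> kre k (Kn n) u j0 /\ Sim n @ \oo --> - kim k (Kn n) u j0.
  have [l1 l2] := hg _ (@kdual_L2 R d k (Kn n) u Lu).
  have [r1 r2] := ip_kdual k1 (Kn n) j0 Lu.
  have E1 : (fun M => complex.Re (\sum_(j \in box M)
      (ip g (Psi k j) * ip (Psi k j) (kdual k (Kn n) u)))) = Sre n.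
    by apply/funext => M; rewrite SE.
  have E2 : (fun M => complex.Im (\sum_(j \in box M)
      (ip g (Psi k j) * ip (Psi k j) (kdual k (Kn n) u)))) = Sim n.
    by apply/funext => M; rewrite SE.
  by split; [rewrite -E1 -r1; exact: l1|rewrite -E2 -r2; exact: l2].
have e8 (e : R) : 0 < e -> 0 < e / 4 by move=> ?; lra.
(* For each [n] the sums over boxes converge to [f n] by the dual equation, so an estimate valid for
   large [M] passes to [f n] before [n] grows. *)
have pass (F : nat -> nat -> R) (f : nat -> R) T : (forall n, F n @ \oo --> f n) ->
   (forall e, 0 < e -> \forall n \near \oo, exists M0, forall M, (M0 <= M)%N -> `|F n M - T| <= e) ->
   f @ \oo --> T.
  move=> Ff FT; apply/cvgrPdist_le => e e0; near=> n.
  have [M0 hM0] : exists M0, forall M, (M0 <= M)%N -> `|F n M - T| <= e by near: n; exact: FT.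
  have c : (fun M => `|F n M - T|) @ \oo --> `|f n - T|.
    by apply: cvg_norm; apply: cvgB; [exact: Ff|exact: cvg_cst].
  rewrite distrC -(cvg_lim _ c)//; apply: limr_le; first by apply/cvg_ex; eexists; exact: c.
  by exists M0 => // M /= hM; exact: hM0.
have tr re (v w : 'rV[R]_d -> R) (e : R) : schwartzR v -> sqi w -> 0 < e ->
    \forall n \near \oo, exists M0, forall M, (M0 <= M)%N ->
    `|\sum_(j <- boxs d M) kterm k re (Kn n) v w j - starget re v w| <= e / 4.
  by move=> sv sw /e8; exact: kterm_near.
split.
  apply: (pass Sre) => [n|e e0]; first by have [] := lim n.
  near=> n.
  have [Ma ha] : exists M0, forall M, (M0 <= M)%N ->
    `|\sum_(j <- boxs d M) kterm k true (Kn n) (reP u) (reP g) j - starget true (reP u) (reP g)| <= e / 4.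
    by near: n; exact: tr.
  have [Mb hb] : exists M0, forall M, (M0 <= M)%N ->
    `|\sum_(j <- boxs d M) kterm k false (Kn n) (imP u) (reP g) j - starget false (imP u) (reP g)| <= e / 4.
    by near: n; exact: tr.
  have [Mc hc] : exists M0, forall M, (M0 <= M)%N ->
    `|\sum_(j <- boxs d M) kterm k false (Kn n) (reP u) (imP g) j - starget false (reP u) (imP g)| <= e / 4.
    by near: n; exact: tr.
  have [Md hd] : exists M0, forall M, (M0 <= M)%N ->
    `|\sum_(j <- boxs d M) kterm k true (Kn n) (imP u) (imP g) j - starget true (imP u) (imP g)| <= e / 4.
    by near: n; exact: tr.
  exists (maxn (maxn Ma Mb) (maxn Mc Md)) => M; rewrite !geq_max;
  move=> /andP[/andP[/ha {}ha /hb {}hb] /andP[/hc {}hc /hd {}hd]].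
  have -> : Sre n M = \sum_(j <- boxs d M) kterm k true (Kn n) (reP u) (reP g) j -
      \sum_(j <- boxs d M) kterm k false (Kn n) (imP u) (reP g) j +
      \sum_(j <- boxs d M) kterm k false (Kn n) (reP u) (imP g) j +
      \sum_(j <- boxs d M) kterm k true (Kn n) (imP u) (imP g) j.
    by rewrite -sumrB -!big_split.
  move: ha hb hc hd; rewrite /starget !subr0 (@Int_eq _ _ (fun x => reP g x * reP u x) _ (fun x => mulrC _ _))
    (@Int_eq _ _ (fun x => imP g x * imP u x) _ (fun x => mulrC _ _)) mulrDr.
  rewrite !ler_norml => /andP[? ?] /andP[? ?] /andP[? ?] /andP[? ?]; apply/andP; split; lra.
rewrite -[X in _ --> X]opprK; under eq_fun do rewrite -[kim _ _ _ _]opprK; apply: cvgN.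
apply: (pass Sim) => [n|e e0]; first by have [] := lim n.
near=> n.
have [Ma ha] : exists M0, forall M, (M0 <= M)%N ->
  `|\sum_(j <- boxs d M) kterm k true (Kn n) (imP u) (reP g) j - starget true (imP u) (reP g)| <= e / 4.
  by near: n; exact: tr.
have [Mb hb] : exists M0, forall M, (M0 <= M)%N ->
  `|\sum_(j <- boxs d M) kterm k false (Kn n) (reP u) (reP g) j - starget false (reP u) (reP g)| <= e / 4.
  by near: n; exact: tr.
have [Mc hc] : exists M0, forall M, (M0 <= M)%N ->
  `|\sum_(j <- boxs d M) kterm k true (Kn n) (reP u) (imP g) j - starget true (reP u) (imP g)| <= e / 4.
  by near: n; exact: tr.
have [Md hd] : exists M0, forall M, (M0 <= M)%N ->
  `|\sum_(j <- boxs d M) kterm k false (Kn n) (imP u) (imP g) j - starget false (imP u) (imP g)| <= e / 4.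
  by near: n; exact: tr.
exists (maxn (maxn Ma Mb) (maxn Mc Md)) => M; rewrite !geq_max;
  move=> /andP[/andP[/ha {}ha /hb {}hb] /andP[/hc {}hc /hd {}hd]].
have -> : Sim n M = - (\sum_(j <- boxs d M) kterm k true (Kn n) (imP u) (reP g) j +
    \sum_(j <- boxs d M) kterm k false (Kn n) (reP u) (reP g) j -
    \sum_(j <- boxs d M) kterm k true (Kn n) (reP u) (imP g) j +
    \sum_(j <- boxs d M) kterm k false (Kn n) (imP u) (imP g) j).
  by rewrite -big_split -sumrB -!big_split.
move: ha hb hc hd; rewrite /starget !subr0 (@Int_eq _ _ (fun x => reP g x * imP u x) _ (fun x => mulrC _ _))
  (@Int_eq _ _ (fun x => imP g x * reP u x) _ (fun x => mulrC _ _)) mulrBr.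
rewrite !ler_norml => /andP[? ?] /andP[? ?] /andP[? ?] /andP[? ?]; apply/andP; split; lra.
Unshelve. all: by end_near. Qed.

Lemma kre_kim_sqr K u j : kre k K u j ^+ 2 + kim k K u j ^+ 2 <=
  2 * (kap K (bc k (reP u)) j ^+ 2 + kap K (bs k (reP u)) j ^+ 2 +
    (kap K (bc k (imP u)) j ^+ 2 + kap K (bs k (imP u)) j ^+ 2)).
Proof.
rewrite /kre /kim; move: (kap _ _ _) (kap _ _ _) (kap _ _ _) (kap _ _ _) => a b c e.
have := sqr_ge0 (a + b); have := sqr_ge0 (e - c); nra.
Qed.

End fixed.

Lemma kap_bound d q : (0 < d)%N -> exists2 C, 0 <= C & forall (k : R) K (u : 'rV[R]_d -> R[i]),
  1 <= k -> knorm K <= 9 -> schwartz u ->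
  sumle (fun j => wt k j ^+ q * (kre k K u j ^+ 2 + kim k K u j ^+ 2)) (C * hS k q u).
Proof.
move=> d0; have [A A0 hA] := @kap_weighted R d d0 q; exists (4 * A); first by rewrite mulr_ge0.
move=> k K u k1 K9 [s1 s2]; have [a1 a2] := hA k K _ k1 K9 s1; have [a3 a4] := hA k K _ k1 K9 s2.
have e2 : 0 <= 2 :> R by [].
have := sumleZ e2 (sumleD (sumleD a1 a2) (sumleD a3 a4)).
rewrite (_ : 2 * _ = 4 * A * hS k q u); last by rewrite /hS; ring.
apply: sumle_le => j; rewrite -!mulrDr mulrCA ler_wpM2l ?exprn_ge0 ?wt_ge0//.
exact: kre_kim_sqr.
Qed.

Definition dcoef d (Psistar : gidx d -> 'rV[R]_d -> C) u j : C := ip u (Psistar j).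

Lemma dual_bound d q : (0 < d)%N -> exists2 C, 0 <= C & forall (k : R) Psistar (u : 'rV[R]_d -> R[i]),
  1 <= k -> dual_frame k Psistar -> schwartz u ->
  sumle (fun j => wt k j ^+ q * (complex.Re (dcoef Psistar u j) ^+ 2 +
    complex.Im (dcoef Psistar u j) ^+ 2)) (C * hS k q u).
Proof.
move=> d0; have [A A0 hA] := kap_bound q d0; exists A => // k Psistar u k1 dF su s us.
have D1 : 1 <= 2 ^+ d :> R by rewrite exprn_ege1//; lra.
pose F n := \sum_(j <- s) wt k j ^+ q * (kre k (Kn n) u j ^+ 2 + kim k (Kn n) u j ^+ 2).
have cF : F @ \oo --> \sum_(j <- s) wt k j ^+ q * ((2 ^+ d * complex.Re (dcoef Psistar u j)) ^+ 2 +
     (2 ^+ d * complex.Im (dcoef Psistar u j)) ^+ 2).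
  apply: cvg_sumr => j; apply: cvgM; first exact: cvg_cst.
  have [c1 c2] := dual_coef_cvg k1 su (dF j).
  by apply: cvgD; rewrite expr2; under eq_fun do rewrite expr2; exact: cvgM.
apply: (@le_trans _ _ (\sum_(j <- s) wt k j ^+ q * ((2 ^+ d * complex.Re (dcoef Psistar u j)) ^+ 2 +
     (2 ^+ d * complex.Im (dcoef Psistar u j)) ^+ 2))).
  apply: ler_sum => j _; rewrite ler_wpM2l ?exprn_ge0 ?wt_ge0//.
  have D2 : 1 <= (2 ^+ d) ^+ 2 :> R by rewrite exprn_ege1.
  by apply: lerD; rewrite exprMn ler_peMl ?sqr_ge0.
rewrite -(cvg_lim _ cF)//; apply: limr_le; first by apply/cvg_ex; eexists; exact: cF.
by apply: nearW => n; exact: (hA k (Kn n) u k1 (Kn9 n) su s us).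
Qed.

(** Both sides carry [2^d]: the coefficients of [Kn n] tend to [2^d] times the dual coefficients,
    and the sums built from them to [2^d] times the pairing. [weak_passage] exchanges the limits,
    and the common factor is cancelled. *)
Lemma weak_reconstruction d (k : R) Psistar (u : 'rV[R]_d -> R[i]) (g : 'rV[R]_d -> R) :
  (0 < d)%N -> 1 <= k -> dual_frame k Psistar -> schwartz u -> sqi g ->
  (fun M => \sum_(j <- boxs d M) (complex.Re (dcoef Psistar u j) * bc k g j -
     complex.Im (dcoef Psistar u j) * bs k g j)) @ \oo --> Int (fun x => g x * reP u x) /\
  (fun M => \sum_(j <- boxs d M) (complex.Re (dcoef Psistar u j) * bs k g j +
     complex.Im (dcoef Psistar u j) * bc k g j)) @ \oo --> Int (fun x => g x * imP u x).
Proof.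
move=> d0 k1 dF su sg; have k0 : 0 < k by lra.
have [A A0 hA] := kap_bound 0 d0; have [s1 s2] := su.
have D0 : 2 ^+ d != 0 :> R by rewrite expf_neq0// pnatr_eq0.
set cr := fun j => complex.Re (dcoef Psistar u j); set ci := fun j => complex.Im (dcoef Psistar u j).
have cv j := dual_coef_cvg k1 su (dF j).
have hn n : sumle (fun j => kre k (Kn n) u j ^+ 2 + kim k (Kn n) u j ^+ 2) (A * hS k 0 u).
  apply: sumle_le (hA k (Kn n) u k1 (Kn9 n) su) => j; by rewrite expr0 mul1r.
have hl : sumle (fun j => (2 ^+ d * cr j) ^+ 2 + (2 ^+ d * ci j) ^+ 2) (A * hS k 0 u).
  move=> s us.
  have cF : (fun n => \sum_(j <- s) (kre k (Kn n) u j ^+ 2 + kim k (Kn n) u j ^+ 2)) @ \oo -->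
     \sum_(j <- s) ((2 ^+ d * cr j) ^+ 2 + (2 ^+ d * ci j) ^+ 2).
    apply: cvg_sumr => j; have [c1 c2] := cv j.
    by apply: cvgD; rewrite expr2; under eq_fun do rewrite expr2; exact: cvgM.
  rewrite -(cvg_lim _ cF)//; apply: limr_le; first by apply/cvg_ex; eexists; exact: cF.
  by apply: nearW => n; exact: hn.
have hb := sumleD (bessel_bc k0 sg) (bessel_bs k0 sg).
have hb' := sumleD (bessel_bs k0 sg) (bessel_bc k0 sg).
have e2 (e : R) : 0 < e -> 0 < e / 2 by move=> ?; lra.
have scale (F : nat -> R) (l : R) : (fun M => 2 ^+ d * F M : R) @ \oo --> 2 ^+ d * l -> F @ \oo --> l.
  move=> h; have c : (fun M => (2 ^+ d)^-1 * (2 ^+ d * F M)) @ \oo --> (2 ^+ d)^-1 * (2 ^+ d * l).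
    by apply: cvgM => //; exact: cvg_cst.
  by move: c; rewrite mulKf//; under eq_fun do rewrite mulKf//.
split; apply: scale.
  have := @weak_passage d (fun n j => kre k (Kn n) u j) (fun n j => - kim k (Kn n) u j)
    (fun j => 2 ^+ d * cr j) (fun j => - (2 ^+ d * ci j)) (bc k g) (bs k g) _ _
    (2 ^+ d * Int (fun x => g x * reP u x)) (fun j => (cv j).1) (fun j => cvgN (cv j).2) _ _ hb.
  rewrite (_ : (fun M => \sum_(j <- boxs d M) _) = (fun M => 2 ^+ d *
     \sum_(j <- boxs d M) (cr j * bc k g j - ci j * bs k g j))); last first.
    apply/funext => M; rewrite mulr_sumr; apply: eq_bigr => j _; ring.
  apply.
  - by move=> n; under eq_fun do rewrite sqrrN; exact: hn.
  - by under eq_fun do rewrite sqrrN; exact: hl.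
  move=> e e0; near=> n.
  have [Ma ha] : exists M0, forall M, (M0 <= M)%N ->
    `|\sum_(j <- boxs d M) kterm k true (Kn n) (reP u) g j - starget true (reP u) g| <= e / 2.
    by near: n; apply: kterm_near => //; exact: e2.
  have [Mb hb2] : exists M0, forall M, (M0 <= M)%N ->
    `|\sum_(j <- boxs d M) kterm k false (Kn n) (imP u) g j - starget false (imP u) g| <= e / 2.
    by near: n; apply: kterm_near => //; exact: e2.
  exists (maxn Ma Mb) => M; rewrite geq_max => /andP[/ha {}ha /hb2 {}hb2].
  have -> : \sum_(j <- boxs d M) (kre k (Kn n) u j * bc k g j + - kim k (Kn n) u j * bs k g j) =
     \sum_(j <- boxs d M) kterm k true (Kn n) (reP u) g j -
     \sum_(j <- boxs d M) kterm k false (Kn n) (imP u) g j.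
    by rewrite -sumrB; apply: eq_bigr => j _; rewrite /kterm /kre /kim; ring.
  move: ha hb2; rewrite /starget subr0.
  by rewrite !ler_norml => /andP[? ?] /andP[? ?]; apply/andP; split; lra.
have := @weak_passage d (fun n j => kre k (Kn n) u j) (fun n j => kim k (Kn n) u j)
  (fun j => 2 ^+ d * cr j) (fun j => 2 ^+ d * ci j) (bs k g) (bc k g) _ _
  (2 ^+ d * Int (fun x => g x * imP u x)) (fun j => (cv j).1) (fun j => (cv j).2) hn hl hb'.
rewrite (_ : (fun M => \sum_(j <- boxs d M) _) = (fun M => 2 ^+ d *
   \sum_(j <- boxs d M) (cr j * bs k g j + ci j * bc k g j))); last first.
  apply/funext => M; rewrite mulr_sumr; apply: eq_bigr => j _; ring.
apply=> e e0; near=> n.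
have [Ma ha] : exists M0, forall M, (M0 <= M)%N ->
  `|\sum_(j <- boxs d M) kterm k false (Kn n) (reP u) g j - starget false (reP u) g| <= e / 2.
  by near: n; apply: kterm_near => //; exact: e2.
have [Mb hb2] : exists M0, forall M, (M0 <= M)%N ->
  `|\sum_(j <- boxs d M) kterm k true (Kn n) (imP u) g j - starget true (imP u) g| <= e / 2.
  by near: n; apply: kterm_near => //; exact: e2.
exists (maxn Ma Mb) => M; rewrite geq_max => /andP[/ha {}ha /hb2 {}hb2].
have -> : \sum_(j <- boxs d M) (kre k (Kn n) u j * bs k g j + kim k (Kn n) u j * bc k g j) =
   \sum_(j <- boxs d M) kterm k false (Kn n) (reP u) g j +
   \sum_(j <- boxs d M) kterm k true (Kn n) (imP u) g j.
  by rewrite -big_split; apply: eq_bigr => j _; rewrite /kterm /kre /kim /=; ring.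
move: ha hb2; rewrite /starget subr0.
by rewrite !ler_norml => /andP[? ?] /andP[? ?]; apply/andP; split; lra.
Unshelve. all: by end_near. Qed.

End Dual_coefficients.

(** * The truncation error of Schwartz functions *)

Section Main_estimate.
Variable R : realType.
Local Notation C := R[i].

(** The sign of each integration by parts is put into the test function, which produces the formal
    transpose. *)
Lemma adjoint_iter d (i : 'I_d) n (g : 'rV[R]_d -> R) : schwartzR g ->
  exists2 G, schwartzR G & forall f, schwartzR f ->
    Int (fun x => iter n (@pd R d i) f x * g x) = Int (fun x => f x * G x).
Proof.
elim: n g => [|n IH] g sg; first by exists g.
have [G sG hG] := IH _ (schwartzRZ (-1) (schwartzR_pd i sg)).
exists G => // f sf; rewrite -hG//= (Int_by_parts i (schwartzR_iter i n sf) sg).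
rewrite -IntN; last first.
  by apply: sqi_mul; apply: sqi_schwartz; [exact: schwartzR_iter|exact: schwartzR_pd].
by apply: Int_eq => x; ring.
Qed.

Lemma adjoint_dmulti d (a : 'I_d -> nat) (g : 'rV[R]_d -> R) : schwartzR g ->
  exists2 G, schwartzR G & forall f, schwartzR f ->
    Int (fun x => dmulti a f x * g x) = Int (fun x => f x * G x).
Proof.
rewrite /dmulti; elim: (enum 'I_d) g => [|i s IH] g sg; first by exists g.
have [G sG hG] := adjoint_iter i (a i) sg; have [H sH hH] := IH G sG.
exists H => // f sf; rewrite -hH//=; apply: hG.
exact: (schwartzR_pdlist a s sf).
Qed.

(* The term of [w] is the pairing of [w] with a Schwartz function, hence the limit of the same pairing
   with [W M], which Cauchy-Schwarz bounds by [sqrt (B * hterm w)]. *)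
Lemma hterm_weak_le d (k : R) a q (W : nat -> 'rV[R]_d -> R) (w : 'rV[R]_d -> R) B :
  (forall M, schwartzR (W M)) -> schwartzR w ->
  (forall G, schwartzR G -> (fun M => Int (fun x => W M x * G x)) @ \oo --> Int (fun x => w x * G x)) ->
  (forall M, hterm k a q (W M) <= B) -> hterm k a q w <= B.
Proof.
move=> sW sw h hB; set T := hterm k a q w.
have T0 : 0 <= T by exact: hterm_ge0.
have B0 : 0 <= B by exact: le_trans (hterm_ge0 k a q (W 0%N)) (hB 0%N).
have sdw := schwartzR_dmulti a sw.
have [G sG hG] := adjoint_dmulti a (schwartzR_euc2 q sdw).
have TE (f : 'rV[R]_d -> R) : schwartzR f -> Int (fun x => f x * G x) =
    Int (fun x => (euc x ^+ q * dmulti a f x) * (euc x ^+ q * dmulti a w x)).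
  move=> sf; rewrite -hG//; apply: Int_eq => x.
  by rewrite mul2n -addnn exprD; ring.
have cs M : `|Int (fun x => W M x * G x)| ^+ 2 <= B * T.
  rewrite real_normK ?num_real// TE//.
  apply: (le_trans (Cauchy_Schwarz (sqi_euc q (schwartzR_dmulti a (sW M))) (sqi_euc q sdw))).
  exact: (ler_wpM2r T0 (hB M)).
have wT : Int (fun x => w x * G x) = T.
  by rewrite TE//; apply: Int_eq => x; rewrite expr2.
have c : (fun M => `|Int (fun x => W M x * G x)| ^+ 2) @ \oo --> T ^+ 2.
  have c1 : (fun M => `|Int (fun x => W M x * G x)|) @ \oo --> `|T|.
    by apply: cvg_norm; rewrite -wT; exact: h.
  rewrite -[T in X in _ --> X]ger0_norm// expr2; under eq_fun do rewrite expr2; exact: cvgM.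
have le : T ^+ 2 <= B * T.
  rewrite -(cvg_lim _ c)//; apply: limr_le; first by apply/cvg_ex; eexists; exact: c.
  by apply: nearW.
have [->//|Tn] := eqVneq T 0.
have Tp : 0 < T by rewrite lt_neqAle eq_sym Tn.
by rewrite -(ler_pM2r Tp) -expr2.
Qed.

Definition nterms d p : R :=
  \sum_(a : {ffun 'I_d -> 'I_p.+1} | (mlen a <= p)%N) \sum_(q < (p - mlen a).+1) 1.

Lemma nterms_ge0 d p : 0 <= nterms d p.
Proof. by apply: sumr_ge0 => a _; apply: sumr_ge0. Qed.

(** Semicontinuity is used term by term, each term being bounded by all of [B]; this costs the
    number of terms of the norm. *)
Lemma hs_weak_le d (k : R) p (W : nat -> 'rV[R]_d -> R) (w : 'rV[R]_d -> R) B : 1 <= k ->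
  (forall M, schwartzR (W M)) -> schwartzR w ->
  (forall G, schwartzR G -> (fun M => Int (fun x => W M x * G x)) @ \oo --> Int (fun x => w x * G x)) ->
  (forall M, hs k p (W M) <= B) -> hs k p w <= nterms d p * B.
Proof.
move=> k1 sW sw h hB; rewrite /hs /nterms mulr_suml; apply: ler_sum => a ap.
rewrite mulr_suml; apply: ler_sum => q _; rewrite mul1r.
have kp : 0 < k ^+ (2 * mlen a) by rewrite exprn_gt0//; lra.
rewrite mulrC ler_pdivrMr//; apply: (hterm_weak_le sW sw h) => M.
rewrite -ler_pdivrMr// mulrC; apply: le_trans (hB M); apply: hterm_le_hs => //.
by have := ltn_ord q; rewrite ltnS leq_subRL.
Qed.

Lemma hs_lin d (k : R) p (f g : 'rV[R]_d -> R) (s : R) : 1 <= k -> `|s| <= 1 ->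
  schwartzR f -> schwartzR g ->
  hs k p (fun x => f x + s * g x) <= 2 * (hs k p f + hs k p g).
Proof.
move=> k1 s1 sf sg; rewrite /hs -big_split mulr_sumr; apply: ler_sum => a _ /=.
rewrite -big_split mulr_sumr; apply: ler_sum => q _ /=.
have kp : 0 <= k ^- (2 * mlen a) by rewrite invr_ge0 exprn_ge0//; lra.
rewrite -mulrDr mulrCA ler_wpM2l//.
set al : 'I_d -> nat := fun j => a j.
have sdf := schwartzR_dmulti al sf; have sdg := schwartzR_dmulti al sg.
have E : dmulti al (fun x => f x + s * g x) = fun x => dmulti al f x + s * dmulti al g x.
  pose F (b : bool) := if b then f else g; pose c (b : bool) : R := if b then 1 else s.
  have sF b : schwartzR (F b) by case: b.
  have -> : (fun x => f x + s * g x) = (fun x => \sum_(b <- [:: true; false]) c b * F b x).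
    by apply/funext => x; rewrite !big_cons big_nil addr0 mul1r.
  rewrite (dmulti_sum _ _ _ sF); apply/funext => x.
  by rewrite !big_cons big_nil addr0 mul1r.
have qf := (sqi_euc q sdf).2; have qg := (sqi_euc q sdg).2.
have sD : schwartzR (dmulti al (fun x => f x + s * g x)).
  by apply: schwartzR_dmulti; apply: schwartzRD => //; exact: schwartzRZ.
rewrite /hterm -(IntD qf qg) -(IntZ _ (intgD qf qg)).
apply: le_Int; [exact: (sqi_euc q sD).2|exact: intgZ (intgD qf qg)|].
move=> x; rewrite E mulrDr mulrCA; move: (euc x ^+ q * _) (euc x ^+ q * _) => y z.
have ss : s ^+ 2 <= 1 by rewrite -real_normK ?num_real// expr_le1.
have : s ^+ 2 * z ^+ 2 <= 1 * z ^+ 2 by rewrite ler_wpM2r ?sqr_ge0.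
have := sqr_ge0 (y - s * z); nra.
Qed.

Lemma hS_lin d (k : R) p (f g : 'rV[R]_d -> C) (s : R) : 1 <= k -> `|s| <= 1 ->
  schwartz f -> schwartz g ->
  hS k p (fun x => f x + s%:C * g x) <= 2 * (hS k p f + hS k p g).
Proof.
move=> k1 s1 [f1 f2] [g1 g2]; rewrite /hS.
have -> : reP (fun x => f x + s%:C * g x) = fun x => reP f x + s * reP g x.
  by apply/funext => x; rewrite /reP; case: (f x) (g x) => [a b] [c e]; simpc.
have -> : imP (fun x => f x + s%:C * g x) = fun x => imP f x + s * imP g x.
  by apply/funext => x; rewrite /imP; case: (f x) (g x) => [a b] [c e]; simpc.
have := hs_lin p k1 s1 f1 g1; have := hs_lin p k1 s1 f2 g2; lra.
Qed.

Definition synth d (k : R) (c c' : gidx d -> R) (M : nat) (x : 'rV[R]_d) : R :=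
  \sum_(j <- boxs d M) (c j * ec k j x + c' j * es k j x).

Lemma schwartzR_synth d k (c c' : gidx d -> R) M : 0 < k -> schwartzR (synth k c c' M).
Proof.
by move=> k0; apply: schwartzR_sum => j; apply: schwartzRD; apply: schwartzRZ; exact: schwartzR_efam.
Qed.

Lemma synth_hs d p : (0 < d)%N -> exists2 A, 0 <= A & forall (k : R) M (c c' : gidx d -> R), 1 <= k ->
  hs k p (synth k c c' M) <= A * \sum_(j <- boxs d M) (c j ^+ 2 + c' j ^+ 2) * wt k j ^+ p.
Proof.
move=> d0.
have f1 b : fam 0 (fun k (j : gidx d) (x : 'rV[R]_d) => 1 * efam k (@pone R d) b j x).
  by apply: (@fam_efam _ _ _ (fun _ _ => 1) _ _ 1) => k j k1; rewrite normr1 expr0 mulr1.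
have [A1 a1 h1] := fam_hs_bound d0 p (f1 0); have [A2 a2 h2] := fam_hs_bound d0 p (f1 (- (pi / 2))).
exists (2 * (A1 + A2)); first by rewrite mulr_ge0// addr_ge0.
move=> k M c c' k1; have k0 : 0 < k by lra.
have sE b : schwartzR (fun x => \sum_(j <- boxs d M) (if b then c j else c' j) *
    (1 * efam k (@pone R d) (if b then 0 else - (pi / 2)) j x)).
  by apply: schwartzR_sum => j; do 2 apply: schwartzRZ; exact: schwartzR_efam.
have -> : synth k c c' M = fun x => (\sum_(j <- boxs d M) c j * (1 * efam k (@pone R d) 0 j x)) +
    1 * \sum_(j <- boxs d M) c' j * (1 * efam k (@pone R d) (- (pi / 2)) j x).
  apply/funext => x; rewrite mul1r -big_split; apply: eq_bigr => j _.
  by rewrite !mul1r.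
have n1 : `|1 : R| <= 1 by rewrite normr1.
apply: (le_trans (hs_lin p k1 n1 (sE true) (sE false))).
have b1 := h1 k k1 M c; have b2 := h2 k k1 M c'.
set S := \sum_(j <- _) _; set S1 := \sum_(j <- _) _ in b1; set S2 := \sum_(j <- _) _ in b2.
have w0 (j : gidx d) : 0 <= wt k j ^+ p by rewrite exprn_ge0// wt_ge0.
have s1 : S1 <= S by apply: ler_sum => j _; rewrite ler_wpM2r// lerDl sqr_ge0.
have s2 : S2 <= S by apply: ler_sum => j _; rewrite ler_wpM2r// lerDr sqr_ge0.
have := ler_wpM2l a1 s1; have := ler_wpM2l a2 s2; lra.
Qed.

Section fixed.
Variables (d : nat) (k D : R).
Hypothesis d0 : (0 < d)%N.
Hypothesis k1 : 1 <= k.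
Hypothesis D0 : 0 < D.
Variable Psistar : gidx d -> 'rV[R]_d -> C.
Hypothesis dF : dual_frame k Psistar.

Let k0 : 0 < k. Proof. exact: lt_le_trans ltr01 k1. Qed.

Implicit Types u v : 'rV[R]_d -> C.
Local Notation cr u := (fun j => complex.Re (dcoef Psistar u j)).
Local Notation ci u := (fun j => complex.Im (dcoef Psistar u j)).

Definition ind (j : gidx d) : R := (j \in idxD k D)%:R.

(** The norm bound limits every index by [D / h], so [PiD] is a finite sum. *)
Lemma idxD_box : exists M0, forall j : gidx d, j \in idxD k D -> j \in boxs d M0.
Proof.
have h0 := hk_gt0 k0; pose M0 := (Num.truncn (D / hk k)).+1.
have DM : D / hk k <= M0%:R by rewrite ltW// truncnS_gt.
exists M0 => j; rewrite inE /idxD /= => jD.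
have bound (s : R) (z : int) : 0 <= s -> hk k * z%:~R = s \/ hk k * z%:~R = - s ->
    s <= D -> `|z| <= M0%:Z.
  move=> s0 hz sD; have zE : `|z%:~R| = s / hk k :> R.
    have n : `|hk k * z%:~R| = s by case: hz => ->; rewrite ?normrN ger0_norm.
    by rewrite -n normrM (gtr0_norm h0) mulrC mulKf// gt_eqF.
  rewrite -(ler_int R) intr_norm zE; apply: le_trans DM.
  by rewrite ler_wpM2r// invr_ge0 ltW.
have cmp (y : R) : y ^+ 2 <= \sum_i (xk k j.1 0 i) ^+ 2 + \sum_i (xk k j.2 0 i) ^+ 2 -> `|y| <= D.
  by move=> yy; rewrite -sqrtr_sqr (le_trans _ jD)// ler_wsqrtr.
have p1 : 0 <= \sum_i (xk k j.1 0 i) ^+ 2 by apply: sumr_ge0 => i _; exact: sqr_ge0.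
have p2 : 0 <= \sum_i (xk k j.2 0 i) ^+ 2 by apply: sumr_ge0 => i _; exact: sqr_ge0.
have sgn (y : R) : y = `|y| \/ y = - `|y|.
  by case: (lerP 0 y) => y0; [left; rewrite ger0_norm|right; rewrite ltr0_norm// opprK].
rewrite mem_boxs !mem_zbox; apply/andP; split; apply/forallP => i.
  apply: (bound `|xk k j.1 0 i|) => //; first by have := sgn (xk k j.1 0 i); rewrite {1 3}mxE.
  apply: cmp; rewrite (bigD1 i)//= -addrA lerDl addr_ge0//.
  by apply: sumr_ge0 => l _; exact: sqr_ge0.
apply: (bound `|xk k j.2 0 i|) => //; first by have := sgn (xk k j.2 0 i); rewrite {1 3}mxE.
apply: cmp; rewrite [\sum_i xk k j.2 0 i ^+ 2](bigD1 i)//= addrCA lerDl addr_ge0//.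
by apply: sumr_ge0 => l _; exact: sqr_ge0.
Qed.

Lemma ind_sum M0 M (F : gidx d -> R) : (forall j : gidx d, j \in idxD k D -> j \in boxs d M0) ->
  (M0 <= M)%N -> \sum_(j <- boxs d M) ind j * F j = \sum_(j <- boxs d M0) ind j * F j.
Proof.
move=> h0 le; rewrite (boxs_split _ le) -[RHS]addr0; congr (_ + _); rewrite big_seq big1// => j.
rewrite mem_filter => /andP[jn _]; rewrite /ind (_ : j \in _ = false) ?mul0r//.
by apply/negP => /h0; rewrite (negbTE jn).
Qed.

Lemma PiD_parts M0 u : (forall j : gidx d, j \in idxD k D -> j \in boxs d M0) ->
  reP (PiD k D Psistar u) = synth k (fun j => ind j * cr u j) (fun j => - (ind j * ci u j)) M0 /\
  imP (PiD k D Psistar u) = synth k (fun j => ind j * ci u j) (fun j => ind j * cr u j) M0.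
Proof.
move=> h0.
have E x : PiD k D Psistar u x =
    \sum_(j <- boxs d M0) (ind j)%:C * (dcoef Psistar u j * Psi k j x).
  rewrite /PiD.
  have -> : idxD k D = [set` [seq j <- boxs d M0 | j \in idxD k D]].
    apply/seteqP; split=> j /=; rewrite mem_filter.
      by move=> jD; apply/andP; split; [exact: mem_set|apply: h0; exact: mem_set].
    by move=> /andP[/set_mem].
  rewrite -fsbig_seq ?filter_uniq ?uniq_boxs// big_filter big_mkcond.
  apply: eq_bigr => j _; rewrite /ind; case: ifP => _; first by rewrite mul1r.
  by rewrite mul0r.
by split; apply/funext => x; rewrite /reP /imP E /synth;
  (elim: (boxs d M0) => [|j s IH]; first by rewrite !big_nil);
  rewrite !big_cons -IH PsiE//; case: (dcoef _ _ _) (\sum_(_ <- _) _) => [a b] [p q]; simpc => /=; ring.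
Qed.

Lemma schwartz_PiD u : schwartz (PiD k D Psistar u).
Proof.
have [M0 h0] := idxD_box; have [e1 e2] := PiD_parts u h0.
by split; rewrite ?e1 ?e2; exact: schwartzR_synth.
Qed.

Lemma Int_synth (c c' : gidx d -> R) M (g : 'rV[R]_d -> R) : sqi g ->
  Int (fun x => synth k c c' M x * g x) = \sum_(j <- boxs d M) (c j * bc k g j + c' j * bs k g j).
Proof.
move=> sg; have ie j := sqi_mul sg (sqi_ec k0 j); have is' j := sqi_mul sg (sqi_es k0 j).
rewrite (@Int_eq _ _ _ (fun x => \sum_(j <- boxs d M) (c j * (g x * ec k j x) + c' j * (g x * es k j x)))).
  rewrite Int_sum; last by move=> j; apply: intgD; exact: intgZ.
  by apply: eq_bigr => j _; rewrite (IntD (intgZ _ (ie j)) (intgZ _ (is' j))) !IntZ.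
by move=> x; rewrite /synth mulr_suml; apply: eq_bigr => j _; ring.
Qed.

(** A discarded index has weight at least [D^2], so [r] additional powers of the weight gain
    [D^(-2 r)] in the squared norm. *)
Lemma wt_outside p r (j : gidx d) : j \notin idxD k D ->
  wt k j ^+ p <= (D ^+ r)^-1 ^+ 2 * wt k j ^+ (p + r).
Proof.
move=> jD; have wD : D ^+ 2 <= wt k j.
  have /negP : ~ (idxD k D j) by move=> h; move: jD; rewrite mem_set.
  rewrite /idxD /= -ltNge => lt.
  have s0 : 0 <= \sum_i (xk k j.1 0 i) ^+ 2 + \sum_i (xk k j.2 0 i) ^+ 2.
    by rewrite addr_ge0// sumr_ge0// => i _; exact: sqr_ge0.
  have : D ^+ 2 <= Num.sqrt (\sum_i (xk k j.1 0 i) ^+ 2 + \sum_i (xk k j.2 0 i) ^+ 2) ^+ 2.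
    by apply: lerXn2r; rewrite ?nnegrE ?sqrtr_ge0 ?ltW.
  by rewrite sqr_sqrtr// /wt; lra.
have Dr : 0 < D ^+ r by rewrite exprn_gt0.
rewrite exprD mulrCA -[leLHS]mulr1 ler_wpM2l ?exprn_ge0 ?wt_ge0//.
rewrite exprVn mulrC ler_pdivlMr ?exprn_gt0// mul1r -exprM mulnC exprM.
by apply: lerXn2r; rewrite ?nnegrE ?sqr_ge0 ?wt_ge0.
Qed.

(** By weak reconstruction, [u - Pi_D u] is the weak limit of sums over the discarded indices in
    growing boxes. These are bounded by synthesis, [wt_outside] and the weighted bound of the dual
    coefficients, and [hs_weak_le] passes to the limit. *)
Lemma truncation_error p r A1 A2 u : 0 <= A1 -> 0 <= A2 ->
  (forall M (c c' : gidx d -> R),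
    hs k p (synth k c c' M) <= A1 * \sum_(j <- boxs d M) (c j ^+ 2 + c' j ^+ 2) * wt k j ^+ p) ->
  sumle (fun j => wt k j ^+ (p + r) * (cr u j ^+ 2 + ci u j ^+ 2)) (A2 * hS k (p + r) u) ->
  schwartz u ->
  hS k p (fun x => u x + (- 1)%:C * PiD k D Psistar u x) <=
    2 * nterms d p * (A1 * A2) * ((D ^+ r)^-1 ^+ 2 * hS k (p + r) u).
Proof.
move=> A10 A20 hsyn hc su; have [su1 su2] := su.
have [M0 h0] := idxD_box; have [e1 e2] := PiD_parts u h0.
have [sP1 sP2] := schwartz_PiD u.
pose B := A1 * ((D ^+ r)^-1 ^+ 2 * (A2 * hS k (p + r) u)).
pose o (j : gidx d) : R := 1 - ind j.
have Bb (M : nat) (c c' : gidx d -> R) : (forall j, c j ^+ 2 + c' j ^+ 2 = cr u j ^+ 2 + ci u j ^+ 2) ->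
   hs k p (synth k (fun j => o j * c j) (fun j => o j * c' j) M) <= B.
  move=> cc; apply: (le_trans (hsyn _ _ _)); rewrite ler_wpM2l//.
  apply: (@le_trans _ _ (\sum_(j <- boxs d M) (D ^+ r)^-1 ^+ 2 *
     (wt k j ^+ (p + r) * (cr u j ^+ 2 + ci u j ^+ 2)))); last first.
    rewrite -mulr_sumr ler_wpM2l ?sqr_ge0//; exact: hc (uniq_boxs d M).
  apply: ler_sum => j _; rewrite !exprMn -mulrDr cc.
  have c0 : 0 <= cr u j ^+ 2 + ci u j ^+ 2 by rewrite addr_ge0 ?sqr_ge0.
  rewrite -mulrA [_ * wt k j ^+ p]mulrC !mulrA ler_wpM2r// /o /ind.
  case: (boolP (j \in _)) => jD.
    by rewrite subrr expr0n /= mul0r mulr_ge0 ?sqr_ge0 ?exprn_ge0 ?wt_ge0.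
  by rewrite subr0 expr1n mul1r; exact: wt_outside.
(* The real part has coefficients [(cr, - ci)] and the imaginary part [(ci, cr)]: their sums of
   squares agree, so one argument serves both. *)
have half (w t : 'rV[R]_d -> R) (c c' : gidx d -> R) :
    (forall j, c j ^+ 2 + c' j ^+ 2 = cr u j ^+ 2 + ci u j ^+ 2) -> schwartzR w ->
    (forall x, t x = w x - synth k (fun j => ind j * c j) (fun j => ind j * c' j) M0 x) ->
    (forall g, sqi g -> (fun M => \sum_(j <- boxs d M) (c j * bc k g j + c' j * bs k g j)) @ \oo -->
       Int (fun x => g x * w x)) -> hs k p t <= nterms d p * B.
  move=> cc sw tE lim.
  have st : schwartzR t.
    by rewrite (funext tE); apply: schwartzRB => //; exact: schwartzR_synth.
  (* Boxes of size [M + M0] contain every retained index, so exactly [Pi_D u] is subtracted at each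
     stage. *)
  apply: (@hs_weak_le d k p (fun M => synth k (fun j => o j * c j) (fun j => o j * c' j) (M + M0))) => //.
  - by move=> M; exact: schwartzR_synth.
  - move=> G sG; have qG := sqi_schwartz sG.
    have iw := sqi_mul (sqi_schwartz sw) qG.
    have is' := sqi_mul (sqi_schwartz (schwartzR_synth (fun j => ind j * c j) (fun j => ind j * c' j) M0 k0)) qG.
    rewrite [X in _ --> X](_ : _ = Int (fun x => G x * w x) -
        \sum_(j <- boxs d M0) ind j * (c j * bc k G j + c' j * bs k G j)); last first.
      rewrite (@Int_eq _ _ _ (fun x => w x * G x -
         synth k (fun j => ind j * c j) (fun j => ind j * c' j) M0 x * G x)); last first.
        by move=> x; rewrite tE; ring.
      rewrite (IntB iw is') Int_synth//; congr (_ - _).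
        by apply: Int_eq => x; exact: mulrC.
      by apply: eq_bigr => j _; ring.
    under eq_fun do rewrite Int_synth//.
    rewrite (_ : (fun M => _) = (fun M => \sum_(j <- boxs d (M + M0)) (c j * bc k G j + c' j * bs k G j) -
       \sum_(j <- boxs d M0) ind j * (c j * bc k G j + c' j * bs k G j))); last first.
      apply/funext => M; rewrite -(ind_sum _ h0 (leq_addl M M0)) -sumrB.
      by apply: eq_bigr => j _; rewrite /o; ring.
    apply: cvgB; last exact: cvg_cst.
    by have := lim G qG; rewrite -(cvg_shiftn M0).
  by move=> M; exact: Bb.
have -> : 2 * nterms d p * (A1 * A2) * ((D ^+ r)^-1 ^+ 2 * hS k (p + r) u) =
   nterms d p * B + nterms d p * B by rewrite /B; ring.
apply: lerD.
  apply: (half (reP u) _ (cr u) (fun j => - ci u j)) => //.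
  - by move=> j; rewrite sqrrN.
  - move=> x; rewrite (_ : (fun j => ind j * - ci u j) = (fun j => - (ind j * ci u j))) -?e1.
      by rewrite /reP; case: (u x) (PiD _ _ _ _ _) => [a b] [c e]; simpc.
    by apply/funext => j; rewrite mulrN.
  move=> g sg; have [l1 _] := weak_reconstruction d0 k1 dF su sg.
  by under eq_fun do under eq_bigr do rewrite mulNr.
apply: (half (imP u) _ (ci u) (cr u)) => //.
- by move=> j; rewrite addrC.
- move=> x; rewrite -e2.
  by rewrite /imP; case: (u x) (PiD _ _ _ _ _) => [a b] [c e]; simpc.
move=> g sg; have [_ l2] := weak_reconstruction d0 k1 dF su sg.
by under eq_fun do under eq_bigr do rewrite addrC.
Qed.

End fixed.

Lemma truncation_estimate d p r : (0 < d)%N -> exists2 A : R, 0 <= A &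
  forall (k D : R) Psistar (u : 'rV[R]_d -> C), 1 <= k -> 0 < D -> dual_frame k Psistar -> schwartz u ->
  hS k p (fun x => u x + (- 1)%:C * PiD k D Psistar u x) <=
    A * ((D ^+ r)^-1 ^+ 2 * hS k (p + r) u).
Proof.
move=> d0; have [A1 a1 h1] := synth_hs p d0; have [A2 a2 h2] := @dual_bound R d (p + r) d0.
exists (2 * nterms d p * (A1 * A2)).
  by rewrite mulr_ge0 ?(mulr_ge0 a1 a2)// mulr_ge0// nterms_ge0.
move=> k D Psistar u k1 D0 dF su; apply: truncation_error => //.
  by move=> M c c'; exact: h1.
exact: h2.
Qed.

End Main_estimate.

(** * Extension from Schwartz functions to the closure *)

Section Closure.
Variable R : realType.
Local Notation C := R[i].

Lemma complex_ext (z w : C) : complex.Re z = complex.Re w -> complex.Im z = complex.Im w -> z = w.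
Proof. by case: z w => [a b] [c e] /= -> ->. Qed.

Definition wcvg d (phi : nat -> 'rV[R]_d -> R) (u : 'rV[R]_d -> R) :=
  forall g, sqi g -> (fun n => Int (fun x => phi n x * g x)) @ \oo --> Int (fun x => u x * g x).

Lemma wcvg_sqi d (phi : nat -> 'rV[R]_d -> R) u : (forall n, sqi (phi n)) -> sqi u ->
  (forall e : R, 0 < e -> exists M, forall n, (M <= n)%N -> Int (fun x => (phi n x - u x) ^+ 2) < e) ->
  wcvg phi u.
Proof.
move=> sp su h g sg; apply/cvgrPdist_lt => e e0.
set T := Int (fun x => g x ^+ 2).
have T0 : 0 <= T by apply: Int_ge0 => x; exact: sqr_ge0.
have [|M hM] := h (e ^+ 2 / (1 + T)); first by rewrite divr_gt0 ?exprn_gt0//; lra.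
exists M => // n /= Mn.
have sd := sqiB (sp n) su.
rewrite distrC -(IntB (sqi_mul (sp n) sg) (sqi_mul su sg)).
rewrite (@Int_eq _ _ _ (fun x => (phi n x - u x) * g x)); last by move=> x; ring.
rewrite -(@ltr_pXn2r _ 2)// ?nnegrE// ?ltW// real_normK ?num_real//.
apply: (le_lt_trans (Cauchy_Schwarz sd sg)); rewrite -/T.
have T1 : 0 < 1 + T by lra.
have lt := hM n Mn; rewrite ltr_pdivlMr// in lt; apply: le_lt_trans lt.
rewrite ler_wpM2l//; last by lra.
by apply: Int_ge0 => x; exact: sqr_ge0.
Qed.

Lemma wcvg_L2 d (phi : nat -> 'rV[R]_d -> C) u : (forall n, L2 (phi n)) -> L2 u ->
  (forall e : R, 0 < e -> exists M, forall n, (M <= n)%N ->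
     (L2sq (fun x => (phi n x - u x)%R) < e%:E)%E) ->
  wcvg (fun n => reP (phi n)) (reP u) /\ wcvg (fun n => imP (phi n)) (imP u).
Proof.
move=> Lp Lu h; have [u1 u2] := (L2_sqi _).1 Lu.
have p1 n := ((L2_sqi _).1 (Lp n)).1; have p2 n := ((L2_sqi _).1 (Lp n)).2.
have reB n : reP (fun x => phi n x - u x) = fun x => reP (phi n) x - reP u x.
  by apply/funext => x; rewrite /reP; case: (phi n x) (u x) => [a b] [c e]; simpc.
have imB n : imP (fun x => phi n x - u x) = fun x => imP (phi n) x - imP u x.
  by apply/funext => x; rewrite /imP; case: (phi n x) (u x) => [a b] [c e]; simpc.
have LB n : L2 (fun x => phi n x - u x).
  by apply/L2_sqi; rewrite reB imB; split; exact: sqiB.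
have i1 n : 0 <= Int (fun x => (reP (phi n) x - reP u x) ^+ 2).
  by apply: Int_ge0 => x; exact: sqr_ge0.
have i2 n : 0 <= Int (fun x => (imP (phi n) x - imP u x) ^+ 2).
  by apply: Int_ge0 => x; exact: sqr_ge0.
split; apply: wcvg_sqi => // e e0; have [M hM] := h e e0; exists M => n /hM;
  rewrite L2sqE// reB imB lte_fin; have := i1 n; have := i2 n; lra.
Qed.

Lemma wcvg_lin d (phi psi : nat -> 'rV[R]_d -> R) u v : (forall n, sqi (phi n)) -> (forall n, sqi (psi n)) ->
  sqi u -> sqi v -> wcvg phi u -> wcvg psi v ->
  wcvg (fun n x => phi n x - psi n x) (fun x => u x - v x).
Proof.
move=> sp ss su sv h1 h2 g sg.
have E (f f' : 'rV[R]_d -> R) : sqi f -> sqi f' -> Int (fun x => (f x - f' x) * g x) =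
    Int (fun x => f x * g x) - Int (fun x => f' x * g x).
  move=> sf sf'; rewrite -(IntB (sqi_mul sf sg) (sqi_mul sf' sg)).
  by apply: Int_eq => x; ring.
rewrite E//; under eq_fun do rewrite E//.
by apply: cvgB; [exact: h1|exact: h2].
Qed.

Lemma ip_cvg d (phi : nat -> 'rV[R]_d -> C) u g : (forall n, L2 (phi n)) -> L2 u -> L2 g ->
  wcvg (fun n => reP (phi n)) (reP u) -> wcvg (fun n => imP (phi n)) (imP u) ->
  (fun n => complex.Re (ip (phi n) g)) @ \oo --> complex.Re (ip u g) /\
  (fun n => complex.Im (ip (phi n) g)) @ \oo --> complex.Im (ip u g).
Proof.
move=> Lp Lu Lg h1 h2; have [g1 g2] := (L2_sqi _).1 Lg.
have [-> ->] := ip_parts Lu Lg; split.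
  under eq_fun do rewrite (ip_parts (Lp _) Lg).1.
  by apply: cvgD; [exact: h1|exact: h2].
under eq_fun do rewrite (ip_parts (Lp _) Lg).2.
by apply: cvgB; [exact: h2|exact: h1].
Qed.

Lemma ipBl d (u v g : 'rV[R]_d -> C) : L2 u -> L2 v -> L2 g ->
  ip (fun x => u x - v x) g = ip u g - ip v g.
Proof.
move=> Lu Lv Lg; have [u1 u2] := (L2_sqi _).1 Lu; have [v1 v2] := (L2_sqi _).1 Lv.
have [g1 g2] := (L2_sqi _).1 Lg.
have reB : reP (fun x => u x - v x) = fun x => reP u x - reP v x.
  by apply/funext => x; rewrite /reP; case: (u x) (v x) => [a b] [c e]; simpc.
have imB : imP (fun x => u x - v x) = fun x => imP u x - imP v x.
  by apply/funext => x; rewrite /imP; case: (u x) (v x) => [a b] [c e]; simpc.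
have LB : L2 (fun x => u x - v x) by apply/L2_sqi; rewrite reB imB; split; exact: sqiB.
have E (f f' h : 'rV[R]_d -> R) : sqi f -> sqi f' -> sqi h ->
   Int (fun x => (f x - f' x) * h x) = Int (fun x => f x * h x) - Int (fun x => f' x * h x).
  move=> sf sf' sh; rewrite -(IntB (sqi_mul sf sh) (sqi_mul sf' sh)).
  by apply: Int_eq => x; ring.
have [e1 e2] := ip_parts LB Lg; have [e3 e4] := ip_parts Lu Lg; have [e5 e6] := ip_parts Lv Lg.
have sub (z w : C) : complex.Re (z - w) = complex.Re z - complex.Re w /\
  complex.Im (z - w) = complex.Im z - complex.Im w by case: z w => [a b] [c e]; simpc.
have [s1 s2] := sub (ip u g) (ip v g).
apply: complex_ext; rewrite ?s1 ?s2 ?e1 ?e2 ?e3 ?e4 ?e5 ?e6 reB imB !E//; ring.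
Qed.

Lemma hS0 d (k : R) p : hS k p (fun _ : 'rV[R]_d => 0 : C) = 0.
Proof.
have z : hs k p (fun _ : 'rV[R]_d => 0 : R) = 0.
  rewrite /hs big1// => a _; rewrite big1// => q _; rewrite /hterm.
  have -> : dmulti (fun j => a j : nat) (fun _ : 'rV[R]_d => 0 : R) = fun _ => 0.
    have := @dmulti_sum R d _ [::] (fun j => a j : nat) (fun=> 1) _ (fun _ : nat => @schwartzR0 R d).
    have z (F : nat -> 'rV[R]_d -> R) : (fun x => \sum_(t <- [::]) 1 * F t x) = fun=> 0.
      by apply/funext => x; rewrite big_nil.
    by rewrite !z.
  rewrite (@Int_eq _ _ _ (fun=> 0)) ?Int0 ?mulr0// => x; by rewrite mulr0 expr0n.
by rewrite /hS (_ : reP _ = fun=> 0)// (_ : imP _ = fun=> 0)// z addr0.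
Qed.

Section fixed.
Variables (d : nat) (k D : R).
Hypothesis k1 : 1 <= k.
Variable Psistar : gidx d -> 'rV[R]_d -> C.
Hypothesis dF : dual_frame k Psistar.

Local Notation Pi := (PiD k D Psistar).

(** A finite sum of Gaussian states is a Schwartz function, so a constant approximating sequence
    suffices. *)
Lemma Hhat_PiD p u : Hhat k p (Pi u).
Proof.
have s := @schwartz_PiD R d k D k1 Psistar u.
have z : (fun x => Pi u x - Pi u x) = fun=> 0 by apply/funext => x; rewrite subrr.
have s0 : schwartz (fun _ : 'rV[R]_d => 0 : C) by split; exact: schwartzR0.
exists (Num.sqrt (hS k p (Pi u))); split; first exact: L2_schwartz.
split; first exact: sqrtr_ge0.
exists (fun=> Pi u); split=> //; split; [|split] => e e0; exists 0%N.
- move=> n _; rewrite z L2sqE; last exact: L2_schwartz.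
  rewrite (@Int_eq _ _ _ (fun=> 0)) ?Int0; last by move=> x; rewrite expr0n.
  by rewrite addr0 lte_fin.
- by move=> n m _ _; rewrite z HsqE// hS0 lte_fin.
- move=> n _; rewrite HsqE// !lte_fin sqr_sqrtr ?hS_ge0//; apply/andP; split; lra.
Qed.

Lemma PiDB u v : L2 u -> L2 v -> Pi (fun x => u x - v x) = fun x => Pi u x - Pi v x.
Proof.
move=> Lu Lv; have [M0 h0] := @idxD_box R d k D k1.
have fin : finite_set (idxD k D : set (gidx d)).
  apply: (@sub_finite_set _ _ [set` boxs d M0]); last exact: finite_seq.
  by move=> j jD; apply: h0; exact: mem_set.
apply/funext => x; rewrite /PiD !fsbig_finite// -sumrB; apply: eq_bigr => j _.
by rewrite ipBl// ?mulrBl//; exact: (dF j).1.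
Qed.

(** [Pi_D] has finite rank, and its coefficients are pairings with square-integrable functions,
    which weak convergence preserves. *)
Lemma wcvg_PiD (phi : nat -> 'rV[R]_d -> C) u : (forall n, L2 (phi n)) -> L2 u ->
  wcvg (fun n => reP (phi n)) (reP u) -> wcvg (fun n => imP (phi n)) (imP u) ->
  wcvg (fun n => reP (Pi (phi n))) (reP (Pi u)) /\ wcvg (fun n => imP (Pi (phi n))) (imP (Pi u)).
Proof.
move=> Lp Lu h1 h2; have [M0 h0] := @idxD_box R d k D k1.
have cv j := ip_cvg Lp Lu (dF j).1 h1 h2.
have c1 j := (cv j).1; have c2 j := (cv j).2.
have [e1 e2] := PiD_parts k1 Psistar u h0.
split=> g sg; [rewrite e1|rewrite e2]; rewrite Int_synth//.
  under eq_fun do rewrite (PiD_parts k1 _ _ h0).1 Int_synth//.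
  apply: cvg_sumr => j; apply: cvgD; apply: cvgMl; [exact: cvgMr (c1 j)|].
  by apply: cvgN; exact: cvgMr (c2 j).
under eq_fun do rewrite (PiD_parts k1 _ _ h0).2 Int_synth//.
by apply: cvg_sumr => j; apply: cvgD; apply: cvgMl; [exact: cvgMr (c2 j)|exact: cvgMr (c1 j)].
Qed.

End fixed.

Lemma schwartzB d (u v : 'rV[R]_d -> C) : schwartz u -> schwartz v -> schwartz (fun x => u x - v x).
Proof.
move=> [u1 u2] [v1 v2]; split.
  rewrite (_ : reP _ = fun x => reP u x - reP v x); first exact: schwartzRB.
  by apply/funext => x; rewrite /reP; case: (u x) (v x) => [a b] [c e]; simpc.
rewrite (_ : imP _ = fun x => imP u x - imP v x); first exact: schwartzRB.
by apply/funext => x; rewrite /imP; case: (u x) (v x) => [a b] [c e]; simpc.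
Qed.

Lemma subC d (u v : 'rV[R]_d -> C) : (fun x => u x + (- 1)%:C * v x) = fun x => u x - v x.
Proof. by apply/funext => x; rewrite rmorphN rmorph1 mulN1r. Qed.

Lemma hS_B d (k : R) p (f g : 'rV[R]_d -> C) : 1 <= k -> schwartz f -> schwartz g ->
  hS k p (fun x => f x - g x) <= 2 * (hS k p f + hS k p g).
Proof. by move=> k1 sf sg; rewrite -subC; apply: hS_lin; rewrite ?normrN ?normr1. Qed.

(* [w n - w m] converges weakly to [w n] when [m] grows. *)
Lemma closability d (k : R) p (w : nat -> 'rV[R]_d -> C) B : 1 <= k -> (forall n, schwartz (w n)) ->
  wcvg (fun n => reP (w n)) (fun=> 0) -> wcvg (fun n => imP (w n)) (fun=> 0) ->
  forall n M, (forall m, (M <= m)%N -> hS k p (fun x => w n x - w m x) <= B) ->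
  hS k p (w n) <= 2 * (nterms R d p * B).
Proof.
move=> k1 sw h1 h2 n M hB.
have half (P : ('rV[R]_d -> C) -> 'rV[R]_d -> R) :
    (forall v, schwartz v -> schwartzR (P v)) ->
    (forall u v, P (fun x => u x - v x) = fun x => P u x - P v x) ->
    wcvg (fun n => P (w n)) (fun=> 0) ->
    (forall v, schwartz v -> hs k p (P v) <= hS k p v) -> hs k p (P (w n)) <= nterms R d p * B.
  move=> sP PB h le.
  apply: (@hs_weak_le R d k p (fun m => P (fun x => w n x - w (m + M)%N x))) => //.
  - by move=> m; apply: sP; exact: schwartzB.
  - exact: sP.
  - move=> G sG; have qG := sqi_schwartz sG.
    have i m := sqi_mul (sqi_schwartz (sP _ (sw m))) qG.
    have E m : Int (fun x => P (fun x => w n x - w (m + M)%N x) x * G x) =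
        Int (fun x => P (w n) x * G x) - Int (fun x => P (w (m + M)%N) x * G x).
      by rewrite PB -(IntB (i n) (i (m + M)%N)); apply: Int_eq => x; ring.
    under eq_fun do rewrite E.
    rewrite -[Z in nbhs Z]subr0; apply: cvgB; first exact: cvg_cst.
    have := h G qG; rewrite (@Int_eq _ _ _ (fun=> 0)) ?Int0; last by move=> x; rewrite mul0r.
    by rewrite -(cvg_shiftn M).
  move=> m; apply: le_trans (hB (m + M)%N (leq_addl _ _)); apply: le; exact: schwartzB.
rewrite mulr2n mulrDl !mul1r; apply: lerD.
  apply: (half (@reP R d)) => //.
  - by move=> v [].
  - by move=> u v; apply/funext => x; rewrite /reP; case: (u x) (v x) => [a b] [c e]; simpc.
  - by move=> v _; rewrite lerDl hs_ge0.
apply: (half (@imP R d)) => //.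
- by move=> v [].
- by move=> u v; apply/funext => x; rewrite /imP; case: (u x) (v x) => [a b] [c e]; simpc.
- by move=> v _; rewrite lerDr hs_ge0.
Qed.

Lemma ler_epsM (x y K : R) : 0 <= K -> (forall e, 0 < e -> x <= y + K * e) -> x <= y.
Proof.
move=> K0 h; apply/ler_addgt0Pr => e e0; have K1 : 0 < K + 1 by lra.
apply: (le_trans (h _ (divr_gt0 e0 K1))); rewrite lerD2l mulrA ler_pdivrMr//.
by rewrite mulrC ler_wpM2l ?ltW//; lra.
Qed.

(** The number [N] comes from some sequence [psi] approximating [u - Pi_D u], whereas the estimate
    for Schwartz functions concerns [phi n - Pi_D (phi n)]. Closability shows that the two sequences
    differ by little in norm; recombining them costs the factor 2. *)
Lemma truncation_closure d (k D A : R) p r Psistar (u : 'rV[R]_d -> C) Nu N :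
  (0 < d)%N -> 1 <= k -> 0 < D -> 0 <= A -> dual_frame k Psistar ->
  (forall v : 'rV[R]_d -> C, schwartz v -> hS k p (fun x => v x - PiD k D Psistar v x) <=
    A * ((D ^+ r)^-1 ^+ 2 * hS k (p + r) v)) ->
  Hhat_norm k (p + r) u Nu -> Hhat_norm k p (fun x => u x - PiD k D Psistar u x) N ->
  N ^+ 2 <= 2 * A * ((D ^+ r)^-1 ^+ 2 * Nu ^+ 2).
Proof.
move=> d0 k1 D0 A0 dF est.
move=> [Lu [Nu0 [phi [sphi [lphi [cphi nphi]]]]]] [Lw [N0 [psi [spsi [lpsi [cpsi npsi]]]]]].
set T := (D ^+ r)^-1 ^+ 2 in est *; have T0 : 0 <= T by exact: sqr_ge0.
have sPi v := @schwartz_PiD R d k D k1 Psistar v.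
pose chi n : 'rV[R]_d -> C := fun x => phi n x - PiD k D Psistar (phi n) x.
(* Both sequences tend weakly to [u - Pi_D u], so [om] tends weakly to 0. It is Cauchy in norm since
   [psi] is, and since the estimate applied to [phi n - phi m] makes [chi] Cauchy. *)
pose om n : 'rV[R]_d -> C := fun x => psi n x - chi n x.
have schi n : schwartz (chi n) by exact: schwartzB.
have som n : schwartz (om n) by exact: schwartzB.
have Lphi n := L2_schwartz (sphi n); have Lpsi n := L2_schwartz (spsi n).
have [wp1 wp2] := wcvg_L2 Lphi Lu lphi.
have [wq1 wq2] := wcvg_L2 Lpsi Lw lpsi.
have [wP1 wP2] := wcvg_PiD D k1 dF Lphi Lu wp1 wp2.
have [u1 u2] := (L2_sqi _).1 Lu.
have reB (f g : 'rV[R]_d -> C) : reP (fun x => f x - g x) = fun x => reP f x - reP g x.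
  by apply/funext => x; rewrite /reP; case: (f x) (g x) => [a b] [c e]; simpc.
have imB (f g : 'rV[R]_d -> C) : imP (fun x => f x - g x) = fun x => imP f x - imP g x.
  by apply/funext => x; rewrite /imP; case: (f x) (g x) => [a b] [c e]; simpc.
have qre (v : 'rV[R]_d -> C) : schwartz v -> sqi (reP v) by move=> [s _]; exact: sqi_schwartz.
have qim (v : 'rV[R]_d -> C) : schwartz v -> sqi (imP v) by move=> [_ s]; exact: sqi_schwartz.
have wo1 : wcvg (fun n => reP (om n)) (fun=> 0).
  have c1 := wcvg_lin (fun n => qre _ (sphi n)) (fun n => qre _ (sPi (phi n))) u1 (qre _ (sPi u)) wp1 wP1.
  have su := sqiB u1 (qre _ (sPi u)).
  have Lw1 := ((L2_sqi _).1 Lw).1.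
  have sc n : sqi (fun x => reP (phi n) x - reP (PiD k D Psistar (phi n)) x).
    by apply: sqiB; exact: qre.
  have := wcvg_lin (fun n => qre _ (spsi n)) sc Lw1 su wq1 c1.
  rewrite reB (_ : (fun x => _ - _) = fun=> 0); last by apply/funext => x; rewrite subrr.
  by rewrite (_ : (fun n x => _ - _) = fun n => reP (om n))//; apply/funext => n; rewrite !reB.
have wo2 : wcvg (fun n => imP (om n)) (fun=> 0).
  have c1 := wcvg_lin (fun n => qim _ (sphi n)) (fun n => qim _ (sPi (phi n))) u2 (qim _ (sPi u)) wp2 wP2.
  have su := sqiB u2 (qim _ (sPi u)).
  have Lw1 := ((L2_sqi _).1 Lw).2.
  have sc n : sqi (fun x => imP (phi n) x - imP (PiD k D Psistar (phi n)) x).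
    by apply: sqiB; exact: qim.
  have := wcvg_lin (fun n => qim _ (spsi n)) sc Lw1 su wq2 c1.
  rewrite imB (_ : (fun x => _ - _) = fun=> 0); last by apply/funext => x; rewrite subrr.
  by rewrite (_ : (fun n x => _ - _) = fun n => imP (om n))//; apply/funext => n; rewrite !imB.
pose n0 := nterms R d p; have n00 : 0 <= n0 by exact: nterms_ge0.
have AT0 : 0 <= A * T by exact: mulr_ge0.
(* The multiples of [e] collected below: 1 from the lower bound on the norm of [psi n],
   [8 n0 (1 + A T)] from [om n], and [2 A T] from the norm of [phi n]. *)
apply: (@ler_epsM _ _ (1 + 8 * n0 * (1 + A * T) + 2 * (A * T))).
  have : 0 <= n0 * (1 + A * T) by rewrite mulr_ge0// addr_ge0.
  by rewrite -mulrA; lra.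
move=> e e0.
have [M1 h1] := cphi e e0; have [M2 h2] := nphi e e0.
have [M3 h3] := cpsi e e0; have [M4 h4] := npsi e e0.
pose n := maxn (maxn M1 M2) (maxn M3 M4).
have m1 : (M1 <= n)%N by rewrite !leq_max leqnn.
have m2 : (M2 <= n)%N by rewrite !leq_max leqnn ?orbT.
have m3 : (M3 <= n)%N by rewrite !leq_max leqnn ?orbT.
have m4 : (M4 <= n)%N by rewrite !leq_max leqnn ?orbT.
have ob : hS k p (om n) <= 2 * (n0 * (2 * (e + A * (T * e)))).
  apply: (closability k1 som wo1 wo2 (M := n)) => m nm.
  have -> : (fun x => om n x - om m x) = (fun x => (psi n x - psi m x) -
      ((phi n x - phi m x) - PiD k D Psistar (fun x => phi n x - phi m x) x)).
    by rewrite (PiDB D k1 dF)//; apply/funext => x; rewrite /om /chi; ring.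
  have sd := schwartzB (sphi n) (sphi m).
  apply: (le_trans (hS_B p k1 (schwartzB (spsi n) (spsi m)) (schwartzB sd (sPi _)))).
  rewrite ler_wpM2l// lerD//.
    have := h3 n m m3 (leq_trans m3 nm); rewrite HsqE ?lte_fin; first exact: ltW.
    exact: schwartzB.
  apply: (le_trans (est _ sd)); rewrite !ler_wpM2l//.
  by have := h1 n m m1 (leq_trans m1 nm); rewrite HsqE ?lte_fin//; exact: ltW.
have pb : hS k p (psi n) <= 2 * (hS k p (om n) + hS k p (chi n)).
  have -> : psi n = fun x => om n x + 1%:C * chi n x.
    by apply/funext => x; rewrite /om mul1r subrK.
  by apply: hS_lin => //; rewrite normr1.
have cb := est _ (sphi n).
have fb : hS k (p + r) (phi n) <= Nu ^+ 2 + e.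
  by have := h2 n m2; rewrite HsqE// !lte_fin => /andP[_ /ltW].
have gb : N ^+ 2 - e <= hS k p (psi n).
  by have := h4 n m4; rewrite HsqE// !lte_fin => /andP[/ltW].
have cb' : hS k p (chi n) <= A * (T * (Nu ^+ 2 + e)).
  by apply: (le_trans cb); rewrite !ler_wpM2l.
have -> : 2 * A * (T * Nu ^+ 2) + (1 + 8 * n0 * (1 + A * T) + 2 * (A * T)) * e =
  e + 2 * (2 * (n0 * (2 * (e + A * (T * e))))+ A * (T * (Nu ^+ 2 + e))) by ring.
lra.
Qed.

End Closure.

Local Close Scope complex_scope.

Theorem theorem3p1 (R : realType) (d p r : nat) :
  (1 <= d)%N ->
  exists Cpr : R,
  forall (k D : R), 1 <= k -> 0 < D -> Num.sqrt pi < Num.sqrt k * D ->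
  forall Psistar : gidx d -> 'rV[R]_d -> R[i], dual_frame k Psistar ->
  forall (u : 'rV[R]_d -> R[i]) (Nu : R), Hhat_norm k (p + r) u Nu ->
    Hhat k p (PiD k D Psistar u) /\
    forall N : R, Hhat_norm k p (fun x => u x - PiD k D Psistar u x) N ->
      N <= Cpr * D ^- r * Nu.
Proof.
move=> d0; have [A A0 est] := @truncation_estimate R d p r d0.
(* The estimate in the closure is one between squared norms with constant [2 A]. *)
exists (Num.sqrt (2 * A)) => k D k1 D0 _ Psistar dF u Nu hu; split; first exact: Hhat_PiD.
move=> N hN; have [_ [N0 _]] := hN; have [_ [Nu0 _]] := hu.
have Dr : 0 <= D ^- r by rewrite invr_ge0 exprn_ge0 ?ltW.
rewrite -(@ler_pXn2r _ 2)// ?nnegrE//; last by rewrite !mulr_ge0 ?sqrtr_ge0.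
rewrite !exprMn sqr_sqrtr ?mulr_ge0// -mulrA.
apply: (truncation_closure d0 k1 D0 A0 dF _ hu hN) => v sv.
by have := est k D Psistar v k1 D0 dF sv; rewrite subC.
Qed.
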